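(* Let $N\ge 2$, let $\Omega\subseteq\mathbb{R}^N$ be a bounded open set, let $T>0$ and $Q=(0,T)\times\Omega$, and let $M:\Omega\to\mathbb{R}^{N\times N}$ be a matrix with bounded, measurable entries such that, for some $\alpha>0$, $M(x)\xi\cdot\xi\ge\alpha|\xi|^2$ for a.e. $x\in\Omega$ and all $\xi\in\mathbb{R}^N$. Let $\mu\in\mathcal{M}(Q)$ and $u_0\in L^1(\Omega)$. Then there exists a unique duality solution $u\in L^1(Q)$ of the problem $$u_t-\mathrm{div}(M(x)\nabla u)=\mu\ \text{ in }(0,T)\times\Omega,\qquad u(0)=u_0\ \text{ in }\Omega,\qquad u=0\ \text{ on }(0,T)\times\partial\Omega.$$
   Context: $\mathcal{M}(Q)$ is the space of (signed) Radon measures with bounded total variation on $Q$. $M^{\ast}$ denotes the transposed matrix of $M$. Duality solution: a function $u\in L^1(Q)$ is a duality solution of the problem above if $$-\int_\Omega u_0\,w(0)\,dx+\int_Q u\,g\,dx\,dt=\int_Q w\,d\mu$$ for every $g\in L^\infty(Q)$, where $w$ is the (weak, finite energy) solution of the retrograde problem $$-w_t-\mathrm{div}(M^{\ast}(x)\nabla w)=g\ \text{ in }(0,T)\times\Omega,\qquad w(T,x)=0\ \text{ in }\Omega,\qquad w=0\ \text{ on }(0,T)\times\partial\Omega.$$ By standard parabolic regularity $w$ is bounded and continuous on $Q$ (one uses this continuous representative) and $w(0)\in L^\infty(\Omega)$, so all terms are well defined. *)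

(* Defs.v *)
From HB Require Import structures.
From mathcomp Require Import all_boot all_order all_algebra.
From mathcomp Require Import all_classical all_reals all_analysis.

Set Implicit Arguments.
Unset Strict Implicit.
Unset Printing Implicit Defensive.

Import Order.TTheory GRing.Theory Num.Theory.
Import numFieldNormedType.Exports.

Local Open Scope classical_set_scope.
Local Open Scope ring_scope.

(* Matrices carry the sigma-algebra generated by their entries; for
   R : realType this is the Borel sigma-algebra of 'M[R]_(m, n). *)
Section measurable_matrix.
Context {d : measure_display} {T : measurableType d} {m n : nat}.

Definition mx_entries_measurable : set_system 'M[T]_(m, n) :=
  <<s \bigcup_(ij in [set: 'I_m * 'I_n])
        preimage_set_system setT (fun A : 'M[T]_(m, n) => A ij.1 ij.2)
          measurable >>.

Let mx0 : mx_entries_measurable set0.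
Proof. exact: sigma_algebra0. Qed.

Let mxC A : mx_entries_measurable A -> mx_entries_measurable (~` A).
Proof. exact: sigma_algebraC. Qed.

Let mxU (F : _^nat) : (forall i, mx_entries_measurable (F i)) ->
  mx_entries_measurable (\bigcup_i F i).
Proof. exact: sigma_algebra_bigcup. Qed.

HB.instance Definition _ := @isMeasurable.Build (measure_tuple_display d)
  'M[T]_(m, n) mx_entries_measurable mx0 mxC mxU.

End measurable_matrix.

Lemma measurable_mx_entry d (T : measurableType d) m n (i : 'I_m) (j : 'I_n) :
  measurable_fun [set: 'M[T]_(m, n)] (fun A => A i j).
Proof.
move=> _ Y mY; rewrite setTI; apply: sub_sigma_algebra.
by exists (i, j) => //=; exists Y => //; rewrite setTI.
Qed.

Lemma measurable_fun_mx d d' (S : measurableType d) (T : measurableType d')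
    m n (f : S -> 'M[T]_(m, n)) :
  (forall i j, measurable_fun setT (fun s => f s i j)) ->
  measurable_fun setT f.
Proof.
move=> mf _ Y mY; rewrite setTI.
have sY : (measurable : set_system 'M[T]_(m, n)) `<=`
    [set A | measurable (f @^-1` A)].
  apply: smallest_sub; first split => /=.
  - by rewrite preimage_set0.
  - by move=> A mA; rewrite setTD preimage_setC; exact: measurableC.
  - by move=> F mF; rewrite preimage_bigcup; exact: bigcup_measurable.
  move=> _ [[i j] _ [B mB <-]] /=; rewrite setTI.
  by have := mf i j measurableT B mB; rewrite setTI.
exact: sY.
Qed.

(* [lebesgue_measure], over R with its canonical measurable structure rather
   than over the alias measurableTypeR R, so that it can be used on products
   that also carry a norm. *)
Section lebesgue_line.
Context {R : realType}.
Local Open Scope ereal_scope.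

Definition lebesgue1 : set R -> \bar R := @lebesgue_measure R.

HB.instance Definition _ := isMeasure.Build default_measure_display R R
  lebesgue1 (measure0 (@lebesgue_measure R)) (measure_ge0 (@lebesgue_measure R))
  (@measure_semi_sigma_additive _ _ _ (@lebesgue_measure R)).

HB.instance Definition _ := Measure_isSigmaFinite.Build _ _ _ lebesgue1
  (sigma_finiteT (@lebesgue_measure R)).

End lebesgue_line.

Section lebesgue_vector.
Context {R : realType}.
Local Open Scope ereal_scope.

Definition vcons n (p : R * 'cV[R]_n) : 'cV[R]_n.+1 :=
  col_mx (p.1%:M : 'M[R]_1) p.2.

Lemma measurable_vcons n : measurable_fun setT (@vcons n).
Proof.
apply: measurable_fun_mx => i j; rewrite ord1.
rewrite -[n.+1]/(1 + n)%N in i *.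
case: (split_ordP i) => k ->.
  apply: (eq_measurable_fun fst) => //.
  by move=> p _; rewrite /vcons (col_mxEu (p.1%:M : 'M[R]_1)) ord1 mxE eqxx mulr1n.
apply: (eq_measurable_fun ((fun A : 'cV[R]_n => A k ord0) \o snd)).
  by move=> p _; rewrite /= /vcons (col_mxEd (p.1%:M : 'M[R]_1)).
apply: measurableT_comp => //; exact: measurable_mx_entry.
Qed.

Definition vuncons n (v : 'cV[R]_n.+1) : R * 'cV[R]_n :=
  (v ord0 ord0, \col_i v (lift ord0 i) ord0).

Lemma measurable_vuncons n : measurable_fun setT (@vuncons n).
Proof.
apply: measurable_fun_pair; first exact: measurable_mx_entry.
apply: measurable_fun_mx => i j.
apply: (eq_measurable_fun (fun v : 'cV[R]_n.+1 => v (lift ord0 i) ord0)).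
  by move=> v _; rewrite mxE.
exact: measurable_mx_entry.
Qed.

Lemma vunconsK n : cancel (@vcons n) (@vuncons n).
Proof.
move=> [a v]; rewrite /vuncons /vcons /=; congr pair.
  have -> : ord0 = lshift n (ord0 : 'I_1) :> 'I_(1 + n) by exact/val_inj.
  by rewrite (col_mxEu (a%:M : 'M[R]_1)) mxE eqxx mulr1n.
apply/colP => i; rewrite mxE.
have -> : lift ord0 i = rshift 1 i :> 'I_(1 + n) by exact/val_inj.
by rewrite (col_mxEd (a%:M : 'M[R]_1)).
Qed.

Section lebesgue_vcons.
Variables (n : nat) (mu : {sigma_finite_measure set 'cV[R]_n -> \bar R}).

Definition lebesgue_vcons : set 'cV[R]_n.+1 -> \bar R :=
  pushforward (lebesgue1 \x mu) (@vcons n).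

Let mvcons (A : set 'cV[R]_n.+1) : measurable A -> measurable (@vcons n @^-1` A).
Proof. by move=> mA; rewrite -[X in measurable X]setTI; exact: measurable_vcons. Qed.

Let lv0 : lebesgue_vcons set0 = 0.
Proof. by rewrite /lebesgue_vcons /pushforward preimage_set0 measure0. Qed.

Let lv_ge0 A : 0 <= lebesgue_vcons A.
Proof. exact: (measure_ge0 (lebesgue1 \x mu)). Qed.

Let lv_sigma_additive : semi_sigma_additive lebesgue_vcons.
Proof.
move=> F mF tF mUF; rewrite /lebesgue_vcons /pushforward preimage_bigcup.
apply: (@measure_semi_sigma_additive _ _ _ (lebesgue1 \x mu)).
- by move=> i; exact: mvcons.
- apply/trivIsetP => /= i j _ _ ij; rewrite -preimage_setI.
  by move/trivIsetP : tF => /(_ _ _ _ _ ij) ->//; rewrite preimage_set0.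
- by rewrite -preimage_bigcup; exact: mvcons.
Qed.

HB.instance Definition _ := isMeasure.Build _ _ _ lebesgue_vcons
  lv0 lv_ge0 lv_sigma_additive.

Let lv_sigma_finite : sigma_finite setT lebesgue_vcons.
Proof.
have /sigma_finiteP[F [TF ndF Foo]] := sigma_finiteT (@lebesgue1 R).
have /sigma_finiteP[G [TG ndG Goo]] := sigma_finiteT mu.
exists (fun k => @vuncons n @^-1` (F k `*` G k)).
  rewrite -preimage_bigcup (_ : \bigcup_k _ = setT) ?preimage_setT//.
  rewrite -subTset -setXTT TF TG => -[x y] [/= [i _ Fix] [j _ Gjy]].
  exists (maxn i j) => //; split.
    by move: x Fix; exact/subsetPset/ndF/leq_maxl.
  by move: y Gjy; exact/subsetPset/ndG/leq_maxr.
move=> k; have [mF Fk] := Foo k; have [mG Gk] := Goo k; split.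
  rewrite -[X in measurable X]setTI; apply: measurable_vuncons => //.
  exact: measurableX.
rewrite /lebesgue_vcons /pushforward -comp_preimage.
rewrite (_ : @vuncons n \o @vcons n = id); last first.
  by apply/funext => p; exact: vunconsK.
by rewrite preimage_id product_measure1E// lte_mul_pinfty// ge0_fin_numE.
Qed.

HB.instance Definition _ := Measure_isSigmaFinite.Build _ _ _ lebesgue_vcons
  lv_sigma_finite.

End lebesgue_vcons.

Fixpoint lebesgue_vec (n : nat) : {sigma_finite_measure set 'cV[R]_n -> \bar R} :=
  match n with
  | 0 => dirac (0%R : 'cV[R]_0)
  | k.+1 => lebesgue_vcons (lebesgue_vec k)
  end.

(* Lebesgue measure on R x R^n (time, space) *)
Definition lebesgue_tx (n : nat) :
    {measure set (R * 'cV[R]_n)%type -> \bar R} :=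
  lebesgue1 \x lebesgue_vec n.

End lebesgue_vector.

(* For D open this is C_c^oo(D): [smooth] asks that all iterated directional
   derivatives exist and are continuous. *)
Section test_functions.
Context {R : realType} {V : normedModType R}.

Definition smooth (f : V -> R) := forall vs : seq V,
  let h := foldr (fun v h => 'D_v h) f vs in
  continuous h /\ forall x v, derivable h x v.

Definition test_function (D : set V) (f : V -> R) :=
  [/\ smooth f, compact (closure [set x | f x != 0])
    & closure [set x | f x != 0] `<=` D].

End test_functions.

Section Lp_on_a_set.
Context {d : measure_display} {T : measurableType d} {R : realType}.
Variables (mu : {measure set T -> \bar R}) (D : set T).
Local Open Scope ereal_scope.

Definition in_L1 (f : T -> R) := mu.-integrable D (EFin \o f).

Definition in_L2 (f : T -> R) := measurable_fun D f /\
  \int[mu]_(x in D) (f x ^+ 2)%:E < +oo.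

Definition in_Loo (f : T -> R) := measurable_fun D f /\
  exists C : R, {ae mu, forall x, D x -> (`|f x| <= C)%R}.

End Lp_on_a_set.

Section charge_integral.
Context {d : measure_display} {T : measurableType d} {R : realType}.

(* The integral of f over D against the signed measure nu, through the Jordan
   decomposition of nu (which does not depend on the Hahn decomposition). *)
Definition charge_integral (nu : {charge set T -> \bar R}) (D : set T)
    (f : T -> R) : R :=
  let: exist P exN := cid (Hahn_decomposition nu) in
  let: exist N PN := cid exN in
  Rintegral (jordan_pos PN) D f - Rintegral (jordan_neg PN) D f.

End charge_integral.

Section parabolic.
Context {R : realType} {N : nat}.
Implicit Types (Omega : set 'cV[R]_N) (T : R) (M : 'cV[R]_N -> 'M[R]_N).
Local Notation dx := (@lebesgue_vec R N).
Local Notation dtdx := (@lebesgue_tx R N).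

Definition dot (a b : 'cV[R]_N) : R := \sum_i a i ord0 * b i ord0.

Definition cylinder T Omega : set (R * 'cV[R]_N)%type := `]0, T[ `*` Omega.

Definition grad (f : 'cV[R]_N -> R) (x : 'cV[R]_N) : 'cV[R]_N :=
  \col_i 'D_(delta_mx i ord0) f x.

Definition dt (f : R * 'cV[R]_N -> R) (z : R * 'cV[R]_N) : R :=
  'D_((1, 0) : R * 'cV[R]_N) f z.

Definition gradx (f : R * 'cV[R]_N -> R) (z : R * 'cV[R]_N) : 'cV[R]_N :=
  \col_i 'D_((0, delta_mx i ord0) : R * 'cV[R]_N) f z.

Definition elliptic Omega M (alpha : R) :=
  {ae dx, forall x, Omega x ->
    forall xi : 'cV[R]_N, alpha * dot xi xi <= dot (M x *m xi) xi}.

Definition weak_gradient Omega (v : 'cV[R]_N -> R) (G : 'cV[R]_N -> 'cV[R]_N) :=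
  forall phi, test_function Omega phi -> forall i : 'I_N,
    \int[dx]_(x in Omega) (v x * grad phi x i ord0) =
    - \int[dx]_(x in Omega) (G x i ord0 * phi x).

(* v is in H^1_0(Omega), the closure of C_c^oo(Omega) in H^1(Omega), and G is
   its weak gradient. *)
Definition in_H10 Omega (v : 'cV[R]_N -> R) (G : 'cV[R]_N -> 'cV[R]_N) :=
  [/\ in_L2 dx Omega v, (forall i, in_L2 dx Omega (fun x => G x i ord0)),
      weak_gradient Omega v G
    & forall e : R, 0 < e -> exists2 phi, test_function Omega phi &
        (\int[dx]_(x in Omega) ((v x - phi x) ^+ 2)%:E +
         \int[dx]_(x in Omega) (dot (G x - grad phi x) (G x - grad phi x))%:E
         < e%:E)%E].

(* w is in L^2(0, T; H^1_0(Omega)), with spatial gradient G. *)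
Definition in_L2H10 Omega T (w : R * 'cV[R]_N -> R)
    (G : R * 'cV[R]_N -> 'cV[R]_N) :=
  [/\ in_L2 dtdx (cylinder T Omega) w,
      (forall i, in_L2 dtdx (cylinder T Omega) (fun z => G z i ord0))
    & {ae lebesgue1, forall t : R, 0 < t < T ->
        in_H10 Omega (fun x => w (t, x)) (fun x => G (t, x))}].

(* w is in C([0, T]; L^2(Omega)). *)
Definition in_CL2 Omega T (w : R * 'cV[R]_N -> R) :=
  (forall t, 0 <= t <= T -> in_L2 dx Omega (fun x => w (t, x))) /\
  (forall t, 0 <= t <= T ->
    (\int[dx]_(x in Omega) ((w (s, x) - w (t, x)) ^+ 2)%:E)%E
      @[s --> within `[0, T] (nbhs t)] --> 0%E).

(* w is the finite energy weak solution of
     - w_t - div (M^* grad w) = g in the cylinder, w(T) = 0, w = 0 on the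
   lateral boundary. The equation is read in the sense of distributions; it
   puts w_t in L^2(0, T; H^-1(Omega)). The pointwise slices w(t, .) are the
   L^2-continuous ones, so that w(0, .) and w(T, .) are the traces of w. *)
Definition retrograde_solution Omega T M (g w : R * 'cV[R]_N -> R) :=
  [/\ in_CL2 Omega T w,
      {ae dx, forall x, Omega x -> w (T, x) = 0}
    & exists G, in_L2H10 Omega T w G /\
      forall phi, test_function (cylinder T Omega) phi ->
        \int[dtdx]_(z in cylinder T Omega) (w z * dt phi z) +
        \int[dtdx]_(z in cylinder T Omega)
           dot ((M z.2)^T *m G z) (gradx phi z) =
        \int[dtdx]_(z in cylinder T Omega) (g z * phi z)].

(* Among the representatives of the retrograde solution, w is taken continuous
   on the cylinder, as mu may charge Lebesgue-null sets. Only the restriction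
   of mu to the cylinder matters; a finite signed Borel measure on the (open)
   cylinder is automatically a Radon measure. *)
Definition duality_solution Omega T M (mu : {charge set (R * 'cV[R]_N)%type -> \bar R})
    (u0 : 'cV[R]_N -> R) (u : R * 'cV[R]_N -> R) :=
  in_L1 dtdx (cylinder T Omega) u /\
  forall g, in_Loo dtdx (cylinder T Omega) g ->
  forall w, retrograde_solution Omega T M g w ->
    {within cylinder T Omega, continuous w} ->
    - (\int[dx]_(x in Omega) (u0 x * w (0, x))) +
      \int[dtdx]_(z in cylinder T Omega) (u z * g z) =
    charge_integral mu (cylinder T Omega) w.

End parabolic.

(* Main.v *)
(* A duality solution is a density u with \int u g = L(g), where L(g) is the value of u0 and mu on a
   retrograde solution w with source g.  Two facts make L a density.
   (1) |w| <= C (1 + \int |g|^(N+2)): pair w(t) with the iterates of the resolvent of the adjoint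
   elliptic operator, whose smoothing from L^1 to L^2 (Nash inequality) gives an integrable
   weight in t.  This also yields uniqueness of w.
   (2) There are enough continuous w: if v solves an elliptic equation, then v is continuous by
   De Giorgi's theorem and (c - t)_+ v(x) is an explicit retrograde solution; sums of such
   functions along an implicit Euler scheme give, by bounded a.e. limits, every bounded source.
   So L extends to all bounded g as an absolutely continuous charge, and u is its
   Radon-Nikodym density; testing with the sign of a difference gives uniqueness. *)
From HB Require Import structures.
Require Import Defs.
From mathcomp Require Import all_boot all_order all_algebra.
From mathcomp Require Import all_classical all_reals all_analysis.
From mathcomp Require Import measurable_realfun.
From mathcomp Require Import ring lra.

Set Implicit Arguments.
Unset Strict Implicit.
Unset Printing Implicit Defensive.

Import Order.TTheory GRing.Theory Num.Theory.
Import numFieldNormedType.Exports.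

Local Open Scope classical_set_scope.
Local Open Scope ring_scope.

Local Notation mfun := measurable_fun.
Local Notation mEFinP := measurable_EFinP.
Local Notation mfunTS := measurable_funTS.
Local Notation mcomp := measurableT_comp.
Local Notation lvec := lebesgue_vec.
Local Notation leb1 := lebesgue1.
Local Notation mfunT := (mfun setT).

(** The obstacle is that the duality identity speaks only of the sources [g] that admit a continuous
    [w], and that the value attached to [g] is not known in advance to be unique. Both are therefore
    kept in a linear relation, [dual_pair]: one a priori bound makes it single-valued and
    continuous, and a density principle extends its closure to all bounded sources. The exponent N+2
    comes from Young's inequality. Along the resolvent iterates u_k the L1 norm stays at most 1 and
    the squared L2 norm at most A rho_k^(-N), where rho_k is of the size of the square root of the
    elapsed time. Splitting |g u| into |u| / rho, rho^N u^2 / 2 and |g|^(N+2) / 2 costs 1/rho + A/2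
    per unit of time, and 1/rho is integrable. De Giorgi's argument runs on the same Nash
    inequality. Paraboloids take the role of cut-off functions there, so that all test functions are
    piecewise linear in u. *)

Lemma leEq d (T: porderType d) (x y: T): x = y -> (x <= y)%O.
by move->. Qed.

(** * Smooth functions and cut-offs *)
Section smooth_functions.
Context {R: realType} {V: normedModType R}.
Implicit Types f g: V -> R.

(** [smooth] speaks of all lists of directions at once; this graded form allows induction on the
    number of derivatives, as products and compositions require. *)
Fixpoint Cn (n: nat) (f: V -> R): Prop :=
 if n is m.+1 then
  continuous f /\ forall v, (forall x, derivable f x v) /\ Cn m ('D_v f)
 else continuous f.

Lemma CnW n f: Cn n.+1 f -> Cn n f.
elim: n f => [|n IH] f; first by case.
by move=> [cf df]; split =>// v; have [? ?] := df v; split =>//; exact: IH.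
Qed.
Lemma sm_derive f v: smooth f -> smooth ('D_v f).
by move=> sf vs; have := sf (rcons vs v); rewrite /= foldr_rcons. Qed.

Lemma smoothP f: smooth f <-> forall n, Cn n f.
split.
 move=> sf n; elim: n f sf => [|n IH] f sf; first by have [] := sf [::].
 split => [|v]; first by have [] := sf [::].
 split => [x|]; first by have [_] := sf [::]; exact.
 by apply: IH; exact: sm_derive.
move=> Cf vs; elim/last_ind: vs f Cf => [|vs v IH] f Cf /=.
 by split; [exact: (Cf 0%N)|move=> x v; have [_ /(_ v)[]] := Cf 1%N].
by rewrite foldr_rcons; apply: IH => n; have [_ /(_ v)[]] := Cf n.+1.
Qed.
Lemma sm_cont f: smooth f -> continuous f.
by move=> sf; have [] := sf [::]. Qed.
Lemma sm_der f x v: smooth f -> derivable f x v.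
by move=> sf; have [_] := sf [::]; exact. Qed.

Lemma derive_line f x v :
 'D_v f x = 'D_1 (fun h: R => f (h *: v + x)) 0.
rewrite /derive; set g1 := fun h => h^-1 *: _; set g2 := fun h => h^-1 *: _.
suff ->: g1 = g2 by [].
by rewrite funeqE /g1 /g2 => h /=; rewrite addr0 scale0r add0r [_%:A]mulr1.
Qed.

(** Only the derivative of [f] in the direction [v] is given. On the line through [x] along [v] it
    becomes differentiability in one variable, where the chain rule applies. *)
Lemma isd_comp (b: R -> R) f x v :
 derivable f x v -> derivable b (f x) 1 ->
 is_derive x v (b \o f) ('D_1 b (f x) * 'D_v f x).
move=> df db; set phi := fun h: R => f (h *: v + x).
have phi0: phi 0 = f x by rewrite /phi scale0r add0r.
have dphi: derivable phi 0 1 by exact: (derivable1P _ _ _).1 df.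
have db': derivable b (phi 0) 1 by rewrite phi0.
apply: DeriveDef.
 apply: (derivable1P _ _ _).2; apply/derivable1_diffP.
 exact: (differentiable_comp ((derivable1_diffP _ _).1 dphi)
  ((derivable1_diffP _ _).1 db')).
rewrite (derive_line f) -/phi -phi0 derive_line.
by have := derive1_comp dphi db'; rewrite !derive1E.
Qed.

Lemma isd_comp_eq (b: R -> R) f x v (df db: R) :
 is_derive x v f df -> is_derive (f x) (1: R) b db ->
 is_derive x v (fun y => b (f y)) (db * df).
by move=> [f1 <-] [b1 <-]; have [? ?] := isd_comp f1 b1; apply: DeriveDef.
Qed.
Lemma Cn_ext n f g: f =1 g -> Cn n f -> Cn n g.
by move=> /funext ->. Qed.

Lemma Cn_cst n (c: R): Cn n (fun=> c).
elim: n c => [|n IH] c; first exact: cst_continuous.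
split; first exact: cst_continuous.
move=> v; split; first by move=> x; exact: derivable_cst.
by apply: Cn_ext (IH 0) => x; rewrite derive_cst.
Qed.

Lemma CnD n f g: Cn n f -> Cn n g -> Cn n (fun x => f x + g x).
elim: n f g => [|n IH] f g.
 by move=> cf cg x; apply: continuousD; [exact: cf|exact: cg].
move=> [cf df] [cg dg]; split.
 by move=> x; apply: continuousD; [exact: cf|exact: cg].
move=> v; have [dfv Cf] := df v; have [dgv Cg] := dg v; split.
 by move=> x; apply: derivableD.
by apply: Cn_ext (IH _ _ Cf Cg) => x; rewrite -deriveD.
Qed.

Lemma CnM n f g: Cn n f -> Cn n g -> Cn n (fun x => f x * g x).
elim: n f g => [|n IH] f g.
 by move=> cf cg x; apply: continuousM; [exact: cf|exact: cg].
move=> Hf Hg; have [cf df] := Hf; have [cg dg] := Hg; split.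
 by move=> x; apply: continuousM; [exact: cf|exact: cg].
move=> v; have [dfv Cf] := df v; have [dgv Cg] := dg v; split.
 by move=> x; apply: derivableM.
apply: (@Cn_ext _ (fun x => f x * 'D_v g x + g x * 'D_v f x)).
 by move=> x; rewrite [RHS](deriveM (dfv x) (dgv x)).
by apply: CnD; apply: IH =>//; exact: CnW.
Qed.
Lemma sm_ext f g: f =1 g -> smooth f -> smooth g.
by move=> /funext ->. Qed.
Lemma sm_cst (c: R): smooth (fun _: V => c).
by apply/smoothP => n; exact: Cn_cst. Qed.
Lemma smoothD f g: smooth f -> smooth g -> smooth (fun x => f x + g x).
by move=> /smoothP sf /smoothP sg; apply/smoothP => n; exact: CnD. Qed.
Lemma smoothM f g: smooth f -> smooth g -> smooth (fun x => f x * g x).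
by move=> /smoothP sf /smoothP sg; apply/smoothP => n; exact: CnM. Qed.
Lemma smoothZ (c: R) f: smooth f -> smooth (fun x => c * f x).
by move=> sf; exact: smoothM (sm_cst c) sf. Qed.

Lemma smoothB f g: smooth f -> smooth g -> smooth (fun x => f x - g x).
move=> sf sg; apply: (@sm_ext (fun x => f x + (- 1) * g x)).
 by move=> x; rewrite mulN1r.
exact: smoothD sf (smoothZ (-1) sg).
Qed.

Lemma sm_sum (I: Type) (r: seq I) (F: I -> V -> R) :
 (forall i, smooth (F i)) -> smooth (fun x => \sum_(i <- r) F i x).
move=> sF; elim: r => [|i r IH].
 rewrite (_: (fun _ => _) = fun=> 0); first exact: sm_cst.
 by apply/funext => x; rewrite big_nil.
rewrite (_: (fun _ => _) = fun x => F i x + \sum_(j <- r) F j x).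
 exact: smoothD (sF i) IH.
by apply/funext => x; rewrite big_cons.
Qed.

Lemma sm_prod (I: Type) (r: seq I) (F: I -> V -> R) :
 (forall i, smooth (F i)) -> smooth (fun x => \prod_(i <- r) F i x).
move=> sF; elim: r => [|i r IH].
 rewrite (_: (fun _ => _) = fun=> 1); first exact: sm_cst.
 by apply/funext => x; rewrite big_nil.
rewrite (_: (fun _ => _) = fun x => F i x * \prod_(j <- r) F j x).
 exact: smoothM (sF i) IH.
by apply/funext => x; rewrite big_cons.
Qed.
End smooth_functions.

Section smooth_composition.
Context {R: realType}.

Lemma Cn_comp {V: normedModType R} n (b: R -> R) (f: V -> R) :
 Cn n b -> Cn n f -> Cn n (b \o f).
elim: n b f => [|n IH] b f.
 by move=> cb cf x; apply: continuous_comp; [exact: cf|exact: cb].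
move=> Hb Hf; have [cb db] := Hb; have [cf df] := Hf; split.
 by move=> x; apply: continuous_comp; [exact: cf|exact: cb].
move=> v; have [dfv Cf] := df v; have [dbv Cb] := db 1.
have cd x := isd_comp (dfv x) (dbv (f x)).
split; first by move=> x; have [] := cd x.
apply: (@Cn_ext _ _ _ (fun x => ('D_1 b \o f) x * 'D_v f x)).
 by move=> x; have [_ ->] := cd x.
by apply: CnM =>//; apply: IH =>//; exact: CnW.
Qed.
Lemma sm_comp {V: normedModType R} (b: R -> R) (f: V -> R) :
 smooth b -> smooth f -> smooth (b \o f).
by move=> /smoothP sb /smoothP sf; apply/smoothP => n; exact: Cn_comp. Qed.

Lemma isd_comp_lin {V W: normedModType R} (L: W -> V)
  (lL: forall (a: R) u w, L (a *: u + w) = a *: L u + L w)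
  (f: V -> R) x v :
 ('D_v (f \o L) x = 'D_(L v) f (L x)) *
 (derivable (f \o L) x v = derivable f (L x) (L v)).
suff E: (fun h => h^-1 *: (((f \o L) \o shift x) (h *: v) - (f \o L) x)) =
  (fun h => h^-1 *: ((f \o shift (L x)) (h *: L v) - f (L x))).
 by rewrite /derive /derivable E.
by apply/funext => h /=; rewrite lL.
Qed.

Lemma sm_comp_lin {V W: normedModType R} (L: W -> V)
  (f: V -> R): (forall (a: R) u w, L (a *: u + w) = a *: L u + L w) ->
 continuous L -> smooth f -> smooth (f \o L).
move=> lL cL /smoothP sf; apply/smoothP => n; have {sf} := sf n.
elim: n f => [|n IH] f.
 by move=> cf x; apply: continuous_comp; [exact: cL|exact: cf].
move=> [cf df]; split.
 by move=> x; apply: continuous_comp; [exact: cL|exact: cf].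
move=> v; have [dfv Cf] := df (L v); split.
 by move=> x; rewrite (isd_comp_lin lL).
by apply: Cn_ext (IH _ Cf) => x /=; rewrite (isd_comp_lin lL).
Qed.

Lemma sm_id: smooth (id: R -> R).
apply/smoothP => -[|n]; first by move=> x.
split; [by move=> x|move=> v; split; first by move=> x; exact: derivable_id].
by apply: Cn_ext (Cn_cst n v) => x; rewrite derive_id.
Qed.

(* A family of functions closed under differentiation, up to polynomial
  expressions, consists of smooth functions. *)
Lemma sm_closed (P: (R -> R) -> Prop) :
 (forall f, P f -> continuous f /\ forall x, derivable f x 1) ->
 (forall f, P f -> exists2 s: seq ((R -> R) * R),
   (forall p, p \in s -> P p.1) & 'D_1 f = fun x => \sum_(p <- s) p.2 * p.1 x) ->
 forall f, P f -> smooth f.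
move=> Pc Pd f Pf; apply/smoothP => n.
elim: n f Pf => [|n IH] f Pf; first by have [] := Pc f Pf.
have [cf df] := Pc f Pf; split; first exact: cf.
move=> v.
have dv x: is_derive x v f (v * 'D_1 f x).
 have da: is_derive (0: R) (1: R) (fun h: R => h *: v + x) v.
  apply: is_derive_eq (is_deriveD (is_deriveM (is_derive_id (0: R) (1: R))
   (is_derive_cst v (0: R) (1: R))) (is_derive_cst x (0: R) (1: R))) _.
  by rewrite /GRing.scale /= mul0r add0r addr0 mulr1.
 have [d1 d2] := isd_comp_eq da (derivableP (df _)).
 apply: DeriveDef; first by apply: (derivable1P _ _ _).2.
 by rewrite derive_line d2 scale0r add0r mulrC.
split; first by move=> x; have [] := dv x.
have [s Ps Ds] := Pd f Pf.
apply: (@Cn_ext _ _ _ (fun x => v * \sum_(p <- s) p.2 * p.1 x)).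
 by move=> x; have [_ ->] := dv x; congr (v * _); rewrite [RHS](congr1 (@^~ x) Ds).
apply: CnM; first exact: Cn_cst.
elim: s Ps {Ds} => [|p s IHs] Ps.
 by apply: Cn_ext (Cn_cst n 0) => x; rewrite big_nil.
apply: (@Cn_ext _ _ _ (fun x => p.2 * p.1 x + \sum_(q <- s) q.2 * q.1 x)).
 by move=> x; rewrite big_cons.
apply: CnD.
 by apply: CnM; [exact: Cn_cst|apply: IH; apply: Ps; rewrite mem_head].
by apply: IHs => q qs; apply: Ps; rewrite in_cons qs orbT.
Qed.
End smooth_composition.
Section smooth_examples.
Context {R: realType}.
Lemma sm_lin {V: normedModType R} (L: V -> R) :
 (forall (a: R) u w, L (a *: u + w) = a * L u + L w) -> continuous L -> smooth L.
by move=> lL cL; exact: (sm_comp_lin lL cL sm_id). Qed.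

Lemma sm_expR: smooth (@expR R).
apply: (@sm_closed _ (fun f => f = @expR R)) =>// _ ->.
 by split; [exact: continuous_expR|exact: derivable_expR].
exists [:: (@expR R, 1)]; first by move=> p; rewrite inE => /eqP ->.
apply/funext => x; rewrite big_seq1 mul1r.
exact: (congr1 (@^~ x) (@derive_expR R)).
Qed.
(** The functions s^(-k) exp(-1/s) extended by 0. The whole family in [k] is defined because the
    derivative of one member is a combination of those of index k+1 and k+2. *)
Definition flatexp (k: nat) (s: R): R :=
 if 0 < s then s^-1 ^+ k * expR (- s^-1) else 0.

Lemma flatexp_ge0 k s: 0 <= flatexp k s.
rewrite /flatexp; case: ifPn =>// s0.
by rewrite mulr_ge0 ?expR_ge0// exprn_ge0// invr_ge0 ltW.
Qed.

Lemma flatexp_gt0 k s: 0 < s -> 0 < flatexp k s.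
by move=> s0; rewrite /flatexp s0 mulr_gt0 ?expR_gt0// exprn_gt0// invr_gt0.
Qed.
Lemma flatexp_le0 k s: s <= 0 -> flatexp k s = 0.
by rewrite /flatexp leNgt => /negbTE ->. Qed.

(** Follows from exp(1/s) >= (1/s)^(k+1) / (k+1)!. The difference quotient of [flatexp k] at 0 is
    [flatexp k.+1], and this linear bound makes it tend to 0. *)
Lemma flatexp_le k s: flatexp k s <= k.+1`!%:R * `|s|.
have [s0|s0] := ltP 0 s; last by rewrite flatexp_le0// mulr_ge0.
rewrite /flatexp s0 expRN gtr0_norm// ler_pdivrMr ?expR_gt0//.
have := expR_ge1Dxn k (ltW (_: 0 < s^-1)); rewrite invr_gt0 => /(_ s0) h.
have f0: 0 < k.+1`!%:R * s by rewrite mulr_gt0// ltr0n fact_gt0.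
rewrite -ler_pdivrMl//; apply: le_trans h; rewrite ler_wpDl//.
by rewrite exprS invfM le_eqVlt; apply/orP; left; apply/eqP; ring.
Qed.

Lemma isd_invr (s: R): s != 0 ->
 is_derive s (1: R) (fun x: R => x^-1) (- s^-1 ^+ 2).
move=> s0; apply: DeriveDef; first by apply: (@derivableV _ _ id).
by rewrite (@deriveV _ _ id)// derive_id [LHS]mulr1 exprVn.
Qed.

Lemma isd_expVr k (s: R): s != 0 ->
 is_derive s (1: R) (fun x: R => x^-1 ^+ k * expR (- x^-1))
  (s^-1 ^+ k.+2 * expR (- s^-1) - k%:R * (s^-1 ^+ k.+1 * expR (- s^-1))).
move=> s0; have dV := isd_invr s0.
have dE := isd_comp_eq (is_deriveN dV) (is_derive_expR _).
have dX := is_deriveX k dV.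
rewrite (_: (fun _ => _) = (fun x: R => x^-1) ^+ k * (fun x: R => expR (- x^-1))).
 apply: is_derive_eq (is_deriveM dX dE) _.
 rewrite /= /GRing.scale /= !opprK exprfctE.
 have ->: (- (fun x: R => x^-1)) s = - s^-1 by [].
 case: k {dX} => [|k] /=; first by rewrite !expr0 !mul0r !mul1r mulr0 subr0 addr0 mulrC.
 rewrite !exprS; ring.
by rewrite exprfctE.
Qed.

Lemma isd_flatexp k (s: R) :
 is_derive s (1: R) (flatexp k) (flatexp k.+2 s - k%:R * flatexp k.+1 s).
have [s0|s0|s0] := ltgtP s 0.
- rewrite !flatexp_le0 ?(ltW s0)// mulr0 subr0.
 have E: {near s, cst (0: R) =1 flatexp k}.
  by near=> x; rewrite flatexp_le0//; near: x; exact: lt_le_nbhsl.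
 exact: near_eq_is_derive E (is_derive_cst _ _ _).
- have E: {near s, (fun x: R => x^-1 ^+ k * expR (- x^-1)) =1 flatexp k}.
  near=> x; have x0: 0 < x by near: x; exact: lt_nbhsr.
  by rewrite /flatexp x0.
 rewrite [flatexp k.+2 s]/flatexp [flatexp k.+1 s]/flatexp s0.
 exact: near_eq_is_derive E (isd_expVr k (lt0r_neq0 s0)).
- rewrite s0 !flatexp_le0// mulr0 subr0.
 have c0: (fun h: R => h^-1 *: ((flatexp k \o shift (0: R)) (h *: (1: R)) - flatexp k 0)) @ 0^' --> (0: R).
  have ->: (fun h: R => h^-1 *: ((flatexp k \o shift (0: R)) (h *: (1: R)) - flatexp k 0)) = flatexp k.+1.
   apply/funext => h /=; rewrite addr0 [h *: 1]mulr1 (@flatexp_le0 _ 0)// subr0.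
   have [h0|h0] := ltP 0 h; last by rewrite !flatexp_le0// scaler0.
   by rewrite /flatexp h0 exprS /GRing.scale /= mulrA.
  have h1: {for (0: R), continuous (fun h: R => k.+2`!%:R * `|h| : R)}.
   by apply: continuousM; [exact: cst_continuous|exact: norm_continuous].
  move: h1; rewrite /prop_for /continuous_at /= normr0 mulr0 => h1.
  have h2: (fun h: R => k.+2`!%:R * `|h|) @ 0^' --> (0: R).
   exact: cvg_within_filter h1.
  apply: (squeeze_cvgr _ (cvg_cst 0) h2).
  by near=> x; rewrite flatexp_ge0 flatexp_le.
 by apply: DeriveDef; [apply/cvg_ex; exists 0|exact: cvg_lim c0].
Unshelve. all: by end_near. Qed.

Lemma sm_flatexp k: smooth (flatexp k).
apply: (@sm_closed _ (fun f => exists k, f = flatexp k)); last by exists k.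
 move=> _ [j ->]; have d x: derivable (flatexp j) x 1.
  by have [] := isd_flatexp j x.
 by split =>// x; apply/differentiable_continuous/derivable1_diffP.
move=> _ [j ->]; exists [:: (flatexp j.+2, 1); (flatexp j.+1, - j%:R)].
 by move=> p; rewrite !inE => /orP[] /eqP -> /=; [exists j.+2|exists j.+1].
apply/funext => x; rewrite big_cons big_seq1 /= mul1r mulNr.
by have [_ ->] := isd_flatexp j x.
Qed.
(** [flatexp 0] composed with itself: the inner difference is nonpositive for s <= 0 and constant
    for s >= 1, which flattens both ends, and the only divisor is a constant. *)
Definition step (s: R): R :=
 flatexp 0 (flatexp 0 1 - flatexp 0 (1 - s)) / flatexp 0 (flatexp 0 1).

Lemma flatexp0_homo: {homo flatexp 0: x y / x <= y}.
move=> x y xy; rewrite /flatexp !expr0 !mul1r.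
case: ifPn => x0; last by case: ifPn =>// _; exact: expR_ge0.
by rewrite (lt_le_trans x0 xy) ler_expR lerN2 lef_pV2 ?posrE// (lt_le_trans x0).
Qed.

Lemma step_le0 s: s <= 0 -> step s = 0.
move=> s0; rewrite /step (@flatexp_le0 _ (_ - _)) ?mul0r// subr_le0.
by apply: flatexp0_homo; rewrite lerDl oppr_ge0.
Qed.

Lemma step_ge1 s: 1 <= s -> step s = 1.
move=> s1; rewrite /step (@flatexp_le0 _ (1 - s)) ?subr_le0// subr0 divff//.
by rewrite gt_eqF// flatexp_gt0// flatexp_gt0.
Qed.

Lemma step_01 s: 0 <= step s <= 1.
have h: 0 < flatexp 0 (flatexp 0 1) by rewrite flatexp_gt0// flatexp_gt0.
rewrite /step divr_ge0 ?flatexp_ge0//= ler_pdivrMr// mul1r flatexp0_homo//.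
by rewrite gerBl flatexp_ge0.
Qed.

Lemma sm_step: smooth step.
have h: smooth (fun s: R => flatexp 0 1 - flatexp 0 (1 - s)).
 apply: smoothB; first exact: sm_cst.
 apply: (sm_comp (sm_flatexp 0)).
 exact: smoothB (sm_cst 1) sm_id.
apply: sm_ext (smoothZ (flatexp 0 (flatexp 0 1))^-1
 (sm_comp (sm_flatexp 0) h)) => s.
by rewrite mulrC.
Qed.
Definition sigmoid (s: R): R := (1 + expR (- s))^-1.
Lemma sigmoid_den (s: R): 0 < 1 + expR (- s).
by rewrite addr_gt0// expR_gt0. Qed.

Lemma sigmoid_01 s: 0 <= sigmoid s <= 1.
rewrite invr_ge0 (ltW (sigmoid_den s))/= invf_le1 ?sigmoid_den//.
by rewrite lerDl expR_ge0.
Qed.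

Lemma isd_onePexpR (s c: R) :
 is_derive s (1: R) (fun x => 1 + expR (c * x)) (c * expR (c * s)).
have dc: is_derive s (1: R) (fun x: R => c * x) c.
 by apply: is_derive_eq (is_deriveZ c (is_derive_id s (1: R))) _; rewrite [LHS]mulr1.
have dE := isd_comp_eq dc (is_derive_expR _).
apply: is_derive_eq (is_deriveD (is_derive_cst (1: R) s (1: R)) dE) _.
by rewrite add0r mulrC.
Qed.

Lemma isd_sigmoid (s: R) :
 is_derive s (1: R) sigmoid (sigmoid s - sigmoid s ^+ 2).
have d: is_derive s (1: R) (fun x => 1 + expR (- x)) (- expR (- s)).
 have := isd_onePexpR s (- 1); rewrite mulN1r.
 by under eq_fun do rewrite mulN1r; rewrite mulN1r.
have n0 := lt0r_neq0 (sigmoid_den s).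
apply: is_derive_eq (isd_comp_eq d (isd_invr n0)) _.
by rewrite /sigmoid; move: (expR (- s)) n0 => e n0; field.
Qed.

Lemma isd_softplus (s: R) :
 is_derive s (1: R) (fun s => ln (1 + expR s)) (sigmoid s).
have p x: 0 < 1 + expR x :> R by rewrite addr_gt0// expR_gt0.
have d: is_derive s (1: R) (fun x => 1 + expR x) (expR s).
 have := isd_onePexpR s 1; rewrite !mul1r.
 by under eq_fun do rewrite mul1r.
have [d1 d2] := d.
have dl := is_derive1_ln (p s).
have [dl1 dl2] := dl.
apply: is_derive_eq (isd_comp d1 dl1) _.
rewrite d2 dl2 /sigmoid expRN; have := expR_gt0 s; move: (expR s) => e e0.
by field; rewrite !lt0r_neq0// addr_gt0.
Qed.

(** The family closed under differentiation consists of the softplus and of all powers of its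
    derivative [sigmoid], because sigmoid' = sigmoid - sigmoid^2. *)
Lemma sm_softplus: smooth (fun s: R => ln (1 + expR s)).
pose Q (f: R -> R) := (f = fun s => ln (1 + expR s)) \/
 exists k, f = sigmoid ^+ k.
have dX k s := is_deriveX k (isd_sigmoid s).
apply: (@sm_closed _ Q); last by left.
 move=> f Qf; suff d x: derivable f x 1.
  by split =>// x; apply/differentiable_continuous/derivable1_diffP.
 case: Qf => [->|[k ->]]; first by have [] := isd_softplus x.
 by have [] := dX k x.
move=> f [->|[k ->]].
 exists [:: (sigmoid ^+ 1, 1)].
  by move=> p; rewrite inE => /eqP ->; right; exists 1%N.
 apply/funext => x; rewrite big_seq1 mul1r expr1.
 by have [_ ->] := isd_softplus x.
exists [:: (sigmoid ^+ k, k%:R); (sigmoid ^+ k.+1, - k%:R)].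
 by move=> p; rewrite !inE => /orP[] /eqP -> /=; right; [exists k|exists k.+1].
apply/funext => x; rewrite big_cons big_seq1 /=.
have [_ E] := dX k x; rewrite [LHS]E /GRing.scale /= !exprfctE.
by case: k {dX E} => [|k] /=; rewrite ?mul0r ?oppr0 ?mul0r ?addr0// !exprS; ring.
Qed.
Lemma derive_softplus (s: R): 'D_1 (fun s => ln (1 + expR s)) s = sigmoid s.
by have [_ ->] := isd_softplus s. Qed.
End smooth_examples.

(** * Test functions *)

Section test_function_theory.
Context {R: realType} {V: normedModType R}.
Implicit Types (D K: set V) (f g: V -> R).

Lemma tfI D K f: smooth f -> compact K -> K `<=` D ->
 (forall x, f x != 0 -> K x) -> test_function D f.
move=> sf cK KD fK.
have clK: closed K by exact: (compact_closed (@norm_hausdorff _ _)).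
have sub: closure [set x | f x != 0] `<=` K.
 by move/closure_id: clK => ->; exact: closure_subset.
split =>//; last exact: subset_trans sub KD.
exact: subclosed_compact (@closed_closure _ _) cK sub.
Qed.
Lemma tf_smooth D f: test_function D f -> smooth f.
by case. Qed.

Lemma tf_out D f x: test_function D f -> ~ D x -> f x = 0.
move=> [_ _ fD] Dx; apply/eqP/negPn/negP => fx; apply: Dx; apply: fD.
exact: subset_closure.
Qed.

Lemma tf0 D: test_function D (fun=> 0).
by apply: (@tfI _ set0);
 [exact: sm_cst|exact: compact0|exact: sub0set|move=> x /=; rewrite eqxx].
Qed.

Lemma tfM D f g: test_function D f -> smooth g ->
 test_function D (fun x => f x * g x).
move=> [sf cf fD] sg; apply: (tfI (smoothM sf sg) cf fD) => x.
by rewrite mulf_eq0 negb_or => /andP[fx _]; exact: subset_closure.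
Qed.

Lemma tfD D f g: test_function D f -> test_function D g ->
 test_function D (fun x => f x + g x).
move=> [sf cf fD] [sg cg gD].
apply: (tfI (smoothD sf sg) (compactU cf cg)).
 by move=> x [/fD|/gD].
move=> x; have [fx|fx] := eqVneq (f x) 0.
 by rewrite fx add0r => gx; right; exact: subset_closure.
by move=> _; left; exact: subset_closure.
Qed.

Lemma tfZ D (c: R) f: test_function D f ->
 test_function D (fun x => c * f x).
move=> tf; rewrite (_: (fun _ => _) = fun x => f x * c).
 exact: tfM tf (sm_cst c).
by apply/funext => x; rewrite mulrC.
Qed.

Lemma tf_sum (I: Type) (r: seq I) D (F: I -> V -> R) :
 (forall i, test_function D (F i)) ->
 test_function D (fun x => \sum_(i <- r) F i x).
move=> sF; elim: r => [|i r IH].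
 rewrite (_: (fun _ => _) = fun=> 0); first exact: tf0.
 by apply/funext => x; rewrite big_nil.
rewrite (_: (fun _ => _) = fun x => F i x + \sum_(j <- r) F j x).
 exact: tfD (sF i) IH.
by apply/funext => x; rewrite big_cons.
Qed.

Lemma tf_comp D f (b: R -> R): test_function D f -> smooth b ->
 b 0 = 0 -> test_function D (b \o f).
move=> [sf cf fD] sb b0; apply: (tfI (sm_comp sb sf) cf fD) => x.
by have [/= ->|fx] := eqVneq (f x) 0; rewrite ?b0 ?eqxx// => _; exact: subset_closure.
Qed.

Lemma tf_derive D f v: test_function D f -> test_function D ('D_v f).
move=> [sf cf fD]; apply: (tfI (sm_derive v sf) cf fD) => x.
apply: contraPP => xK; apply/negP; rewrite negbK; apply/eqP.
have op: open (~` closure [set x | f x != 0]).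
 by rewrite openC; exact: closed_closure.
rewrite (@near_eq_derive _ _ _ f (cst 0)) ?derive_cst//.
near=> y; apply/eqP/negPn/negP => fy.
have: (~` closure [set x | f x != 0]) y by near: y; exact: open_nbhs_nbhs.
by apply; exact: subset_closure.
Unshelve. all: by end_near. Qed.

Lemma tf_bnd D f: test_function D f ->
 exists2 C, 0 <= C & forall x, `|f x| <= C.
move=> [sf cf fD].
have cK: compact (f @` closure [set x | f x != 0]).
 apply: continuous_compact cf; apply: continuous_subspaceT => x.
 exact: sm_cont.
have [M [_ MC]] := compact_bounded cK.
have M1: M < `|M| + 1 by rewrite (le_lt_trans (ler_norm M))// ltrDl.
exists (`|M| + 1) => [|x]; first by rewrite addr_ge0.
have [->|fx] := eqVneq (f x) 0; first by rewrite normr0 addr_ge0.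
by apply: (MC _ M1); exists x =>//; exact: subset_closure.
Qed.
End test_function_theory.

Section tf_prod.
Context {R: realType} {V W: normedModType R}.

Lemma sm_fst (f: V -> R): smooth f -> smooth (fun z: V * W => f z.1).
by apply: (@sm_comp_lin _ V (V * W)%type fst) =>// x; exact: cvg_fst.
Qed.

Lemma sm_snd (f: W -> R): smooth f -> smooth (fun z: V * W => f z.2).
by apply: (@sm_comp_lin _ W (V * W)%type snd) =>// x; exact: cvg_snd.
Qed.

Lemma tf_prod (A: set V) (B: set W) f g :
 test_function A f -> test_function B g ->
 test_function (A `*` B) (fun z: V * W => f z.1 * g z.2).
move=> [sf cf fA] [sg cg gB].
apply: (tfI (smoothM (sm_fst sf) (sm_snd sg))
 (compact_setX cf cg)).
 by move=> [x y] [/= /fA ? /gB].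
move=> [x y] /=; rewrite mulf_eq0 negb_or => /andP[fx gy].
by split; exact: subset_closure.
Qed.
Lemma derive_fst (f: V -> R) (v: V) (w: W) z :
 'D_((v, w): V * W) (fun z: V * W => f z.1) z = 'D_v f z.1.
by have [-> _] := @isd_comp_lin _ V (V * W)%type fst (fun _ _ _ => erefl) f z (v, w). Qed.
Lemma derive_snd (f: W -> R) (v: V) (w: W) z :
 'D_((v, w): V * W) (fun z: V * W => f z.2) z = 'D_w f z.2.
by have [-> _] := @isd_comp_lin _ W (V * W)%type snd (fun _ _ _ => erefl) f z (v, w). Qed.
End tf_prod.

(** * Bumps and cut-offs on boxes *)

Section bumps.
Context {R: realType} {n: nat}.
Implicit Types a b x: 'cV[R]_n.

Lemma sm_coord (i: 'I_n): smooth (fun x: 'cV[R]_n => x i ord0).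
apply: sm_lin; first by move=> a u w; rewrite !mxE.
exact: coord_continuous.
Qed.
Definition obox a b := [set x: 'cV[R]_n | forall i, a i ord0 < x i ord0 < b i ord0].
Definition cbox a b := [set x: 'cV[R]_n | forall i, a i ord0 <= x i ord0 <= b i ord0].

Lemma trmx_cont p q: continuous (@trmx R p q).
move=> x A [P hP PA]; exists (fun i j => P j i) => [i j|y Py].
 by have := hP j i; rewrite mxE.
by apply: PA => i j; rewrite mxE; exact: Py.
Qed.

Lemma cbox_compact a b: compact (cbox a b).
have h := @rV_compact R n (fun i => `[a i ord0, b i ord0]%classic)
 (fun i => @segment_compact _ _ _).
suff ->: cbox a b = @trmx R 1 n @`
  [set v: 'rV[R]_n | forall i, `[a i ord0, b i ord0]%classic (v ord0 i)].
 by apply: continuous_compact h; apply: continuous_subspaceT => x; exact: trmx_cont.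
apply/seteqP; split => [x ax|_ [y ay <-] i].
 by exists x^T => [i|]; rewrite ?trmxK//= mxE in_itv/=; exact: ax.
by have := ay i; rewrite /= in_itv /= mxE.
Qed.
Definition bump a b x: R :=
 \prod_i (flatexp 0 (x i ord0 - a i ord0) * flatexp 0 (b i ord0 - x i ord0)).

Lemma sm_bump a b: smooth (bump a b).
apply: sm_prod => i; apply: smoothM.
 apply: (sm_comp (sm_flatexp 0)).
 exact: smoothB (sm_coord i) (sm_cst _).
apply: (sm_comp (sm_flatexp 0)).
exact: smoothB (sm_cst _) (sm_coord i).
Qed.
Lemma bump_ge0 a b x: 0 <= bump a b x.
by apply: prodr_ge0 => i _; rewrite mulr_ge0// flatexp_ge0. Qed.

Lemma bump_gt0 a b x: (0 < bump a b x) = `[< obox a b x >].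
apply/idP/asboolP => [h i|h]; last first.
 apply: prodr_gt0 => i _; have /andP[h1 h2] := h i.
 by rewrite mulr_gt0// flatexp_gt0// subr_gt0.
rewrite !ltNge -negb_or; apply/negP => hi; move: h.
rewrite /bump (bigD1 i)//= (_: flatexp 0 _ * flatexp 0 _ = 0) ?mul0r ?ltxx//.
case/orP: hi => hi; first by rewrite flatexp_le0 ?mul0r// subr_le0.
by rewrite [X in _ * X]flatexp_le0 ?mulr0// subr_le0.
Qed.

Lemma test_bump (D: set 'cV[R]_n) a b: cbox a b `<=` D ->
 test_function D (bump a b).
move=> abD; apply: (tfI (sm_bump a b) (@cbox_compact a b) abD) => x bx.
have: 0 < bump a b x by rewrite lt_def bx bump_ge0.
by rewrite bump_gt0 => /asboolP h i; have /andP[/ltW -> /ltW ->] := h i.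
Qed.

(* equal to 1 on the cube of radius r around c, to 0 outside that of radius s *)
Definition cutoff (c: 'cV[R]_n) (r s: R) x: R :=
 \prod_i (step ((s - (x i ord0 - c i ord0)) / (s - r)) *
      step ((s + (x i ord0 - c i ord0)) / (s - r))).

Lemma sm_cutoff c r s: smooth (cutoff c r s).
have sc i := smoothB (sm_coord i) (sm_cst (c i ord0)).
apply: sm_prod => i; apply: smoothM.
 apply: (sm_comp sm_step).
 exact: smoothM (smoothB (sm_cst s) (sc i)) (sm_cst (s - r)^-1).
apply: (sm_comp sm_step).
exact: smoothM (smoothD (sm_cst s) (sc i)) (sm_cst (s - r)^-1).
Qed.
Lemma mulr_01 (p q: R): 0 <= p <= 1 -> 0 <= q <= 1 -> 0 <= p * q <= 1.
by move=> /andP[p0 p1] /andP[q0 q1]; rewrite mulr_ge0// mulr_ile1. Qed.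

Lemma cutoff_01 c r s x: 0 <= cutoff c r s x <= 1.
have h i: 0 <= step ((s - (x i ord0 - c i ord0)) / (s - r)) *
   step ((s + (x i ord0 - c i ord0)) / (s - r)) <= 1.
 exact: mulr_01 (step_01 _) (step_01 _).
rewrite /cutoff; apply/andP; split.
 by apply: prodr_ge0 => i _; have /andP[] := h i.
by apply: prodr_ile1 => i _; exact: h.
Qed.

Lemma cutoff_eq1 (c: 'cV[R]_n) (r s: R) x: r < s -> (forall i, `|x i ord0 - c i ord0| <= r) ->
 cutoff c r s x = 1.
move=> rs xr; rewrite /cutoff big1// => i _.
have := xr i; rewrite ler_norml => /andP[h1 h2].
by rewrite !step_ge1 ?mulr1// ler_pdivlMr ?subr_gt0// mul1r; lra.
Qed.

Lemma cutoff_neq0 (c: 'cV[R]_n) (r s: R) x: r < s -> cutoff c r s x != 0 ->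
 forall i, `|x i ord0 - c i ord0| < s.
move=> rs h i; rewrite ltNge; apply: contra h => h; apply/eqP.
suff E: step ((s - (x i ord0 - c i ord0)) / (s - r)) *
   step ((s + (x i ord0 - c i ord0)) / (s - r)) = 0.
 by rewrite /cutoff (bigD1 i) //; apply/eqP; rewrite mulf_eq0 E eqxx.
have sr: 0 < (s - r)^-1 by rewrite invr_gt0 subr_gt0.
have [x0|x0] := leP 0 (x i ord0 - c i ord0).
 rewrite ger0_norm// in h.
 by rewrite step_le0 ?mul0r// pmulr_lle0// subr_le0.
rewrite ltr0_norm// in h.
by rewrite [X in _ * X]step_le0 ?mulr0// pmulr_lle0//; lra.
Qed.
End bumps.
(** * Lebesgue measure on columns *)
Section vec_measurable.
Context {R: realType}.
Lemma meas_coord n (i: 'I_n) :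
 measurable_fun [set: 'cV[R]_n] (fun x: 'cV[R]_n => x i ord0).
exact: measurable_mx_entry. Qed.

Lemma meas_forall_coord n (B: 'I_n -> set R) :
 (forall i, measurable (B i)) ->
 measurable [set x: 'cV[R]_n | forall i, B i (x i ord0)].
move=> mB.
rewrite (_: [set x | _] = \bigcap_(i in [set: 'I_n]) ((fun x: 'cV[R]_n => x i ord0) @^-1` B i)).
 apply: fin_bigcap_measurable =>// i _; rewrite -[X in measurable X]setTI.
 by apply: meas_coord.
by apply/seteqP; split => [x h i _|x h i]; [exact: h|exact: (h i)].
Qed.

Lemma meas_obox n (a b: 'cV[R]_n): measurable (obox a b).
rewrite (_: obox a b = [set x | forall i, `]a i ord0, b i ord0[%classic (x i ord0)]).
 by apply: (meas_forall_coord (B := fun i => _)) => i; exact: measurable_itv.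
by apply/seteqP; split => x h i; have := h i; rewrite /= in_itv.
Qed.

Lemma meas_cbox n (a b: 'cV[R]_n): measurable (cbox a b).
rewrite (_: cbox a b = [set x | forall i, `[a i ord0, b i ord0]%classic (x i ord0)]).
 by apply: (meas_forall_coord (B := fun i => _)) => i; exact: measurable_itv.
by apply/seteqP; split => x h i; have := h i; rewrite /= in_itv.
Qed.

Lemma open_nbhs_box n (O: set 'cV[R]_n) x: open O -> O x ->
 exists2 e, 0 < e & forall y: 'cV[R]_n,
  (forall i, `|y i ord0 - x i ord0| < e) -> O y.
move=> oO Ox; have: nbhs x O by exact: open_nbhs_nbhs.
move=> /nbhs_ballP[e e0 eO]; exists e =>// y hy; apply: eO; split =>// i j.
by rewrite ord1 /ball /= distrC; exact: hy.
Qed.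

(** Boxes with rational corners, enumerated through [pickle]. Countability is what makes open sets
    measurable for the sigma-algebra of the entries, and later lets null sets be collected. *)
Lemma box_basis n: exists F: nat -> 'cV[R]_n * 'cV[R]_n, forall x (e: R), 0 < e ->
 exists k, obox (F k).1 (F k).2 x /\
  forall y, cbox (F k).1 (F k).2 y -> forall i, `|y i ord0 - x i ord0| < e.
pose G (p: 'cV[rat]_n * 'cV[rat]_n): 'cV[R]_n * 'cV[R]_n :=
 (map_mx ratr p.1, map_mx ratr p.2).
pose F k := if @unpickle ('cV[rat]_n * 'cV[rat]_n)%type k is Some p then G p else (0, 0).
exists F => x e e0.
have h1 (i: 'I_n): exists q: rat, x i ord0 - e < ratr q < x i ord0.
 have /rat_in_itvoo[q]: x i ord0 - e < x i ord0 by rewrite gtrBl.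
 by rewrite in_itv; exists q.
have h2 (i: 'I_n): exists q: rat, x i ord0 < ratr q < x i ord0 + e.
 have /rat_in_itvoo[q]: x i ord0 < x i ord0 + e by rewrite ltrDl.
 by rewrite in_itv; exists q.
have [f1 f1P] := choice h1; have [f2 f2P] := choice h2.
pose p := (\col_i f1 i, \col_i f2 i): 'cV[rat]_n * 'cV[rat]_n.
have Fp: F (pickle p) = G p by rewrite /F pickleK.
exists (pickle p); rewrite /= Fp /=; split.
 by move=> i; rewrite !mxE; have /andP[_ ->] := f1P i; have /andP[-> _] := f2P i.
move=> y yp i; have := yp i; rewrite !mxE.
by have /andP[? ?] := f1P i; have /andP[? ?] := f2P i => /andP[? ?]; rewrite ltr_norml; lra.
Qed.

Lemma open_bigcup_box n (O: set 'cV[R]_n): open O ->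
 exists (F: nat -> 'cV[R]_n * 'cV[R]_n) (P: set nat),
  O = \bigcup_(k in P) obox (F k).1 (F k).2 /\
  forall k, P k -> cbox (F k).1 (F k).2 `<=` O.
move=> oO; have [F FP] := box_basis n.
exists F, [set k | cbox (F k).1 (F k).2 `<=` O]; split =>//.
apply/seteqP; split => [x Ox|x [k kO xk]]; last first.
 by apply: kO => i; have /andP[/ltW -> /ltW ->] := xk i.
have [e e0 eO] := open_nbhs_box oO Ox; have [k [kx kc]] := FP x e e0.
by exists k =>//= y /kc; exact: eO.
Qed.

Lemma open_meas_vec n (O: set 'cV[R]_n): open O -> measurable O.
move=> /open_bigcup_box[F [P [-> _]]].
by apply: bigcup_measurable => k _; exact: meas_obox.
Qed.

Lemma vuncons_cont n: continuous (@vuncons R n).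
move=> v A [[P Q] [/= nP nQ] PQA].
have n1: nbhs v ((fun w: 'cV[R]_n.+1 => w ord0 ord0) @^-1` P).
 exact: (@coord_continuous R n.+1 1 ord0 ord0 v P nP).
have n2: nbhs v ((fun w: 'cV[R]_n.+1 => \col_i w (lift ord0 i) ord0) @^-1` Q).
 move: nQ => [B hB BQ].
 exists (fun i j => if unlift ord0 i is Some k then B k j else setT).
  move=> i j; case: unliftP => [k ->|_]; last exact: filterT.
  by rewrite (ord1 j); have := hB k ord0; rewrite mxE.
 move=> y By; apply: BQ => i j; rewrite mxE.
 by rewrite (ord1 j); have := By (lift ord0 i) ord0; rewrite liftK.
by apply: filterS (filterI n1 n2) => w [w1 w2]; apply: PQA.
Qed.
Lemma vcons0 n s (x: 'cV[R]_n): vcons (s, x) ord0 ord0 = s.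
exact: (congr1 fst (vunconsK (s, x))). Qed.

Lemma vconsS n s (x: 'cV[R]_n) i: vcons (s, x) (lift ord0 i) ord0 = x i ord0.
by have /colP/(_ i) := congr1 snd (vunconsK (s, x)); rewrite mxE.
Qed.

Lemma vconsP n (v: 'cV[R]_n.+1) s (x: 'cV[R]_n): v ord0 ord0 = s ->
 (forall i, v (lift ord0 i) ord0 = x i ord0) -> v = vcons (s, x).
move=> v0 vS; apply/colP => i; case: (unliftP ord0 i) => [k ->|->].
 by rewrite vS vconsS.
by rewrite v0 vcons0.
Qed.

Lemma vcons_cont n: continuous (@vcons R n).
move=> [s x] A [P hP PA].
exists (P ord0 ord0, [set y: 'cV[R]_n | forall i, P (lift ord0 i) ord0 (y i ord0)]).
 split; first by have := hP ord0 ord0; rewrite vcons0.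
 exists (fun i j => P (lift ord0 i) ord0) => [i j|y h i]; last exact: h.
 by rewrite ord1; have := hP (lift ord0 i) ord0; rewrite vconsS.
move=> [t y] [/= h1 h2]; apply: PA => i j; rewrite ord1.
by case: (unliftP ord0 i) => [k ->|->]; rewrite ?vconsS ?vcons0.
Qed.

(** The sigma-algebra of the product comes from rectangles; [vuncons] carries the question to
    R^(n+1), where open sets are countable unions of boxes. *)
Lemma open_meas_tx n (O: set (R * 'cV[R]_n)%type): open O -> measurable O.
move=> oO.
have m1: measurable (@vuncons R n @^-1` O).
 apply: open_meas_vec; apply: open_comp oO => x _.
 exact: vuncons_cont.
have := @measurable_vcons R n measurableT _ m1.
rewrite setTI (_: _ @^-1` _ = O)//; apply/seteqP.
by split => z; rewrite /= vunconsK.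
Qed.

Lemma open_preimage_meas d (T: measurableType d) (D: set T) (f: T -> R) :
 (forall X: set R, open X -> measurable (D `&` f @^-1` X)) -> mfun D f.
move=> h; apply: (measurability _ (measurable_realfun.RGenOpens.measurableE R)).
by move=> _ [_ [a [b ->] <-]]; apply: h; exact: interval_open.
Qed.

Lemma within_meas_vec n (D: set 'cV[R]_n) (f: 'cV[R]_n -> R) :
 open D -> {within D, continuous f} -> mfun D f.
move=> oD; rewrite continuous_open_subspace// => /(continuous_inP _ oD) h.
by apply: open_preimage_meas => X oX; apply: open_meas_vec; exact: h.
Qed.

Lemma within_meas_tx n (D: set (R * 'cV[R]_n)) (f: R * 'cV[R]_n -> R) :
 open D -> {within D, continuous f} -> mfun D f.
move=> oD; rewrite continuous_open_subspace// => /(continuous_inP _ oD) h.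
by apply: open_preimage_meas => X oX; apply: open_meas_tx; exact: h.
Qed.

Lemma cont_vec n (f: 'cV[R]_n -> R): continuous f ->
 mfun setT f.
move=> /continuousP h; apply: open_preimage_meas => X oX.
by rewrite setTI; apply: open_meas_vec; exact: h.
Qed.

Lemma cont_meas_tx n (f: R * 'cV[R]_n -> R): continuous f ->
 mfun setT f.
move=> /continuousP h; apply: open_preimage_meas => X oX.
by rewrite setTI; apply: open_meas_tx; exact: h.
Qed.
End vec_measurable.

(** * Integration on the line and on columns *)

Section tonelli_in.
Context d1 d2 (T1: measurableType d1) (T2: measurableType d2) (R: realType).
Variables (m1: {sigma_finite_measure set T1 -> \bar R})
 (m2: {sigma_finite_measure set T2 -> \bar R}).
Local Open Scope ereal_scope.
Implicit Types f: T1 * T2 -> \bar R.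
Lemma patch_snd (B: set T2) f x y :
 (f \_ (setT `*` B)) (x, y) = ((fun y => f (x, y)) \_ B) y.
by rewrite /patch /= in_setX in_setT. Qed.

Lemma int_sndm (B: set T2) f: measurable B -> mfun setT f ->
 (forall z, 0 <= f z) -> mfunT (fun x => \int[m2]_(y in B) f (x, y)).
move=> mB mf f0.
have mg: mfunT (f \_ (setT `*` B)).
 apply/(measurable_restrictT f (measurableX measurableT mB)).
 exact: measurable_funS mf.
have g0 z: 0 <= (f \_ (setT `*` B)) z by rewrite /patch; case: ifPn.
apply: (eq_measurable_fun (fubini_F m2 (f \_ (setT `*` B)))).
 move=> x _; rewrite /fubini_F [RHS]integral_mkcond.
 by apply: eq_integral => y _; rewrite patch_snd.
exact: measurable_fun_fubini_tonelli_F.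
Qed.

Lemma tonelli_in (A: set T1) (B: set T2) f: measurable A -> measurable B ->
 mfun setT f -> (forall z, 0 <= f z) ->
 \int[m1]_(x in A) \int[m2]_(y in B) f (x, y) =
 \int[m2]_(y in B) \int[m1]_(x in A) f (x, y).
move=> mA mB mf f0; pose g := f \_ (A `*` B).
have mg: mfun setT g.
 apply/(measurable_restrictT f (measurableX mA mB)).
 exact: measurable_funS mf.
have g0 z: 0 <= g z by rewrite /g /patch; case: ifPn.
have := @fubini_tonelli _ _ _ _ _ m1 m2 g mg g0.
have E1 x: \int[m2]_y g (x, y) = ((fun x => \int[m2]_(y in B) f (x, y)) \_ A) x.
 rewrite /patch; case: ifPn => xA.
  rewrite [RHS]integral_mkcond; apply: eq_integral => y _.
  by rewrite /g /patch in_setX xA.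
 by rewrite integral0_eq// => y _; rewrite /g /patch in_setX (negbTE xA).
have E2 y: \int[m1]_x g (x, y) = ((fun y => \int[m1]_(x in A) f (x, y)) \_ B) y.
 rewrite /patch; case: ifPn => yB.
  rewrite [RHS]integral_mkcond; apply: eq_integral => x _.
  by rewrite /g /patch in_setX yB andbT.
 by rewrite integral0_eq// => x _; rewrite /g /patch in_setX (negbTE yB) andbF.
by under eq_integral do rewrite E1; under [in RHS]eq_integral do rewrite E2;
 rewrite -!integral_mkcond.
Qed.
End tonelli_in.

Section lebesgue_line_theory.
Context {R: realType}.
Local Open Scope ereal_scope.
(** The two types have the same points but carry different structures; the push-forward of Lebesgue
    measure along this identity is [leb1]. *)
Definition line_id (s: measurableTypeR R): R := s.
Lemma meas_line_id: mfun setT line_id.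
by move=> _ Y mY; rewrite setTI. Qed.

HB.instance Definition _ := isMeasurableFun.Build _ _ _ _ line_id meas_line_id.

Lemma ge0_int_leb1 (D: set R) (f: R -> \bar R): measurable D ->
 mfun D f -> (forall s, D s -> 0 <= f s) ->
 \int[leb1]_(s in D) f s = \int[@lebesgue_measure R]_(s in D) f s.
move=> mD mf f0.
rewrite (eq_measure_integral (pushforward (@lebesgue_measure R) line_id))//.
rewrite (ge0_integral_pushforward meas_line_id)// => s.
by rewrite inE; exact: f0.
Qed.

Lemma int_leb1 (D: set R) (f: R -> \bar R): measurable D ->
 mfun D f ->
 \int[leb1]_(s in D) f s = \int[@lebesgue_measure R]_(s in D) f s.
move=> mD mf; rewrite integralE [RHS]integralE !ge0_int_leb1//.
- exact: measurable_funeneg.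
- exact: measurable_funepos.
Qed.

Lemma leb1_itv (a b: R): (a <= b)%R -> leb1 `[a, b]%classic = (b - a)%:E.
rewrite /leb1 /= lebesgue_measure_itv/= lte_fin le_eqVlt.
by move=> /predU1P[->|->]; rewrite ?ltxx ?subrr ?EFinB.
Qed.
Lemma meas_shift (a: R): mfunT (fun s: R => s + a)%R.
by apply: measurable_funD. Qed.
Definition shift_line (a: R) (s: measurableTypeR R): measurableTypeR R := (s + a)%R.

HB.instance Definition _ (a: R) := isMeasurableFun.Build _ _ _ _ (shift_line a)
 (meas_shift a).

Lemma leb1_shift (a: R) (A: set (measurableTypeR R)): measurable A ->
 lebesgue_measure A = pushforward (@lebesgue_measure R) (shift_line a) A.
apply: lebesgue_measure_unique => _ [[x y] _ <-] /=.
transitivity (lebesgue_measure (shift_line a @^-1` `]x, y]%classic)) =>//.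
rewrite (_: _ @^-1` _ = `](x - a)%R, (y - a)%R]%classic); last first.
 by apply/seteqP; split => s /=; rewrite !in_itv/= ltrBlDr lerBrDr.
rewrite !lebesgue_measure_itv/= !lte_fin ltrD2r; case: ifPn =>// _.
by rewrite -!EFinB; congr (_%:E); ring.
Qed.

Lemma int_shift (a: R) (f: R -> \bar R): mfun setT f ->
 (forall s, 0 <= f s) -> \int[leb1]_s f (s + a)%R = \int[leb1]_s f s.
move=> mf f0; have m: mfunT (shift_line a) by exact: meas_shift.
rewrite !ge0_int_leb1//; last first.
 by apply: mcomp mf _; exact: meas_shift.
rewrite [RHS](eq_measure_integral (pushforward (@lebesgue_measure R) (shift_line a))); last first.
 by move=> A mA _; exact: leb1_shift.
by rewrite (ge0_integral_pushforward m)//= preimage_setT.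
Qed.

Lemma FTC_line (phi dphi: R -> R) (a b: R): (a <= b)%R ->
 (forall s, is_derive s (1%R: R) phi (dphi s)) -> continuous dphi ->
 \int[leb1]_(s in `[a, b]) (dphi s)%:E = (phi b - phi a)%:E.
move=> + dP cd; have mc: measurable_fun `[a, b] (EFin \o dphi).
 by apply/mEFinP/mfunTS; exact: continuous_measurable_fun.
rewrite le_eqVlt => /predU1P[ab|ab].
 by rewrite int_leb1// ab ?set_itv1 ?integral_set1 ?subrr//.
have cphi: continuous phi.
 move=> x; apply/differentiable_continuous/derivable1_diffP.
 by have [] := dP x.
rewrite EFinB int_leb1//; apply: (continuous_FTC2 ab).
- exact: continuous_subspaceT.
- split => [x _||]; first by have [] := dP x.
  exact/cvg_at_right_filter/cphi.
 exact/cvg_at_left_filter/cphi.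
- by move=> x _; rewrite derive1E; have [_ ->] := dP x.
Qed.

Lemma FTC_line_le (phi dphi: R -> R) (a b s t: R) :
 (forall s, is_derive s (1%R: R) phi (dphi s)) -> continuous dphi ->
 (a <= s <= b)%R -> (a <= t <= b)%R ->
 `|phi s - phi t|%:E <= \int[leb1]_(s in `[a, b]) `|dphi s|%:E.
move=> dP cd; wlog ts: s t / (t <= s)%R.
 move=> h hs ht; have [?|/ltW ?] := leP t s; first exact: h.
 by rewrite distrC; exact: h.
move=> /andP[as_ sb] /andP[at_ tb].
have md: mfunT (fun x => `|dphi x|%:E).
 by apply/mEFinP/mcomp =>//; exact: continuous_measurable_fun.
apply: (@le_trans _ _ (\int[leb1]_(s in `[t, s]) `|dphi s|%:E)).
 have := FTC_line ts dP cd => /(congr1 abse) /= <-.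
 apply: (le_abse_integral leb1 (measurable_itv _)).
 by apply/mEFinP; apply: mfunTS; exact: continuous_measurable_fun.
apply: ge0_subset_integral =>//; first exact: mfunTS.
by move=> x /=; rewrite !in_itv/= => /andP[h1 h2]; rewrite (le_trans at_)//= (le_trans h2).
Qed.
End lebesgue_line_theory.

Section lebesgue_vec_theory.
Context {R: realType}.
Local Open Scope ereal_scope.

Lemma int_vecS n (f: 'cV[R]_n.+1 -> \bar R): mfun setT f ->
 (forall x, 0 <= f x) ->
 \int[lvec n.+1]_x f x =
 \int[leb1]_s \int[lvec n]_x f (vcons (s, x)).
move=> mf f0.
rewrite [LHS](@ge0_integral_pushforward _ _ _ _ R _ (@measurable_vcons R n)
 (leb1 \x lvec n) setT f)//=.
rewrite preimage_setT.
apply: (@fubini_tonelli1 _ _ _ _ _ leb1 (lvec n) (fun z => f (vcons z))) =>//.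
exact: mcomp mf (@measurable_vcons R n).
Qed.

Lemma meas_vcons_comp n (f: 'cV[R]_n.+1 -> \bar R): mfun setT f ->
 mfunT (fun z: R * 'cV[R]_n => f (vcons (z.1, z.2))).
move=> mf; apply: (eq_measurable_fun (f \o @vcons R n)); first by move=> [].
exact: mcomp mf (@measurable_vcons R n).
Qed.

Lemma meas_vcons2 n (f: 'cV[R]_n.+1 -> \bar R) s: mfun setT f ->
 mfunT (fun x: 'cV[R]_n => f (vcons (s, x))).
move=> mf; apply: mcomp mf _.
by apply: mcomp (@measurable_vcons R n) _; apply: measurable_fun_pair.
Qed.

Lemma vconsD n s t (x y: 'cV[R]_n) :
 (vcons (s, x) + vcons (t, y) = vcons (s + t, x + y))%R.
apply: vconsP; first by rewrite mxE !vcons0.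
by move=> i; rewrite [LHS]mxE [RHS]mxE !vconsS.
Qed.

Lemma meas_translate n (h: 'cV[R]_n): mfunT (fun x: 'cV[R]_n => x + h)%R.
apply: measurable_fun_mx => i j; rewrite (ord1 j).
apply: (eq_measurable_fun (fun x: 'cV[R]_n => x i ord0 + h i ord0)%R).
 by move=> x _; rewrite mxE.
by apply: measurable_funD =>//; exact: meas_coord.
Qed.

Lemma int_vec_translate n (h: 'cV[R]_n) (f: 'cV[R]_n -> \bar R) :
 mfun setT f -> (forall x, 0 <= f x) ->
 \int[lvec n]_x f (x + h)%R = \int[lvec n]_x f x.
elim: n h f => [|n IH] h f mf f0.
 by apply: eq_integral => x _; congr f; apply/colP => -[].
rewrite [LHS]int_vecS//; last exact: mcomp mf (meas_translate h).
rewrite [RHS](int_vecS mf f0).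
pose F s := \int[lvec n]_x f (vcons (s, x)).
have mF: mfun setT F.
 apply: (@int_sndm _ _ _ _ R (lvec n) setT
  (fun z: R * 'cV[R]_n => f (vcons (z.1, z.2)))) =>//.
 exact: meas_vcons_comp.
have F0 s: 0 <= F s by exact: integral_ge0.
rewrite -[RHS](int_shift (h ord0 ord0) mF F0); apply: eq_integral => s _.
rewrite /F -(IH (\col_i h (lift ord0 i) ord0) (fun x => f (vcons (s + h ord0 ord0, x))%R))//.
 apply: eq_integral => x _; congr f; rewrite -vconsD; congr (_ + _)%R.
 by apply: vconsP =>// i; rewrite mxE.
exact: meas_vcons2.
Qed.
Definition cube n (a: 'cV[R]_n) (r: R) := cbox a (\col_i (a i ord0 + r)%R).
Lemma meas_cube n (a: 'cV[R]_n) (r: R): measurable (cube a r).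
exact: meas_cbox. Qed.

Lemma cubeS n (a: 'cV[R]_n.+1) r s x: cube a r (vcons (s, x)) <->
 (`[a ord0 ord0, (a ord0 ord0 + r)%R]%classic s /\
  cube (\col_i a (lift ord0 i) ord0) r x).
split=> [h|[h1 h2] i].
 split=> [|i]; first by have := h ord0; rewrite vcons0 !mxE /= in_itv.
 by have := h (lift ord0 i); rewrite vconsS !mxE.
case: (unliftP ord0 i) => [k ->|->]; rewrite ?vconsS ?vcons0 !mxE.
 by have := h2 k; rewrite !mxE.
by move: h1; rewrite /= in_itv.
Qed.

Lemma int_cubeS n (a: 'cV[R]_n.+1) r (f: 'cV[R]_n.+1 -> \bar R) :
 mfun setT f -> (forall x, 0 <= f x) ->
 \int[lvec n.+1]_(x in cube a r) f x =
 \int[leb1]_(s in `[a ord0 ord0, (a ord0 ord0 + r)%R])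
  \int[lvec n]_(x in cube (\col_i a (lift ord0 i) ord0) r) f (vcons (s, x)).
move=> mf f0; rewrite integral_mkcond int_vecS; last 2 first.
- by apply/(measurable_restrictT f (meas_cube a r)); exact: mfunTS.
- by move=> x; rewrite /patch; case: ifPn.
rewrite [RHS]integral_mkcond; apply: eq_integral => s _.
rewrite [RHS]/patch; case: ifPn => sI.
 rewrite [RHS]integral_mkcond; apply: eq_integral => x _; rewrite /patch.
 rewrite (_: (vcons (s, x) \in cube a r) = (x \in cube (\col_i a (lift ord0 i) ord0) r))//.
 apply/idP/idP => [/set_mem/cubeS[_ h]|/set_mem h]; apply/mem_set =>//.
 by apply/cubeS; split =>//; exact/set_mem.
rewrite integral0_eq// => x _; rewrite /patch; case: ifPn =>//.
by rewrite inE => /cubeS[/mem_set]; rewrite (negbTE sI).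
Qed.

Lemma leb_cube n (a: 'cV[R]_n) (r: R): (0 <= r)%R ->
 lvec n (cube a r) = (r ^+ n)%:E.
move=> r0; elim: n a => [|n IH] a.
 by rewrite /= /dirac indicE mem_set// => -[].
rewrite -(mul1e (lvec _ _)) -integral_cst; last exact: meas_cube.
rewrite int_cubeS//.
rewrite (eq_integral (fun=> (r ^+ n)%:E)) => [|s _]; last first.
 transitivity (1 * lvec n (cube (\col_i a (lift ord0 i) ord0) r)).
  by rewrite -integral_cst//; exact: meas_cube.
 by rewrite mul1e IH.
by rewrite integral_cst//= leb1_itv ?lerDl// addrAC subrr add0r -EFinM -exprSr.
Qed.
End lebesgue_vec_theory.

(** * The Poincare and Nash inequalities for C1 functions *)

Section c1_functions.
Context {R: realType}.
Lemma continuous_compo (T U W: topologicalType) (f: T -> U) (g: U -> W) :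
 continuous f -> continuous g -> continuous (fun x => g (f x)).
by move=> cf cg x; apply: continuous_comp; [exact: cf|exact: cg]. Qed.
Definition ei n (i: 'I_n): 'cV[R]_n := delta_mx i ord0.
(** Only partial derivatives along the axes are recorded: this is what survives when one coordinate
    is frozen, as in the induction on the dimension of [cube_poincare]. *)
Definition c1 n (f: 'cV[R]_n -> R) := continuous f /\
 forall i, (forall x, derivable f x (ei i)) /\ continuous ('D_(ei i) f).

Lemma sm_c1 n (f: 'cV[R]_n -> R): smooth f -> c1 f.
move=> sf; split=> [|i]; first exact: sm_cont.
split=> [x|]; first exact: sm_der.
exact: sm_cont (sm_derive _ sf).
Qed.

Lemma vcons_ei0 n (h s: R) (x: 'cV[R]_n) :
 h *: ei ord0 + vcons (s, x) = vcons (h + s, x).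
apply: vconsP => [|i]; rewrite mxE [X in X + _]mxE [X in _ * X + _]mxE.
 by rewrite vcons0 !eqxx mulr1.
by rewrite vconsS (_: (_ == _) = false) ?mulr0 ?add0r.
Qed.

Lemma vcons_eiS n (h s: R) (x: 'cV[R]_n) i :
 h *: ei (lift ord0 i) + vcons (s, x) = vcons (s, h *: ei i + x).
apply: vconsP => [|j]; rewrite mxE [X in X + _]mxE [X in _ * X + _]mxE.
 by rewrite vcons0 mulr0 add0r.
by rewrite vconsS [RHS]mxE [X in _ = X + _]mxE [X in _ = _ * X + _]mxE (inj_eq lift_inj).
Qed.

Lemma derive_vcons0 n (f: 'cV[R]_n.+1 -> R) s x :
 ('D_(ei ord0) f (vcons (s, x)) = 'D_1 (fun t => f (vcons (t, x))) s) *
 (derivable f (vcons (s, x)) (ei ord0) = derivable (fun t => f (vcons (t, x))) s 1).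
suff E: (fun h: R => h^-1 *: ((f \o shift (vcons (s, x))) (h *: ei ord0) - f (vcons (s, x)))) =
  (fun h: R => h^-1 *: (((fun t => f (vcons (t, x))) \o shift s) (h *: (1: R)) - f (vcons (s, x)))).
 by rewrite /derive /derivable E.
by apply/funext => h /=; rewrite vcons_ei0 [h *: 1]mulr1.
Qed.

Lemma derive_vconsS n (f: 'cV[R]_n.+1 -> R) s x i :
 ('D_(ei (lift ord0 i)) f (vcons (s, x)) = 'D_(ei i) (fun y => f (vcons (s, y))) x) *
 (derivable f (vcons (s, x)) (ei (lift ord0 i)) =
  derivable (fun y => f (vcons (s, y))) x (ei i)).
suff E: (fun h: R => h^-1 *: ((f \o shift (vcons (s, x))) (h *: ei (lift ord0 i)) - f (vcons (s, x)))) =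
  (fun h: R => h^-1 *: (((fun y => f (vcons (s, y))) \o shift x) (h *: ei i) - f (vcons (s, x)))).
 by rewrite /derive /derivable E.
by apply/funext => h /=; rewrite vcons_eiS.
Qed.

Lemma vcons_contl n (x: 'cV[R]_n): continuous (fun t: R => vcons (t, x)).
apply: (@continuous_compo _ _ _ (fun t: R => (t, x)) (@vcons R n)); last exact: vcons_cont.
move=> t A [[P Q] [/= nP nQ] PQ]; apply: filterS nP => u Pu; apply: PQ; split =>//.
exact: nbhs_singleton nQ.
Qed.

Lemma vcons_contr n (t: R): continuous (fun x: 'cV[R]_n => vcons (t, x)).
apply: (@continuous_compo _ _ _ (fun x: 'cV[R]_n => (t, x)) (@vcons R n)); last exact: vcons_cont.
move=> x A [[P Q] [/= nP nQ] PQ]; apply: filterS nQ => u Pu; apply: PQ; split =>//.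
exact: nbhs_singleton nP.
Qed.

Lemma c1_slice n (f: 'cV[R]_n.+1 -> R) s: c1 f ->
 c1 (fun x: 'cV[R]_n => f (vcons (s, x))).
move=> [cf df]; split=> [|i].
 exact: continuous_compo (@vcons_contr n s) cf.
have [d c] := df (lift ord0 i); split=> [x|].
 by rewrite -(derive_vconsS f s x i).2.
rewrite (_: 'D_(ei i) _ = fun x => 'D_(ei (lift ord0 i)) f (vcons (s, x))).
 exact: continuous_compo (@vcons_contr n s) c.
by apply/funext => y; rewrite derive_vconsS.
Qed.

Lemma c1_line n (f: 'cV[R]_n.+1 -> R) x: c1 f ->
 (forall s, is_derive s (1: R) (fun t => f (vcons (t, x)))
  ('D_(ei ord0) f (vcons (s, x)))) /\
 continuous (fun s => 'D_(ei ord0) f (vcons (s, x))).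
move=> [cf df]; have [d c] := df ord0; split=> [s|].
 by apply: DeriveDef; rewrite -?(derive_vcons0 f s x).2// -derive_vcons0.
exact: continuous_compo (@vcons_contl n x) c.
Qed.
End c1_functions.

Section c1_integrals.
Context {R: realType}.
Local Open Scope ereal_scope.

Lemma meas_abs_cont n (f: 'cV[R]_n -> R): continuous f ->
 mfunT (fun x => `|f x|%:E).
move=> cf; apply/mEFinP/mcomp =>//.
exact: cont_vec.
Qed.
Lemma c1_meas n (f: 'cV[R]_n -> R) i: c1 f ->
 mfunT (fun x => `|'D_(ei i) f x|%:E).
by move=> [_ df]; have [_ c] := df i; exact: meas_abs_cont. Qed.
End c1_integrals.
Section cube_poincare.
Context {R: realType}.
Local Open Scope ereal_scope.

(** Induction on the dimension. On the way from (s,x) to (t,y) through (t,x), the first leg is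
    bounded by the integral of the first partial derivative along a line, and the second is the
    inequality for the slice at t. Each leg is integrated over the variables that it does not
    involve, and both produce the same power of r. *)
Lemma cube_poincare n (f: 'cV[R]_n -> R) (a: 'cV[R]_n) (r: R): c1 f -> (0 <= r)%R ->
 \int[lvec n]_(x in cube a r) \int[lvec n]_(y in cube a r)
  `|f x - f y|%:E <=
 (r ^+ n.+1)%:E *
  \sum_i \int[lvec n]_(x in cube a r) `|'D_(ei i) f x|%:E.
move=> + r0; elim: n f a => [|n IH] f a cf.
 rewrite big_ord0 mule0 integral0_eq// => x _.
 rewrite integral0_eq// => y _; rewrite (_: x = y) ?subrr ?normr0//.
 by apply/colP => -[].
have [cf0 df] := cf; have mf := cont_vec cf0.
set I := `[a ord0 ord0, (a ord0 ord0 + r)%R]%classic.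
pose a': 'cV[R]_n := (\col_i a (lift ord0 i) ord0)%R; set Q := cube a' r.
have mQ: measurable Q := meas_cube a' r.
have mI: measurable I by exact: measurable_itv.
have mfv: mfunT (fun z: R * 'cV[R]_n => f (vcons (z.1, z.2))).
 apply: (eq_measurable_fun (f \o @vcons R n)); first by move=> [].
 exact: mcomp mf (@measurable_vcons R n).
have mp d (X: measurableType d) (u: X -> R) (v: X -> 'cV[R]_n) :
  mfun setT u -> mfun setT v ->
  mfunT (fun x => f (vcons (u x, v x))).
 by move=> mu mv; exact: mcomp mfv (measurable_fun_pair mu mv).
have md d (X: measurableType d) (u v: X -> R) :
 mfun setT u -> mfun setT v ->
 mfunT (fun x => `|u x - v x|%:E).
 by move=> mu mv; apply/mEFinP/mcomp =>//; exact: measurable_funB.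
pose D x := \int[leb1]_(u in I) `|'D_(ei ord0) f (vcons (u, x))|%:E.
pose E x := \int[leb1]_(t in I) \int[lvec n]_(y in Q)
 `|f (vcons (t, x)) - f (vcons (t, y))|%:E.
have mDi i: mfunT (fun z: 'cV[R]_n * R =>
  `|'D_(ei i) f (vcons (z.2, z.1))|%:E).
 apply: (mcomp (c1_meas i cf)).
 by apply: mcomp (@measurable_vcons R n) _; exact: measurable_fun_pair.
have mD: mfun setT D.
 exact: (@int_sndm _ _ _ _ R leb1 I
  (fun z: 'cV[R]_n * R => `|'D_(ei ord0) f (vcons (z.2, z.1))|%:E)).
pose G3 (z: ('cV[R]_n * R) * 'cV[R]_n) :=
 `|f (vcons (z.1.2, z.1.1)) - f (vcons (z.1.2, z.2))|%:E.
have mG3: mfun setT G3.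
 apply: md; apply: mp =>//.
 - exact: (mcomp (@measurable_snd _ _ _ _) (@measurable_fst _ _ _ _)).
 - exact: (mcomp (@measurable_fst _ _ _ _) (@measurable_fst _ _ _ _)).
 - exact: (mcomp (@measurable_snd _ _ _ _) (@measurable_fst _ _ _ _)).
have mG2: mfunT (fun z: 'cV[R]_n * R =>
  \int[lvec n]_(y in Q) `|f (vcons (z.2, z.1)) - f (vcons (z.2, y))|%:E).
 apply: (eq_measurable_fun (fun w => \int[lvec n]_(y in Q) G3 (w, y))).
  by move=> [].
 by apply: int_sndm =>// z; rewrite /G3 lee_fin.
have mE: mfun setT E.
 apply: (@int_sndm _ _ _ _ R leb1 I (fun z: 'cV[R]_n * R =>
  \int[lvec n]_(y in Q) `|f (vcons (z.2, z.1)) - f (vcons (z.2, y))|%:E)) =>//.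
 by move=> z; exact: integral_ge0.
have D0 x: 0 <= D x by exact: integral_ge0.
have E0 x: 0 <= E x by apply: integral_ge0 => t _; exact: integral_ge0.
have lI: leb1 I = r%:E by rewrite leb1_itv ?lerDl// addrAC subrr add0r.
have lQ: lvec n Q = (r ^+ n)%:E by exact: leb_cube.
pose F x := \int[lvec n.+1]_(y in cube a r) `|f x - f y|%:E.
have mF: mfun setT F.
 apply: (@int_sndm _ _ _ _ R (lvec n.+1) (cube a r)
  (fun z: 'cV[R]_n.+1 * 'cV[R]_n.+1 => `|f z.1 - f z.2|%:E)) =>//.
  exact: meas_cube.
 by apply: md; apply: (mcomp mf).
rewrite int_cubeS//; last by move=> x; exact: integral_ge0.
rewrite -/I -/a' -/Q.
have key s x: I s -> Q x ->
  F (vcons (s, x)) <= (r ^+ n.+1)%:E * D x + E x.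
 move=> Is Qx; rewrite /F int_cubeS//; last exact: md.
 rewrite -/I -/a' -/Q.
 have m1 t: mfunT (fun y: 'cV[R]_n => `|f (vcons (s, x)) - f (vcons (t, y))|%:E).
  by apply: md =>//; exact: mp.
 have m2 t: mfunT (fun y: 'cV[R]_n => `|f (vcons (t, x)) - f (vcons (t, y))|%:E).
  by apply: md =>//; exact: mp.
 have h t: I t -> \int[lvec n]_(y in Q) `|f (vcons (s, x)) - f (vcons (t, y))|%:E <=
   (r ^+ n)%:E * D x + \int[lvec n]_(y in Q) `|f (vcons (t, x)) - f (vcons (t, y))|%:E.
  move=> It.
  have ->: (r ^+ n)%:E * D x = \int[lvec n]_(y in Q) (cst (D x) y).
   by rewrite integral_cst//= lQ muleC.
  have p1 y: Q y -> 0 <= cst (D x) y by move=> _; exact: D0.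
  have p2 y: Q y -> 0 <= `|f (vcons (t, x)) - f (vcons (t, y))|%:E by rewrite lee_fin.
  rewrite -(ge0_integralD _ mQ p1 (measurable_cst _) p2 (mfunTS (m2 t))).
  apply: ge0_le_integral =>//.
  - exact: mfunTS.
  - exact: emeasurable_funD (measurable_cst _) (mfunTS (m2 t)).
  move=> y _; apply: (@le_trans _ _ (`|f (vcons (s, x)) - f (vcons (t, x))|%:E +
   `|f (vcons (t, x)) - f (vcons (t, y))|%:E)); first by rewrite -EFinD lee_fin ler_distD.
  apply: leeD =>//; have [d c] := c1_line x cf.
  apply: (@FTC_line_le R (fun s => f (vcons (s, x))) _ (a ord0 ord0) (a ord0 ord0 + r)%R s t d c).
   by move: Is; rewrite /I /= in_itv.
  by move: It; rewrite /I /= in_itv.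
 have mG2x: mfunT (fun t => \int[lvec n]_(y in Q)
   `|f (vcons (t, x)) - f (vcons (t, y))|%:E).
  exact: mcomp mG2 (measurable_fun_pair (measurable_cst _) (@measurable_id _ _ _)).
 apply: (@le_trans _ _ (\int[leb1]_(t in I) ((r ^+ n)%:E * D x +
   \int[lvec n]_(y in Q) `|f (vcons (t, x)) - f (vcons (t, y))|%:E))).
  apply: ge0_le_integral =>//.
  - by move=> t _; exact: integral_ge0.
  - apply: mfunTS.
   apply: (@int_sndm _ _ _ _ R (lvec n) Q
    (fun z: R * 'cV[R]_n => `|f (vcons (s, x)) - f (vcons (z.1, z.2))|%:E)) =>//.
   exact: md.
  - exact: emeasurable_funD (measurable_cst _) (mfunTS mG2x).
 have q1 t: I t -> 0 <= cst ((r ^+ n)%:E * D x) t.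
  by move=> _; rewrite mule_ge0// lee_fin exprn_ge0.
 have q2 t: I t -> 0 <= \int[lvec n]_(y in Q) `|f (vcons (t, x)) - f (vcons (t, y))|%:E.
  by move=> _; exact: integral_ge0.
 have q3: mfun I (fun t => \int[lvec n]_(y in Q) `|f (vcons (t, x)) - f (vcons (t, y))|%:E).
  exact: mfunTS.
 rewrite (ge0_integralD _ mI q1 (measurable_cst _) q2 q3) leeD2r//.
 have ->: \int[leb1]_(t in I) cst ((r ^+ n)%:E * D x) t = ((r ^+ n)%:E * D x) * leb1 I.
  exact: integral_cst.
 by rewrite lI muleC muleA -EFinM -exprS.
apply: (@le_trans _ _ (\int[leb1]_(s in I) \int[lvec n]_(x in Q)
  ((r ^+ n.+1)%:E * D x + E x))).
 apply: ge0_le_integral =>//.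
 - by move=> s _; apply: integral_ge0 => x _; exact: integral_ge0.
 - apply: mfunTS; apply: (@int_sndm _ _ _ _ R (lvec n) Q
   (fun z: R * 'cV[R]_n => F (vcons (z.1, z.2)))) =>//.
   exact: meas_vcons_comp.
  by move=> z; exact: integral_ge0.
 move=> s Is; apply: ge0_le_integral =>//.
 - by move=> x _; exact: integral_ge0.
 - exact: mfunTS (meas_vcons2 s mF).
 - by apply: mfunTS; exact: emeasurable_funD (emeasurable_funM (measurable_cst _) mD) mE.
 by move=> x Qx; exact: key.
rewrite [X in X <= _](_: _ = (\int[lvec n]_(x in Q) ((r ^+ n.+1)%:E * D x + E x)) * leb1 I); last first.
 exact: integral_cst.
rewrite lI.
have r1 x: Q x -> 0 <= (r ^+ n.+1)%:E * D x.
 by move=> _; rewrite mule_ge0// lee_fin exprn_ge0.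
have r2 x: Q x -> 0 <= E x by [].
have r3: mfun Q (fun x => (r ^+ n.+1)%:E * D x).
 by apply: mfunTS; exact: emeasurable_funM.
have rn0: (0 <= r ^+ n.+1)%R by rewrite exprn_ge0.
have r4 x: Q x -> 0 <= D x by [].
rewrite (ge0_integralD _ mQ r1 r3 r2 (mfunTS mE)).
rewrite (ge0_integralZl_EFin _ mQ r4 (mfunTS mD) rn0).
have iD: 0 <= \int[lvec n]_(x in Q) D x by exact: integral_ge0.
have iE: 0 <= \int[lvec n]_(x in Q) E x by exact: integral_ge0.
have iD': 0 <= (r ^+ n.+1)%:E * \int[lvec n]_(x in Q) D x.
 by rewrite mule_ge0// lee_fin.
rewrite muleC (ge0_muleDr _ iD' iE).
have t1: 0 <= \int[lvec n.+1]_(x in cube a r) `|'D_(ei ord0) f x|%:E.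
 exact: integral_ge0.
have t2: 0 <= \sum_(i < n) \int[lvec n.+1]_(x in cube a r) `|'D_(ei (lift ord0 i)) f x|%:E.
 by apply: sume_ge0 => i _; exact: integral_ge0.
rewrite big_ord_recl (ge0_muleDr _ t1 t2).
have ED: \int[lvec n]_(x in Q) D x =
  \int[lvec n.+1]_(x in cube a r) `|'D_(ei ord0) f x|%:E.
 rewrite int_cubeS//; last exact: c1_meas.
 rewrite -/I -/a' -/Q /D.
 exact: (@tonelli_in _ _ _ _ R (lvec n) leb1 Q I
  (fun z: 'cV[R]_n * R => `|'D_(ei ord0) f (vcons (z.2, z.1))|%:E)).
apply: leeD; first by rewrite muleA -EFinM -exprS ED.
have ->: \int[lvec n]_(x in Q) E x =
  \int[leb1]_(t in I) \int[lvec n]_(x in Q) \int[lvec n]_(y in Q)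
   `|f (vcons (t, x)) - f (vcons (t, y))|%:E.
 apply: (@tonelli_in _ _ _ _ R (lvec n) leb1 Q I (fun z: 'cV[R]_n * R =>
  \int[lvec n]_(y in Q) `|f (vcons (z.2, z.1)) - f (vcons (z.2, y))|%:E)) =>//.
 by move=> z; exact: integral_ge0.
pose G (i: 'I_n) (t: R) := \int[lvec n]_(x in Q) `|'D_(ei (lift ord0 i)) f (vcons (t, x))|%:E.
have G0 i s: 0 <= G i s by exact: integral_ge0.
have mG i: mfunT (G i).
 apply: (@int_sndm _ _ _ _ R (lvec n) Q
  (fun z: R * 'cV[R]_n => `|'D_(ei (lift ord0 i)) f (vcons (z.1, z.2))|%:E)) =>//.
 exact: (meas_vcons_comp (c1_meas _ cf)).
have EG (i: 'I_n) t: \int[lvec n]_(x in Q) `|'D_(ei i) (fun y => f (vcons (t, y))) x|%:E = G i t.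
 by apply: eq_integral => x _; rewrite derive_vconsS.
have EI (i: 'I_n): \int[lvec n.+1]_(x in cube a r) `|'D_(ei (lift ord0 i)) f x|%:E =
  \int[leb1]_(t in I) G i t.
 by rewrite (int_cubeS _ _ (c1_meas _ cf)).
clearbody G.
rewrite (eq_bigr (fun i: 'I_n => \int[leb1]_(t in I) G i t)); last by move=> i _; exact: EI.
have mGI i: mfun I (G i) by apply: mfunTS; exact: mG.
rewrite -(ge0_integral_sum leb1 mI mGI); last by move=> i s _; exact: G0.
rewrite [in leRHS]exprS EFinM -muleA; apply: lee_wpmul2l; first by rewrite lee_fin.
have sG0 t: I t -> 0 <= \sum_i G i t by move=> _; apply: sume_ge0.
have msG: mfun I (fun t => \sum_i G i t) by apply: emeasurable_sum => i; exact: mGI.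
rewrite -(ge0_integralZl_EFin _ mI sG0 msG rn0).
apply: ge0_le_integral =>//.
- by move=> t _; apply: integral_ge0 => x _; exact: integral_ge0.
- apply: mfunTS.
 apply: (@int_sndm _ _ _ _ R (lvec n) Q (fun z: R * 'cV[R]_n =>
  \int[lvec n]_(y in Q) `|f (vcons (z.1, z.2)) - f (vcons (z.1, y))|%:E)) =>//.
  exact: mcomp mG2 (measurable_fun_pair (@measurable_snd _ _ _ _) (@measurable_fst _ _ _ _)).
 by move=> z; exact: integral_ge0.
- exact: emeasurable_funM.
move=> t _; have := IH _ a' (c1_slice t cf); move/le_trans; apply.
apply: leEq; congr (_ * _).
exact: (eq_bigr _ (fun i _ => EG i t)).
Qed.
End cube_poincare.
Section nash.
Context {R: realType} {n: nat}.
Local Open Scope ereal_scope.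
Notation mu := (lvec n: {sigma_finite_measure set 'cV[R]_n -> \bar R}).

(** Tonelli: a point x lies in the cubes whose corner ranges over a translated cube, of volume
    r^n. *)
Lemma int_cubes (h: 'cV[R]_n -> \bar R) (r: R): (0 <= r)%R -> mfun setT h ->
 (forall x, 0 <= h x) ->
 mfunT (fun a => \int[mu]_(x in cube a r) h x) /\
 \int[mu]_a \int[mu]_(x in cube a r) h x = (r ^+ n)%:E * \int[mu]_x h x.
move=> r0 mh h0; pose c: 'cV[R]_n := const_mx r.
pose F (z: 'cV[R]_n * 'cV[R]_n) := h z.2 * (\1_(cube 0%R r) (z.2 - z.1)%R)%:E.
have cE (a x: 'cV[R]_n): cube a r x <-> cube 0%R r (x - a)%R.
 by split=> H i; have := H i; rewrite /= !mxE ?add0r => /andP[? ?]; apply/andP; lra.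
have cE' a x: cube 0%R r (x - a)%R <-> cube (x - c)%R r a.
 by split=> H i; have := H i; rewrite /= !mxE ?add0r => /andP[? ?]; apply/andP; lra.
have mF: mfun setT F.
 apply: emeasurable_funM; first exact: mcomp mh _.
 apply/mEFinP/(mcomp (measurable_indic (meas_cube _ _))).
 apply: measurable_fun_mx => i j; rewrite (ord1 j).
 apply: (eq_measurable_fun (fun z: 'cV[R]_n * 'cV[R]_n => z.2 i ord0 - z.1 i ord0)%R).
  by move=> z _; rewrite !mxE.
 by apply: measurable_funB; exact: mcomp (meas_coord i) _.
have F0 z: 0 <= F z by rewrite mule_ge0// lee_fin.
have ->: (fun a => \int[mu]_(x in cube a r) h x) = (fun a => \int[mu]_x F (a, x)).
 apply/funext => a; rewrite integral_mkcond; apply: eq_integral => x _.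
 rewrite /F /patch /= indicE (_: (_ \in cube 0%R r) = (x \in cube a r)).
  by case: ifP => _; rewrite ?mule1 ?mule0.
 by apply/idP/idP => /set_mem h1; apply/mem_set; [apply/(cE a x).2|apply/(cE a x).1].
split; first exact: int_sndm.
rewrite (@tonelli_in _ _ _ _ R mu mu setT setT)// -ge0_integralZl_EFin ?exprn_ge0//.
apply: eq_integral => x _; rewrite muleC -(@leb_cube R n (x - c)%R r r0) -[cube _ _]setIT -integral_indic; [|exact: measurableT|exact: meas_cube].
have mi: mfunT (fun a: 'cV[R]_n => (\1_(cube (x - c)%R r) a)%:E: \bar R).
 by apply/mEFinP; exact: measurable_indic (meas_cube _ _).
rewrite -ge0_integralZl//.
apply: eq_integral => a _; rewrite /F /=; congr (_ * (_: R)%:E); rewrite !indicE; congr (_: bool)%:R.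
by apply/idP/idP => /set_mem h1; apply/mem_set; [apply/(cE' a x).1|apply/(cE' a x).2].
Qed.

(** With q = f^2, the pointwise inequality q(x) <= |f x| |f y| + |q(x) - q(y)| is integrated over x
    and y in one cube of side r, where [cube_poincare] for q bounds the last term; [int_cubes] then
    integrates over all positions of the cube. Enlarging one of the two factors |f| to its integral
    over the whole space keeps the result linear in the local data. *)
Lemma nash_c1 (f: 'cV[R]_n -> R) (r: R): c1 f -> c1 (fun x => f x ^+ 2)%R ->
 (0 < r)%R ->
 (r ^+ n)%:E * \int[mu]_x (f x ^+ 2)%:E <=
 (\int[mu]_x `|f x|%:E) * (\int[mu]_x `|f x|%:E) +
 (r ^+ n.+1)%:E * \sum_i \int[mu]_x `|'D_(ei i) (fun x => f x ^+ 2)%R x|%:E.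
set q := fun x => (f x ^+ 2)%R; move=> cf cq r0; have rn k: (0 <= r ^+ k)%R by rewrite exprn_ge0// ltW.
have mq: mfunT (fun x => (q x)%:E) by apply/mEFinP; exact: (cont_vec cq.1).
have maf: mfunT (fun x => `|f x|%:E) := meas_abs_cont cf.1.
have q0 x: 0 <= (q x)%:E by rewrite lee_fin sqr_ge0.
have af0 x: 0 <= `|f x|%:E by rewrite lee_fin.
set A := \int[mu]_x `|f x|%:E; have A0: 0 <= A by exact: integral_ge0.
have D0 i x: 0 <= `|'D_(ei i) q x|%:E by rewrite lee_fin.
have mD i: mfunT (fun x => `|'D_(ei i) q x|%:E) by exact: c1_meas.
pose S x := \sum_i `|'D_(ei i) q x|%:E; have S0 x: 0 <= S x by exact: sume_ge0.
have mS: mfun setT S by exact: emeasurable_sum.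
have mAf: mfunT (fun x => A * `|f x|%:E) by exact: emeasurable_funM.
have mrS: mfunT (fun x => (r ^+ n.+1)%:E * S x) by exact: emeasurable_funM.
have Af0 x: 0 <= A * `|f x|%:E by exact: mule_ge0.
have rS0 x: 0 <= (r ^+ n.+1)%:E * S x by apply: mule_ge0; rewrite ?lee_fin.
have split X: measurable X -> \int[mu]_(x in X) (A * `|f x|%:E + (r ^+ n.+1)%:E * S x) =
  A * \int[mu]_(x in X) `|f x|%:E + (r ^+ n.+1)%:E * \sum_i \int[mu]_(x in X) `|'D_(ei i) q x|%:E.
 move=> mX; rewrite ge0_integralD//; [|exact: mfunTS..].
 have [mf' mS'] := (mfunTS maf: mfun X _, mfunTS mS: mfun X _).
 rewrite (ge0_integralZl mu mX mf')// (ge0_integralZl_EFin mu mX _ mS' (rn _))//.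
 by rewrite ge0_integral_sum// => i; exact: mfunTS.
rewrite -(@lee_pmul2l _ (r ^+ n)%:E)//; last by rewrite lte_fin exprn_gt0.
have mrq: mfunT (fun x => (r ^+ n)%:E * (q x)%:E) by exact: emeasurable_funM.
have rq0 x: 0 <= (r ^+ n)%:E * (q x)%:E by apply: mule_ge0; rewrite ?lee_fin// sqr_ge0.
have [m1 e1] := int_cubes (ltW r0) mrq rq0.
have [m2 e2] := int_cubes (ltW r0) (emeasurable_funD mAf mrS) (fun x => adde_ge0 (Af0 x) (rS0 x)).
rewrite -split// -(ge0_integralZl_EFin mu measurableT _ mq (rn n))// -e1 -e2; apply: ge0_le_integral =>//.
- by move=> a _; apply: integral_ge0 => x _; exact: rq0.
move=> a _; set K := cube a r; have mK: measurable K := meas_cube a r.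
pose d x := \int[mu]_(y in K) `|q x - q y|%:E.
have mqq: mfunT (fun z => `|q z.1 - q z.2|%:E).
 apply/mEFinP/mcomp =>//; apply: measurable_funB; apply: mcomp (cont_vec cq.1) _ =>//.
have md: mfun setT d by exact: (@int_sndm _ _ _ _ R mu K (fun z => `|q z.1 - q z.2|%:E)).
have d0 x: 0 <= d x by exact: integral_ge0.
rewrite split//; apply: (@le_trans _ _ (A * \int[mu]_(x in K) `|f x|%:E + \int[mu]_(x in K) d x)); last by rewrite leeD2l// cube_poincare// ltW.
rewrite -(ge0_integralZl mu mK (mfunTS maf))// -ge0_integralD//; [|exact: mfunTS..].
apply: ge0_le_integral =>//; [exact: mfunTS|apply: mfunTS; exact: emeasurable_funD|].
move=> x _; have mdx: mfunT (fun y => `|q x - q y|%:E) by exact: mcomp mqq (measurable_fun_pair (measurable_cst _) (@measurable_id _ _ _)).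
rewrite -(leb_cube a (ltW r0)) muleC -integral_cst//.
apply: (@le_trans _ _ (\int[mu]_(y in K) (`|f x|%:E * `|f y|%:E + `|q x - q y|%:E))).
 apply: ge0_le_integral =>//; [by move=> y _; exact: q0| |].
  by apply: mfunTS; apply: emeasurable_funD =>//; exact: emeasurable_funM.
 move=> y _; rewrite /cst -EFinM -EFinD lee_fin /q -(real_normK (num_real (f x))) -(real_normK (num_real (f y))).
 have := normr_ge0 (f x); have := normr_ge0 (f y); move: (`|f x|)%R (`|f y|)%R => b s s0 b0.
 have := ler_norm (b ^+ 2 - s ^+ 2)%R; have := normr_ge0 (b ^+ 2 - s ^+ 2)%R; move: (`|b ^+ 2 - s ^+ 2|)%R => z.
 by have [|] := leP b s; nra.
rewrite ge0_integralD//; [|exact: mfunTS (emeasurable_funM _ maf)|exact: mfunTS].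
rewrite leeD2r// (ge0_integralZl_EFin mu mK _ (mfunTS maf))// muleC lee_wpmul2r//.
exact: ge0_subset_integral.
Qed.
End nash.

(** * Integrals of test functions and of their derivatives *)

Section integral_tests.
Context {R: realType}.
Local Open Scope ereal_scope.

Lemma bnd_set_cube n (A: set 'cV[R]_n): bounded_set A ->
 exists (a: 'cV[R]_n) r, (0 <= r)%R /\ forall x, A x -> cube a r x.
move=> [M [Mr MA]]; have M1: (M < `|M| + 1)%R by rewrite (le_lt_trans (ler_norm M))// ltrDl.
exists (\col_i - (`|M| + 1))%R, (2 * (`|M| + 1))%R; split.
 by rewrite mulr_ge0// addr_ge0.
move=> x Ax i; have := MA _ M1 x Ax => /=.
rewrite [`|x|%R]mx_normrE => h; have: (`|x i ord0| <= `|M| + 1)%R.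
 apply: le_trans h; apply: (@le_bigmax _ _ _ (0%R: R) (fun ij: 'I_n * 'I_1 => `|x ij.1 ij.2|%R) (i, ord0)).
rewrite !mxE ler_norml => /andP[-> h2] /=; apply: le_trans h2 _.
by rewrite mulr2n mulrDl !mul1r addKr.
Qed.

Lemma bnd_set_leb n (A: set 'cV[R]_n): measurable A -> bounded_set A ->
 lvec n A < +oo.
move=> mA /bnd_set_cube[a [r [r0 h]]].
apply: (@le_lt_trans _ _ (lvec n (cube a r))).
 by apply: le_measure; rewrite ?inE//; exact: meas_cube.
by rewrite leb_cube// ltry.
Qed.
Lemma leb_cube_fin n (a: 'cV[R]_n) r: (0 <= r)%R -> lvec n (cube a r) < +oo.
by move=> r0; rewrite leb_cube// ltry. Qed.

Lemma isd_line n (f: 'cV[R]_n -> R) (v x: 'cV[R]_n) s: smooth f ->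
 is_derive s (1%R: R) (fun t: R => f (t *: v + x)%R) ('D_v f (s *: v + x)%R).
move=> sf; have E: (fun h: R => h^-1 *: (((fun t: R => f (t *: v + x)) \o shift s) (h *: (1: R)) - f (s *: v + x)))%R =
  (fun h: R => h^-1 *: ((f \o shift (s *: v + x)) (h *: v) - f (s *: v + x)%R))%R.
 by apply/funext => h /=; rewrite [(h *: 1)%R]mulr1 scalerDl addrA.
have [Ed EE]: (derivable (fun t: R => f (t *: v + x)%R) s (1%R: R) = derivable f (s *: v + x)%R v) *
  ('D_1 (fun t: R => f (t *: v + x)%R) s = 'D_v f (s *: v + x)%R).
 by rewrite /derive /derivable E.
by apply: DeriveDef =>//; rewrite Ed; exact: sm_der.
Qed.

Lemma lipschitz_line (g dg: R -> R) (C s t: R) :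
 (forall s, is_derive s (1%R: R) g (dg s)) -> (forall s, `|dg s| <= C)%R ->
 (`|g s - g t| <= C * `|s - t|)%R.
move=> dgP gC; wlog ts: s t / (t <= s)%R.
 move=> H; have [/H//|/ltW /H] := leP t s.
 by rewrite distrC (distrC s).
have cg: {within `[t, s], continuous g}.
 by apply: derivable_within_continuous => x _; have [] := dgP x.
have [c _ ->] := MVT_segment ts (fun x _ => dgP x) cg.
by rewrite normrM ler_wpM2r.
Qed.

Lemma sm_lipschitz n (f: 'cV[R]_n -> R) (v x: 'cV[R]_n) (C h: R): smooth f ->
 (forall x, `|'D_v f x| <= C)%R -> (`|f (h *: v + x)%R - f x| <= C * `|h|)%R.
move=> sf fC; have := lipschitz_line h 0%R (fun s => isd_line v x s sf) (fun s => fC _).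
by rewrite scale0r add0r subr0.
Qed.

Lemma test_integrable n (D: set 'cV[R]_n) f: test_function D f ->
 (lvec n).-integrable setT (EFin \o f).
move=> tf; have [C C0 fC] := tf_bnd tf; have [sf cf _] := tf.
have [a [r [r0 h]]] := bnd_set_cube (compact_bounded cf).
have mc := meas_cube a r.
have: (lvec n).-integrable (cube a r) (EFin \o f).
 apply: (@measurable_bounded_integrable _ _ _ (lvec n)) =>//.
 - exact: leb_cube_fin.
 - by apply: mfunTS; exact: cont_vec (sm_cont sf).
 - by exists C; split; rewrite ?num_real// => M CM x _; exact: le_trans (fC x) (ltW CM).
move=> /(integrable_mkcond _ mc); congr integrable.
apply/funext => x; rewrite patchE; case: ifPn =>//= /negP xc.
have [->//|fx] := eqVneq (f x) 0%R.
by exfalso; apply: xc; rewrite inE; apply: h; exact: subset_closure.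
Qed.

(** Translation invariance makes the integral of every difference quotient vanish; the Lipschitz
    bound on one cube containing all the supports allows dominated convergence. Applied to products
    this is integration by parts. *)
Lemma int_test_derive n (D: set 'cV[R]_n) f (v: 'cV[R]_n): test_function D f ->
 \int[lvec n]_x ('D_v f x)%:E = 0.
move=> tf; have tD := tf_derive v tf; have [sf cf _] := tf.
have [C C0 fC] := tf_bnd tD.
have [a [r [r0 h]]] := bnd_set_cube (compact_bounded cf).
set mu := lvec n; have mf := cont_vec (sm_cont sf).
pose k_ m: R := (m.+1%:R^-1)%R.
have k0 m: (0 < k_ m)%R by rewrite invr_gt0.
have k1 m: (k_ m <= 1)%R by rewrite invf_le1// ler1n.
pose q m x := ((k_ m)^-1 * (f (k_ m *: v + x)%R - f x))%R.
have msh m: mfunT (fun x: 'cV[R]_n => f (k_ m *: v + x)%R).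
 apply: (eq_measurable_fun (fun x: 'cV[R]_n => f (x + k_ m *: v)%R)).
  by move=> x _; rewrite addrC.
 exact: mcomp mf (meas_translate _).
have mq m: mfunT (q m).
 by apply: measurable_funM; [exact: measurable_cst|exact: measurable_funB].
(* the support of all the quotients lies in the cube of side r + 2 V *)
pose V := (\sum_i `|v i ord0|)%R.
have V0: (0 <= V)%R by apply: sumr_ge0.
have vV i: (`|v i ord0| <= V)%R by rewrite /V (bigD1 i)//= lerDl sumr_ge0.
pose a': 'cV[R]_n := (\col_i (a i ord0 - V))%R; pose r' := (r + 2 * V)%R.
have r'0: (0 <= r')%R by rewrite addr_ge0// mulr_ge0.
have mc := meas_cube a' r'.
have suppf x: f x != 0%R -> cube a r x by move=> fx; apply: h; exact: subset_closure.
have suppq m x: q m x != 0%R -> cube a' r' x.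
 move=> qx i; rewrite !mxE; have [fx|fx] := eqVneq (f x) 0%R; last first.
  have := suppf _ fx i; rewrite !mxE /r'; move: V0; clear; lra.
 have: f (k_ m *: v + x)%R != 0%R.
  by apply: contra qx => /eqP E; rewrite /q E fx subrr mulr0.
 move=> /suppf /(_ i); rewrite !mxE /r'.
 have: (`|k_ m * v i ord0| <= V)%R.
  rewrite normrM (gtr0_norm (k0 m)); apply: le_trans (vV i).
  by rewrite ler_piMl.
 rewrite ler_norml; move: (k_ m * v i ord0)%R V0 => p; clear; lra.
pose g := (fun x => (C * \1_(cube a' r') x)%:E).
have ig: mu.-integrable setT g.
 have: mu.-integrable (cube a' r') (EFin \o cst C).
  apply: (@measurable_bounded_integrable _ _ _ mu) =>//.
  - exact: leb_cube_fin.
  - by exists C; split; rewrite ?num_real// => M CM x _; rewrite /= ger0_norm// ltW.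
 move=> /(integrable_mkcond _ mc); congr integrable.
 by apply/funext => x; rewrite patchE /g indicE; case: ifPn => _; rewrite ?mulr1 ?mulr0.
have dom: {ae mu, forall x m, setT x -> `|(q m x)%:E| <= g x}.
 apply/aeW => x m _; rewrite /g lee_fin indicE.
 have [->|qx] := eqVneq (q m x) 0%R; first by rewrite normr0 mulr_ge0.
 rewrite mem_set ?mulr1; last exact: suppq qx.
 rewrite /q normrM gtr0_norm ?invr_gt0// mulrC ler_pdivrMr//.
 by have := @sm_lipschitz _ f v x C (k_ m) sf fC; rewrite (gtr0_norm (k0 m)).
have cv: {ae mu, forall x, setT x -> (fun m => (q m x)%:E) @ \oo --> ('D_v f x)%:E}.
 apply/aeW => x _; apply: cvg_EFin; first by near=> m.
 have dv: derivable f x v by exact: sm_der.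
 have: (fun h: R => h^-1 *: ((f \o shift x) (h *: v) - f x))%R @ (0%R: R)^' --> 'D_v f x by exact: dv.
 move=> /cvgr_dnbhsP /(_ k_); apply; split=> [m|]; first by rewrite gt_eqF.
 exact: cvg_harmonic.
have mqE m: mfunT (EFin \o q m) by exact/mEFinP.
have mDE: mfunT (fun x => ('D_v f x)%:E).
 by apply/mEFinP; apply: cont_vec (sm_cont (sm_derive v sf)).
have [_ _] := dominated_convergence measurableT mqE mDE cv ig dom.
have q0 m: \int[mu]_x (q m x)%:E = 0.
 have i1: mu.-integrable setT (EFin \o f) := test_integrable tf.
 have tr: \int[mu]_x (f (k_ m *: v + x)%R)%:E = \int[mu]_x (f x)%:E.
  have mE: mfunT (EFin \o f) by exact/mEFinP.
  rewrite integralE [RHS]integralE; congr (_ - _).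
   rewrite (eq_integral (fun x: 'cV[R]_n => (EFin \o f)^\+ (x + k_ m *: v)%R)); last first.
    by move=> x _; rewrite !funeposE /= addrC.
   exact: (int_vec_translate (k_ m *: v) (measurable_funepos mE) (funepos_ge0 _)).
  rewrite (eq_integral (fun x: 'cV[R]_n => (EFin \o f)^\- (x + k_ m *: v)%R)); last first.
   by move=> x _; rewrite !funenegE /= addrC.
  exact: (int_vec_translate (k_ m *: v) (measurable_funeneg mE) (funeneg_ge0 _)).
 have i2: mu.-integrable setT (fun x => (f (k_ m *: v + x)%R)%:E).
  apply/integrableP; split; first exact/mEFinP.
  rewrite (eq_integral (fun x: 'cV[R]_n => (fun y: 'cV[R]_n => `|f y|%:E) (x + k_ m *: v)%R)); last first.
   by move=> x _; rewrite /= addrC.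
  rewrite (int_vec_translate (k_ m *: v) (f := fun y: 'cV[R]_n => `|f y|%:E))//.
   by case/integrableP: i1.
  exact: meas_abs_cont (sm_cont sf).
 rewrite /q; under eq_integral do rewrite EFinM EFinB.
 rewrite integralZl//; last exact: integrableB.
 by rewrite integralB// tr subee ?mule0//; exact: integrable_fin_num.
under eq_fun do rewrite q0.
by move=> /(cvg_lim (@ereal_hausdorff R)) <-; exact: lim_cst.
Unshelve. all: by end_near. Qed.
End integral_tests.
Lemma nat_above {R: realType} (x: R): exists n, x < n.+1%:R.
by exists (Num.truncn x); exact: truncnS_gt. Qed.

Lemma expr_lt_near {R: realType} (q K e: R): 0 <= q < 1 -> 0 <= K -> 0 < e ->
 exists n0, forall n, (n0 <= n)%N -> q ^+ n * K < e.
move=> /andP[q0 q1] K0 e0.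
have h: (fun n => q ^+ n) @ \oo --> (0: R) by apply: cvg_expr; rewrite ger0_norm.
have d0: 0 < e / (K + 1) by rewrite divr_gt0// ltr_wpDl.
have [n0 _ hn0]: \forall n \near \oo, `|0 - q ^+ n| < e / (K + 1) by exact: (cvgrPdist_lt _ _).1 h _ d0.
exists n0 => n nn; have := hn0 n nn; rewrite /= sub0r normrN ger0_norm ?exprn_ge0//.
rewrite ltr_pdivlMr ?ltr_wpDl// => h1; apply: le_lt_trans h1.
by rewrite mulrDr mulr1 lerDl exprn_ge0.
Qed.

(** * Hilbert space methods *)
Section lax_milgram.
Context {R: realType} {E: lmodType R}.
Variable ip: E -> E -> R.
Hypothesis ipDl: forall x y z, ip (x + y) z = ip x z + ip y z.
Hypothesis ipZl: forall (c: R) x y, ip (c *: x) y = c * ip x y.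
Hypothesis ipC: forall x y, ip x y = ip y x.
Hypothesis ip_ge0: forall x, 0 <= ip x x.
Implicit Types (W: set E) (l: E -> R).
Definition ip_cauchy (u: nat -> E) := forall e: R, 0 < e ->
 exists n0, forall m n, (n0 <= m)%N -> (n0 <= n)%N -> ip (u m - u n) (u m - u n) < e.
Definition ip_cvg (u: nat -> E) x := forall e: R, 0 < e ->
 exists n0, forall n, (n0 <= n)%N -> ip (u n - x) (u n - x) < e.
Hypothesis ip_complete: forall u, ip_cauchy u -> exists x, ip_cvg u x.
Definition subsp_of W := W 0 /\ forall (c: R) x y, W x -> W y -> W (c *: x + y).
(** As [ip] may vanish on nonzero vectors, the closure contains with x every vector at distance 0
    from it. For functions this absorbs changes on null sets. *)
Definition ip_closure W x := forall e: R, 0 < e ->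
 exists2 w, W w & ip (x - w) (x - w) < e.
Definition linear_on l := forall (c: R) x y, l (c *: x + y) = c * l x + l y.
Lemma ipDr x y z: ip x (y + z) = ip x y + ip x z.
by rewrite ipC ipDl !(ipC x). Qed.
Lemma ipZr c x y: ip x (c *: y) = c * ip x y.
by rewrite ipC ipZl ipC. Qed.
Lemma ipNl x y: ip (- x) y = - ip x y.
by rewrite -scaleN1r ipZl mulN1r. Qed.
Lemma ipNr x y: ip x (- y) = - ip x y.
by rewrite ipC ipNl ipC. Qed.
Definition ip_lin := (ipDl, ipDr, ipNl, ipNr, ipZl, ipZr).
Lemma ip_sqD x y: ip (x + y) (x + y) = ip x x + 2 * ip x y + ip y y.
by rewrite !ip_lin (ipC y x); ring. Qed.

Lemma ip_cs x y: ip x y ^+ 2 <= ip x x * ip y y.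
have h (t: R): 0 <= ip x x + 2 * t * ip x y + t ^+ 2 * ip y y.
 have := ip_ge0 (x + t *: y); rewrite ip_sqD !ip_lin => h.
 by apply: le_trans h _; apply: leEq; ring.
have [y0|y0] := eqVneq (ip y y) 0.
 have [-> //|xy0] := eqVneq (ip x y) 0; first by rewrite expr0n y0 mulr0.
 have := h (- (ip x x + 1) / (2 * ip x y)); rewrite y0 mulr0 addr0.
 have ->: 2 * (- (ip x x + 1) / (2 * ip x y)) * ip x y = - (ip x x + 1) by field.
 by lra.
have y1: 0 < ip y y by rewrite lt_def y0 ip_ge0.
have := h (- ip x y / ip y y).
have ->: ip x x + 2 * (- ip x y / ip y y) * ip x y + (- ip x y / ip y y) ^+ 2 * ip y y =
  ip x x - ip x y ^+ 2 / ip y y by field.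
by rewrite subr_ge0 ler_pdivrMr.
Qed.

Lemma ip_sq_le x y: ip (x + y) (x + y) <= 2 * ip x x + 2 * ip y y.
have := ip_ge0 (x - y); rewrite ip_sqD [ip (x + y) _]ip_sqD !ip_lin.
by lra.
Qed.
Lemma subspZ W c x: subsp_of W -> W x -> W (c *: x).
by move=> [W0 WD] Wx; rewrite -[c *: x]addr0; exact: WD. Qed.
Lemma subspD W x y: subsp_of W -> W x -> W y -> W (x + y).
by move=> [W0 WD] Wx Wy; rewrite -[x]scale1r; exact: WD. Qed.

Lemma subspB W x y: subsp_of W -> W x -> W y -> W (x - y).
by move=> sW Wx Wy; apply: subspD =>//; rewrite -scaleN1r; exact: subspZ.
Qed.

Lemma ip_cvg_closure W u x: ip_cvg u x -> (forall n, W (u n)) -> ip_closure W x.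
move=> ux Wu e e0; have [n0 h] := ux e e0; exists (u n0) =>//.
by have := h n0 (leqnn _); rewrite -(opprB x) ipNl ipNr opprK.
Qed.

Lemma closure_subsp W: subsp_of W -> subsp_of (ip_closure W).
move=> sW; split=> [e e0|c x y cx cy e e0].
 by exists 0; [case: sW|rewrite subr0 -(scale0r 0) ipZl mul0r].
have d0: 0 < e / (4 * (c ^+ 2 + 1)) by rewrite divr_gt0// mulr_gt0// ltr_wpDl// sqr_ge0.
have [w Ww hw] := cx _ d0.
have [z Wz hz] := cy _ (divr_gt0 e0 (ltr0n _ 4)).
exists (c *: w + z); first by have [_ WD] := sW; exact: WD.
have ->: c *: x + y - (c *: w + z) = c *: (x - w) + (y - z).
 by rewrite scalerBr opprD addrACA.
apply: le_lt_trans (ip_sq_le _ _) _; rewrite ipZl ipZr.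
have h: c ^+ 2 * ip (x - w) (x - w) <= e / 4.
 apply: le_trans (_: (c ^+ 2 + 1) * (e / (4 * (c ^+ 2 + 1))) <= _).
  by apply: ler_pM; rewrite ?sqr_ge0 ?ip_ge0 ?lerDl ?(ltW hw).
 apply: leEq.
 have: c ^+ 2 + 1 != 0 by rewrite gt_eqF// ltr_wpDl// sqr_ge0.
 by move=> ?; field.
by rewrite expr2 -mulrA in h; lra.
Qed.

Lemma ip_cvg_ip u x y: ip_cvg u x -> forall e: R, 0 < e ->
 exists n0, forall n, (n0 <= n)%N -> `|ip (u n) y - ip x y| < e.
move=> ux e e0; have d0: 0 < e ^+ 2 / (ip y y + 1).
 by rewrite divr_gt0 ?exprn_gt0// ltr_wpDl// ip_ge0.
have [n0 h] := ux _ d0; exists n0 => n /h hn.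
rewrite -ipNl -ipDl; have cs := ip_cs (u n - x) y.
have y1: 0 < ip y y + 1 by rewrite ltr_wpDl// ip_ge0.
rewrite -ltr_sqr ?nnegrE// ?(ltW e0)// real_normK ?num_real//.
apply: le_lt_trans cs _; rewrite ltr_pdivlMr// in hn.
have := ip_ge0 (u n - x); nra.
Qed.

(* The minimizing sequences of |w|^2/2 - l(w) over W are Cauchy. *)
Lemma riesz_dense W l C: subsp_of W -> linear_on l -> 0 <= C ->
 (forall w, W w -> l w ^+ 2 <= C * ip w w) ->
 exists2 u, ip_closure W u & forall w, W w -> ip u w = l w.
move=> sW ll C0 lC.
pose J w := ip w w / 2 - l w.
have lD x y: l (x + y) = l x + l y by rewrite -[x]scale1r ll mul1r scale1r.
have l0: l 0 = 0 by have := lD 0 0; rewrite addr0; lra.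
have lZ c x: l (c *: x) = c * l x by have := ll c x 0; rewrite l0 !addr0.
have lN x: l (- x) = - l x by rewrite -scaleN1r lZ mulN1r.
have JB w: W w -> - C <= J w.
 move=> Ww; have := lC w Ww; have := ip_ge0 w; rewrite /J.
 have [lw|lw] := leP (l w) C; first by lra.
 move=> i0 h; nra.
have hl: has_lbound [set J w | w in W].
 by exists (- C) => _ [w Ww <-]; exact: JB.
have hi: has_inf [set J w | w in W].
 by split =>//; exists (J 0), 0 =>//; case: sW.
set m := inf [set J w | w in W].
have mJ w: W w -> m <= J w by move=> Ww; apply: ge_inf =>//; exists w.
have ex n: exists w, W w /\ J w < m + n.+1%:R^-1.
 have n0: (0: R) < n.+1%:R^-1 by rewrite invr_gt0.
 by have [_ [w Ww <-] h] := inf_adherent n0 hi; exists w.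
have [u uP] := choice ex.
(* Parallelogram identity for [J]. The midpoint stays in [W], so [J] is at least [m] there, and the
   right side is small for a minimizing sequence. *)
have par x y: ip (x - y) (x - y) = 4 * (J x + J y - 2 * J (2^-1 *: (x + y))).
 by rewrite /J lZ lD !ip_lin (ipC y x); field.
have cu: ip_cauchy u.
 move=> e e0; have [n0 hn0]: exists n0: nat, 8 / e < n0.+1%:R.
  exact: nat_above.
 exists n0 => p q np nq; rewrite par.
 have hW: W (2^-1 *: (u p + u q)).
  by apply: subspZ =>//; apply: subspD =>//; [exact: (uP p).1|exact: (uP q).1].
 have h1 := mJ _ hW; have [_ h2] := uP p; have [_ h3] := uP q.
 have k (r: nat): (n0 <= r)%N -> (r.+1%:R^-1: R) < e / 8.
  move=> nr; rewrite invf_plt ?posrE ?divr_gt0// invf_div.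
  by apply: lt_le_trans hn0 _; rewrite ler_nat.
 have := k p np; have := k q nq; move: h1 h2 h3.
 move: (J (2^-1 *: _)) (J (u p)) (J (u q)) (p.+1%:R^-1: R) (q.+1%:R^-1: R).
 by move=> a b c f g; lra.
have [x ux] := ip_complete cu.
have clx: ip_closure W x by apply: (ip_cvg_closure ux) => n; exact: (uP n).1.
exists x =>// w Ww; apply/eqP; rewrite -subr_eq0; apply/eqP.
have vn n (t: R): 0 <= n.+1%:R^-1 + t * (ip (u n) w - l w) + t ^+ 2 / 2 * ip w w.
 have Wt: W (u n + t *: w).
  by apply: subspD =>//; [exact: (uP n).1|exact: subspZ].
 have := mJ _ Wt; have [_ h2] := uP n; rewrite /J in h2 *.
 rewrite ip_sqD lD lZ !ip_lin => h1.
 have h: 0 <= n.+1%:R^-1 + (t * (ip (u n) w - l w) + t ^+ 2 / 2 * ip w w).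
  have: t ^+ 2 / 2 * ip w w = t * (t * ip w w) / 2 by field.
  move=> ->; move: h1 h2; move: (n.+1%:R^-1: R) => k.
  by move: (ip (u n) w) (t * (t * ip w w)) => p q h1 h2; lra.
 by rewrite -addrA.
have v (t: R): 0 <= t * (ip x w - l w) + t ^+ 2 / 2 * ip w w.
 apply/ler_addgt0Pr => e e0; rewrite -[leRHS]/(_ + e).
 have d0: 0 < e / (2 * (`|t| + 1)) by rewrite divr_gt0// mulr_gt0// ltr_wpDl.
 have [n0 h] := ip_cvg_ip w ux d0.
 have [n1 hn1]: exists n1: nat, 2 / e < n1.+1%:R.
  exact: nat_above.
 have := h (maxn n0 n1) (leq_maxl _ _); have := vn (maxn n0 n1) t.
 set n := maxn n0 n1 => h1 h2.
 have h3: (n.+1%:R^-1: R) < e / 2.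
  rewrite invf_plt ?posrE ?divr_gt0// invf_div.
  by apply: lt_le_trans hn1 _; rewrite ler_nat ltnS leq_maxr.
 have h4: t * (ip (u n) w - ip x w) <= e / 2.
  apply: le_trans (ler_norm _) _; rewrite normrM.
  apply: le_trans (_: `|t| * (e / (2 * (`|t| + 1))) <= _).
   by rewrite ler_wpM2l// ltW.
  rewrite mulrA ler_pdivrMr ?mulr_gt0 ?ltr_wpDl//.
  have ->: e / 2 * (2 * (`|t| + 1)) = `|t| * e + e by field.
  by rewrite lerDl ltW.
 by move: h1 h3; move: (n.+1%:R^-1: R) => k; clear -h4 => h1 h3; lra.
set b := ip x w - l w; have [w0|w0] := eqVneq (ip w w) 0.
 by have := v 1; have := v (- 1); rewrite w0 -/b !mulr0 !addr0; lra.
have w1: 0 < ip w w by rewrite lt_def w0 ip_ge0.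
have := v (- b / ip w w); rewrite -/b.
have ->: - b / ip w w * b + (- b / ip w w) ^+ 2 / 2 * ip w w = - (b ^+ 2 / (2 * ip w w)) by field.
rewrite oppr_ge0 pmulr_lle0 ?invr_gt0 ?mulr_gt0// => hb.
by apply/eqP; rewrite -sqrf_eq0 eq_le hb sqr_ge0.
Qed.

(** Transfers identities from [W] to its closure; the quadratic bound expresses the continuity of
    [l]. *)
Lemma closure_ext W (l: E -> R) C: (forall c x y, l (c *: x + y) = c * l x + l y) ->
 0 <= C -> (forall w, l w ^+ 2 <= C * ip w w) -> (forall w, W w -> l w = 0) ->
 forall x, ip_closure W x -> l x = 0.
move=> ll C0 lC lW x cx.
have lD y z: l (y + z) = l y + l z by rewrite -[y]scale1r ll mul1r scale1r.
apply/eqP; rewrite -sqrf_eq0 eq_le sqr_ge0 andbT.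
apply/ler_addgt0Pr => e e0; rewrite add0r.
have d0: 0 < e / (C + 1) by rewrite divr_gt0// ltr_wpDl.
have [w Ww hw] := cx _ d0.
rewrite -(subrK w x) lD (lW w Ww) addr0; apply: le_trans (lC _) _.
rewrite ltr_pdivlMr ?ltr_wpDl// in hw.
by have := ip_ge0 (x - w); nra.
Qed.

Lemma lax_milgram W (a: E -> E -> R) (l: E -> R) (al C L: R) :
 subsp_of W -> 0 < al -> 0 <= C -> 0 <= L ->
 (forall y, linear_on (a ^~ y)) -> (forall x, linear_on (a x)) ->
 (forall x y, a x y ^+ 2 <= C * ip x x * ip y y) ->
 (forall x, ip_closure W x -> al * ip x x <= a x x) ->
 linear_on l -> (forall w, l w ^+ 2 <= L * ip w w) ->
 exists2 u, ip_closure W u & forall w, W w -> a u w = l w.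
move=> sW al0 C0 L0 all alr aC aal ll lL.
(* Minimizes 1 - 2 rho al + rho^2 (C + al^2), which becomes the contraction factor [q]. Adding al^2
   to C keeps the denominator positive when C = 0 and makes [q] nonnegative. *)
pose rho := al / (C + al ^+ 2).
have CC: 0 < C + al ^+ 2 by rewrite ltr_wpDl// exprn_gt0.
have rho0: 0 < rho by rewrite divr_gt0.
(* one step of the iteration u -> u - rho (A u - l) *)
have step u: exists v, ip_closure W v /\
  forall w, W w -> ip v w = a u w - l w.
 have [|||v cv vP] := @riesz_dense W (fun w => a u w - l w) (2 * (C * ip u u) + 2 * L) sW.
 - by move=> c x y; rewrite alr ll; ring.
 - by rewrite addr_ge0// mulr_ge0// mulr_ge0// ip_ge0.
 - move=> w Ww; have := aC u w; have := lL w => h1 h2.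
  have: 0 <= (a u w + l w) ^+ 2 by rewrite sqr_ge0.
  by nra.
 by exists v.
have [S SP] := choice step.
have Sl u: ip_closure W (S u) := (SP u).1.
pose F u := u - rho *: S u.
have clW := closure_subsp sW.
have FW u: ip_closure W u -> ip_closure W (F u).
 by move=> cu; exact: (subspB clW cu (subspZ rho clW (Sl u))).
(* S u - S v represents a (u - v) on the closure of W *)
have aBl u v y: a (u - v) y = a u y - a v y.
 by have := all y (- 1) v u; rewrite scaleN1r addrC => ->; ring.
have rep u v x: ip_closure W x -> ip (S u - S v) x = a (u - v) x.
 move=> cx; apply/eqP; rewrite -subr_eq0; apply/eqP.
 pose C' := 2 * ip (S u - S v) (S u - S v) + 2 * (C * ip (u - v) (u - v)).
 apply: (@closure_ext W (fun x => ip (S u - S v) x - a (u - v) x) C') cx.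
 - by move=> c y z; rewrite alr !ip_lin; ring.
 - by rewrite addr_ge0// mulr_ge0// ?ip_ge0// mulr_ge0// ip_ge0.
 - move=> w; have h1 := ip_cs (S u - S v) w; have h2 := aC (u - v) w.
  have: 0 <= (ip (S u - S v) w + a (u - v) w) ^+ 2 by rewrite sqr_ge0.
  by rewrite /C'; nra.
 move=> w Ww; rewrite ipDl ipNl !(SP _).2// aBl; ring.
pose q := 1 - al ^+ 2 / (C + al ^+ 2).
have q0: 0 <= q.
 by rewrite subr_ge0 ler_pdivrMr// mul1r lerDr.
have q1: q < 1 by rewrite ltrBlDr ltrDl divr_gt0// exprn_gt0.
have contr u v: ip_closure W u -> ip_closure W v ->
  ip (F u - F v) (F u - F v) <= q * ip (u - v) (u - v).
 move=> cu cv; set d := u - v; set s := S u - S v.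
 have cd: ip_closure W d := subspB clW cu cv.
 have cs: ip_closure W s := subspB clW (Sl u) (Sl v).
 have ->: F u - F v = d - rho *: s.
  by rewrite /F /d /s scalerBr !opprD !opprK addrACA.
 have h1: ip s d = a d d by exact: rep.
 have h2: ip s s = a d s by exact: rep.
 have h3: ip s s <= C * ip d d.
  have := aC d s; rewrite -h2; have := ip_ge0 s; have := ip_ge0 d => d0 s0 h.
  have [s00|s00] := eqVneq (ip s s) 0; first by rewrite s00 mulr_ge0.
  have s1: 0 < ip s s by rewrite lt_def s00.
  by rewrite -(ler_pM2r s1) -expr2.
 have h4 := aal d cd.
 clearbody d s; rewrite !ip_lin (ipC d s) h1.
 have d0 := ip_ge0 d.
 have e1: q * ip d d = ip d d - 2 * rho * (al * ip d d) + rho ^+ 2 * ((C + al ^+ 2) * ip d d).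
  by rewrite /q /rho; field; rewrite gt_eqF.
 rewrite e1; have h5: ip s s <= (C + al ^+ 2) * ip d d.
  by apply: le_trans h3 _; rewrite ler_wpM2r// lerDl sqr_ge0.
 have: rho ^+ 2 * ip s s <= rho ^+ 2 * ((C + al ^+ 2) * ip d d).
  by rewrite ler_wpM2l// sqr_ge0.
 have: rho * (al * ip d d) <= rho * a d d by rewrite ler_wpM2l// ltW.
 by rewrite expr2; lra.
pose U n := iter n F 0.
have UW n: ip_closure W (U n).
 by elim: n => [|n IH]; [case: clW|exact: FW].
(* Young's inequality with weight [d] gives (1 + d) q = q' < 1. The bound [K] on the squared
   distance from [U 0] then reproduces itself along the iteration, with no square roots. *)
pose q' := q * (3 - q) / 2; pose d := (1 - q) / 2.
have d0: 0 < d by rewrite divr_gt0// subr_gt0.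
have q'1: 0 < 1 - q' by rewrite /q'; nra.
pose B1 := ip (U 1%N - U 0%N) (U 1%N - U 0%N).
have B10: 0 <= B1 by exact: ip_ge0.
pose K := (1 + d^-1) * B1 / (1 - q').
have dV: 0 < d^-1 by rewrite invr_gt0.
have K0: 0 <= K by rewrite divr_ge0 ?(ltW q'1)// mulr_ge0// addr_ge0// ltW.
have young x y: ip (x + y) (x + y) <= (1 + d) * ip x x + (1 + d^-1) * ip y y.
 have := ip_ge0 (d *: x - y); rewrite (ip_sqD (d *: x)) (ip_sqD x y) !ip_lin => h.
 have h': 0 <= d^-1 * (d * (d * ip x x) + 2 * - (d * ip x y) - - ip y y).
  by rewrite mulr_ge0// ltW.
 suff: d^-1 * (d * (d * ip x x) + 2 * - (d * ip x y) - - ip y y) =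
  d * ip x x - 2 * ip x y + d^-1 * ip y y by move=> e; rewrite e in h'; lra.
 by field; rewrite gt_eqF.
have BK m: ip (U m - U 0%N) (U m - U 0%N) <= K.
 elim: m => [|m IH]; first by rewrite subrr -(scale0r 0) ipZl mul0r.
 have ->: U m.+1 - U 0%N = (U m.+1 - U 1%N) + (U 1%N - U 0%N) by rewrite addrA subrK.
 apply: le_trans (young _ _) _.
 have h := contr _ _ (UW m) (UW 0%N).
 have h2: (1 + d) * ip (U m.+1 - U 1%N) (U m.+1 - U 1%N) <= (1 + d) * (q * K).
  rewrite ler_wpM2l ?addr_ge0 ?(ltW d0)//; apply: le_trans h _.
  by rewrite ler_wpM2l.
 have e1: (1 + d^-1) * B1 = K * (1 - q') by rewrite /K divfK// gt_eqF.
 rewrite -/B1 e1; have e2: K = (1 + d) * (q * K) + K * (1 - q') by rewrite /d /q'; field.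
 by rewrite [leRHS]e2 lerD2r.
have Umn m n: ip (U (n + m)%N - U n) (U (n + m)%N - U n) <= q ^+ n * K.
 elim: n => [|n IH]; first by rewrite expr0 mul1r add0n.
 rewrite addSn; apply: le_trans (contr _ _ (UW _) (UW n)) _.
 by rewrite exprS -mulrA ler_wpM2l.
have q01: 0 <= q < 1 by rewrite q0.
have cU: ip_cauchy U.
 move=> e e0; have [n0 h] := expr_lt_near q01 K0 e0.
 exists n0 => m n; wlog mn: m n / (m <= n)%N.
  move=> H m0 n1; have [/H|/ltnW /H] := leqP m n; first exact.
  by move=> /(_ n1 m0); rewrite -(opprB (U m)) ipNl ipNr opprK.
 move=> m0 _; rewrite -(opprB (U n)) ipNl ipNr opprK -(subnKC mn).
 exact: le_lt_trans (Umn _ _) (h _ m0).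
have [x Ux] := ip_complete cU.
have cx: ip_closure W x.
 have [W0 WD] := clW => e e0; have [n0 h] := Ux _ (divr_gt0 e0 (ltr0n _ 4)).
 have [w Ww hw] := UW n0 _ (divr_gt0 e0 (ltr0n _ 4)); exists w =>//.
 have ->: x - w = - (U n0 - x) + (U n0 - w) by rewrite opprB addrA subrK.
 apply: le_lt_trans (ip_sq_le _ _) _; rewrite ipNl ipNr opprK.
 by have := h n0 (leqnn _); lra.
exists x =>// w Ww.
(* The limit is a fixed point only up to a vector of length 0, which is enough: the representative
   [S x] also has length 0 and is orthogonal to everything. *)
have Fx: ip (x - F x) (x - F x) = 0.
 apply/eqP; rewrite eq_le ip_ge0 andbT; apply/ler_addgt0Pr => e e0; rewrite add0r.
 have [n0 h] := Ux _ (divr_gt0 e0 (ltr0n _ 4)).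
 have ->: x - F x = - (U n0.+1 - x) + (U n0.+1 - F x) by rewrite (opprB (U n0.+1) x) addrA subrK.
 apply: le_trans (ip_sq_le _ _) _; rewrite ipNl ipNr opprK.
 have h1 := h n0 (leqnn _); have h2 := h n0.+1 (leqnSn _).
 have h3: ip (U n0.+1 - F x) (U n0.+1 - F x) <= q * ip (U n0 - x) (U n0 - x) := contr _ _ (UW n0) cx.
 have h4: q * ip (U n0 - x) (U n0 - x) <= ip (U n0 - x) (U n0 - x).
  by rewrite ler_piMl ?ip_ge0// ltW.
 by lra.
have Sx0: ip (S x) (S x) = 0.
 move: Fx; rewrite /F opprB addrC subrK ipZl ipZr => /eqP.
 by move: rho0 => /gt_eqF h; rewrite (mulf_eq0 rho) h (mulf_eq0 rho) h => /eqP.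
have: ip (S x) w = 0.
 by have := ip_cs (S x) w; rewrite Sx0 mul0r => h; apply/eqP; rewrite -sqrf_eq0 eq_le h sqr_ge0.
by rewrite (SP x).2// => /eqP; rewrite subr_eq0 => /eqP.
Qed.
End lax_milgram.

(** * Square integrable functions *)

Section L2_functions.
Context d (T: measurableType d) (R: realType).
Variables (mu: {measure set T -> \bar R}) (D: set T).
Hypothesis mD: measurable D.
Implicit Types f g: T -> R.

Lemma in_L1_le f g: mfun D f -> (forall x, D x -> `|f x| <= g x) ->
 in_L1 mu D g -> in_L1 mu D f.
move=> mf fg; apply: le_integrable =>//; first exact/mEFinP.
by move=> x Dx; rewrite lee_fin; apply: le_trans (fg x Dx) (ler_norm _).
Qed.

Lemma in_L1_le_ae f g: mfun D f -> {ae mu, forall x, D x -> `|f x| <= g x} ->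
 in_L1 mu D g -> in_L1 mu D f.
move=> mf fg ig; have /integrableP[mg gfin] := ig.
apply/integrableP; split; first exact/mEFinP.
apply: le_lt_trans gfin; apply: ae_ge0_le_integral =>//.
- by apply: mcomp =>//; exact/mEFinP.
- exact: mcomp.
apply: filterS fg => x h Dx; rewrite lee_fin; apply: le_trans (h Dx) _.
exact: ler_norm.
Qed.
Lemma in_L1D f g: in_L1 mu D f -> in_L1 mu D g -> in_L1 mu D (fun x => f x + g x).
by move=> fi gi; have := integrableD mD fi gi. Qed.
Lemma in_L1Z c f: in_L1 mu D f -> in_L1 mu D (fun x => c * f x).
by move=> fi; have := integrableZl mD c fi. Qed.
Lemma in_L1B f g: in_L1 mu D f -> in_L1 mu D g -> in_L1 mu D (fun x => f x - g x).
by move=> fi gi; have := integrableB mD fi gi. Qed.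
Lemma in_L1_abs f: in_L1 mu D f -> in_L1 mu D (fun x => `|f x|).
by move=> fi; have := integrable_abse fi. Qed.

Lemma in_L1_sum (I: Type) (r: seq I) (F: I -> T -> R) :
 (forall i, in_L1 mu D (F i)) -> in_L1 mu D (fun x => \sum_(i <- r) F i x).
move=> FL; elim: r => [|i r IH].
 by under eq_fun do rewrite big_nil; exact: integrable0.
by under eq_fun do rewrite big_cons; exact: in_L1D.
Qed.
Lemma in_L1_meas f: in_L1 mu D f -> mfun D f.
by move=> /integrableP[/mEFinP]. Qed.

Lemma Rint_sum (I: Type) (r: seq I) (F: I -> T -> R) :
 (forall i, in_L1 mu D (F i)) ->
 \int[mu]_(x in D) (\sum_(i <- r) F i x) = \sum_(i <- r) \int[mu]_(x in D) F i x.
move=> FL; elim: r => [|i r IH].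
 rewrite big_nil; under eq_Rintegral do rewrite big_nil.
 by rewrite Rintegral_cst// mul0r.
rewrite big_cons -IH; under eq_Rintegral do rewrite big_cons.
exact: RintegralD mD (FL i) (in_L1_sum r FL).
Qed.

Lemma Rint_ae_eq f g: mfun D f -> mfun D g ->
 {ae mu, forall x, D x -> f x = g x} ->
 \int[mu]_(x in D) f x = \int[mu]_(x in D) g x.
move=> mf mg fg; congr fine; apply: ae_eq_integral =>//.
- exact/mEFinP.
- exact/mEFinP.
by apply: filterS fg => x h Dx; rewrite (h Dx).
Qed.

Lemma le_Rint_ae f g: in_L1 mu D f -> in_L1 mu D g ->
 {ae mu, forall x, D x -> f x <= g x} ->
 \int[mu]_(x in D) f x <= \int[mu]_(x in D) g x.
move=> fi gi fg; have mf := in_L1_meas fi; have mg := in_L1_meas gi.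
have mh: mfun D (fun x => Num.min (f x) (g x)) by exact: measurable_minr.
rewrite (Rint_ae_eq mf mh); last first.
 by apply: filterS fg => x h /h /min_idPl.
apply: le_Rintegral =>//.
 apply: (in_L1_le mh _ (in_L1D (in_L1_abs fi) (in_L1_abs gi))) => x _.
 by rewrite /Num.min; case: ifP => _; rewrite ?lerDl ?lerDr.
by move=> x _; rewrite ge_min lexx orbT.
Qed.

Lemma in_L2_sq f: in_L2 mu D f -> in_L1 mu D (fun x => f x ^+ 2).
move=> [mf fi]; apply/integrableP; split; first exact/mEFinP/measurable_funX.
apply: le_lt_trans fi; apply: leEq.
by apply: eq_integral => x _; rewrite /= ger0_norm// sqr_ge0.
Qed.

Lemma in_L2P f: mfun D f -> in_L1 mu D (fun x => f x ^+ 2) -> in_L2 mu D f.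
move=> mf /integrableP[_ fi]; split =>//; apply: le_lt_trans fi.
apply: leEq.
by apply: eq_integral => x _; rewrite /= ger0_norm// sqr_ge0.
Qed.

Lemma in_L2M f g: in_L2 mu D f -> in_L2 mu D g -> in_L1 mu D (fun x => f x * g x).
move=> f2 g2; apply: (in_L1_le _ _ (in_L1D (in_L2_sq f2) (in_L2_sq g2))).
 exact: measurable_funM f2.1 g2.1.
move=> x _; rewrite normrM -[f x ^+ 2]real_normK ?num_real// -[g x ^+ 2]real_normK ?num_real//.
move: (`|f x|) (`|g x|) (normr_ge0 (f x)) (normr_ge0 (g x)) => a b a0 b0; nra.
Qed.

Lemma in_L2_le f g: mfun D f -> in_L2 mu D g ->
 {ae mu, forall x, D x -> `|f x| <= `|g x|} -> in_L2 mu D f.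
move=> mf g2 fg; apply: in_L2P =>//.
apply: (in_L1_le_ae _ _ (in_L2_sq g2)); first exact: measurable_funX.
apply: filterS fg => x h Dx; rewrite ger0_norm ?sqr_ge0//.
by rewrite -[f x ^+ 2]real_normK ?num_real// -[leRHS]real_normK ?num_real// lerXn2r ?nnegrE ?h.
Qed.

Lemma in_L2_lin (c: R) f g: in_L2 mu D f -> in_L2 mu D g ->
 in_L2 mu D (fun x => c * f x + g x).
move=> f2 g2; apply: in_L2P.
 by apply: measurable_funD g2.1; apply: measurable_funM f2.1; exact: measurable_cst.
have h: in_L1 mu D (fun x => 2 * (c ^+ 2 * f x ^+ 2) + 2 * g x ^+ 2).
 by apply: in_L1D; apply: in_L1Z; [apply: in_L1Z|]; exact: in_L2_sq.
apply: in_L1_le h.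
 apply: measurable_funX; apply: measurable_funD g2.1.
 by apply: measurable_funM f2.1; exact: measurable_cst.
by move=> x _; rewrite ger0_norm ?sqr_ge0//; have := sqr_ge0 (c * f x - g x); nra.
Qed.

Lemma in_L20: in_L2 mu D (fun=> 0).
apply: in_L2P; first exact: measurable_cst.
by rewrite expr0n; exact: integrable0.
Qed.

(* [mD] is kept in the body so that the module structure on [L2] can be inferred from the type. *)
Definition L2pred: {pred T -> R} := let _ := mD in mem [set f | in_L2 mu D f].
Lemma L2predP f: (f \in L2pred) <-> in_L2 mu D f.
by rewrite /L2pred inE. Qed.

(** Functions and not classes modulo null sets: [u x] keeps a meaning at every point, and [dotL] is
    a semi-inner product. *)
Inductive L2 := MkL2 (f: T -> R) of f \in L2pred.
Definition L2fun (u: L2): T -> R := let: MkL2 f _ := u in f.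
Coercion L2fun: L2 >-> Funclass.

HB.instance Definition _ := [isSub of L2 for L2fun].
HB.instance Definition _ := [Choice of L2 by <:].

Lemma L2_submod: submod_closed L2pred.
split; first by apply/L2predP; exact: in_L20.
by move=> c f g /L2predP f2 /L2predP g2; apply/L2predP; exact: in_L2_lin.
Qed.

HB.instance Definition _ := GRing.isSubmodClosed.Build _ _ L2pred L2_submod.
HB.instance Definition _ := [SubChoice_isSubLmodule of L2 by <:].
Lemma L2P (f: L2): in_L2 mu D f.
by case: f => f /= /L2predP. Qed.

(* Opaque on purpose: unfolding it makes unification diverge. *)
Fact toL2_subproof :
 {F: (T -> R) -> L2 | forall f, in_L2 mu D f -> F f = f :> (T -> R)}.
by exists (insubd 0) => f f2; rewrite val_insubd ifT//; apply/L2predP. Qed.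
Definition toL2: (T -> R) -> L2 := sval toL2_subproof.
Lemma toL2E f: in_L2 mu D f -> toL2 f = f :> (T -> R).
exact: (svalP toL2_subproof). Qed.
Lemma toL2x f: in_L2 mu D f -> forall x, toL2 f x = f x.
by move=> f2 x; rewrite toL2E. Qed.
Lemma L2_eqP (f g: L2): (forall x, f x = g x) -> f = g.
by move=> fg; apply: val_inj; apply/funext. Qed.

Fact dotL_subproof :
 {F: L2 -> L2 -> R | forall f g: L2, F f g = \int[mu]_(x in D) (f x * g x)}.
by eexists. Qed.
Definition dotL: L2 -> L2 -> R := sval dotL_subproof.
Lemma dotLE (f g: L2): dotL f g = \int[mu]_(x in D) (f x * g x).
exact: (svalP dotL_subproof). Qed.
Lemma dotL_L1 (f g: L2): in_L1 mu D (fun x => f x * g x).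
exact: in_L2M (L2P f) (L2P g). Qed.
Lemma dotLC (f g: L2): dotL f g = dotL g f.
by rewrite !dotLE; apply: eq_Rintegral => x _; rewrite mulrC. Qed.

Lemma dotLDl (f g h: L2): dotL (f + g) h = dotL f h + dotL g h.
rewrite !dotLE -(RintegralD mD (dotL_L1 f h) (dotL_L1 g h)).
by apply: eq_Rintegral => x _; rewrite -mulrDl.
Qed.

Lemma dotLZl c (f g: L2): dotL (c *: f) g = c * dotL f g.
rewrite !dotLE -(RintegralZl c mD (dotL_L1 f g)).
by apply: eq_Rintegral => x _; rewrite mulrA.
Qed.
Lemma dotL_ge0 (f: L2): 0 <= dotL f f.
by rewrite dotLE; apply: Rintegral_ge0 => x _; rewrite -expr2 sqr_ge0. Qed.

Lemma dotL_EFin (f: L2): (\int[mu]_(x in D) (f x ^+ 2)%:E = (dotL f f)%:E)%E.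
rewrite dotLE -[LHS]fineK; first by congr (_%:E); exact: eq_Rintegral.
by apply: integrable_fin_num =>//; exact: (in_L2_sq (L2P f)).
Qed.
Lemma le_dotL (f g f' g': L2): {ae mu, forall x, D x -> f x * g x <= f' x * g' x} ->
 dotL f g <= dotL f' g'.
by rewrite !dotLE; exact: le_Rint_ae (dotL_L1 _ _) (dotL_L1 _ _). Qed.

Lemma eq_dotL (f g f' g': L2): {ae mu, forall x, D x -> f x * g x = f' x * g' x} ->
 dotL f g = dotL f' g'.
by move=> h; apply/eqP; rewrite eq_le !le_dotL//; apply: filterS h => x h /h ->.
Qed.

Lemma dotL_eq0 (f: L2): dotL f f <= 0 -> {ae mu, forall x, D x -> f x = 0}.
move=> f0; have {}f0: dotL f f = 0 by apply/eqP; rewrite eq_le f0 dotL_ge0.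
have h: (\int[mu]_(x in D) (f x ^+ 2)%:E = 0)%E by rewrite dotL_EFin f0.
have mf2: mfun D (fun x => (f x ^+ 2)%:E).
 by apply/mEFinP/measurable_funX; case: (L2P f).
have: (\int[mu]_(x in D) `|(f x ^+ 2)%:E| = 0)%E.
 by rewrite -h; apply: eq_integral => x _; rewrite /= ger0_norm// sqr_ge0.
move=> /(ae_eq_integral_abs mu mD mf2); apply: filterS => x /= e /e[] /eqP.
by rewrite sqrf_eq0 => /eqP.
Qed.
Notation cvgL := (ip_cvg dotL).

Lemma cvgL_dominated (u: nat -> L2) (f g: L2) :
 {ae mu, forall x, D x -> forall n, `|u n x| <= `|g x|} ->
 {ae mu, forall x, D x -> u n x @[n --> \oo] --> f x} -> cvgL u f.
move=> ug uf; have mu_ n: mfun D (u n) by case: (L2P (u n)).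
have mf: mfun D f by case: (L2P f).
pose q n x := ((u n x - f x) ^+ 2)%:E.
have mq n: mfun D (q n).
 by apply/mEFinP/measurable_funX; exact: measurable_funB.
have ig: mu.-integrable D (EFin \o (fun x => 2 * g x ^+ 2 + 2 * f x ^+ 2)).
 by apply: in_L1D; apply: in_L1Z; apply: in_L2_sq; exact: L2P.
have dom: {ae mu, forall x n, D x -> (`|q n x| <= (2 * g x ^+ 2 + 2 * f x ^+ 2)%:E)%E}.
 apply: filterS ug => x h n Dx; rewrite lee_fin ger0_norm ?sqr_ge0//.
 have: u n x ^+ 2 <= g x ^+ 2.
  rewrite -[u n x ^+ 2]real_normK ?num_real// -[leRHS]real_normK ?num_real//.
  by rewrite lerXn2r ?nnegrE ?h.
 by have := sqr_ge0 (u n x + f x); nra.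
have cv: {ae mu, forall x, D x -> (q n x @[n --> \oo] --> (0: R)%:E)}.
 apply: filterS uf => x h Dx; apply: cvg_EFin; first by near=> n.
 have: (fun n => (u n x - f x) * (u n x - f x)) @ \oo --> (f x - f x) * (f x - f x).
  by apply: cvgM; apply: cvgB; (exact: h || exact: cvg_cst).
 by rewrite subrr mul0r.
have [_ _ c0] := dominated_convergence mD mq (measurable_cst _) cv ig dom.
move: c0; rewrite integral0 => c0 e e0.
have [n0 _ hn]: \forall n \near \oo, (\int[mu]_(x in D) q n x < e%:E)%E.
 have: nbhs (0: \bar R)%E [set y | (y < e%:E)%E].
  by apply: open_nbhs_nbhs; split; [exact: open_ereal_lt_ereal|rewrite /= lte_fin].
 exact: c0.
exists n0 => n /hn /=; rewrite -lte_fin -dotL_EFin.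
by congr (_ < _)%E.
Unshelve. all: by end_near. Qed.

Lemma limn_einf_le (v: nat -> \bar R) (e: \bar R): (forall n, (v n <= e)%E) ->
 (limn_einf v <= e)%E.
move=> ve; rewrite limn_einf_lim; apply: lime_le; first exact: is_cvg_einfs.
apply: nearW => n; apply: le_trans (ve n).
by apply: ereal_inf_lbound; exists n => /=.
Qed.

(** The series of the integrals converges geometrically, so the sum of the functions is integrable
    and hence finite almost everywhere. *)
Lemma sum_int_ae (h: nat -> T -> R) (K: R): (forall n, mfun D (h n)) ->
 (forall n x, 0 <= h n x) ->
 (forall n, (\int[mu]_(x in D) (h n x)%:E <= (2^-1 ^+ n * K)%:E)%E) ->
 {ae mu, forall x, D x -> exists B, forall n, \sum_(i < n) h i x <= B}.
move=> mh h0 hK; pose H x := (\sum_(n <oo) (h n x)%:E)%E.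
have mhE n: mfun D (fun x => (h n x)%:E) by exact/mEFinP.
have hE0 n x: D x -> (0 <= (h n x)%:E)%E by rewrite lee_fin.
have IH: (\int[mu]_(x in D) H x < +oo)%E.
 rewrite (integral_nneseries mu mD mhE hE0).
 apply: (@le_lt_trans _ _ (2 * `|K|)%:E); last by rewrite ltry.
 apply: lime_le.
  by apply: is_cvg_nneseries => n _ _; apply: integral_ge0 => x /hE0.
 apply: nearW => n; rewrite big_mkord.
 apply: (@le_trans _ _ (\sum_(i < n) (2^-1 ^+ i * `|K|)%:E)%E).
  apply: lee_sum => i _; apply: le_trans (hK i) _.
  by rewrite lee_fin ler_wpM2l ?ler_norm ?exprn_ge0.
 rewrite sumEFin lee_fin -mulr_suml ler_wpM2r//.
 have ->: \sum_(i < n) (2^-1: R) ^+ i = 2 - 2 * 2^-1 ^+ n.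
  elim: n => [|n IH]; first by rewrite big_ord0 expr0; ring.
  by rewrite big_ord_recr/= IH exprS; field.
 by rewrite gerBl mulr_ge0// exprn_ge0.
have mH: mfun D H by apply: ge0_emeasurable_sum =>// n x Dx _; exact: hE0.
have H0 x: (0 <= H x)%E by apply: nneseries_ge0 => n _ _; rewrite lee_fin.
have iH: mu.-integrable D H.
 apply/integrableP; split =>//; apply: le_lt_trans IH.
 by apply/leEq/eq_integral => x _; rewrite gee0_abs.
have := integrable_ae mD iH; apply: filterS => x Hx Dx.
exists (fine (H x)) => n; rewrite -lee_fin fineK ?Hx//.
have := @nneseries_lim_ge R (fun n => (h n x)%:E) xpredT 0 n (fun n _ _ => h0 n x).
by rewrite big_mkord sumEFin.
Qed.

Lemma cauchy_series_bound (u: nat -> R) (B: R) :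
 (forall n, \sum_(i < n) `|u i.+1 - u i| <= B) -> exists l: R, u @ \oo --> l.
move=> uB; pose v i := u i.+1 - u i.
have E n: [normed series v] n = \sum_(i < n) `|u i.+1 - u i| by rewrite /= /series/= big_mkord.
have cv: cvgn [normed series v].
 apply: nondecreasing_is_cvgn.
  by apply/nondecreasing_seqP => n; rewrite !E big_ord_recr/= lerDl.
 by exists B => _ [n _ <-]; rewrite E.
have /cvg_ex[l hl] := normed_cvg cv.
exists (l + u 0%N).
have: (fun n => series v n + u 0%N) @ \oo --> l + u 0%N.
 by apply: cvgD; [exact: hl|exact: cvg_cst].
rewrite (_: (fun n => _) = u)//.
by apply/funext => n; rewrite /series/= telescope_sumr// subrK.
Qed.
Hypothesis muD: (mu D < +oo)%E.

Lemma in_L1_cst (c: R): in_L1 mu D (fun=> c).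
apply: measurable_bounded_integrable =>//.
by exists `|c|; split; rewrite ?num_real// => M CM x _; exact: ltW.
Qed.
Lemma in_L1_bnd f (C: R): mfun D f -> (forall x, D x -> `|f x| <= C) ->
 in_L1 mu D f.
by move=> mf fC; apply: in_L1_le (in_L1_cst C). Qed.

Lemma in_L2_bnd f (C: R): mfun D f ->
 {ae mu, forall x, D x -> `|f x| <= C} -> in_L2 mu D f.
move=> mf fC; apply: in_L2P =>//; apply: in_L1_le_ae (in_L1_cst (C ^+ 2)).
 exact: measurable_funX.
apply: filterS fC => x h Dx; rewrite ger0_norm ?sqr_ge0//.
by rewrite -[leLHS]real_normK ?num_real//; have := h Dx; have := normr_ge0 (f x); nra.
Qed.

(** The subsequence [s] makes consecutive squared distances at most 4^(-k). As t <= a + t^2 / a with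
    a = 2^(-k), the increments are summable in L1, and the subsequence converges almost everywhere.
    It is part of the conclusion because [cvgL_ae] reads pointwise limits from it. *)
Lemma riesz_fischer (u: nat -> L2): ip_cauchy dotL u ->
 exists (f: L2) (s: nat -> nat), [/\ cvgL u f, forall k, (k <= s k)%N &
  {ae mu, forall x, D x -> u (s k) x @[k --> \oo] --> f x}].
move=> cu; have ex k: exists n0, forall m n, (n0 <= m)%N -> (n0 <= n)%N ->
  dotL (u m - u n) (u m - u n) < 4^-1 ^+ k by apply: cu; rewrite exprn_gt0.
have [t tP] := choice ex.
pose s := fix s k := if k is k'.+1 then maxn (maxn k (t k)) (s k') else t 0%N.
have sk k: (k <= s k)%N by case: k =>// k; rewrite /= !leq_max leqnn.
have ts k: (t k <= s k)%N by case: k =>// k; rewrite /= !leq_max leqnn orbT.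
have ss k: (s k <= s k.+1)%N by rewrite /= leq_max leqnn orbT.
have sd k: dotL (u (s k.+1) - u (s k)) (u (s k.+1) - u (s k)) <= 4^-1 ^+ k.
 by apply/ltW/tP =>//; exact: leq_trans (ts k) (ss k).
have mu_ n: mfun D (u n) by case: (L2P (u n)).
pose h k x := `|u (s k.+1) x - u (s k) x|.
have mh k: mfun D (h k) by apply: mcomp =>//; exact: measurable_funB.
have hB k: (\int[mu]_(x in D) (h k x)%:E <= (2^-1 ^+ k * (fine (mu D) + 1))%:E)%E.
 set a := 2^-1 ^+ k; have a0: 0 < a by rewrite exprn_gt0.
 have fd: mu D = (fine (mu D))%:E by rewrite fineK// ge0_fin_numE.
 pose w := u (s k.+1) - u (s k).
 apply: (@le_trans _ _ (\int[mu]_(x in D) (a + a^-1 * w x ^+ 2)%:E)%E).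
  apply: ge0_le_integral =>//.
  - by move=> x _; rewrite lee_fin normr_ge0.
  - exact/mEFinP.
  - apply/mEFinP/measurable_funD; first exact: measurable_cst.
   apply: measurable_funM; first exact: measurable_cst.
   by apply: measurable_funX; case: (L2P w).
  move=> x _; rewrite lee_fin /h -[X in _ <= _ + _ * X ^+ 2]/(u (s k.+1) x - u (s k) x).
  move: (u (s k.+1) x - u (s k) x) => y.
  rewrite -[y ^+ 2]real_normK ?num_real//; have := normr_ge0 y; move: `|y| => z z0.
  have: 0 <= a^-1 * ((a - z) ^+ 2 + a * z).
   by apply: mulr_ge0; [rewrite invr_ge0 ltW|rewrite addr_ge0 ?sqr_ge0// mulr_ge0// ltW].
  have ->: a^-1 * ((a - z) ^+ 2 + a * z) = a + a^-1 * z ^+ 2 - z by field; rewrite gt_eqF.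
  by rewrite subr_ge0.
 have mw: mfun D (fun x => (a^-1 * w x ^+ 2)%:E).
  apply/mEFinP/measurable_funM; first exact: measurable_cst.
  by apply: measurable_funX; case: (L2P w).
 rewrite (eq_integral (fun x => a%:E + (a^-1 * w x ^+ 2)%:E)%E)//.
 rewrite ge0_integralD//; last 2 first.
 - by move=> x _; rewrite lee_fin ltW.
 - by move=> x _; rewrite lee_fin mulr_ge0 ?sqr_ge0// invr_ge0 ltW.
 rewrite integral_cst// fd; rewrite (eq_integral (fun x => a^-1%:E * (w x ^+ 2)%:E)%E)//.
 rewrite ge0_integralZl_EFin//; last 3 first.
 - by move=> x _; rewrite lee_fin sqr_ge0.
 - by apply/mEFinP/measurable_funX; case: (L2P w).
 - by rewrite invr_ge0 ltW.
 rewrite dotL_EFin -!EFinM -EFinD lee_fin mulrDr mulr1 lerD2l.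
 rewrite mulrC ler_pdivrMr//; apply: le_trans (sd k) _.
 by rewrite /a -exprMn -invfM -natrM.
have h0 k x: 0 <= h k x := normr_ge0 _.
have cvx := sum_int_ae mh h0 hB.
(* The upper limit is measurable on all of [D] and agrees with the limit wherever that exists. *)
pose g x := fine (limn_esup (fun k => (u (s k) x)%:E)).
have mg: mfun D g.
 apply: mcomp =>//; apply: measurable_fun_limn_esup => k.
 exact/mEFinP.
have ug: {ae mu, forall x, D x -> u (s k) x @[k --> \oo] --> g x}.
 apply: filterS cvx => x H Dx; have [B hBx] := H Dx.
 have [l hl] := cauchy_series_bound (u := fun k => u (s k) x) hBx.
 suff ->: g x = l by [].
 have hlE: (fun k => (u (s k) x)%:E) @ \oo --> l%:E by apply: cvg_EFin =>//; near=> k.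
 rewrite /g is_cvg_limn_esupE; last by apply/cvg_ex; exists l%:E.
 by rewrite (cvg_lim _ hlE).
(* Fatou's lemma *)
have key n e: (forall k, dotL (u n - u (s (n + k)%N)) (u n - u (s (n + k)%N)) <= e) ->
  (\int[mu]_(x in D) ((u n x - g x) ^+ 2)%:E <= e%:E)%E.
 move=> He; pose q k x := ((u n x - u (s (n + k)%N) x) ^+ 2)%:E.
 have mq k: mfun D (q k).
  by apply/mEFinP/measurable_funX; exact: measurable_funB.
 have q0 k x: D x -> (0 <= q k x)%E by rewrite lee_fin sqr_ge0.
 have mgq: mfun D (fun x => ((u n x - g x) ^+ 2)%:E).
  by apply/mEFinP/measurable_funX; exact: measurable_funB.
 have E: {ae mu, forall x, D x -> ((u n x - g x) ^+ 2)%:E = limn_einf (q ^~ x)}.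
  apply: filterS ug => x H Dx; have hx := H Dx.
  have c: q k x @[k --> \oo] --> ((u n x - g x) ^+ 2)%:E.
   apply: cvg_EFin; first by near=> k.
   have hs: (fun k => u (s (n + k)%N) x) @ \oo --> g x.
    by have := hx; rewrite -(cvg_shiftn n); under eq_fun do rewrite addnC.
   have: (fun k => (u n x - u (s (n + k)%N) x) * (u n x - u (s (n + k)%N) x)) @ \oo --> (u n x - g x) * (u n x - g x).
    by apply: cvgM; apply: cvgB; (exact: hs || exact: cvg_cst).
   by rewrite -expr2.
  rewrite is_cvg_limn_einfE; first by rewrite (cvg_lim _ c).
  by apply/cvg_ex; eexists; exact: c.
 rewrite (ae_eq_integral (fun x => limn_einf (q ^~ x)))//; last first.
  rewrite (_: (fun x => _) = fun x => (- limn_esup (fun k => - q k x))%E).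
   apply: mcomp =>//; apply: measurable_fun_limn_esup => k.
   exact: mcomp.
  by apply/funext => x; rewrite -[X in limn_esup X]/(-%E \o (q ^~ x)) limn_esupN oppeK.
 apply: le_trans (fatou mu mD mq q0) _; apply: limn_einf_le => k.
 apply: le_trans (_: (dotL (u n - u (s (n + k)%N)) (u n - u (s (n + k)%N)))%:E <= _)%E.
  by rewrite -dotL_EFin.
 by rewrite lee_fin.
have g2: in_L2 mu D g.
 have [n0 hn0] := cu 1 ltr01.
 have kn: (\int[mu]_(x in D) ((u n0 x - g x) ^+ 2)%:E <= 1%:E)%E.
  apply: key => k; apply/ltW/hn0 =>//; apply: leq_trans (sk _); exact: leq_addr.
 have w2: in_L2 mu D (fun x => u n0 x - g x).
  split; first exact: measurable_funB.
  by apply: le_lt_trans kn _; rewrite ltry.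
 have := in_L2_lin (-1) w2 (L2P (u n0)); congr (in_L2 _ _).
 by apply/funext => x; ring.
exists (toL2 g), s; split =>//; last by rewrite toL2E.
move=> e e0; have [n0 hn0] := cu _ (divr_gt0 e0 (ltr0n _ 2)).
exists n0 => n nn; rewrite -lte_fin -dotL_EFin.
apply: (@le_lt_trans _ _ (e / 2)%:E); last by rewrite lte_fin; lra.
rewrite (eq_integral (fun x => ((u n x - g x) ^+ 2)%:E)); last first.
 by move=> x _; rewrite -{2}(toL2E g2).
apply: key => k; apply/ltW/hn0 =>//; apply: leq_trans (sk _).
by apply: leq_trans nn _; exact: leq_addr.
Unshelve. all: by end_near. Qed.

Lemma cvgL_cauchy (u: nat -> L2) (f: L2): cvgL u f -> ip_cauchy dotL u.
move=> uf e e0; have [n0 h] := uf _ (divr_gt0 e0 (ltr0n _ 4)).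
exists n0 => m n m0 n1; have ->: u m - u n = (u m - f) + - (u n - f).
 by rewrite opprB addrA subrK.
apply: le_lt_trans (ip_sq_le dotLDl dotLZl dotLC dotL_ge0 _ _) _.
have ->: dotL (- (u n - f)) (- (u n - f)) = dotL (u n - f) (u n - f).
 by rewrite (ipNl dotLZl) (ipNr dotLZl dotLC) opprK.
have := h m m0; have := h n n1; move: (dotL (u m - f) _) (dotL (u n - f) _) => p q.
by lra.
Qed.

Lemma cvgL_ae (u: nat -> L2) (f: L2): cvgL u f ->
 exists s: nat -> nat, (forall k, (k <= s k)%N) /\
  {ae mu, forall x, D x -> u (s k) x @[k --> \oo] --> f x}.
move=> uf; have [g [s [ug sk sg]]] := riesz_fischer (cvgL_cauchy uf).
exists s; split =>//.
have: dotL (f - g) (f - g) <= 0.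
 apply/ler_addgt0Pr => e e0; rewrite add0r.
 have [n0 h] := uf _ (divr_gt0 e0 (ltr0n _ 4)).
 have [n1 h1] := ug _ (divr_gt0 e0 (ltr0n _ 4)).
 set n := maxn n0 n1.
 have ->: f - g = - (u n - f) + (u n - g) by rewrite opprB addrA subrK.
 apply: le_trans (ip_sq_le dotLDl dotLZl dotLC dotL_ge0 _ _) _.
 rewrite (ipNl dotLZl) (ipNr dotLZl dotLC) opprK.
 have := h n (leq_maxl _ _); have := h1 n (leq_maxr _ _).
 by move: (dotL (u n - f) _) (dotL (u n - g) _) => p q; lra.
move=> /dotL_eq0 h; apply: filterS2 h sg => x fg H Dx.
suff ->: f x = g x by exact: H.
by apply/eqP; rewrite -subr_eq0; apply/eqP; exact: fg.
Qed.
End L2_functions.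
Section L2_extra.
Context d (T: measurableType d) (R: realType).
Variables (mu: {measure set T -> \bar R}) (D: set T).
Variable mD: measurable D.
Notation L2 := (L2 mu mD).
Notation cvgL := (ip_cvg (@dotL _ _ _ mu D mD)).
Lemma dotL_sqD (f g: L2): dotL (f + g) (f + g) <= 2 * dotL f f + 2 * dotL g g.
exact: (ip_sq_le (@dotLDl _ _ _ mu D mD) (@dotLZl _ _ _ mu D mD) (@dotLC _ _ _ mu D mD) (@dotL_ge0 _ _ _ mu D mD)). Qed.

Lemma cvgL_le (u w: nat -> L2) (f g: L2) (C: R): cvgL w g -> 0 <= C ->
 (forall n, dotL (u n - f) (u n - f) <= C * dotL (w n - g) (w n - g)) -> cvgL u f.
move=> wg C0 h e e0; have d0: 0 < e / (C + 1) by rewrite divr_gt0// ltr_wpDl.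
have [n0 hn] := wg _ d0; exists n0 => n /hn; rewrite ltr_pdivlMr ?ltr_wpDl// => h1.
apply: le_lt_trans (h n) _; apply: le_lt_trans h1; rewrite mulrC ler_wpM2l ?dotL_ge0//.
by rewrite lerDl.
Qed.

Lemma cvgL_ext (u w: nat -> L2) (f g: L2): (forall n x, w n x = u n x) ->
 (forall x, g x = f x) -> cvgL u f -> cvgL w g.
move=> uw gf uf; have ->: g = f by exact: L2_eqP.
by have ->: w = u by apply/funext => n; exact: L2_eqP.
Qed.

Lemma cvgLD (u w: nat -> L2) (f g: L2): cvgL u f -> cvgL w g ->
 cvgL (fun n => u n + w n) (f + g).
move=> uf wg e e0; have d0: 0 < e / 4 by rewrite divr_gt0.
have [n0 h0] := uf _ d0; have [n1 h1] := wg _ d0; exists (maxn n0 n1) => n.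
rewrite geq_max => /andP[/h0 a /h1 b].
rewrite opprD addrACA; apply: le_lt_trans (dotL_sqD _ _) _.
by move: (dotL (u n - f) _) (dotL (w n - g) _) a b => p q; lra.
Qed.

Lemma cvgL_cst (f: L2): cvgL (fun=> f) f.
move=> e e0; exists 0%N => n _; rewrite subrr -(scale0r 0) dotLZl mul0r//.
Qed.

Lemma in_L2_mulb (b: T -> R) (f: L2) (C: R): mfun D b ->
 (forall x, D x -> `|b x| <= C) -> in_L2 mu D (fun x => b x * f x).
move=> mb bC; have mf: mfun D f by case: (L2P f).
have h: in_L2 mu D (fun x => C * f x + 0) by apply: in_L2_lin =>//; [exact: L2P|exact: in_L20].
apply: (in_L2_le mD _ h); first exact: measurable_funM.
apply/aeW => x Dx; rewrite addr0 !normrM ler_wpM2r//.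
exact: le_trans (bC x Dx) (ler_norm _).
Qed.
Lemma toL2_mulb (b: T -> R) (f: L2) (C: R): mfun D b ->
 (forall x, D x -> `|b x| <= C) -> forall x, toL2 mu mD (fun x => b x * f x) x = b x * f x.
by move=> mb bC x; rewrite toL2E//; exact: in_L2_mulb bC. Qed.

(** Splits b_n u_n as b_n (u_n - f) + b_n f: the first part is controlled by the uniform bound on
    b_n, the second by dominated convergence. The gradient in the chain rule is such a product. *)
Lemma cvgL_mulb (b_: nat -> T -> R) (b: T -> R) (C: R) (u: nat -> L2) (f: L2) :
 (forall n, mfun D (b_ n)) -> mfun D b ->
 (forall n x, D x -> `|b_ n x| <= C) -> (forall x, D x -> `|b x| <= C) ->
 {ae mu, forall x, D x -> b_ n x @[n --> \oo] --> b x} -> cvgL u f ->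
 cvgL (fun n => toL2 mu mD (fun x => b_ n x * u n x)) (toL2 mu mD (fun x => b x * f x)).
move=> mb_ mb bC_ bC bb uf.
have E_ n (w: L2) := toL2_mulb w (mb_ n) (bC_ n).
have h1: cvgL (fun n => toL2 mu mD (fun x => b_ n x * f x)) (toL2 mu mD (fun x => b x * f x)).
 pose g := toL2 mu mD (fun x => C * f x).
 have gE x: g x = C * f x.
  by apply: (@toL2_mulb (fun=> C) f `|C|) =>//; exact: measurable_cst.
 apply: (@cvgL_dominated _ _ _ mu D mD _ _ g).
  apply/aeW => x Dx n; rewrite gE E_ !normrM ler_wpM2r//.
  by apply: le_trans (bC_ n x Dx) (ler_norm _).
 apply: filterS bb => x H Dx; rewrite (toL2_mulb _ mb bC).
 under eq_fun do rewrite E_.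
 by apply: cvgM; [exact: H|exact: cvg_cst].
have h2: cvgL (fun n => toL2 mu mD (fun x => b_ n x * (u n - f) x)) 0.
 apply: (cvgL_le uf (sqr_ge0 C)) => n; rewrite subr0 -dotLZl.
 apply: le_dotL; apply/aeW => x Dx.
 rewrite E_ -[(C ^+ 2 *: (u n - f)) x]/(C ^+ 2 * (u n - f) x).
 have: b_ n x ^+ 2 <= C ^+ 2.
  by rewrite -[leLHS]real_normK ?num_real//; have := bC_ n x Dx; have := normr_ge0 (b_ n x); nra.
 have := sqr_ge0 ((u n - f) x); move: ((u n - f) x) (b_ n x) => y z y0 zC.
 by have := mulr_ge0 y0 (_: 0 <= C ^+ 2 - z ^+ 2); rewrite subr_ge0 => /(_ zC); nra.
apply: (cvgL_ext _ _ (cvgLD h2 h1)) => [n x|x]; last by rewrite add0r.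
rewrite -[RHS]/(toL2 mu mD (fun x => b_ n x * (u n - f) x) x + toL2 mu mD (fun x => b_ n x * f x) x).
by rewrite !E_ -[(u n - f) x]/(u n x - f x); ring.
Qed.
Hypothesis muD: (mu D < +oo)%E.

Lemma cvgL_unif (u: nat -> L2) (f: L2) (eps: nat -> R) :
 (forall n x, D x -> `|u n x - f x| <= eps n) -> eps n @[n --> \oo] --> (0: R) -> cvgL u f.
move=> uf e0; have /(cvgrPdist_lt _ _).1 := e0 => eps1.
have [n0 _ hn0] := eps1 1 ltr01.
have oneL: in_L2 mu D (fun=> 1).
 by apply: (in_L2_bnd mD muD (C := 1)); [exact: measurable_cst|apply/aeW => x; rewrite normr1].
pose g: L2 := toL2 mu mD (fun=> 1).
have k: 0 <= dotL g g := dotL_ge0 g.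
move=> e he; have d0: 0 < Num.min 1 (e / (dotL g g + 1)).
 by rewrite lt_min ltr01/= divr_gt0// ltr_wpDl.
have [n1 _ hn1] := eps1 _ d0; exists n1 => n /hn1; rewrite /= sub0r normrN lt_min => /andP[a1 a2].
apply: (@le_lt_trans _ _ (`|eps n| * dotL g g)).
 rewrite -dotLZl; apply: le_dotL; apply/aeW => x Dx.
 rewrite -[(_ *: g) x]/(`|eps n| * g x) toL2E// !mulr1 -[(u n - f) x]/(u n x - f x) -expr2.
 rewrite -[leLHS]real_normK ?num_real//; have := uf n x Dx; have := normr_ge0 (u n x - f x).
 have := ler_norm (eps n); nra.
rewrite ltr_pdivlMr ?ltr_wpDl// in a2.
by apply: le_lt_trans a2; rewrite ler_wpM2l// lerDl.
Qed.
End L2_extra.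

Lemma le_int_ge0 d (T: measurableType d) (R: realType) (mu: {measure set T -> \bar R})
  (D: set T) (f g: T -> \bar R): measurable D -> mfun D f ->
 mfun D g -> (forall x, D x -> (0 <= g x)%E) -> (forall x, D x -> (f x <= g x)%E) ->
 (\int[mu]_(x in D) f x <= \int[mu]_(x in D) g x)%E.
move=> mD mf mg g0 fg; rewrite integralE.
apply: (@le_trans _ _ (\int[mu]_(x in D) f^\+ x)%E).
 by rewrite geeDl// oppe_le0; apply: integral_ge0.
apply: ge0_le_integral =>//; first exact: measurable_funepos.
by move=> x Dx; rewrite funeposE ge_max fg ?g0.
Qed.

(** * Boxes, paraboloids and extrema of cut-offs *)

Section coordinates.
Context {R: realType} {N: nat}.
Implicit Types (x y: 'cV[R]_N) (r: R).
Lemma indic_in (A: set 'cV[R]_N) x: A x -> \1_A x = 1 :> R.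
by move=> Ax; rewrite indicE mem_set. Qed.
Lemma indic_notin (A: set 'cV[R]_N) x: ~ A x -> \1_A x = 0 :> R.
by move=> Ax; rewrite indicE memNset. Qed.
Lemma indic_01 (A: set 'cV[R]_N) x: 0 <= (\1_A x: R) <= 1.
by rewrite indicE; case: (_ \in _); rewrite lexx ler01. Qed.

Lemma derive_coord (i j: 'I_N) x: 'D_(ei i) (fun y: 'cV[R]_N => y j ord0) x = (i == j)%:R :> R.
rewrite /derive; apply: lim_near_cst =>//; exists 1 =>//= h _ h0.
rewrite /= !mxE eqxx andbT (eq_sym j) addrK -[_ *: _]/(h^-1 * (h * (i == j)%:R)).
by rewrite mulrA mulVf// mul1r.
Qed.
Definition cbx x r := cube (\col_i (x i ord0 - r)) (2 * r).

Lemma cbxP x r y: cbx x r y <-> forall i, `|y i ord0 - x i ord0| <= r.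
split=> h i; have := h i.
 by rewrite !mxE => /andP[h1 h2]; rewrite ler_norml; apply/andP; split; lra.
by rewrite !mxE ler_norml => /andP[h1 h2]; apply/andP; split; lra.
Qed.
Lemma meas_cbx x r: measurable (cbx x r).
exact: meas_cube. Qed.
Lemma cbx_le x r s: r <= s -> cbx x r `<=` cbx x s.
by move=> rs y /cbxP h; apply/cbxP => i; apply: le_trans (h i) rs. Qed.
Lemma cbx_center x r: 0 <= r -> cbx x r x.
by move=> r0; apply/cbxP => i; rewrite subrr normr0. Qed.
Definition dsq x y: R := \sum_i (y i ord0 - x i ord0) ^+ 2.
Lemma dsq_ge0 x y: 0 <= dsq x y.
by apply: sumr_ge0 => i _; exact: sqr_ge0. Qed.

Lemma dsq_le x y r: cbx x r y -> dsq x y <= N%:R * r ^+ 2.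
move=> /cbxP h; rewrite /dsq -[N in N%:R]card_ord mulr_natl -sumr_const.
apply: ler_sum => i _; have := h i; rewrite -[X in X <= r ^+ 2]real_normK ?num_real// => h'.
by rewrite lerXn2r ?nnegrE// (le_trans _ h').
Qed.

Lemma dsq_gt x y r: 0 <= r -> ~ cbx x r y -> r ^+ 2 < dsq x y.
move=> r0; apply: contra_notP => /negP; rewrite -leNgt => h; apply/cbxP => i.
rewrite -ler_sqr ?nnegrE// real_normK ?num_real//; apply: le_trans h.
by rewrite /dsq (bigD1 i)//= lerDl sumr_ge0// => j _; exact: sqr_ge0.
Qed.
(** A paraboloid used as a barrier. With c = e / r^2 it exceeds k + e outside [cbx x r], so a
    function bounded by k + e can lie above it only inside that box. *)
Definition bowl x (k c: R) y: R := k + c * dsq x y.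

Lemma sm_bowl x k c: smooth (bowl x k c).
apply: smoothD; first exact: sm_cst.
apply: smoothM; first exact: sm_cst.
apply: sm_sum => i; rewrite (_: (fun y => _) = fun y => (y i ord0 - x i ord0) * (y i ord0 - x i ord0)).
 by apply: smoothM; (apply: smoothB; [exact: sm_coord|exact: sm_cst]).
by apply/funext => y; rewrite expr2.
Qed.

Lemma derive_bowl x k c i y: 'D_(ei i) (bowl x k c) y = c * 2 * (y i ord0 - x i ord0).
have dc j z: derivable (fun y: 'cV[R]_N => y j ord0) z (ei i).
 exact: sm_der (sm_coord j).
have dj j z: is_derive z (ei i) (fun y => (y j ord0 - x j ord0) * (y j ord0 - x j ord0))
  (2 * (z j ord0 - x j ord0) * (i == j)%:R).
 have dl: is_derive z (ei i) (fun y: 'cV[R]_N => y j ord0 - x j ord0) ((i == j)%:R - 0).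
  by apply: is_deriveB; rewrite -(derive_coord i j z); exact/derivableP/dc.
 have h := is_deriveM dl dl; apply: (@is_derive_eq _ _ _ _ _ _ _ _ h).
 rewrite -[LHS]/((z j ord0 - x j ord0) * ((i == j)%:R - 0) + (z j ord0 - x j ord0) * ((i == j)%:R - 0)).
 by rewrite subr0; ring.
have ->: bowl x k c = fun y => k + c * \sum_j (y j ord0 - x j ord0) * (y j ord0 - x j ord0).
 by apply/funext => z; rewrite /bowl /dsq; congr (_ + _ * _); apply: eq_bigr => j _; rewrite expr2.
have ds: is_derive y (ei i) (fun y => \sum_j (y j ord0 - x j ord0) * (y j ord0 - x j ord0))
  (\sum_j 2 * (y j ord0 - x j ord0) * (i == j)%:R).
 rewrite (_: (fun y => _) = \sum_j (fun y: 'cV[R]_N => (y j ord0 - x j ord0) * (y j ord0 - x j ord0))).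
  by apply: is_derive_sum => j.
 by apply/funext => z; rewrite fct_sumE.
have e: \sum_j 2 * (y j ord0 - x j ord0) * (i == j)%:R = 2 * (y i ord0 - x i ord0).
 rewrite (bigD1 i)//= eqxx mulr1 big1 ?addr0// => j /negPf ji.
 by rewrite eq_sym ji mulr0.
rewrite e in ds; have [_ h] := is_deriveD (is_derive_cst k y (ei i)) (is_deriveZ c ds).
by apply: etrans h _; rewrite add0r -mulrA.
Qed.

Lemma derive_extremum (f: 'cV[R]_N -> R) (v x: 'cV[R]_N): smooth f ->
 (forall y, f y <= f x) -> 'D_v f x = 0.
move=> sf fM; pose g t := f (t *: v + x).
have g1 t: is_derive t (1: R) g ('D_v f (t *: v + x)) by exact: isd_line.
have: is_derive (0: R) (1: R) g 0.
 apply: (@derive1_at_max R g (-1) 1 0).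
 - lra.
 - by move=> t _; have [] := g1 t.
 - by rewrite in_itv/= oppr_lt0 ltr01.
 - by move=> t _; rewrite {2}/g scale0r add0r; exact: fM.
by move=> [_ h]; have [_ h'] := g1 0; rewrite -h h' scale0r add0r.
Qed.

(** The values 0 and 1 are the extreme values of the cut-off, so its derivatives vanish wherever
    they are taken, boundary points included. *)
Lemma derive_cutoff0 c r s x v: cutoff c r s x = 0 \/ cutoff c r s x = 1 ->
 'D_v (cutoff c r s) x = 0.
have sc := sm_cutoff c r s; case=> h; last first.
 by apply: (derive_extremum _ sc) => y; rewrite h; case/andP: (cutoff_01 c r s y).
have sN: smooth (fun y => - cutoff c r s y) by apply: sm_ext (smoothZ (-1) sc) => y; rewrite mulN1r.
have: 'D_v (fun y => - cutoff c r s y) x = 0.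
 by apply: (derive_extremum _ sN) => y; rewrite h oppr0 oppr_le0; case/andP: (cutoff_01 c r s y).
rewrite deriveN; last exact: sm_der sc.
by move/eqP; rewrite oppr_eq0 => /eqP.
Qed.
End coordinates.

(** * Continuous representatives from small oscillation *)

Section continuous_representative.
Context {R: realType} {N: nat}.
Notation dx := (lvec N: {measure set 'cV[R]_N -> \bar R}).

Lemma ae_cbx (P: 'cV[R]_N -> Prop) x r: 0 < r -> {ae dx, forall y, P y} ->
 exists2 y, cbx x r y & P y.
move=> r0 aP; apply: contrapT => nP.
have: dx.-negligible (cbx x r).
 by apply: negligibleS aP => y yr Py; apply: nP; exists y.
move/negligibleP => /(_ (meas_cbx x r)) h.
have r2: 0 <= 2 * r by rewrite mulr_ge0// ltW.
have h2 := leb_cube (\col_i (x i ord0 - r)) r2.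
have: ((2 * r) ^+ N)%:E = 0%E :> \bar R by rewrite -h2; exact: h.
by move=> [] /eqP; rewrite gt_eqF// exprn_gt0// mulr_gt0.
Qed.

Lemma cbx_ball x r: 0 < r -> nbhs x (cbx x r: set 'cV[R]_N).
move=> r0; apply/nbhs_ballP; exists r =>//= y [_ h]; apply/cbxP => i.
by rewrite distrC ltW//; exact: (h i ord0).
Qed.

(** [v x] is the infimum, over boxes around x, of the essential upper bounds of u: a value defined
    at every point that ignores null sets. Any essential bounds of u on a box become pointwise
    bounds of v on the half box, and small oscillation turns this into continuity. *)
Lemma continuous_of_osc (Omega: set 'cV[R]_N) (u: 'cV[R]_N -> R): open Omega ->
 (forall x e, Omega x -> 0 < e -> exists r a b, [/\ 0 < r, cbx x r `<=` Omega, b - a < e &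
  {ae dx, forall y, Omega y -> cbx x r y -> a <= u y <= b}]) ->
 exists v: 'cV[R]_N -> R, [/\ {within Omega, continuous v},
  {ae dx, forall y, Omega y -> u y = v y} &
  forall K, {ae dx, forall y, Omega y -> `|u y| <= K} -> forall x, Omega x -> `|v x| <= K].
move=> oO osc.
pose S x := [set b | exists r, [/\ 0 < r, cbx x r `<=` Omega &
 {ae dx, forall y, Omega y -> cbx x r y -> u y <= b}]].
pose v x := inf (S x); exists v.
have vP x r a b: 0 < r -> cbx x r `<=` Omega ->
  {ae dx, forall y, Omega y -> cbx x r y -> a <= u y <= b} -> a <= v x <= b.
 move=> r0 rO ab.
 have Sb: S x b by exists r; split =>//; apply: filterS ab => y h Oy yr; case/andP: (h Oy yr).
 have lb: lbound (S x) a.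
  move=> b' [r' [r'0 r'O ub]]; have m0: 0 < Num.min r r' by rewrite lt_min r0.
  have [y yr [h1 h2]] := ae_cbx x m0 (filterI ab ub).
  have y1: cbx x r y by apply: cbx_le yr; rewrite ge_min lexx.
  have y2: cbx x r' y by apply: cbx_le yr; rewrite ge_min lexx orbT.
  by have /andP[h _] := h1 (rO y y1) y1; apply: le_trans h (h2 (rO y y1) y2).
 apply/andP; split; first by apply: lb_le_inf =>//; exists b.
 by apply: ge_inf =>//; exists a.
have vP2 x r a b: 0 < r -> cbx x r `<=` Omega ->
  {ae dx, forall y, Omega y -> cbx x r y -> a <= u y <= b} ->
  forall y, cbx x (r / 2) y -> a <= v y <= b.
 move=> r0 rO ab y yr; have r2: 0 < r / 2 by rewrite divr_gt0.
 have s: cbx y (r / 2) `<=` cbx x r.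
  move=> w /cbxP h; apply/cbxP => i; move/cbxP: yr => /(_ i); have := h i.
  have ->: w i ord0 - x i ord0 = (w i ord0 - y i ord0) + (y i ord0 - x i ord0) by ring.
  by have := ler_normD (w i ord0 - y i ord0) (y i ord0 - x i ord0); lra.
 apply: (vP y (r / 2)) =>//; first exact: subset_trans s rO.
 by apply: filterS ab => w h Ow wr; apply: h Ow (s w wr).
split.
- rewrite continuous_open_subspace// => x; rewrite inE => Ox.
 move=> A /nbhs_ballP[e /= e0 eA]; have [r [a [b [r0 rO ab h]]]] := osc x e Ox e0.
 have r2: 0 < r / 2 by rewrite divr_gt0.
 have /nbhs_ballP[s s0 sr] := cbx_ball x r2.
 suff: nbhs x (v @^-1` A) by [].
 apply/nbhs_ballP; exists s =>// y /sr yr; apply: eA; rewrite /ball /=.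
 have := vP2 x r a b r0 rO h y yr; have := vP2 x r a b r0 rO h x (cbx_center _ (ltW r2)).
 by rewrite ltr_norml => /andP[h1 h2] /andP[h3 h4]; lra.
(* Only countably many rational boxes and rates are tested, so the exceptional sets still add up to
   a null set. *)
- have [F FP] := @box_basis R N.
 pose G n k := exists a b, [/\ b - a < n.+1%:R^-1,
  {ae dx, forall y, Omega y -> obox (F k).1 (F k).2 y -> a <= u y <= b} &
  forall y, obox (F k).1 (F k).2 y -> a <= v y <= b].
 have Gae n k: {ae dx, forall y, Omega y -> G n k -> obox (F k).1 (F k).2 y ->
   `|u y - v y| <= n.+1%:R^-1}.
  have [g|g] := pselect (G n k); last by apply/aeW.
  have [a [b [ab ua va]]] := g; apply: filterS ua => y h Oy _ yk.
  have := va y yk; have := h Oy yk; move: ab; move: (n.+1%:R^-1) => t.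
  by rewrite ler_norml => ? /andP[? ?] /andP[? ?]; lra.
 have := ae_foralln (fun n => ae_foralln (Gae n)); apply: filterS => y h Oy.
 apply/eqP; rewrite -subr_eq0 -normr_le0; apply/ler_addgt0Pr => t t0; rewrite add0r.
 have [n hn] := nat_above t^-1.
 apply: (@le_trans _ _ n.+1%:R^-1); last first.
  by rewrite -[leRHS]invrK lef_pV2 ?posrE ?invr_gt0// ltW.
 have n0: 0 < n.+1%:R^-1 :> R by rewrite invr_gt0.
 have [r [a [b [r0 rO ab ua]]]] := osc y _ Oy n0.
 have r2: 0 < r / 2 by rewrite divr_gt0.
 have [k [yk kr]] := FP y _ r2; apply: (h n k) =>//; exists a, b; split =>//.
  apply: filterS ua => w hw Ow wk; apply: hw =>//; apply/cbxP => i.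
  have wc: cbox (F k).1 (F k).2 w by move=> j; have /andP[/ltW -> /ltW ->] := wk j.
  by have := kr w wc i; lra.
 move=> w wk; apply: (vP2 y r a b) =>//; apply/cbxP => i; apply/ltW/kr => j.
 by have /andP[/ltW -> /ltW ->] := wk j.
move=> K uK x Ox; have [r [a [b [r0 rO _ _]]]] := osc x 1 Ox ltr01.
rewrite ler_norml; apply: (vP x r) =>//; apply: filterS uK => y h Oy _.
by rewrite -ler_norml h.
Qed.
End continuous_representative.

(** * Fubini's theorem on rectangles *)

Section fubini_in.
Context d1 d2 (T1: measurableType d1) (T2: measurableType d2) (R: realType).
Variables (m1: {sigma_finite_measure set T1 -> \bar R})
 (m2: {sigma_finite_measure set T2 -> \bar R}).
Variables (A: set T1) (B: set T2).
Hypotheses (mA: measurable A) (mB: measurable B).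
Notation mm := (m1 \x m2)%E.

Lemma in_L1_ae_eq d (T: measurableType d) (m: {measure set T -> \bar R}) (D: set T)
  (F: T -> \bar R) (f: T -> R): measurable D -> m.-integrable D F -> mfun D f ->
 {ae m, forall x, D x -> F x = (f x)%:E} -> in_L1 m D f.
move=> mD iF mf Ff; have mF := measurable_int _ iF; have mf': mfun D (EFin \o f) by apply/mEFinP.
apply/integrableP; split =>//; have /integrableP[_] := iF; apply: le_lt_trans.
apply: leEq; apply: ae_eq_integral =>//.
- exact: mcomp.
- exact: mcomp.
- by apply: filterS Ff => x h Dx; rewrite /= h.
Qed.

Lemma patchX1 (f: T1 * T2 -> R) x y :
 ((EFin \o f) \_ (A `*` B)) (x, y) = if x \in A then ((fun y => (f (x, y))%:E) \_ B) y else 0%E.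
rewrite !patchE; case: ifPn => [|n]; first by rewrite inE => -[/= Ax By]; rewrite !mem_set.
case: ifPn =>// Ax; case: ifPn =>// By; move: n; rewrite notin_setE => n; exfalso; apply: n.
by split => /=; rewrite -in_setE.
Qed.
Lemma patchX2 (f: T1 * T2 -> R) x y :
 ((EFin \o f) \_ (A `*` B)) (x, y) = if y \in B then ((fun x => (f (x, y))%:E) \_ A) x else 0%E.
by rewrite patchX1 !patchE; case: (x \in A); case: (y \in B). Qed.

Lemma fubini_in1 (f: T1 * T2 -> R): in_L1 mm (A `*` B) f ->
 [/\ {ae m1, forall x, A x -> in_L1 m2 B (fun y => f (x, y))},
  in_L1 m1 A (fun x => \int[m2]_(y in B) f (x, y)) &
  \int[mm]_(z in A `*` B) f z = \int[m1]_(x in A) \int[m2]_(y in B) f (x, y)].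
move=> f1; have mAB: measurable (A `*` B) by exact: measurableX.
have g1: mm.-integrable setT ((EFin \o f) \_ (A `*` B)) by apply/(integrable_mkcond _ mAB).
have ae1: {ae m1, forall x, A x -> in_L1 m2 B (fun y => f (x, y))}.
 apply: filterS (ae_integrable1 g1) => x h Ax; apply/(integrable_mkcond _ mB).
 apply: eq_integrable h =>// y _; rewrite patchX1 mem_set//.
have FE x: A x -> fubini_F m2 ((EFin \o f) \_ (A `*` B)) x = (\int[m2]_(y in B) (f (x, y))%:E)%E.
 move=> Ax; rewrite /fubini_F [RHS]integral_mkcond; apply: eq_integral => y _.
 by rewrite patchX1 mem_set.
have F0 x: ~ A x -> fubini_F m2 ((EFin \o f) \_ (A `*` B)) x = 0%E.
 move=> Ax; rewrite /fubini_F -[RHS](@integral0 _ _ _ m2 setT); apply: eq_integral => y _.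
 by rewrite patchX1 memNset.
have iF := integrable_fubini_F g1.
have FA: m1.-integrable A (fubini_F m2 ((EFin \o f) \_ (A `*` B))).
 by apply: integrableS iF =>//; exact: measurableT.
have aeE: {ae m1, forall x, A x -> fubini_F m2 ((EFin \o f) \_ (A `*` B)) x =
  (\int[m2]_(y in B) f (x, y))%:E}.
 apply: filterS ae1 => x h Ax; rewrite FE// /Rintegral fineK//.
 by apply: integrable_fin_num =>//; exact: h.
have mF: mfun A (fun x => \int[m2]_(y in B) f (x, y)).
 have mf: mfun A (fubini_F m2 ((EFin \o f) \_ (A `*` B))) by exact: measurable_int FA.
 apply: (eq_measurable_fun (fun x => fine (fubini_F m2 ((EFin \o f) \_ (A `*` B)) x))).
  by move=> x; rewrite inE => Ax; rewrite FE.
 by apply: mcomp mf.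
have iR: in_L1 m1 A (fun x => \int[m2]_(y in B) f (x, y)).
 exact: in_L1_ae_eq mA FA mF aeE.
split =>//.
rewrite /Rintegral [in LHS]integral_mkcond -(integral12_prod_meas1 g1); congr fine.
transitivity (\int[m1]_(x in A) fubini_F m2 ((EFin \o f) \_ (A `*` B)) x)%E.
 rewrite [RHS]integral_mkcond; apply: eq_integral => x _; rewrite patchE.
 by case: ifPn =>//; rewrite notin_setE => /F0.
by apply: ae_eq_integral =>//; [exact: measurable_int FA|exact/mEFinP].
Qed.

Lemma fubini_in2 (f: T1 * T2 -> R): in_L1 mm (A `*` B) f ->
 [/\ {ae m2, forall y, B y -> in_L1 m1 A (fun x => f (x, y))},
  in_L1 m2 B (fun y => \int[m1]_(x in A) f (x, y)) &
  \int[mm]_(z in A `*` B) f z = \int[m2]_(y in B) \int[m1]_(x in A) f (x, y)].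
move=> f1; have mAB: measurable (A `*` B) by exact: measurableX.
have g1: mm.-integrable setT ((EFin \o f) \_ (A `*` B)) by apply/(integrable_mkcond _ mAB).
have ae1: {ae m2, forall y, B y -> in_L1 m1 A (fun x => f (x, y))}.
 apply: filterS (ae_integrable2 g1) => y h By; apply/(integrable_mkcond _ mA).
 apply: eq_integrable h =>// x _; rewrite patchX2 mem_set//.
have FE y: B y -> fubini_G m1 ((EFin \o f) \_ (A `*` B)) y = (\int[m1]_(x in A) (f (x, y))%:E)%E.
 move=> By; rewrite /fubini_G [RHS]integral_mkcond; apply: eq_integral => x _.
 by rewrite patchX2 mem_set.
have F0 y: ~ B y -> fubini_G m1 ((EFin \o f) \_ (A `*` B)) y = 0%E.
 move=> By; rewrite /fubini_G -[RHS](@integral0 _ _ _ m1 setT); apply: eq_integral => x _.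
 by rewrite patchX2 memNset.
have iF: m2.-integrable setT (fubini_G m1 ((EFin \o f) \_ (A `*` B))).
 have mg := measurable_int _ g1.
 apply/integrableP; split; first exact: measurable_fubini_G g1.
 have h := (integrable21ltyP m1 m2 mg).1 g1; apply: (le_lt_trans _ h); apply: ge0_le_integral =>//.
 - by apply: mcomp; last exact: measurable_fubini_G g1.
 - apply: (@measurable_fun_fubini_tonelli_G _ _ _ _ _ m1 (fun z => `|((EFin \o f) \_ (A `*` B)) z|%E)) =>//.
  exact: mcomp mg.
 - by move=> y _; apply: le_abse_integral =>//; apply: mcomp mg _.
have FA: m2.-integrable B (fubini_G m1 ((EFin \o f) \_ (A `*` B))).
 by apply: integrableS iF =>//; exact: measurableT.
have aeE: {ae m2, forall y, B y -> fubini_G m1 ((EFin \o f) \_ (A `*` B)) y =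
  (\int[m1]_(x in A) f (x, y))%:E}.
 apply: filterS ae1 => y h By; rewrite FE// /Rintegral fineK//.
 by apply: integrable_fin_num =>//; exact: h.
have mF: mfun B (fun y => \int[m1]_(x in A) f (x, y)).
 have mf: mfun B (fubini_G m1 ((EFin \o f) \_ (A `*` B))) by exact: measurable_int FA.
 apply: (eq_measurable_fun (fun x => fine (fubini_G m1 ((EFin \o f) \_ (A `*` B)) x))).
  by move=> x; rewrite inE => Ax; rewrite FE.
 by apply: mcomp mf.
have iR: in_L1 m2 B (fun y => \int[m1]_(x in A) f (x, y)).
 exact: in_L1_ae_eq mB FA mF aeE.
split =>//.
rewrite /Rintegral [in LHS]integral_mkcond -(integral21_prod_meas1 g1); congr fine.
transitivity (\int[m2]_(y in B) fubini_G m1 ((EFin \o f) \_ (A `*` B)) y)%E.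
 rewrite [RHS]integral_mkcond; apply: eq_integral => y _; rewrite patchE.
 by case: ifPn =>//; rewrite notin_setE => /F0.
by apply: ae_eq_integral =>//; [exact: measurable_int FA|exact/mEFinP].
Qed.

Lemma in_L2_slices (f: T1 * T2 -> R) (h: T1 -> R): measurable_fun (A `*` B) f ->
 {ae m1, forall x, A x -> (\int[m2]_(y in B) (f (x, y) ^+ 2)%:E <= (h x)%:E)%E} ->
 in_L1 m1 A h -> in_L2 mm (A `*` B) f.
move=> mf fh h1; have mAB: measurable (A `*` B) by exact: measurableX.
split =>//.
have mf2: measurable_fun (A `*` B) (EFin \o (fun z => f z ^+ 2)%R).
 by apply/mEFinP; apply: measurable_funX.
have mg: mfunT ((EFin \o (fun z => f z ^+ 2)%R) \_ (A `*` B)).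
 by apply/(measurable_restrictT _ mAB).
rewrite integral_mkcond (fubini_tonelli1 _ mg); last first.
 by move=> z; rewrite patchE; case: ifP =>// _; rewrite lee_fin sqr_ge0.
have ->: (\int[m1]_x fubini_F m2 ((EFin \o (fun z => f z ^+ 2)%R) \_ (A `*` B)) x =
  \int[m1]_(x in A) fubini_F m2 ((EFin \o (fun z => f z ^+ 2)%R) \_ (A `*` B)) x)%E.
 rewrite [RHS]integral_mkcond; apply: eq_integral => x _; rewrite patchE.
 case: ifPn =>// xA; rewrite /fubini_F -[RHS](@integral0 _ _ _ m2 setT); apply: eq_integral => y _.
 by rewrite patchX1 (negbTE xA).
apply: (@le_lt_trans _ _ (\int[m1]_(x in A) `|(h x)%:E|)%E); last by case/integrableP: h1.
apply: ae_ge0_le_integral =>//.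
- by move=> x _; apply: integral_ge0 => y _; rewrite patchE; case: ifP =>// _; rewrite lee_fin sqr_ge0.
- apply: measurable_funS (measurable_fun_fubini_tonelli_F _ mg _) =>// z.
 by rewrite patchE; case: ifP =>// _; rewrite lee_fin sqr_ge0.
- by apply: mcomp =>//; exact: measurable_int h1.
apply: filterS fh => x hx Ax; apply: le_trans (le_trans (hx Ax) (lee_abs _)).
rewrite /fubini_F [in leRHS]integral_mkcond le_eqVlt; apply/orP; left; apply/eqP.
by apply: eq_integral => y _; rewrite patchX1 mem_set.
Qed.
End fubini_in.
Section in_L2_extra.
Context d (T: measurableType d) (R: realType).
Variables (mu: {measure set T -> \bar R}) (D: set T).
Hypothesis mD: measurable D.

Lemma in_L2_bmul (b f: T -> R) (C: R): mfun D b ->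
 {ae mu, forall x, D x -> `|b x| <= C} -> in_L2 mu D f -> in_L2 mu D (fun x => b x * f x).
move=> mb bC f2; have [mf _] := f2.
have h: in_L2 mu D (fun x => C * f x + 0) by apply: (in_L2_lin mD) =>//; exact: in_L20.
apply: (in_L2_le mD _ h); first exact: measurable_funM.
apply: filterS bC => x bC Dx; rewrite addr0 !normrM ler_wpM2r//.
exact: le_trans (bC Dx) (ler_norm _).
Qed.

Lemma in_L2_sum (I: Type) (r: seq I) (F: I -> T -> R): (forall i, in_L2 mu D (F i)) ->
 in_L2 mu D (fun x => \sum_(i <- r) F i x).
move=> h; elim: r => [|i r IH].
 by rewrite (_: (fun x => _) = fun=> 0); [exact: in_L20|apply/funext => x; rewrite big_nil].
rewrite (_: (fun x => _) = fun x => 1 * F i x + \sum_(i <- r) F i x); first exact: in_L2_lin.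
by apply/funext => x; rewrite big_cons mul1r.
Qed.
End in_L2_extra.
Section derive_prod.
Context {R: realType} {V W: normedModType R}.

Lemma derive_dir0 (f: V -> R) x: 'D_0 f x = 0.
rewrite /derive; apply: lim_near_cst =>//; exists 1 =>//= h _ h0.
by rewrite scaler0 add0r subrr scaler0.
Qed.

Lemma derive_prod (f: V -> R) (g: W -> R) (v: V) (w: W) (z: V * W): smooth f -> smooth g ->
 'D_((v, w): V * W) (fun z: V * W => f z.1 * g z.2) z = 'D_v f z.1 * g z.2 + f z.1 * 'D_w g z.2.
move=> sf sg; have s1 := @sm_fst R V W f sf; have s2 := @sm_snd R V W g sg.
have d1: is_derive z (v, w) (fun z: V * W => f z.1) ('D_v f z.1).
 by rewrite -(derive_fst f v w z); apply/derivableP; exact: sm_der s1.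
have d2: is_derive z (v, w) (fun z: V * W => g z.2) ('D_w g z.2).
 by rewrite -(derive_snd g v w z); apply/derivableP; exact: sm_der s2.
have [_ h] := is_deriveM d1 d2; apply: etrans h _.
by rewrite -[LHS]/(f z.1 * 'D_w g z.2 + g z.2 * 'D_v f z.1) addrC; congr (_ + _); rewrite mulrC.
Qed.
End derive_prod.
Section real_dominated.
Context d (T: measurableType d) (R: realType).
Variables (mu: {measure set T -> \bar R}) (D: set T).
Hypothesis mD: measurable D.

Lemma Rdominated (f_: nat -> T -> R) (f g: T -> R): (forall n, mfun D (f_ n)) ->
 mfun D f -> in_L1 mu D g -> {ae mu, forall x, D x -> forall n, `|f_ n x| <= g x} ->
 {ae mu, forall x, D x -> f_ n x @[n --> \oo] --> f x} ->
 in_L1 mu D f /\ \int[mu]_(x in D) f_ n x @[n --> \oo] --> (\int[mu]_(x in D) f x: R).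
move=> mf_ mf g1 fg cv.
have mf_' n: mfun D (EFin \o f_ n) by apply/mEFinP.
have mf': mfun D (EFin \o f) by apply/mEFinP.
have cv': {ae mu, forall x, D x -> (EFin \o f_ n) x @[n --> \oo] --> (EFin \o f) x}.
 by apply: filterS cv => x h Dx; apply: cvg_EFin; [exact: nearW|exact: h].
have fg': {ae mu, forall x n, D x -> (`|(EFin \o f_ n) x| <= (EFin \o g) x)%E}.
 by apply: filterS fg => x h n Dx; rewrite /= lee_fin h.
have [i1 _ h] := dominated_convergence mD mf_' mf' cv' g1 fg'; split=> //.
have fi: (\int[mu]_(x in D) (f x)%:E)%E \is a fin_num by exact: integrable_fin_num.
by apply: fine_cvg; rewrite /Rintegral fineK.
Qed.
End real_dominated.

(** * Weak derivatives in time *)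

Section weak_derivative.
Context {R: realType}.
Notation l1m := (leb1: {measure set R -> \bar R}).

Lemma derive_step0 (s: R): s <= 0 \/ 1 <= s -> 'D_1 (@step R) s = 0.
have ss := @sm_step R.
have ex (f: R -> R) c: smooth f -> (forall t, f t <= f c) -> 'D_1 f c = 0.
 move=> sf h; have [||||_ ->//] := @derive1_at_max R f (c - 1) (c + 1) c.
 - lra.
 - by move=> t _; exact: sm_der sf.
 - by rewrite in_itv /=; apply/andP; split; lra.
 - by move=> t _; exact: h.
case=> h; last first.
 by apply: (ex _ _ ss) => t; rewrite (step_ge1 h); case/andP: (step_01 t).
have sN: smooth (fun t: R => - step t) by apply: sm_ext (smoothZ (-1) ss) => y; rewrite mulN1r.
have: 'D_1 (fun t: R => - step t) s = 0.
 by apply: (ex _ _ sN) => t; rewrite (step_le0 h) oppr0 oppr_le0; case/andP: (step_01 t).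
rewrite deriveN; last exact: sm_der ss.
by move/eqP; rewrite oppr_eq0 => /eqP.
Qed.

Lemma derive_step_bnd: exists2 C: R, 0 <= C & forall s, `|'D_1 (@step R) s| <= C.
have sD: smooth ('D_1 (@step R)) by apply: sm_derive; exact: sm_step.
have cf: {within `[(0: R), 1], continuous (fun s => `|'D_1 (@step R) s|)}.
 apply: continuous_subspaceT; apply: (continuous_compo (sm_cont sD)).
 exact: norm_continuous.
have [c _ h] := EVT_max ler01 cf; exists `|'D_1 (@step R) c|; first exact: normr_ge0.
move=> s.
have [s0|s0] := leP s 0; first by rewrite derive_step0 ?normr0//; left.
have [s1|s1] := leP 1 s; first by rewrite derive_step0 ?normr0//; right.
by apply: h; rewrite in_itv /= !ltW.
Qed.
(** Rises from 0 at a to 1 at a + d, so its derivative concentrates just to the right of a as d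
    tends to 0. *)
Definition ramp (a d: R) t := step ((t - a) / d).

Lemma sm_ramp a d: smooth (ramp a d).
apply: (@sm_comp R _ step (fun t => (t - a) / d)); first exact: sm_step.
apply: smoothM; last exact: sm_cst.
by apply: smoothB; [exact: sm_id|exact: sm_cst].
Qed.

Lemma derive_ramp a d t: 'D_1 (ramp a d) t = d^-1 * 'D_1 (@step R) ((t - a) / d).
have e: ramp a d = fun t => step (d^-1 * t + - (a / d)).
 by apply/funext => s; rewrite /ramp; congr step; ring.
have d1: is_derive t (1: R) (fun t => d^-1 * t + - (a / d)) (d^-1).
 have h0 := is_derive_id t (1: R).
 have h := is_deriveD (is_deriveZ d^-1 h0) (is_derive_cst (- (a / d)) t (1: R)).
 by apply: is_derive_eq h _; rewrite addr0 -[LHS]/(d^-1 * 1) mulr1.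
have d2: is_derive (d^-1 * t + - (a / d)) (1: R) (@step R) ('D_1 (@step R) (d^-1 * t + - (a / d))).
 by apply/derivableP; exact: sm_der (@sm_step R).
rewrite e; have [_ h] := @is_derive1_comp R (@step R) (fun t => d^-1 * t + - (a / d)) t _ _ d2 d1; apply: etrans h _.
have ->: d^-1 * t + - (a / d) = (t - a) / d by ring.
by rewrite mulrC.
Qed.

Lemma ramp_out a d t: 0 < d -> t <= a \/ a + d <= t -> 'D_1 (ramp a d) t = 0.
move=> d0 h; rewrite derive_ramp derive_step0 ?mulr0//; case: h => h; [left|right].
 by rewrite pmulr_lle0 ?invr_gt0// subr_le0.
by rewrite ler_pdivlMr// mul1r lerBrDl.
Qed.
Variable T: R.
Hypothesis T0: 0 < T.
Notation I0T := (`]0, T[%classic: set R).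
Let mI: measurable I0T. Proof. exact: measurable_itv. Qed.

Lemma Rint_I0T (f: R -> R): measurable_fun `[0, T] f ->
 \int[l1m]_(t in I0T) f t = fine (\int[leb1]_(t in `[0%R, T]) (f t)%:E)%E.
move=> mf; rewrite /Rintegral; congr fine.
have mf': measurable_fun `[0%R, T] (EFin \o f) by apply/mEFinP.
have mI': mfun I0T (EFin \o f).
 apply: (measurable_funS _ _ mf'); first exact: measurable_itv.
 by move=> s /=; rewrite !in_itv /= => /andP[/ltW -> /ltW ->].
rewrite (int_leb1 mI mI') (int_leb1 (measurable_itv _) mf').
have mJ: measurable_fun `]0%R, T] (EFin \o f).
 apply: (measurable_funS _ _ mf'); first exact: measurable_itv.
 by move=> s /=; rewrite !in_itv /= => /andP[/ltW -> ->].
by rewrite (integral_itv_bndo_bndc mI') (integral_itv_obnd_cbnd mJ).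
Qed.

Lemma ramp_int a d: 0 <= a -> 0 < d -> a + d <= T ->
 \int[l1m]_(t in I0T) 'D_1 (ramp a d) t = 1.
move=> a0 d0 ad; have sr := sm_ramp a d; have sd := sm_derive (1: R) sr.
rewrite Rint_I0T; last first.
 by apply: measurable_funS (continuous_measurable_fun (sm_cont sd)).
have sd' s: is_derive s (1: R) (ramp a d) ('D_1 (ramp a d) s).
 by apply/derivableP; exact: sm_der sr.
have h := FTC_line (ltW T0) sd' (sm_cont sd).
apply: (etrans (congr1 fine h)); rewrite /= /ramp step_ge1; last by rewrite ler_pdivlMr// mul1r lerBrDl.
by rewrite step_le0 ?subr0// pmulr_lle0 ?invr_gt0//; lra.
Qed.
Lemma dist_diff (x y p q e: R): `|p - x| <= e -> `|q - y| <= e -> `|x - y - (p - q)| <= 2 * e.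
by rewrite !ler_norml => /andP[? ?] /andP[? ?]; apply/andP; split; lra. Qed.

(* Test with a smooth version of the indicator of [a, b]. *)
Lemma weak_derivative (F h: R -> R): in_L1 l1m I0T F -> in_L1 l1m I0T h ->
 (forall t, 0 < t < T -> forall e, 0 < e -> exists2 d, 0 < d & forall s, 0 < s < T ->
  `|s - t| <= d -> `|F s - F t| <= e) ->
 (forall eta, test_function I0T eta ->
  \int[l1m]_(t in I0T) ('D_1 eta t * F t) = \int[l1m]_(t in I0T) (eta t * h t)) ->
 forall a b, 0 < a -> a < b -> b < T -> F a - F b = \int[l1m]_(t in `]a, b]) h t.
move=> F1 h1 cF wk a b a0 ab bT.
have [C C0 Cb] := derive_step_bnd.
have mramp c d: mfun I0T ('D_1 (ramp c d)).
 have sd := sm_derive (1: R) (sm_ramp c d).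
 by apply: measurable_funS (continuous_measurable_fun (sm_cont sd)).
have fin: (l1m I0T < +oo)%E.
 have hh: (leb1 `[0%R, T]%classic < +oo)%E by rewrite (leb1_itv (ltW T0)) ltry.
 apply: le_lt_trans hh; apply: le_measure; rewrite ?inE; [exact: measurable_itv|exact: measurable_itv|].
 by move=> s /=; rewrite !in_itv /= => /andP[/ltW -> /ltW ->].
have rL1 c d (f: R -> R): 0 < d -> in_L1 l1m I0T f -> in_L1 l1m I0T (fun t => 'D_1 (ramp c d) t * f t).
 move=> d0 f1; apply: (in_L1_le mI (g := fun t => d^-1 * C * `|f t|)).
 - by apply: measurable_funM =>//; exact: (in_L1_meas f1).
 - move=> t _; rewrite normrM ler_wpM2r// derive_ramp normrM ger0_norm ?invr_ge0 ?(ltW d0)//.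
  by rewrite ler_wpM2l ?invr_ge0 ?(ltW d0).
 - by apply: (in_L1Z mI); exact: in_L1_abs.
(* The derivative of [ramp c d] has integral 1, is at most C / d and vanishes off [c, c + d]:
   pairing it with [F] averages the values of [F] close to c. *)
have near c e: 0 < c < T -> 0 < e -> exists2 d0, 0 < d0 & forall d, 0 < d -> d <= d0 ->
  `|\int[l1m]_(t in I0T) ('D_1 (ramp c d) t * F t) - F c| <= C * e.
 move=> c0T e0; have [d1 d10 hd] := cF c c0T e e0; have /andP[c0 cT] := c0T.
 exists (Num.min d1 (T - c)); first by rewrite lt_min d10 subr_gt0.
 move=> d d0; rewrite le_min => /andP[dd1 dT].
 have cst1: in_L1 l1m I0T (fun=> F c) by exact: (in_L1_cst mI fin).
 have e1: F c = \int[l1m]_(t in I0T) ('D_1 (ramp c d) t * F c).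
  rewrite (_: (fun t => _) = fun t => F c * 'D_1 (ramp c d) t); last by apply/funext => t; rewrite mulrC.
  have c1: in_L1 l1m I0T (fun=> 1) by exact: (in_L1_cst mI fin).
  have r1: in_L1 l1m I0T ('D_1 (ramp c d)).
   by have := rL1 c d _ d0 c1; rewrite (_: (fun t => _) = 'D_1 (ramp c d))//; apply/funext => t; rewrite mulr1.
  by rewrite RintegralZl// ramp_int ?mulr1 ?(ltW c0)//; lra.
 rewrite [X in _ - X]e1 -(RintegralB mI (rL1 c d F d0 F1) (rL1 c d (fun=> F c) d0 cst1)).
 have i1: in_L1 l1m I0T (fun t => 'D_1 (ramp c d) t * F t - 'D_1 (ramp c d) t * F c).
  by apply: (in_L1B mI); exact: rL1.
 apply: le_trans (le_normr_Rintegral mI i1) _.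
 pose J := (`[c, c + d]%classic: set R).
 have mJ: measurable J by exact: measurable_itv.
 have J1: in_L1 l1m I0T (fun t => d^-1 * C * e * \1_J t).
  apply: (in_L1Z mI); apply: (in_L1_bnd mI fin (C := 1)).
   by apply: (measurable_funS measurableT (@subsetT _ _)); exact: measurable_indic.
  by move=> t _; rewrite indicE; case: (_ \in _); rewrite ?normr1 ?normr0.
 apply: le_trans (le_Rint_ae mI (in_L1_abs i1) J1 _) _.
  apply/aeW => t; rewrite /= in_itv /= => It; rewrite -mulrBr normrM.
  have [tJ|tJ] := boolP (t \in J).
   rewrite indicE tJ mulr1; apply: ler_pM =>//.
    rewrite derive_ramp normrM ger0_norm ?invr_ge0 ?(ltW d0)//.
    by rewrite ler_wpM2l ?invr_ge0 ?(ltW d0).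
   apply: hd =>//; move: tJ; rewrite inE /J /= in_itv /= => /andP[q1 q2].
   by rewrite ger0_norm ?subr_ge0//; lra.
  rewrite indicE (negbTE tJ) mulr0 ramp_out ?normr0 ?mul0r//.
  move: tJ; rewrite notin_setE /J /= in_itv /=; have [q|q] := leP t c; first by left.
  by have [q'|q' n] := leP (c + d) t; [right|exfalso; apply: n; rewrite !ltW].
 rewrite RintegralZl//; last first.
  apply: (in_L1_bnd mI fin (C := 1)).
   by apply: (measurable_funS measurableT (@subsetT _ _)); exact: measurable_indic.
  by move=> t _; rewrite indicE; case: (_ \in _); rewrite ?normr1 ?normr0.
 have ->: d^-1 * C * e * \int[l1m]_(t in I0T) \1_J t = C * e * (d^-1 * \int[l1m]_(t in I0T) \1_J t) by ring.
 rewrite ler_piMr ?mulr_ge0 ?(ltW e0)// mulrC ler_pdivrMr// mul1r.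
 rewrite /Rintegral integral_indic//; have ->: d = fine (leb1 J) :> R.
  by rewrite leb1_itv /=; lra.
 apply: fine_le; last by apply: le_measure; rewrite ?inE//; exact: measurableI.
  rewrite ge0_fin_numE//; apply: le_lt_trans fin; apply: le_measure; rewrite ?inE//; exact: measurableI.
 by rewrite leb1_itv//; lra.
apply/eqP; rewrite -subr_eq0 -normr_le0; apply/ler_addgt0Pr => e e0; rewrite add0r.
pose e' := e / (2 * C + 2); have e'0: 0 < e' by rewrite divr_gt0//; lra.
have aT: 0 < a < T by rewrite a0 (lt_trans ab).
have bT': 0 < b < T by rewrite bT (lt_trans a0).
have [d1 d10 hd1] := near a e' aT e'0.
have [d2 d20 hd2] := near b e' bT' e'0.
pose d0 := Num.min (Num.min d1 d2) ((T - b) / 2).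
have d00: 0 < d0 by rewrite !lt_min d10 d20 divr_gt0// subr_gt0.
pose dn (n: nat) := d0 / n.+1%:R.
have dn0 n: 0 < dn n by rewrite divr_gt0.
have dnd n: dn n <= d0 by rewrite ler_pdivrMr// ler_peMr ?(ltW d00)// ler1n.
have dnT n: b + dn n < T.
 have: dn n <= (T - b) / 2 by apply: le_trans (dnd n) _; rewrite ge_min lexx orbT.
 by move: (dn n) => q; lra.
pose eta n t := ramp a (dn n) t - ramp b (dn n) t.
have te n: test_function I0T (eta n).
 apply: (@tfI _ _ _ `[a, b + dn n]) =>//.
 - by apply: smoothB; exact: sm_ramp.
 - exact: segment_compact.
 - by move=> t /=; rewrite !in_itv /= => /andP[q1 q2]; have := dnT n; move: (dn n) q2 => q q2 q3; apply/andP; split; lra.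
 move=> t; apply: contra_neqP => nt; rewrite /eta /ramp.
 have [q|q] := leP t a.
  by rewrite !step_le0 ?subrr// pmulr_lle0 ?invr_gt0// subr_le0// (le_trans q) ?ltW.
 have [q'|q'] := leP (b + dn n) t.
  by rewrite !step_ge1 ?subrr// ler_pdivlMr// mul1r lerBrDl// (le_trans _ q')// lerD2r ltW.
 by exfalso; apply: nt; rewrite /= in_itv /= !ltW.
have eta1 n t: `|eta n t| <= 1.
 rewrite /eta /ramp; have := step_01 ((t - a) / dn n); have := step_01 ((t - b) / dn n).
 by move: (step _) (step _) => x y; rewrite ler_norml => /andP[? ?] /andP[? ?]; apply/andP; split; lra.
have mJ: measurable (`]a, b]%classic: set R) by exact: measurable_itv.
have cv: \int[l1m]_(t in I0T) (eta n t * h t) @[n --> \oo] -->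
  (\int[l1m]_(t in I0T) (\1_(`]a, b]%classic) t * h t): R).
 apply: (Rdominated mI _ _ (in_L1_abs h1) _ _).2.
 - move=> n; apply: measurable_funM; last exact: (in_L1_meas h1).
  by apply: measurable_funS (continuous_measurable_fun (sm_cont (tf_smooth (te n)))).
 - apply: measurable_funM; last exact: (in_L1_meas h1).
  by apply: (measurable_funS measurableT (@subsetT _ _)); exact: measurable_indic.
 - by apply/aeW => t _ n; rewrite normrM ler_piMl.
 - apply/aeW => t _; apply: cvgMl; apply: cvg_near_cst.
  have small x: 0 < x -> exists n0, forall n, (n0 <= n)%N -> dn n <= x.
   move=> x0; have [n0 hn] := nat_above (d0 / x); exists n0 => n nn.
   rewrite /dn ler_pdivrMr// mulrC -ler_pdivrMr//; apply: (le_trans (ltW hn)).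
   by rewrite ler_nat.
  have [ta|ta] := leP t a.
   apply: nearW => n; rewrite indicE memNset /=; last by rewrite in_itv /= ltNge ta.
   by rewrite /eta /ramp !step_le0 ?subrr// pmulr_lle0 ?invr_gt0// subr_le0// (le_trans ta) ?ltW.
  have [tb|tb] := leP t b.
   have ta0: 0 < t - a by rewrite subr_gt0.
   have [n0 hn0] := small _ ta0.
   exists n0 =>// n /= /hn0 q; rewrite indicE mem_set /=; last by rewrite in_itv /= ta tb.
   rewrite /eta /ramp step_ge1; last by rewrite ler_pdivlMr// mul1r.
   by rewrite step_le0 ?subr0// pmulr_lle0 ?invr_gt0// subr_le0.
  have tb0: 0 < t - b by rewrite subr_gt0.
  have [n0 hn0] := small _ tb0.
  exists n0 =>// n /= /hn0 q; rewrite indicE memNset /=; last by rewrite in_itv /= leNgt tb andbF.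
  rewrite /eta /ramp !step_ge1 ?subrr// ler_pdivlMr// mul1r//; apply: (le_trans q); lra.
have ->: \int[l1m]_(t in `]a, b]) h t = \int[l1m]_(t in I0T) (\1_(`]a, b]%classic) t * h t).
 rewrite Rintegral_mkcond [RHS]Rintegral_mkcond; apply: eq_Rintegral => t _; rewrite !patchE indicE.
 case: ifPn => [|tJ]; last by rewrite mul0r; case: ifP.
 rewrite inE /= in_itv /= => /andP[q1 q2]; rewrite mul1r mem_set//= in_itv /=; apply/andP; split; lra.
have dom n: `|F a - F b - \int[l1m]_(t in I0T) (eta n t * h t)| <= 2 * C * e'.
 rewrite -(wk _ (te n)) (_: (fun t => _ * F t) = fun t => 'D_1 (ramp a (dn n)) t * F t - 'D_1 (ramp b (dn n)) t * F t); last first.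
  apply/funext => t; rewrite -mulrBl; congr (_ * _).
  rewrite /eta -[LHS]/('D_1 (ramp a (dn n) - ramp b (dn n)) t) deriveB; [by []|exact: sm_der (sm_ramp _ _)|exact: sm_der (sm_ramp _ _)].
 rewrite (RintegralB mI (rL1 _ _ _ (dn0 n) F1) (rL1 _ _ _ (dn0 n) F1)).
 have m1: d0 <= d1 by rewrite !ge_min lexx.
 have m2: d0 <= d2 by rewrite !ge_min lexx orbT.
 rewrite -mulrA; apply: dist_diff.
  exact: hd1 (dn n) (dn0 n) (le_trans (dnd n) m1).
 exact: hd2 (dn n) (dn0 n) (le_trans (dnd n) m2).
have ce: 2 * C * e' < e.
 have k0: 0 < 2 * C + 2 by lra.
 rewrite /e' mulrA ltr_pdivrMr// -subr_gt0.
 have ->: e * (2 * C + 2) - 2 * C * e = 2 * e by ring.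
 by rewrite mulr_gt0.
have ce': 0 < e - 2 * C * e' by rewrite subr_gt0.
have /cvgrPdist_lt /(_ _ ce') [n0 _ /(_ n0 (leqnn _)) /=] := cv.
move=> hn; apply: le_trans (ler_distD (\int[l1m]_(t in I0T) (eta n0 t * h t)) _ _) _.
rewrite distrC in hn; apply: le_trans (lerD (dom n0) (ltW hn)) _.
by rewrite addrC subrK.
Qed.
End weak_derivative.

(** * Arithmetic of the decay along the Euler scheme *)

Section decay_arithmetic.
Context {R: realType}.
Implicit Types a b rho x y: R.

(** If a <= 1/rho the first term suffices; otherwise (rho a)^N >= 1 turns the a^2 / rho^N of Young's
    inequality into a^(N+2). The powers of rho are chosen for functions b with bounded L1 norm and
    squared L2 norm of order rho^(-N). *)
Lemma young_scaled (N: nat) a b rho: 0 <= a -> 0 <= b -> 0 < rho ->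
 a * b <= rho^-1 * b + rho ^+ N * b ^+ 2 / 2 + a ^+ N.+2 / 2.
move=> a0 b0 r0; have rN: 0 < rho ^+ N by rewrite exprn_gt0.
have t1: 0 <= rho ^+ N * b ^+ 2 / 2 by rewrite divr_ge0// mulr_ge0 ?sqr_ge0// ltW.
have t2: 0 <= a ^+ N.+2 / 2 by rewrite divr_ge0// exprn_ge0.
have t3: 0 <= rho^-1 * b by rewrite mulr_ge0// invr_ge0 ltW.
have [h|h] := leP a rho^-1.
 by have := ler_wpM2r b0 h; move: (a * b) (rho^-1 * b) t1 t2 => *; lra.
have aN: 1 <= rho ^+ N * a ^+ N.
 by rewrite -exprMn exprn_ege1// mulrC -ler_pdivrMr// div1r ltW.
have s1: a ^+ 2 / rho ^+ N <= a ^+ N.+2.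
 rewrite ler_pdivrMr// -[leLHS]mul1r; have ->: a ^+ N.+2 * rho ^+ N = (rho ^+ N * a ^+ N) * a ^+ 2.
  by rewrite -addn2 exprD; ring.
 by rewrite ler_wpM2r// sqr_ge0.
have s2: a * b <= rho ^+ N * b ^+ 2 / 2 + a ^+ 2 / rho ^+ N / 2.
 have := sqr_ge0 (rho ^+ N * b - a); rewrite -(pmulr_rge0 _ (_: 0 < (2 * rho ^+ N)^-1)); last first.
  by rewrite invr_gt0 mulr_gt0.
 have ->: (2 * rho ^+ N)^-1 * (rho ^+ N * b - a) ^+ 2 = rho ^+ N * b ^+ 2 / 2 + a ^+ 2 / rho ^+ N / 2 - a * b.
  by field; rewrite gt_eqF.
 by rewrite subr_ge0.
by move: (a * b) (rho ^+ N * b ^+ 2 / 2) (a ^+ 2 / _) (a ^+ N.+2) (rho^-1 * b) s1 s2 t3 => *; lra.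
Qed.

Lemma expr1D_le (N: nat) x: 0 <= x <= 1 -> (1 + x) ^+ N <= 1 + (2 ^+ N - 1) * x.
move=> /andP[x0 x1]; elim: N => [|N IH]; first by rewrite !expr0 subrr mul0r addr0.
have k1: 1 <= 2 ^+ N :> R by rewrite exprn_ege1// ler1n.
rewrite exprSr; apply: le_trans (ler_wpM2r _ IH) _; first by rewrite addr_ge0.
rewrite [in leRHS]exprS; move: (2 ^+ N) k1 => k k1.
have h: (k - 1) * (x * x) <= (k - 1) * x by rewrite ler_wpM2l ?subr_ge0// ler_piMl.
have ->: (1 + (k - 1) * x) * (1 + x) = 1 + k * x + (k - 1) * (x * x) by ring.
have ->: 1 + (2 * k - 1) * x = 1 + k * x + (k - 1) * x by ring.
by rewrite lerD2l.
Qed.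

(** One Euler step of the decay of X rho^N, by contradiction. If X' rho'^N exceeded 32 (N+1), the
    term rho'^(-N) of Nash's inequality would be at most X' / 2, so the dissipation S would control
    X', and the loss X - X' would outweigh the growth of rho^N. The factor 2^(N+1) in c pays for (1
    + y)^N <= 1 + (2^N - 1) y and for rho'^2 <= 2 rho^2. *)
Lemma nash_decay_step (N: nat) (al c lam rho rho' X X' S: R): 0 < al ->
 c = al / (16 * N.+1%:R) / 2 ^+ N.+1 -> 0 < lam -> 0 < rho -> 0 < rho' ->
 rho' ^+ 2 = rho ^+ 2 + c * lam -> c * lam <= rho ^+ 2 -> 0 <= X' -> 0 <= S ->
 X' <= 16 * N.+1%:R * (rho' ^+ 2 * S + (rho' ^+ N)^-1) -> X' + 2 * lam * al * S <= X ->
 X * rho ^+ N <= 32 * N.+1%:R -> X' * rho' ^+ N <= 32 * N.+1%:R.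
move=> al0 cE lam0 r0 r'0 r'E cl X'0 S0 nash en XA.
have n0: 0 < N.+1%:R :> R by rewrite ltr0n.
have p0: 0 < 2 ^+ N.+1 :> R by rewrite exprn_gt0.
have rN: 0 < rho ^+ N by rewrite exprn_gt0. have r'N: 0 < rho' ^+ N by rewrite exprn_gt0.
have c0: 0 < c by rewrite cE !divr_gt0// mulr_gt0.
rewrite leNgt; apply/negP => big.
have X'gt: 0 < X' by rewrite -(pmulr_lgt0 _ r'N); apply: lt_trans big; rewrite mulr_gt0.
have h1: 16 * N.+1%:R * (rho' ^+ N)^-1 <= X' / 2.
 rewrite ler_pdivrMr//; lra.
have h2: X' / 2 <= 16 * N.+1%:R * (rho' ^+ 2 * S).
 move: nash h1; rewrite mulrDr; move: (16 * N.+1%:R * (rho' ^+ 2 * S)) (16 * N.+1%:R / rho' ^+ N) => u v; lra.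
set y := c * lam / rho ^+ 2.
have y01: 0 <= y <= 1.
 by rewrite divr_ge0 ?sqr_ge0 ?mulr_ge0 ?(ltW c0) ?(ltW lam0)//= ler_pdivrMr ?exprn_gt0// mul1r.
have r'y: rho' ^+ 2 = rho ^+ 2 * (1 + y) by rewrite r'E /y; field; rewrite gt_eqF.
have q: rho' <= rho * (1 + y).
 have /andP[y0 _] := y01; rewrite -ler_sqr ?nnegrE ?(ltW r'0) ?mulr_ge0 ?(ltW r0) ?addr_ge0//.
 by rewrite r'y exprMn ler_wpM2l ?sqr_ge0// expr2 ler_peMl ?addr_ge0// lerDl.
have qN: rho' ^+ N <= rho ^+ N * (1 + (2 ^+ N - 1) * y).
 apply: (@le_trans _ _ ((rho * (1 + y)) ^+ N)).
  by rewrite lerXn2r ?nnegrE ?(ltW r'0)// (le_trans (ltW r'0)).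
 by rewrite exprMn ler_wpM2l ?(ltW rN)// expr1D_le.
have gain: X' * (2 ^+ N * y) <= 2 * lam * al * S.
 have r2: rho' ^+ 2 <= 2 * rho ^+ 2 by rewrite r'E; lra.
 have h3: X' <= 32 * N.+1%:R * (2 * rho ^+ 2 * S).
  have: rho' ^+ 2 * S <= 2 * rho ^+ 2 * S by rewrite ler_wpM2r.
  by rewrite -(ler_pM2l (_: 0 < 16 * N.+1%:R :> R)) ?mulr_gt0//; move: h2; move: (16 * _ * _) => u h2 h; lra.
 have k0: 0 <= 2 ^+ N * y by rewrite mulr_ge0 ?exprn_ge0//; case/andP: y01.
 apply: le_trans (ler_wpM2r k0 h3) _; apply: leEq.
 have w0: 0 < 2 ^+ N :> R by rewrite exprn_gt0.
 rewrite /y cE (exprS 2 N); move: (2 ^+ N) w0 (N.+1%:R) n0 => w w0 m m0.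
 by field; rewrite !gt_eqF.
have: X' * (rho ^+ N * (1 + (2 ^+ N - 1) * y)) <= 32 * N.+1%:R.
 apply: le_trans XA; rewrite mulrCA mulrC ler_wpM2r ?(ltW rN)//; apply: le_trans en.
 rewrite mulrDr mulr1 lerD2l; apply: le_trans gain; rewrite ler_wpM2l// ler_wpM2r//; first by case/andP: y01.
 by rewrite gerBl.
apply/negP; rewrite -ltNge; apply: lt_le_trans big _.
by rewrite ler_wpM2l.
Qed.

(** The discrete form of the integrability of t^(-1/2): each term is at most the increment of the
    primitive 2/c sqrt(a0 + c t), the difference being a square. *)
Lemma sum_inv_le (c lam a0: R) (n: nat): 0 < c -> 0 < lam -> 0 < a0 ->
 \sum_(k < n) lam / Num.sqrt (a0 + c * lam * k.+1%:R) <= 2 / c * Num.sqrt (a0 + c * lam * n%:R).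
move=> c0 lam0 a00; have cl: 0 < c * lam by rewrite mulr_gt0.
have pos_ k: 0 < a0 + c * lam * k%:R by rewrite ltr_pwDl// mulr_ge0// ltW.
elim: n => [|n IH]; first by rewrite big_ord0 mulr_ge0 ?sqrtr_ge0// divr_ge0// ltW.
rewrite big_ord_recr /=; set s := Num.sqrt (a0 + c * lam * n.+1%:R).
set r := Num.sqrt (a0 + c * lam * n%:R) in IH *.
have s0: 0 < s by rewrite sqrtr_gt0. have r0: 0 < r by rewrite sqrtr_gt0.
have sE: s ^+ 2 = r ^+ 2 + c * lam.
 by rewrite !sqr_sqrtr ?(ltW (pos_ _))// -natr1; ring.
apply: le_trans (lerD IH (lexx _)) _.
have ->: lam / s = (s ^+ 2 - r ^+ 2) / (c * s) by rewrite sE; field; rewrite !gt_eqF.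
rewrite -subr_ge0.
have ->: 2 / c * s - (2 / c * r + (s ^+ 2 - r ^+ 2) / (c * s)) = (s - r) ^+ 2 / (c * s).
 by field; rewrite !gt_eqF.
by rewrite divr_ge0 ?sqr_ge0// mulr_ge0// ltW.
Qed.
End decay_arithmetic.

(** * From indicators to bounded functions *)

Section sum_of_indicators.
Context {T: Type} {R: realType}.
Variable F: nat -> set T.
Hypothesis tF: trivIset setT F.
Let fE n z j: F j z -> \sum_(k < n) \1_(F k) z = (j < n)%N%:R :> R.
move=> Fz; rewrite (eq_bigr (fun k: 'I_n => (k == j :> nat)%:R)); last first.
 move=> k _; rewrite indicE; have [->|kj] := eqVneq (k: nat) j; first by rewrite mem_set.
 rewrite memNset// => Fk; move/trivIsetP: tF => /(_ k j I I kj) /seteqP[/(_ z)/= h _].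
 by apply: h.
have [jn|jn] := ltnP j n.
 rewrite (bigD1 (Ordinal jn))//= eqxx big1 ?addr0// => k kj; rewrite (_: (k == j :> nat) = false)//.
 by apply/negbTE; apply: contra kj => /eqP kj; apply/eqP/val_inj.
by rewrite big1// => k _; rewrite ltn_eqF// (leq_trans (ltn_ord k)).
Qed.
Let f0 n z: ~ (\bigcup_k F k) z -> \sum_(k < n) \1_(F k) z = 0 :> R.
by move=> nF; apply: big1 => k _; rewrite indicE memNset// => Fk; apply: nF; exists (k: nat). Qed.

Lemma sum_indic_01 n z: `|\sum_(k < n) \1_(F k) z: R| <= 1.
have [[j _ Fj]|nF] := pselect ((\bigcup_k F k) z); last by rewrite f0// normr0.
by rewrite (fE n Fj); case: (j < n)%N; rewrite ?normr1 ?normr0.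
Qed.

Lemma sum_indic_cvg z: \sum_(k < n) \1_(F k) z @[n --> \oo] --> (\1_(\bigcup_k F k) z: R).
rewrite indicE; have [[j _ Fj]|nF] := pselect ((\bigcup_k F k) z).
 rewrite mem_set; last by exists j.
 apply: cvg_near_cst; near=> n; rewrite (fE n Fj) (_: (j < n)%N)//.
 by near: n; exact: nbhs_infty_gt.
by rewrite memNset//; under eq_fun do rewrite f0//; exact: cvg_cst.
Unshelve. all: by end_near. Qed.
End sum_of_indicators.

Lemma sum_ltn_ord {R: realType} (m k: nat): (k <= m)%N -> \sum_(j < m) (j < k)%N%:R = k%:R :> R.
move=> km; rewrite -natr_sum; congr (_%:R); elim: m km => [|m IH]; first by rewrite leqn0 big_ord0 => /eqP.
rewrite big_ord_recr /= leq_eqVlt => /orP[/eqP ->|km]; last by rewrite IH// ltnNge -ltnS km addn0.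
rewrite ltnS leqnn (eq_bigr (fun=> 1%N)) ?sum1_card ?card_ord ?addn1// => j _.
by rewrite ltnS ltnW.
Qed.

Section bnd_class.
Context d (T: measurableType d) (R: realType).
Variables (mu: {measure set T -> \bar R}) (D: set T).
Hypothesis mD: measurable D.
Variable K: (T -> R) -> Prop.
Hypothesis KLoo: forall f, K f -> in_Loo mu D f.
Hypothesis Klin: forall (c: R) f g, K f -> K g -> K (fun z => c * f z + g z).
Hypothesis Klim: forall (f_: nat -> T -> R) (f: T -> R) (B: R), (forall n, K (f_ n)) ->
 mfun D f -> (forall n, {ae mu, forall z, D z -> `|f_ n z| <= B}) ->
 {ae mu, forall z, D z -> f_ n z @[n --> \oo] --> f z} -> K f.

Lemma K_ae f g: K f -> mfun D g -> {ae mu, forall z, D z -> f z = g z} -> K g.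
move=> Kf mg fg; have [_ [B fB]] := KLoo Kf; apply: (Klim (f_ := fun=> f) (B := B)) =>//.
by apply: filterS fg => z h Dz; rewrite h//; exact: cvg_cst.
Qed.

Lemma K_sum (I: Type) (r: seq I) (F: I -> T -> R) (c: R) (f0: T -> R): K f0 ->
 (forall i, K (F i)) -> K (fun z => c * (\sum_(i <- r) F i z) + f0 z).
move=> Kf KF; elim: r => [|i r IH].
 by under eq_fun do rewrite big_nil mulr0 add0r.
have := Klin c (KF i) IH; congr K; apply/funext => z.
by rewrite big_cons mulrDr addrA.
Qed.
Hypothesis Kindic: forall A, measurable A -> K \1_A.

(** Layer-cake approximation: with n+1 levels per unit, the normalized count of the levels below f +
    B differs from f + B by at most 1/(n+1), and it is a finite sum of indicators of superlevel
    sets. *)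
Lemma bnd_class f: in_Loo mu D f -> K f.
move=> [mf [B0 fB0]]; pose B := Num.max B0 0; have BB: 0 <= B by rewrite le_max lexx orbT.
have {fB0}fB: {ae mu, forall z, D z -> `|f z| <= B}.
 by apply: filterS fB0 => z h Dz; apply: le_trans (h Dz) _; rewrite le_max lexx.
pose S n j := D `&` [set z | j.+1%:R <= n.+1%:R * (f z + B)].
have mS n j: measurable (S n j).
 have mg: mfun D (fun z => n.+1%:R * (f z + B)).
  by apply: measurable_funM =>//; exact: measurable_funD.
 have := mg mD _ (measurable_itv `[j.+1%:R, +oo[); congr measurable; congr (_ `&` _).
 by apply/seteqP; split => z /=; rewrite in_itv /= andbT.
pose m n := (Num.truncn (n.+1%:R * (2 * B))).+1.
pose g n z := n.+1%:R^-1 * (\sum_(j < m n) \1_(S n j) z) + (- B * \1_setT z + 0 * \1_setT z).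
have KT := Kindic measurableT.
have gE n z: D z -> `|f z| <= B -> `|g n z - f z| <= n.+1%:R^-1.
 move=> Dz fz; have n0: 0 < n.+1%:R :> R by [].
 set y := n.+1%:R * (f z + B); have fz1 := ler_norm (f z); have fz2 := ler_norm (- f z).
 rewrite normrN in fz2; have y0: 0 <= y by rewrite mulr_ge0//; lra.
 have y1: y <= n.+1%:R * (2 * B) by rewrite ler_pM2l//; lra.
 have /andP[t1 t2] := truncn_itv y0.
 have eqS j: \1_(S n j) z = (j < Num.truncn y)%N%:R :> R.
  rewrite indicE; congr (_%:R); congr nat_of_bool; apply/idP/idP.
   rewrite inE => -[_ /= jy]; have := le_lt_trans jy t2; by rewrite ltr_nat ltnS.
  by move=> jy; rewrite inE; split=> //=; apply: le_trans t1; rewrite ler_nat.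
 have tm: (Num.truncn y <= m n)%N.
  by rewrite /m ltnW// ltnS; apply: le_truncn.
 have ->: g n z - f z = n.+1%:R^-1 * ((Num.truncn y)%:R - y).
  rewrite /g (eq_bigr (fun j: 'I_(m n) => (j < Num.truncn y)%N%:R)); last by move=> j _; exact: eqS.
  rewrite (sum_ltn_ord tm) indicT /= mulrBr /y mulrA mulVf ?gt_eqF// mul1r; ring.
 rewrite normrM ger0_norm ?invr_ge0// ler_piMr ?invr_ge0// ler_norml; apply/andP; split.
  by rewrite lerBrDr addrC -lerBrDr opprK (le_trans (ltW t2))// -natr1.
 by rewrite lerBlDr (le_trans t1)// lerDr.
apply: (Klim (f_ := g) (B := B + 1)) =>//.
- move=> n; apply: (K_sum _ _ (Klin (- B) KT _)) => [|j]; last exact: Kindic.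
 have := Klin (-1) KT KT; congr K; apply/funext => z; by rewrite mul0r mulN1r addNr.
- move=> n; apply: filterS fB => z h Dz; have {}h := h Dz.
 rewrite -[g n z](subrK (f z)) addrC; apply: le_trans (ler_normD _ _) _; apply: lerD =>//.
 by apply: le_trans (gE n z Dz h) _; rewrite invf_le1 ?ler1n.
apply: filterS fB => z h Dz; have {}h := h Dz; apply/cvgrPdist_le => e e0.
have [k hk] := nat_above (e^-1); near=> n.
rewrite distrC; apply: le_trans (gE n z Dz h) _; rewrite invf_ple ?posrE//.
apply: le_trans (ltW hk) _; rewrite ler_nat ltnS; near: n; exact: nbhs_infty_ge.
Unshelve. all: by end_near. Qed.
End bnd_class.
Section essentially_bounded.
Context disp (T: measurableType disp) (R: realType).
Variables (mu: {measure set T -> \bar R}) (D: set T).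
Hypotheses (mD: measurable D) (fD: (mu D < +oo)%E).
Notation Loo := (in_Loo mu D).

Lemma Loo_pow (f: T -> R) n: Loo f -> in_L1 mu D (fun z => `|f z| ^+ n).
move=> [mf [K fK]]; apply: (in_L1_le_ae mD (g := fun=> `|K| ^+ n)).
- by apply: measurable_funX; apply: mcomp mf.
- apply: filterS fK => z h Dz; rewrite ger0_norm ?exprn_ge0// lerXn2r ?nnegrE//.
 exact: le_trans (h Dz) (ler_norm _).
- exact: (in_L1_cst mD fD).
Qed.

Lemma Loo_lin c (f g: T -> R): Loo f -> Loo g -> Loo (fun z => c * f z + g z).
move=> [mf [K fK]] [mg [L gL]]; split; first by apply: measurable_funD =>//; exact: measurable_funM.
exists (`|c| * K + L); apply: filterS2 fK gL => z h1 h2 Dz; apply: le_trans (ler_normD _ _) _.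
by rewrite normrM lerD ?ler_wpM2l ?h1 ?h2.
Qed.

Lemma Loo_indic (A: set T): measurable A -> Loo \1_A.
move=> mA; split; first by apply: (measurable_funS measurableT (@subsetT _ _)); exact: measurable_indic.
by exists 1; apply/aeW => z _; rewrite indicE; case: (z \in A); rewrite ?normr1 ?normr0.
Qed.

Lemma L1_Loo (u h: T -> R): in_L1 mu D u -> Loo h -> in_L1 mu D (fun z => u z * h z).
move=> u1 [mh [K hK]]; apply: (in_L1_le_ae mD (g := fun z => K * `|u z|)).
- by apply: measurable_funM =>//; exact: in_L1_meas u1.
- by apply: filterS hK => z b Dz; rewrite normrM mulrC ler_wpM2r// b.
- by apply: (in_L1Z mD); exact: in_L1_abs.
Qed.
End essentially_bounded.

Lemma Rint_sub_le d (X: measurableType d) {R: realType} (m: {measure set X -> \bar R})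
 (A B: set X) (f: X -> R): measurable A -> measurable B -> A `<=` B -> in_L1 m B f ->
 (forall x, B x -> 0 <= f x) -> \int[m]_(x in A) f x <= \int[m]_(x in B) f x.
move=> mA mB AB fB f0; have fA: in_L1 m A f by exact: (integrableS mB mA AB fB).
apply: fine_le; [exact: integrable_fin_num|exact: integrable_fin_num|].
by apply: ge0_subset_integral =>//; first [exact: (measurable_int _ fB)|move=> x Bx; rewrite lee_fin f0].
Qed.
Lemma iter_arith {R: realFieldType} (S g1 g2 p q r x y z v: R): p + q <= r + z ->
 S + (v + x) + g1 / 2 + (p + q + g2 / 2) + y <= S + r + (v + z + (x + y)) + (g1 / 2 + g2 / 2).
by move=> h; lra. Qed.

Lemma ae_itv {R: realType} (a b: R) (P: R -> Prop): a < b ->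
 {ae (leb1: {measure set R -> \bar R}), forall t, P t} -> exists2 t, `]a, b[%classic t & P t.
move=> ab [N [mN N0 PN]]; apply: contrapT => no.
have sub: `]a, b[%classic `<=` N by move=> t tI; apply: PN => Pt; apply: no; exists t.
have := le_measure (leb1: {measure set R -> \bar R}) (mem_set (measurable_itv `]a, b[)) (mem_set mN) sub.
move=> h; have {}h: (leb1 `]a, b[%classic <= 0)%E by rewrite -N0; exact: h.
move: h; rewrite leNgt => /negP; apply.
by rewrite -[X in (_ < X)%E]/(@lebesgue_measure R `]a, b[%classic) lebesgue_measure_itv /= lte_fin ab -EFinB lte_fin subr_gt0.
Qed.

Lemma open_cylinder {R: realType} (N: nat) (Omega: set 'cV[R]_N) (T: R) :
 open Omega -> open (cylinder T Omega).
move=> oO; have oI: open (`]0, T[%classic: set R).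
 rewrite (_: `]0, T[%classic = [set t | 0 < t] `&` [set t | t < T]); first by apply: openI; [exact: open_gt|exact: open_lt].
 by apply/seteqP; split=> u /=; rewrite in_itv /=; [move/andP|move=> [-> ->]].
rewrite openE => -[t' x'] [t'I Ox']; exists (`]0, T[%classic, Omega) =>//=.
by split; apply: open_nbhs_nbhs; split.
Qed.

Section transpose.
Context {R: realType} {N: nat}.
Variables (Omega: set 'cV[R]_N) (M: 'cV[R]_N -> 'M[R]_N).
Notation dx := (lvec N: {measure set 'cV[R]_N -> \bar R}).
Lemma tr_meas: (forall i j, mfun Omega (fun x => M x i j)) ->
 forall i j, mfun Omega (fun x => (M x)^T i j).
by move=> mM i j; apply: (eq_measurable_fun (fun x => M x j i)) =>// x _; rewrite mxE. Qed.
Lemma tr_bnd (C: R): (forall i j, {ae dx, forall x, Omega x -> `|M x i j| <= C}) ->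
 forall i j, {ae dx, forall x, Omega x -> `|(M x)^T i j| <= C}.
by move=> MC i j; apply: filterS (MC j i) => x h Ox; rewrite mxE; exact: h. Qed.

Lemma tr_elliptic al: elliptic Omega M al -> elliptic Omega (fun x => (M x)^T) al.
apply: filterS => x h Ox xi; apply: le_trans (h Ox xi) _; apply: leEq.
rewrite /dot; under eq_bigr => i _ do rewrite mxE mulr_suml.
under [in RHS]eq_bigr => i _ do rewrite mxE mulr_suml.
rewrite exchange_big /=; apply: eq_bigr => i _; apply: eq_bigr => j _; rewrite mxE; ring.
Qed.
End transpose.
Lemma Rint_eq0 d (X: measurableType d) {R: realType} (m: {measure set X -> \bar R})
 (D: set X) (f: X -> R): (forall x, D x -> f x = 0) -> \int[m]_(x in D) f x = 0.
by move=> f0; rewrite /Rintegral integral0_eq// => x Dx; rewrite f0. Qed.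

Section slices.
Context {R: realType} {V W: normedModType R}.

Lemma derive_slice1 (f: V * W -> R) (v: V) x y :
 ('D_((v, 0): V * W) f (x, y) = 'D_v (fun x => f (x, y)) x) *
 (derivable f (x, y) ((v, 0): V * W) = derivable (fun x => f (x, y)) x v).
suff E: (fun h: R => h^-1 *: ((f \o shift (x, y)) (h *: ((v, 0): V * W)) - f (x, y))) =
  (fun h: R => h^-1 *: (((fun x => f (x, y)) \o shift x) (h *: v) - f (x, y))).
 by rewrite /derive /derivable E.
apply/funext => h /=; congr (_ *: (f _ - _)).
by rewrite -[LHS]/(h *: v + x, h *: (0: W) + y) scaler0 add0r.
Qed.

Lemma derive_slice2 (f: V * W -> R) (w: W) x y :
 ('D_((0, w): V * W) f (x, y) = 'D_w (fun y => f (x, y)) y) *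
 (derivable f (x, y) ((0, w): V * W) = derivable (fun y => f (x, y)) y w).
suff E: (fun h: R => h^-1 *: ((f \o shift (x, y)) (h *: ((0, w): V * W)) - f (x, y))) =
  (fun h: R => h^-1 *: (((fun y => f (x, y)) \o shift y) (h *: w) - f (x, y))).
 by rewrite /derive /derivable E.
apply/funext => h /=; congr (_ *: (f _ - _)).
by rewrite -[LHS]/(h *: (0: V) + x, h *: w + y) scaler0 add0r.
Qed.

Lemma sm_slice (f: V * W -> R) x: smooth f -> smooth (fun y => f (x, y)).
move=> sf vs /=; pose ws: seq (V * W) := [seq (0, w) | w <- vs].
have E: foldr (fun v h => 'D_v h) (fun y => f (x, y)) vs =
  fun y => foldr (fun v h => 'D_v h) f ws (x, y).
 rewrite /ws; elim: vs {ws} => [//|v vs IH] /=; rewrite IH; apply/funext => y.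
 by rewrite (derive_slice2 (foldr (fun v h => 'D_v h) f _) v x y).
have [cf df] := sf ws; rewrite E; split.
 move=> y; apply: (@continuous_comp _ _ _ (fun y => (x, y))); last exact: cf.
 by apply: (@cvg_pair _ _ _ _ (nbhs x) (nbhs y)); [exact: cvg_cst|exact: cvg_id].
by move=> y w; rewrite -(derive_slice2 _ w x y).2; exact: df.
Qed.

Lemma test_slice (A: set V) (B: set W) (f: V * W -> R) x :
 test_function (A `*` B) f -> test_function B (fun y => f (x, y)).
move=> [sf cf sub]; apply: (tfI (K := snd @` closure [set z | f z != 0])).
- exact: sm_slice.
- by apply: continuous_compact =>//; apply: continuous_subspaceT => z; exact: cvg_snd.
- by move=> _ [[a b] /sub [_ Bb] <-].
- by move=> y fy; exists (x, y) =>//; exact: subset_closure.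
Qed.
End slices.

(** * Representation of a linear relation by a density *)

Section representation.
Context disp (T: measurableType disp) (R: realType).
Variables (mu: {sigma_finite_measure set T -> \bar R}) (D: set T) (p: nat).
Hypotheses (mD: measurable D) (fD: (mu D < +oo)%E).
Notation Loo := (in_Loo mu D).
(** The (p+1)-th power of the L^(p+1) norm. Roots are avoided by keeping the power, with
    [power_comb] in the role of the triangle inequality. *)
Definition power (f: T -> R) := \int[mu]_(z in D) (`|f z| ^+ p.+1).

Lemma power_comb c (x y f: T -> R): Loo x -> Loo y ->
 (forall z, D z -> f z = c * x z + y z) ->
 power f <= 2 ^+ p.+1 * (`|c| ^+ p.+1 * power x + power y).
move=> Lx Ly fE; have Lf := Loo_pow mD fD p.+1 (Loo_lin c Lx Ly).
have i1 := in_L1Z mD (`|c| ^+ p.+1) (Loo_pow mD fD p.+1 Lx); have i2 := Loo_pow mD fD p.+1 Ly.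
rewrite /power -(RintegralZl _ mD (Loo_pow mD fD p.+1 Lx)) -(RintegralD mD i1 i2).
rewrite -(RintegralZl _ mD (in_L1D mD i1 i2)).
have ->: \int[mu]_(z in D) (`|f z| ^+ p.+1) = \int[mu]_(z in D) (`|c * x z + y z| ^+ p.+1).
 by apply: eq_Rintegral => z; rewrite inE => Dz; rewrite fE.
apply: (le_Rint_ae mD Lf (in_L1Z mD _ (in_L1D mD i1 i2))); apply/aeW => z _.
rewrite -exprMn -normrM; move: (c * x z) (y z) => a b.
wlog ab: a b / `|a| <= `|b|.
 move=> h; case: (lerP `|a| `|b|) => [|/ltW] ab; first exact: h.
 by rewrite (addrC a) (addrC (`|a| ^+ _)); exact: h.
apply: (@le_trans _ _ (2 ^+ p.+1 * `|b| ^+ p.+1)); last first.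
 by rewrite ler_pM2l ?exprn_gt0// lerDr exprn_ge0.
rewrite -exprMn lerXn2r ?nnegrE ?mulr_ge0//; apply: le_trans (ler_normD _ _) _.
by rewrite mulr_natl mulr2n lerD2r.
Qed.
Lemma halves (k x: R): 0 < k -> k * (x / (k * (1 + 1)) + x / (k * (1 + 1))) = x.
by move=> k0; field; rewrite !gt_eqF. Qed.
Lemma power_ge0 f: 0 <= power f.
by apply: Rintegral_ge0 => z _; exact: exprn_ge0. Qed.

Lemma power_eq0 (f: T -> R): Loo f -> {ae mu, forall z, D z -> f z = 0} -> power f = 0.
move=> Lf f0; have e0: {ae mu, forall z, D z -> `|f z| ^+ p.+1 = 0}.
 by apply: filterS f0 => z h Dz; rewrite h// normr0 expr0n.
rewrite /power (Rint_ae_eq mD (in_L1_meas (Loo_pow mD fD p.+1 Lf)) (measurable_cst _) e0).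
by rewrite Rintegral_cst// mul0r.
Qed.

Lemma power_cvg (f_: nat -> T -> R) (f: T -> R) (B: R): (forall n, Loo (f_ n)) -> Loo f ->
 (forall n, {ae mu, forall z, D z -> `|f_ n z| <= B}) ->
 {ae mu, forall z, D z -> f_ n z @[n --> \oo] --> f z} ->
 forall e, 0 < e -> \forall n \near \oo, power (fun z => -1 * f_ n z + f z) <= e.
move=> Lf_ Lf fB cv e e0; have [mf [Bf fBf]] := Lf.
have Ld n: Loo (fun z => -1 * f_ n z + f z) by exact: Loo_lin.
have mpow n: mfun D (fun z => `|-1 * f_ n z + f z| ^+ p.+1).
 exact: in_L1_meas (Loo_pow mD fD p.+1 (Ld n)).
have aB: {ae mu, forall z, D z -> forall n, `| `|-1 * f_ n z + f z| ^+ p.+1| <= (B + Bf) ^+ p.+1}.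
 have aB := ae_foralln fB; apply: filterS2 aB fBf => z h1 h2 Dz n.
 have b1 := h1 n Dz; have b2 := h2 Dz.
 rewrite ger0_norm ?exprn_ge0// lerXn2r ?nnegrE ?addr_ge0 ?(le_trans _ b1) ?(le_trans _ b2)//.
 by apply: le_trans (ler_normD _ _) _; rewrite mulN1r normrN lerD.
have cv0: {ae mu, forall z, D z -> `|-1 * f_ n z + f z| ^+ p.+1 @[n --> \oo] --> (0: R)}.
 apply: filterS cv => z h Dz; have {}h := h Dz.
 have c0: (-1 * f_ n z + f z) @[n --> \oo] --> (0: R).
  by rewrite -(subrr (f z)); under eq_fun do rewrite mulN1r addrC; apply: cvgB =>//; exact: cvg_cst.
 have cc: {for 0, continuous (fun y: R => `|y| ^+ p.+1)}.
  apply: (@continuous_comp _ _ _ (fun y: R => `|y|) (fun y => y ^+ p.+1)); first exact: norm_continuous.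
  exact: exprn_continuous.
 by have := cvg_comp _ _ c0 cc; rewrite /= normr0 expr0n.
have [_ /cvgrPdist_le/(_ e e0)] := Rdominated mD mpow (measurable_cst _) (in_L1_cst mD fD _) aB cv0.
rewrite Rintegral_cst// mul0r; apply: filterS => n; rewrite sub0r normrN.
by apply: le_trans; exact: ler_norm.
Qed.
(** [S f a] reads: a is a value of the functional at f. It is a relation because uniqueness of a is
    a consequence, obtained in [Sc_eq] from linearity and the bound. *)
Variable S: (T -> R) -> R -> Prop.
Hypothesis SLoo: forall f a, S f a -> Loo f.
Hypothesis Slin: forall c f a g b, S f a -> S g b -> S (fun z => c * f z + g z) (c * a + b).
Variable B: R.
Hypothesis B0: 0 <= B.
Hypothesis Sbound: forall f a, S f a -> `|a| <= B * (1 + power f).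
(** Density as an induction principle: a class that contains the domain of [S] and is stable under
    linear combinations and bounded limits contains everything. It serves twice, to extend the
    functional and to prove the density unique. *)
Hypothesis Sdense: forall K: (T -> R) -> Prop, (forall f, K f -> Loo f) ->
 (forall c f g, K f -> K g -> K (fun z => c * f z + g z)) ->
 (forall (f_: nat -> T -> R) (f: T -> R) (B: R), (forall n, K (f_ n)) ->
  mfun D f -> (forall n, {ae mu, forall z, D z -> `|f_ n z| <= B}) ->
  {ae mu, forall z, D z -> f_ n z @[n --> \oo] --> f z} -> K f) ->
 (forall f a, S f a -> K f) -> forall f, Loo f -> K f.

(* The bound is not homogeneous; applied to [k f] with [k] large it controls [a] by [power f]. *)
Lemma S_cont e: 0 < e -> exists2 d, 0 < d & forall f a, S f a -> power f <= d -> `|a| <= e.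
move=> e0; pose k := 2 * B / e + 1; have k0: 0 < k by rewrite ltr_wpDl// divr_ge0 ?mulr_ge0// ltW.
have k1: 0 < B * k ^+ p.+1 + 1 by rewrite ltr_wpDl// mulr_ge0// exprn_ge0// ltW.
exists (e * k / 2 / (B * k ^+ p.+1 + 1)); first by rewrite !divr_gt0// mulr_gt0.
move=> f a Sf Pf; have S0 := Slin (-1) Sf Sf.
have Sk := Slin k Sf S0; have := Sbound Sk.
have ->: k * a + (-1 * a + a) = k * a by ring.
have ->: power (fun z => k * f z + (-1 * f z + f z)) = k ^+ p.+1 * power f.
 rewrite /power -(RintegralZl _ mD (Loo_pow mD fD p.+1 (SLoo Sf))); apply: eq_Rintegral => z _.
 by rewrite mulN1r addNr addr0 normrM exprMn gtr0_norm.
rewrite normrM gtr0_norm// => h; rewrite -(ler_pM2l k0); apply: le_trans h _.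
rewrite mulrDr mulr1 mulrA; have: B * k ^+ p.+1 * power f <= e * k / 2.
 move: Pf; rewrite ler_pdivlMr// => Pf; apply: le_trans Pf; rewrite mulrC ler_wpM2l ?power_ge0//.
 by rewrite lerDl.
move=> h; apply: le_trans (lerD (lexx _) h) _.
have ->: k * e = e * k / 2 + e * k / 2 by field.
rewrite lerD2r /k mulrDr mulrCA divff ?gt_eqF// mulr1.
have ->: (2 * B + e * 1) / 2 = B + e / 2 by field.
by rewrite lerDl divr_ge0// ltW.
Qed.
(** The closure of the graph of [S], for [power] on functions and the absolute value on numbers. *)
Definition Sc h L := Loo h /\ forall e, 0 < e -> exists f a,
 [/\ S f a, power (fun z => -1 * f z + h z) <= e & `|a - L| <= e].

Lemma Sc_cont e: 0 < e -> exists2 d, 0 < d & forall h L, Sc h L -> power h <= d -> `|L| <= e.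
move=> e0; have [d d0 hd] := S_cont (divr_gt0 e0 (ltr0Sn R 1)).
have k0: 0 < 2 ^+ p.+1 * (1 + 1) :> R by rewrite mulr_gt0// exprn_gt0.
exists (d / (2 ^+ p.+1 * (1 + 1))); first by rewrite divr_gt0.
move=> h L [Lh happ] Ph.
have m0: 0 < Num.min (d / (2 ^+ p.+1 * (1 + 1))) (e / 2) by rewrite lt_min !divr_gt0.
have [f [a [Sf Pf aL]]] := happ _ m0; move: Pf aL; rewrite !le_min => /andP[Pf _] /andP[_ aL].
have af: `|a| <= e / 2.
 apply: (hd f a Sf); have L1 := Loo_lin (-1) (SLoo Sf) Lh.
 apply: le_trans (power_comb (c := -1) (f := f) L1 Lh _) _; first by move=> z _; ring.
 rewrite normrN1 expr1n mul1r; apply: le_trans (ler_wpM2l _ (lerD Pf Ph)) _; first exact: exprn_ge0.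
 by rewrite halves// exprn_gt0.
have ->: L = a - (a - L) by ring.
by apply: le_trans (ler_normB _ _) _; rewrite [leRHS](splitr e) lerD.
Qed.

Lemma S_Sc f a: S f a -> Sc f a.
move=> Sf; split=> [|e e0]; first exact: SLoo Sf.
exists f, a; split=> //; last by rewrite subrr normr0 ltW.
rewrite power_eq0 ?(ltW e0)//; first exact: Loo_lin (SLoo Sf) (SLoo Sf).
by apply/aeW => z _; rewrite mulN1r addNr.
Qed.

Lemma Sc_lin c h L k M: Sc h L -> Sc k M -> Sc (fun z => c * h z + k z) (c * L + M).
move=> [Lh ha] [Lk ka]; split=> [|e e0]; first exact: Loo_lin.
pose q := 2 ^+ p.+1 * (`|c| ^+ p.+1 + 1) + (`|c| + 1).
have q1: 0 <= 2 ^+ p.+1 * (`|c| ^+ p.+1 + 1) by rewrite mulr_ge0 ?addr_ge0 ?exprn_ge0.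
have q2: 0 <= `|c| + 1 by rewrite addr_ge0.
have q0: 0 < q by rewrite /q ltr_wpDl// ltr_wpDl.
pose d := e / q; have d0: 0 < d by rewrite divr_gt0.
have dq: q * d = e by rewrite mulrC divfK ?gt_eqF.
have [f [a [Sf Pf aL]]] := ha d d0; have [g [b [Sg Pg bM]]] := ka d d0.
exists (fun z => c * f z + g z), (c * a + b); split; first exact: Slin.
- have L1 := Loo_lin (-1) (SLoo Sf) Lh; have L2 := Loo_lin (-1) (SLoo Sg) Lk.
 apply: le_trans (power_comb (c := c) L1 L2 _) _; first by move=> z _; ring.
 rewrite -dq; apply: (@le_trans _ _ (2 ^+ p.+1 * (`|c| ^+ p.+1 + 1) * d)).
  by rewrite -mulrA ler_wpM2l ?exprn_ge0// mulrDl mul1r lerD// ler_wpM2l ?exprn_ge0.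
 by rewrite ler_wpM2r ?(ltW d0)// lerDl.
have ->: c * a + b - (c * L + M) = c * (a - L) + (b - M) by ring.
apply: le_trans (ler_normD _ _) _; rewrite normrM -dq.
apply: (@le_trans _ _ ((`|c| + 1) * d)); first by rewrite mulrDl mul1r lerD// ler_wpM2l.
by rewrite ler_wpM2r ?(ltW d0)// lerDr.
Qed.

Lemma Sc_eq h k L M: Sc h L -> Sc k M -> {ae mu, forall z, D z -> h z = k z} -> L = M.
move=> Sh Sk hk; have Sd := Sc_lin (-1) Sh Sk; have [Ld _] := Sd.
have P0: power (fun z => -1 * h z + k z) = 0.
 by apply: power_eq0 =>//; apply: filterS hk => z e Dz; rewrite e// mulN1r addNr.
apply/eqP; rewrite -subr_eq0 -normr_le0 distrC; apply/ler_addgt0Pr => e e0; rewrite add0r.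
have [d d0 hd] := Sc_cont e0; have := hd _ _ Sd; rewrite P0 mulN1r addrC; apply; exact: ltW.
Qed.

(** Bounded convergence makes [power] of the differences tend to 0, so the values form a Cauchy
    sequence by [Sc_cont], and the limit pair stays in the closed graph. *)
Lemma Sc_lim (f_: nat -> T -> R) (f: T -> R) (Bf: R) (L_: nat -> R): (forall n, Sc (f_ n) (L_ n)) ->
 mfun D f -> (forall n, {ae mu, forall z, D z -> `|f_ n z| <= Bf}) ->
 {ae mu, forall z, D z -> f_ n z @[n --> \oo] --> f z} ->
 exists2 L, Sc f L & L_ n @[n --> \oo] --> L.
move=> Sf mf fB cv; have Lf_ n: Loo (f_ n) by have [] := Sf n.
have Lf: Loo f.
 split=> //; exists Bf; apply: filterS2 (ae_foralln fB) cv => z h1 h2 Dz.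
 apply/ler_addgt0Pr => e e0; have /cvgrPdist_le/(_ e e0)[n _ hn] := h2 Dz.
 have {}hn := hn n (leqnn _); have b := h1 n Dz.
 by rewrite -[f z](subrK (f_ n z)) addrC; apply: le_trans (ler_normD _ _) _; rewrite lerD.
have pc := power_cvg Lf_ Lf fB cv.
have k0: 0 < 2 ^+ p.+1 * (1 + 1) :> R by rewrite mulr_gt0// exprn_gt0.
have cau: cvg (L_ n @[n --> \oo]).
 apply/cauchy_cvgP; apply: cauchy_exP => e e0.
 have [d d0 hd] := Sc_cont (divr_gt0 e0 (ltr0Sn R 1)).
 have [n0 _ hn] := pc _ (divr_gt0 d0 k0); exists (L_ n0); exists n0 =>// n n0n.
 rewrite /= /ball /=; apply: (@le_lt_trans _ _ (e / 2)); last by rewrite ltr_pdivrMr// mulr_natr mulr2n ltrDl.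
 have := hd _ _ (Sc_lin (-1) (Sf n) (Sf n0)); rewrite mulN1r addrC; apply.
 have L1 := Loo_lin (-1) (Lf_ n) Lf; have L2 := Loo_lin (-1) (Lf_ n0) Lf.
 apply: le_trans (power_comb (c := -1) (x := fun z => -1 * f_ n0 z + f z) L2 L1 _) _.
  by move=> z _; ring.
 rewrite normrN1 expr1n mul1r; apply: le_trans (ler_wpM2l _ (lerD (hn n0 (leqnn _)) (hn n n0n))) _.
  exact: exprn_ge0.
 by rewrite halves// exprn_gt0.
have {cau}[L cL]: exists L: R, L_ n @[n --> \oo] --> L by exists (lim (L_ n @[n --> \oo])).
exists L =>//; split=> // e e0; have e2: 0 < e / 2 by rewrite divr_gt0.
pose d := e / (2 ^+ p.+1 * (1 + 1)); have d0: 0 < d by rewrite divr_gt0.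
have /cvgrPdist_le/(_ _ e2) cL' := cL.
have [n [Pn Ln]]: exists n, power (fun z => -1 * f_ n z + f z) <= d /\ `|L - L_ n| <= e / 2.
 by have [n1 _ h] := filterI (pc _ d0) cL'; exists n1; apply: h; exact: leqnn.
have m0: 0 < Num.min d (e / 2) by rewrite lt_min d0.
have [Lfn happ] := Sf n; have [g [a [Sg Pg aL]]] := happ _ m0.
move: Pg aL; rewrite !le_min => /andP[Pg _] /andP[_ aL]; exists g, a; split=> //.
 have L1 := Loo_lin (-1) (SLoo Sg) Lfn; have L2 := Loo_lin (-1) Lfn Lf.
 apply: le_trans (power_comb (c := 1) L1 L2 _) _; first by move=> z _; ring.
 rewrite normr1 expr1n mul1r; apply: le_trans (ler_wpM2l _ (lerD Pg Pn)) _; first exact: exprn_ge0.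
 by rewrite halves// exprn_gt0.
have ->: a - L = (a - L_ n) - (L - L_ n) by ring.
by apply: le_trans (ler_normB _ _) _; rewrite [leRHS](splitr e) lerD.
Qed.

Lemma Sc_total h: Loo h -> exists L, Sc h L.
apply: (Sdense (K := fun h => exists L, Sc h L)).
- by move=> f [L []].
- by move=> c f g [L hL] [M hM]; exists (c * L + M); exact: Sc_lin.
- move=> f_ f Bf hf mf fB cv.
 have [L hL _] := Sc_lim (fun n => projT2 (cid (hf n))) mf fB cv; by exists L.
- by move=> f a Sf; exists a; exact: S_Sc.
Qed.
Definition lam h := xget 0 [set L | Sc h L].
Lemma lamP h: Loo h -> Sc h (lam h).
by move=> /Sc_total[L hL]; exact: (xgetI 0 hL). Qed.
Lemma lam_eq h L: Sc h L -> lam h = L.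
by move=> hL; have [Lh _] := hL; apply: (Sc_eq (lamP Lh) hL); exact: aeW. Qed.
Lemma lam_indic_ae A A': measurable A -> measurable A' ->
 {ae mu, forall z, D z -> \1_A z = \1_A' z :> R} -> lam \1_A = lam \1_A'.
by move=> mA mA'; apply: Sc_eq; apply: lamP; exact: Loo_indic. Qed.

Lemma lam_null A: measurable A -> {ae mu, forall z, D z -> \1_A z = 0 :> R} -> lam \1_A = 0.
move=> mA A0; have h := lamP (Loo_indic mu D mA).
have h0 := Sc_lin (-1) h h; rewrite mulN1r addNr in h0.
by apply: (Sc_eq h h0); apply: filterS A0 => z e Dz; rewrite e// mulr0 addr0.
Qed.
Definition lam_charge (A: set T): \bar R := (lam \1_A)%:E.
Let lam_charge0: lam_charge set0 = 0%E.
by congr (_%:E); apply: lam_null =>//; apply/aeW => z _; rewrite indic0. Qed.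
Let lam_charge_fin A: measurable A -> lam_charge A \is a fin_num.
by []. Qed.
(** Partial sums of disjoint indicators are bounded by 1 and converge pointwise, so [Sc_lim] gives
    countable additivity. *)
Let lam_charge_additive: semi_sigma_additive lam_charge.
move=> F mF tF mU; under eq_fun do rewrite big_mkord sumEFin.
apply: cvg_EFin; first exact: nearW.
pose f n z: R := \sum_(k < n) \1_(F k) z.
have Sf n: Sc (f n) (\sum_(k < n) lam \1_(F k)).
 elim: n => [|n IH].
  have h := lamP (Loo_indic mu D (@measurable0 _ T)); have := Sc_lin (-1) h h.
  rewrite mulN1r addNr /f big_ord0; congr Sc; apply/funext => z.
  by rewrite big_ord0 mulN1r addNr.
 have := Sc_lin 1 IH (lamP (Loo_indic mu D (mF n))); rewrite mul1r /f big_ord_recr /=; congr Sc.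
 by apply/funext => z; rewrite big_ord_recr /= mul1r.
have mU1: mfun D (\1_(\bigcup_k F k): T -> R) by have [] := Loo_indic mu D mU.
have fB n: {ae mu, forall z, D z -> `|f n z| <= 1} by apply/aeW => z _; exact: sum_indic_01.
have cv: {ae mu, forall z, D z -> f n z @[n --> \oo] --> (\1_(\bigcup_k F k) z: R)}.
 by apply/aeW => z _; exact: sum_indic_cvg.
have [L hL cL] := Sc_lim Sf mU1 fB cv.
by rewrite (lam_eq hL).
Qed.

HB.instance Definition _ := isCharge.Build _ T R lam_charge lam_charge0 lam_charge_fin lam_charge_additive.

Lemma lam_charge_dominated: lam_charge `<< mu.
apply/null_content_dominatesP => A mA A0; congr (_%:E); apply: lam_null =>//.
by exists A; split=> // z /= h; apply: contrapT => zA; apply: h => _; rewrite indicE memNset.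
Qed.
Definition density z := fine (Radon_Nikodym (lam_charge: {charge set T -> \bar R}) mu z).
Lemma densityE z: (density z)%:E = Radon_Nikodym (lam_charge: {charge set T -> \bar R}) mu z.
by rewrite fineK// Radon_Nikodym_fin_num//; exact: lam_charge_dominated. Qed.

Lemma density_L1: in_L1 mu D density.
rewrite /in_L1 (_: EFin \o density = Radon_Nikodym (lam_charge: {charge set T -> \bar R}) mu); last first.
 by apply/funext => z; exact: densityE.
apply: (integrableS measurableT mD (@subsetT _ _)); apply: Radon_Nikodym_integrable.
exact: lam_charge_dominated.
Qed.

Lemma L1_Loo_cvg (u: T -> R) (f_: nat -> T -> R) (f: T -> R) (Bf: R): in_L1 mu D u ->
 (forall n, Loo (f_ n)) -> mfun D f -> (forall n, {ae mu, forall z, D z -> `|f_ n z| <= Bf}) ->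
 {ae mu, forall z, D z -> f_ n z @[n --> \oo] --> f z} ->
 \int[mu]_(z in D) (u z * f_ n z) @[n --> \oo] --> \int[mu]_(z in D) (u z * f z).
move=> u1 Lf mf fB cv; have mu_ := in_L1_meas u1.
have g1: in_L1 mu D (fun z => Bf * `|u z|) by apply: (in_L1Z mD); exact: in_L1_abs.
have b1: {ae mu, forall z, D z -> forall n, `|u z * f_ n z| <= Bf * `|u z|}.
 by apply: filterS (ae_foralln fB) => z b Dz n; rewrite normrM mulrC ler_wpM2r// b.
have c1: {ae mu, forall z, D z -> u z * f_ n z @[n --> \oo] --> u z * f z}.
 by apply: filterS cv => z h Dz; apply: cvgMl_tmp; exact: h.
by have [] := Rdominated mD (fun n => measurable_funM mu_ (Lf n).1) (measurable_funM mu_ mf) g1 b1 c1.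
Qed.

Lemma lamE h: Loo h -> lam h = \int[mu]_(z in D) (density z * h z).
move=> Lh; pose K h := Loo h /\ lam h = \int[mu]_(z in D) (density z * h z).
suff []: K h by []; apply: (bnd_class (mu := mu) (D := D) (K := K) mD) Lh.
- move=> c f g [Lf Ef] [Lg Eg]; split; first exact: Loo_lin.
 rewrite (lam_eq (Sc_lin c (lamP Lf) (lamP Lg))) Ef Eg.
 have i1 := L1_Loo mD density_L1 Lf; have i2 := L1_Loo mD density_L1 Lg.
 rewrite -(RintegralZl _ mD i1) -(RintegralD mD (in_L1Z mD c i1) i2).
 by apply: eq_Rintegral => z _; ring.
- move=> f_ f Bf Kf mf fB cv; have Lf_ n := (Kf n).1.
 have [L hL cL] := Sc_lim (fun n => lamP (Lf_ n)) mf fB cv; have [Lf _] := hL; split=> //.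
 rewrite (lam_eq hL); have cI := L1_Loo_cvg density_L1 Lf_ mf fB cv.
 have e: (fun n => lam (f_ n)) = fun n => \int[mu]_(z in D) (density z * f_ n z).
  by apply/funext => n; exact: (Kf n).2.
 by rewrite e in cL; exact: (cvg_unique (@Rhausdorff R) cL cI).
move=> A mA; split; first exact: Loo_indic.
have mAD: measurable (D `&` A) by exact: measurableI.
rewrite (lam_indic_ae mA mAD); last first.
 by apply/aeW => z Dz; rewrite !indicE in_setI (mem_set Dz).
rewrite -[LHS]/(fine (lam_charge (D `&` A))) (Radon_Nikodym_integral lam_charge_dominated mAD).
rewrite integral_mkcondr; congr fine; apply: eq_integral => z _.
by rewrite patchE indicE; case: (z \in A); rewrite ?mulr1 ?mulr0// densityE.
Qed.

Lemma representation: exists2 u, in_L1 mu D u /\ (forall f a, S f a -> \int[mu]_(z in D) (u z * f z) = a) &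
 forall v, in_L1 mu D v -> (forall f a, S f a -> \int[mu]_(z in D) (v z * f z) = a) ->
 {ae mu, forall z, D z -> v z = u z}.
have rep f a: S f a -> \int[mu]_(z in D) (density z * f z) = a.
 by move=> Sf; rewrite -(lamE (SLoo Sf)); exact: lam_eq (S_Sc Sf).
exists density; first by split=> //; exact: density_L1.
move=> v v1 vrep; pose w z := v z - density z; have w1: in_L1 mu D w by exact: (in_L1B mD v1 density_L1).
have orth h: Loo h -> \int[mu]_(z in D) (w z * h z) = 0.
 move=> Lh; pose K h := Loo h /\ \int[mu]_(z in D) (w z * h z) = 0.
 suff []: K h by []; apply: (Sdense (K := K)) Lh.
 - by move=> f [].
 - move=> c f g [Lf Ef] [Lg Eg]; split; first exact: Loo_lin.
  have i1 := L1_Loo mD w1 Lf; have i2 := L1_Loo mD w1 Lg.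
  transitivity (\int[mu]_(z in D) (c * (w z * f z) + w z * g z)); first by apply: eq_Rintegral => z _; ring.
  by rewrite (RintegralD mD (in_L1Z mD c i1) i2) (RintegralZl _ mD i1) Ef Eg mulr0 addr0.
 - move=> f_ f Bf Kf mf fB cv; have Lf_ n := (Kf n).1.
  have [L hL _] := Sc_lim (fun n => lamP (Lf_ n)) mf fB cv; have [Lf _] := hL; split=> //.
  have cI := L1_Loo_cvg w1 Lf_ mf fB cv; apply: (cvg_unique (@Rhausdorff R) cI).
  have e: (fun n => \int[mu]_(z in D) (w z * f_ n z)) = fun=> 0 by apply/funext => n; exact: (Kf n).2.
  by rewrite e; exact: cvg_cst.
 - move=> f a Sf; split; first exact: SLoo Sf.
  have Lf := SLoo Sf; have i1 := L1_Loo mD v1 Lf; have i2 := L1_Loo mD density_L1 Lf.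
  transitivity (\int[mu]_(z in D) (v z * f z - density z * f z)); first by apply: eq_Rintegral => z _; rewrite mulrBl.
  by rewrite (RintegralB mD i1 i2) (vrep f a Sf) (rep f a Sf) subrr.
pose sg z: R := if w z < 0 then -1 else 1.
have mw := in_L1_meas w1.
have Lsg: Loo sg.
 split; last by exists 1; apply/aeW => z _; rewrite /sg; case: ifP; rewrite ?normrN normr1.
 apply: measurable_fun_if =>//; try exact: measurable_cst.
 by apply: measurable_fun_ltr =>//; exact: measurable_cst.
have := orth sg Lsg; have ->: \int[mu]_(z in D) (w z * sg z) = \int[mu]_(z in D) `|w z|.
 apply: eq_Rintegral => z _; rewrite /sg; case: ltP => h; first by rewrite mulrN1 ltr0_norm.
 by rewrite mulr1 ger0_norm.
move=> W0; have mw': mfun D (EFin \o w) by exact/mEFinP.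
have fw: (\int[mu]_(z in D) `|w z|%:E)%E \is a fin_num by apply: integrable_fin_num =>//; exact: in_L1_abs.
have: (\int[mu]_(z in D) `|(EFin \o w) z| = 0)%E.
 by rewrite -[RHS]/((0: R)%:E) -W0 /Rintegral fineK.
move=> /(ae_eq_integral_abs mu mD mw'); apply: filterS => z h Dz.
by have := h Dz; rewrite /= => -[] /eqP; rewrite subr_eq0 => /eqP.
Qed.
End representation.

(** Hides the Hahn decomposition picked by [cid]: only two fixed finite measures remain, the same
    for all [D] and [f], so linearity and bounds can be read from them. *)
Lemma charge_intE d (T: measurableType d) (R: realType) (nu: {charge set T -> \bar R}) :
 exists m1 m2: {finite_measure set T -> \bar R}, forall D f,
  charge_integral nu D f = Rintegral m1 D f - Rintegral m2 D f.
rewrite /charge_integral; case: cid => P exN; case: cid => N' PN.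
by exists (jordan_pos PN), (jordan_neg PN).
Qed.

(** * Sobolev functions *)
Section open_domain.
Context {R: realType} {N: nat} {Omega: set 'cV[R]_N}.
Hypotheses (oO: open Omega) (fO: (lvec N Omega < +oo)%E) (bO: bounded_set Omega).
Notation vec := 'cV[R]_N.
Notation dx := (lvec N: {measure set vec -> \bar R}).
Notation "{ 'aeO' x , P }" := {ae dx, forall x, Omega x -> P} (x name).
Notation mO := (open_meas_vec oO).
Notation L2O := (L2 dx mO).
Notation E := (L2O * ('I_N -> L2O))%type.
Notation toL := (toL2 dx mO).
Notation dot2 := (@dotL _ _ _ dx Omega mO).
Notation cvgL := (ip_cvg dot2).
Section sobolev.
Implicit Types (u v w: E) (phi psi chi: vec -> R).
(** Elements of [E] are a function and a candidate gradient, a priori unrelated. The link is created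
    by [H1_0], the closure for this product of the pairs that come from test functions. *)
Definition ipE u v: R := dotL u.1 v.1 + \sum_i dotL (u.2 i) (v.2 i).

Lemma ipEDl u v w: ipE (u + v) w = ipE u w + ipE v w.
rewrite /ipE dotLDl addrACA; congr (_ + _); rewrite -big_split; apply: eq_bigr => i _.
exact: dotLDl.
Qed.
Lemma ipEZl c u v: ipE (c *: u) v = c * ipE u v.
by rewrite /ipE mulrDr mulr_sumr dotLZl; congr (_ + _); apply: eq_bigr => i _; exact: dotLZl. Qed.
Lemma ipEC u v: ipE u v = ipE v u.
by rewrite /ipE dotLC; congr (_ + _); apply: eq_bigr => i _; exact: dotLC. Qed.
Lemma ipE_ge0 u: 0 <= ipE u u.
by rewrite addr_ge0 ?dotL_ge0// sumr_ge0// => i _; exact: dotL_ge0. Qed.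
Lemma ipE_ge1 u: dotL u.1 u.1 <= ipE u u.
by rewrite lerDl sumr_ge0// => i _; exact: dotL_ge0. Qed.

Lemma ipE_ge2 u i: dotL (u.2 i) (u.2 i) <= ipE u u.
rewrite /ipE (bigD1 i)//= addrCA lerDl addr_ge0 ?dotL_ge0// sumr_ge0// => j _; exact: dotL_ge0.
Qed.

Lemma ipE_cvgP (u: nat -> E) v: ip_cvg ipE u v <->
 cvgL (fun n => (u n).1) v.1 /\ forall i, cvgL (fun n => (u n).2 i) (v.2 i).
split=> [h|[h1 h2]].
 split=> [e /h[n0 hn]|i e /h[n0 hn]]; exists n0 => n /hn; apply: le_lt_trans.
  exact: (ipE_ge1 (u n - v)).
 exact: (ipE_ge2 (u n - v) i).
move=> e e0; pose d := e / (2 * (N.+1%:R)).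
have d0: 0 < d by rewrite divr_gt0// mulr_gt0.
have [n0 hn0] := h1 _ d0.
have [t tP] := choice (fun i => h2 i _ d0).
exists (n0 + \sum_i t i)%N => n nn.
apply: (@le_lt_trans _ _ (d + \sum_(i < N) d)).
 apply: lerD; first by apply/ltW/hn0; apply: leq_trans nn; exact: leq_addr.
 apply: ler_sum => i _; apply/ltW/tP; apply: leq_trans nn.
 by rewrite (bigD1 i)//= addnCA leq_addr.
rewrite sumr_const card_ord -[X in X + _]mulr1n -mulrnDr add1n -mulr_natr /d.
have: (N.+1%:R: R) != 0 by rewrite pnatr_eq0.
move: (N.+1%:R: R) => k k0; have ->: e / (2 * k) * k = e / 2 by field.
by lra.
Qed.

Lemma ipE_complete (u: nat -> E): ip_cauchy ipE u -> exists v, ip_cvg ipE u v.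
move=> cu; have c1: ip_cauchy (@dotL _ _ _ dx Omega mO) (fun n => (u n).1).
 move=> e /cu[n0 hn]; exists n0 => m n m0 n1; apply: le_lt_trans (hn m n m0 n1).
 exact: (ipE_ge1 (u m - u n)).
have c2 i: ip_cauchy (@dotL _ _ _ dx Omega mO) (fun n => (u n).2 i).
 move=> e /cu[n0 hn]; exists n0 => m n m0 n1; apply: le_lt_trans (hn m n m0 n1).
 exact: (ipE_ge2 (u m - u n) i).
have [f [_ [hf _ _]]] := riesz_fischer fO c1.
have ex i: exists g: L2O, cvgL (fun n => (u n).2 i) g.
 by have [g [_ [hg _ _]]] := riesz_fischer fO (c2 i); exists g.
have [g hg] := choice ex.
by exists (f, g); apply/ipE_cvgP.
Qed.

Lemma in_L2_test phi: test_function Omega phi -> in_L2 dx Omega phi.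
move=> tp; have [C C0 pC] := tf_bnd tp.
apply: (in_L2_bnd mO fO (C := C)); last by apply/aeW => x _.
by apply: mfunTS; apply: cont_vec; case: tp => /sm_cont.
Qed.
Lemma in_L2_test_derive phi i: test_function Omega phi -> in_L2 dx Omega ('D_(ei i) phi).
by move=> /(tf_derive (ei i)); exact: in_L2_test. Qed.

Fact tstE_subproof: {F: (vec -> R) -> E |
 forall phi, F phi = (toL phi, fun i => toL ('D_(ei i) phi))}.
by eexists. Qed.
Definition tstE: (vec -> R) -> E := sval tstE_subproof.
Lemma tstE_E phi: tstE phi = (toL phi, fun i => toL ('D_(ei i) phi)).
exact: (svalP tstE_subproof). Qed.
Definition testE: set E := [set u | exists2 phi, test_function Omega phi & u = tstE phi].
Definition H1_0: set E := ip_closure ipE testE.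
Lemma tstE1 phi: test_function Omega phi -> forall x, (tstE phi).1 x = phi x.
by move=> tp x; rewrite tstE_E toL2x//; exact: in_L2_test. Qed.
Lemma tstE2 phi i: test_function Omega phi -> forall x, (tstE phi).2 i x = 'D_(ei i) phi x.
by move=> tp x; rewrite tstE_E toL2x//; exact: in_L2_test_derive. Qed.

Lemma isd_lincomb phi psi (c: R) (x v: vec): smooth phi -> smooth psi ->
 is_derive x v (fun x => c * phi x + psi x) (c * 'D_v phi x + 'D_v psi x).
move=> sp sq; have dp := @sm_der _ _ _ x v sp.
have dq := @sm_der _ _ _ x v sq.
have hp: is_derive x v phi ('D_v phi x) by exact: DeriveDef.
have hq: is_derive x v psi ('D_v psi x) by exact: DeriveDef.
exact: (is_deriveD (is_deriveZ c hp) hq).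
Qed.

Lemma tstE_ext phi u: test_function Omega phi -> (forall x, u.1 x = phi x) ->
 (forall i x, u.2 i x = 'D_(ei i) phi x) -> u = tstE phi.
move=> tp; case: u => v V /= h1 h2; rewrite tstE_E; congr pair.
 by apply: L2_eqP => x; rewrite h1 toL2E//; exact: in_L2_test.
by apply/funext => i; apply: L2_eqP => x; rewrite h2 toL2E//; exact: in_L2_test_derive.
Qed.

Lemma testE_subsp: subsp_of testE.
split.
 exists (fun=> 0); first exact: tf0.
 apply: tstE_ext; first exact: tf0.
  by [].
 by move=> i x; rewrite derive_cst.
move=> c u v [phi tp ->] [psi tq ->].
have t: test_function Omega (fun x => c * phi x + psi x).
 exact: tfD (tfZ c tp) tq.
exists (fun x => c * phi x + psi x); [exact: t|apply: (tstE_ext t) => [x|i x]].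
 by rewrite -[LHS]/(c * (tstE phi).1 x + (tstE psi).1 x) (tstE1 tp) (tstE1 tq).
rewrite -[LHS]/(c * (tstE phi).2 i x + (tstE psi).2 i x) (tstE2 i tp) (tstE2 i tq).
by have [_ ->] := isd_lincomb c x (ei i) (tf_smooth tp) (tf_smooth tq).
Qed.
Lemma H_subsp: subsp_of H1_0.
exact: (closure_subsp ipEDl ipEZl ipEC ipE_ge0 testE_subsp). Qed.

Lemma H_test phi: test_function Omega phi -> H1_0 (tstE phi).
move=> tp e e0; exists (tstE phi); first by exists phi.
by rewrite subrr -(scale0r 0) ipEZl mul0r.
Qed.

Lemma H_lim (u: nat -> E) v: (forall n, H1_0 (u n)) ->
 cvgL (fun n => (u n).1) v.1 -> (forall i, cvgL (fun n => (u n).2 i) (v.2 i)) -> H1_0 v.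
move=> Hu c1 c2; have /ipE_cvgP uv := conj c1 c2.
move=> e e0; have [n0 hn] := uv _ (divr_gt0 e0 (ltr0n _ 4)).
have [w tw hw] := Hu n0 _ (divr_gt0 e0 (ltr0n _ 4)); exists w =>//.
have ->: v - w = - (u n0 - v) + (u n0 - w) by rewrite opprB addrA subrK.
apply: le_lt_trans (ip_sq_le ipEDl ipEZl ipEC ipE_ge0 _ _) _.
rewrite (ipNl ipEZl) (ipNr ipEZl ipEC) opprK; have := hn n0 (leqnn _).
by move: (ipE (u n0 - v) _) (ipE (u n0 - w) _) hw => p q; lra.
Qed.

(** Convergence almost everywhere is included because the chain rule composes u with derivatives
    that are merely continuous, where convergence in L2 alone does not pass through. *)
Lemma H_seq u: H1_0 u -> exists phi_: nat -> vec -> R,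
 [/\ forall n, test_function Omega (phi_ n), cvgL (fun n => (tstE (phi_ n)).1) u.1,
  forall i, cvgL (fun n => (tstE (phi_ n)).2 i) (u.2 i) &
  {aeO x, phi_ n x @[n --> \oo] --> u.1 x}].
move=> Hu; have ex n: exists phi, test_function Omega phi /\
  ipE (u - tstE phi) (u - tstE phi) < n.+1%:R^-1.
 have n0: (0: R) < n.+1%:R^-1 by rewrite invr_gt0.
 by have [_ [phi tp ->] h] := Hu _ n0; exists phi.
have [f fP] := choice ex.
have cv: ip_cvg ipE (fun n => tstE (f n)) u.
 move=> e e0; have [n0 hn0] := nat_above (e^-1).
 exists n0 => n nn; have [_ h] := fP n.
 rewrite -opprB (ipNl ipEZl) (ipNr ipEZl ipEC) opprK; apply: lt_trans h _.
 rewrite invf_plt ?posrE//; apply: lt_le_trans hn0 _; by rewrite ler_nat.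
have [c1 c2] := (ipE_cvgP _ _).1 cv.
have [s [sk cs]] := cvgL_ae fO c1.
exists (fun n => f (s n)); split => [n||i|].
- by case: (fP (s n)).
- by move=> e /c1[n0 hn]; exists n0 => n nn; apply: hn; exact: leq_trans (sk n).
- by move=> e /(c2 i)[n0 hn]; exists n0 => n nn; apply: hn; exact: leq_trans (sk n).
apply: filterS cs => x H Dx.
rewrite (_: (fun n => f (s n) x) = (fun k => (tstE (f (s k))).1 x)); first exact: H.
by apply/funext => k; rewrite tstE1//; case: (fP (s k)).
Qed.
End sobolev.

(** * Chain rule and truncations in H1_0 *)

Section chain_rule.
Implicit Types (chi l phi: vec -> R) (be ga b: R -> R).
(** The function chi be(u - l) with its formal gradient. [ga] stands for the derivative of [be] but
    is a separate argument, so that functions with a kink such as [pos] are covered. *)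
Definition chainE chi l be ga (u: E): E :=
 (toL (fun x => chi x * be (u.1 x - l x)),
  fun i => toL (fun x => 'D_(ei i) chi x * be (u.1 x - l x) +
   chi x * (ga (u.1 x - l x) * (u.2 i x - 'D_(ei i) l x)))).
(** The bounds are asked on [Omega] only, because [l] will be a paraboloid. *)
Definition chain_ok chi l (C: R) := [/\ smooth chi, smooth l, 0 <= C,
 forall x, Omega x -> `|chi x| <= C /\ `|l x| <= C &
 forall i x, Omega x -> `|'D_(ei i) chi x| <= C /\ `|'D_(ei i) l x| <= C].
Definition lip be (C: R) := forall s t, `|be s - be t| <= C * `|s - t|.

Lemma lip_meas be C: lip be C -> mfun setT be.
move=> lb; apply: continuous_measurable_fun => s; apply/cvgrPdist_lt => e e0.
have C1: 0 < `|C| + 1 by rewrite ltr_wpDl.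
exists (e / (`|C| + 1)) => [|t st]; first by rewrite /= divr_gt0.
apply: le_lt_trans (lb s t) _.
apply: (@le_lt_trans _ _ (`|C| * `|s - t|)); first by rewrite ler_wpM2r// ler_norm.
apply: (@le_lt_trans _ _ ((`|C| + 1) * `|s - t|)); first by rewrite ler_wpM2r// lerDl.
by rewrite mulrC -ltr_pdivlMr.
Qed.

Section fixed.
Variables (chi l: vec -> R) (C: R).
Hypothesis ok: chain_ok chi l C.
Let mchi: mfun Omega chi.
by case: ok => s _ _ _ _; apply: mfunTS; apply: cont_vec; exact: sm_cont. Qed.
Let ml: mfun Omega l.
by case: ok => _ s _ _ _; apply: mfunTS; apply: cont_vec; exact: sm_cont. Qed.
Let mDchi i: mfun Omega ('D_(ei i) chi).
by case: ok => s _ _ _ _; apply: mfunTS; apply: cont_vec; exact: sm_cont (sm_derive _ s). Qed.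
Let mDl i: mfun Omega ('D_(ei i) l).
by case: ok => _ s _ _ _; apply: mfunTS; apply: cont_vec; exact: sm_cont (sm_derive _ s). Qed.

Lemma in_L2_lip be (f: L2O): lip be C -> in_L2 dx Omega (fun x => be (f x - l x)).
move=> lb; have [_ _ C0 bnd _] := ok.
have mf: mfun Omega f by case: (L2P f).
have mb: mfun Omega (fun x => be (f x - l x)).
 by apply: mcomp (lip_meas lb) _; exact: measurable_funB.
pose K := C * C + `|be 0|.
have K0: 0 <= K by rewrite addr_ge0// mulr_ge0.
apply: in_L2P =>//.
have i1: in_L1 dx Omega (fun x => 2 * (C ^+ 2 * f x ^+ 2) + 2 * K ^+ 2).
 apply: (in_L1D mO); last exact: (in_L1_cst mO fO).
 by apply: (in_L1Z mO); apply: (in_L1Z mO); exact: in_L2_sq (L2P f).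
apply: (in_L1_le mO _ _ i1); first exact: measurable_funX.
move=> x Ox; rewrite ger0_norm ?sqr_ge0//.
have h: `|be (f x - l x)| <= C * `|f x| + K.
 have h1 := lb (f x - l x) 0; rewrite subr0 in h1.
 have h2: `|f x - l x| <= `|f x| + C.
  by apply: le_trans (ler_normB _ _) _; rewrite lerD2l; case: (bnd x Ox).
 have h3: `|be (f x - l x)| <= `|be (f x - l x) - be 0| + `|be 0|.
  by have := ler_normD (be (f x - l x) - be 0) (be 0); rewrite subrK.
 by apply: le_trans h3 _; rewrite /K addrA lerD2r; apply: le_trans h1 _; rewrite -mulrDr ler_wpM2l.
rewrite -[leLHS]real_normK ?num_real// -[f x ^+ 2]real_normK ?num_real//.
move: (`|be _|) (`|f x|) h (normr_ge0 (be (f x - l x))) => p q h p0.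
have := sqr_ge0 (C * q - K); nra.
Qed.

Lemma in_L2_Dl i: in_L2 dx Omega ('D_(ei i) l).
case: ok => _ _ C0 _ bnd; apply: (in_L2_bnd mO fO (C := C)) =>//.
by apply/aeW => x /(bnd i)[].
Qed.

Lemma chain_meas be ga (f: L2O): mfun setT ga ->
 mfun Omega (fun x => chi x * ga (f x - l x)).
move=> mg; apply: measurable_funM =>//; apply: mcomp mg _.
by apply: measurable_funB =>//; case: (L2P f).
Qed.

Lemma chain_bnd ga (f: L2O): (forall s, `|ga s| <= C) ->
 forall x, Omega x -> `|chi x * ga (f x - l x)| <= C * C.
by case: ok => _ _ C0 bnd _ gC x Ox; rewrite normrM ler_pM//; case: (bnd x Ox).
Qed.
Variables (be ga: R -> R).
Hypotheses (lb: lip be C) (mg: mfun setT ga) (gC: forall s, `|ga s| <= C).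
Let p (u: E) := toL (fun x => be (u.1 x - l x)).
Let q (u: E) i := u.2 i - toL ('D_(ei i) l).
Let pE u x: p u x = be (u.1 x - l x).
by rewrite toL2x//; exact: in_L2_lip. Qed.
Let qE u i x: q u i x = u.2 i x - 'D_(ei i) l x.
by rewrite -[LHS]/(u.2 i x - toL ('D_(ei i) l) x) toL2x//; exact: in_L2_Dl. Qed.
Let chiC x: Omega x -> `|chi x| <= C.
by case: ok => _ _ _ bnd _ /bnd[]. Qed.
Let DchiC i x: Omega x -> `|'D_(ei i) chi x| <= C.
by case: ok => _ _ _ _ bnd /(bnd i)[]. Qed.

Lemma chainE_1E u x: (chainE chi l be ga u).1 x = toL (fun x => chi x * p u x) x.
rewrite (toL2_mulb _ mchi chiC) pE toL2x//.
have := in_L2_mulb (p u) mchi chiC; congr (in_L2 _ _ _).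
by apply/funext => y; rewrite pE.
Qed.

Lemma chainE_2E u i x: (chainE chi l be ga u).2 i x =
 toL (fun x => 'D_(ei i) chi x * p u x) x +
 toL (fun x => (chi x * ga (u.1 x - l x)) * q u i x) x.
rewrite (toL2_mulb _ (mDchi i) (DchiC i)) (toL2_mulb _ (chain_meas be _ mg) (chain_bnd _ gC)) pE qE.
rewrite toL2x; first by rewrite mulrA.
have h1 := in_L2_mulb (p u) (mDchi i) (DchiC i).
have h2 := in_L2_mulb (q u i) (chain_meas be u.1 mg) (chain_bnd u.1 gC).
have := in_L2_lin mO 1 h1 h2; congr (in_L2 _ _ _).
by apply/funext => y; rewrite pE qE mul1r mulrA.
Qed.
Lemma chainE1 u x: (chainE chi l be ga u).1 x = chi x * be (u.1 x - l x).
by rewrite chainE_1E (toL2_mulb _ mchi chiC) pE. Qed.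

Lemma chainE2 u i x: (chainE chi l be ga u).2 i x =
 'D_(ei i) chi x * be (u.1 x - l x) + chi x * (ga (u.1 x - l x) * (u.2 i x - 'D_(ei i) l x)).
by rewrite chainE_2E (toL2_mulb _ (mDchi i) (DchiC i)) (toL2_mulb _ (chain_meas be _ mg) (chain_bnd _ gC)) pE qE mulrA.
Qed.
End fixed.

(** One statement for two limits: test functions tending to u with a fixed smooth [be] ([H_chain]),
    and smooth functions tending to a kinked [be] with u fixed ([H_chain_lim]). *)
Lemma chain_cv chi l C (be_ ga_: nat -> R -> R) be ga (u_: nat -> E) (u: E) (eps: nat -> R) :
 chain_ok chi l C -> (forall n, lip (be_ n) C) -> lip be C ->
 (forall n s, `|be_ n s - be s| <= eps n) -> eps @ \oo --> (0: R) ->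
 (forall n, mfunT (ga_ n)) -> mfun setT ga ->
 (forall n s, `|ga_ n s| <= C) -> (forall s, `|ga s| <= C) ->
 cvgL (fun n => (u_ n).1) u.1 -> (forall i, cvgL (fun n => (u_ n).2 i) (u.2 i)) ->
 {aeO x,
  (fun n => ga_ n ((u_ n).1 x - l x)) @ \oo --> ga (u.1 x - l x)} ->
 cvgL (fun n => (chainE chi l (be_ n) (ga_ n) (u_ n)).1) (chainE chi l be ga u).1 /\
 forall i, cvgL (fun n => (chainE chi l (be_ n) (ga_ n) (u_ n)).2 i) ((chainE chi l be ga u).2 i).
move=> ok lb_ lb bb e0 mg_ mg gC_ gC c1 c2 cg.
have [schi sl C0 bnd bndD] := ok.
have mchi: mfun Omega chi.
 by apply: mfunTS; apply: cont_vec; exact: sm_cont.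
have mDchi i: mfun Omega ('D_(ei i) chi).
 by apply: mfunTS; apply: cont_vec; exact: sm_cont (sm_derive _ schi).
have chiC x: Omega x -> `|chi x| <= C by move=> /bnd[].
have DchiC i x: Omega x -> `|'D_(ei i) chi x| <= C by move=> /(bndD i)[].
pose p_ n := toL (fun x => be_ n ((u_ n).1 x - l x)).
pose r_ n := toL (fun x => be_ n (u.1 x - l x)).
pose p := toL (fun x => be (u.1 x - l x)).
have p_E n x: p_ n x = be_ n ((u_ n).1 x - l x) by rewrite toL2x//; exact: (in_L2_lip ok).
have r_E n x: r_ n x = be_ n (u.1 x - l x) by rewrite toL2x//; exact: (in_L2_lip ok).
have pE x: p x = be (u.1 x - l x) by rewrite toL2x//; exact: (in_L2_lip ok).
have cr: cvgL r_ p by apply: (cvgL_unif fO (eps := eps)) =>// n x Ox; rewrite r_E pE.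
have cpr: cvgL (fun n => p_ n - r_ n) 0.
 apply: (cvgL_le c1 (sqr_ge0 C)) => n; rewrite subr0 -dotLZl.
 apply: le_dotL; apply/aeW => x Ox.
 rewrite -[(p_ n - r_ n) x]/(p_ n x - r_ n x) -[(C ^+ 2 *: ((u_ n).1 - u.1)) x]/(C ^+ 2 * ((u_ n).1 x - u.1 x)).
 rewrite -[((u_ n).1 - u.1) x]/((u_ n).1 x - u.1 x) p_E r_E -mulrA -!expr2 -exprMn.
 rewrite -[leLHS]real_normK ?num_real// -[leRHS]real_normK ?num_real// lerXn2r ?nnegrE//.
 rewrite normrM (ger0_norm C0); apply: le_trans (lb_ n _ _) _.
 by rewrite opprB addrA subrK.
have cp: cvgL p_ p.
 apply: (cvgL_ext _ _ (cvgLD cpr cr)) => [n x|x]; last by rewrite add0r.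
 by rewrite -[RHS]/(p_ n x - r_ n x + r_ n x) subrK.
split=> [|i].
 have := cvgL_mulb (fun=> mchi) mchi (fun=> chiC) chiC _ cp.
 move=> H; apply: (cvgL_ext _ _ (H _)) => [n x|x|].
 - by rewrite (chainE_1E ok _ (lb_ n)).
 - by rewrite (chainE_1E ok _ lb).
 - by apply/aeW => x _; exact: cvg_cst.
have H1: cvgL (fun n => toL (fun x => 'D_(ei i) chi x * p_ n x)) (toL (fun x => 'D_(ei i) chi x * p x)).
 apply: (cvgL_mulb (fun=> mDchi i) (mDchi i) (fun=> DchiC i) (DchiC i)) =>//.
 by apply/aeW => x _; exact: cvg_cst.
have cq: cvgL (fun n => (u_ n).2 i - toL ('D_(ei i) l)) (u.2 i - toL ('D_(ei i) l)).
 exact: (cvgLD (c2 i) (cvgL_cst _)).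
have H2 := cvgL_mulb (fun n => chain_meas ok be (u_ n).1 (mg_ n)) (chain_meas ok be u.1 mg)
 (fun n => chain_bnd ok (u_ n).1 (gC_ n)) (chain_bnd ok u.1 gC) _ cq.
have {}H2 := H2 _.
apply: (cvgL_ext _ _ (cvgLD H1 (H2 _))) => [n x|x|].
- by rewrite (chainE_2E ok (lb_ n) (mg_ n) (gC_ n)).
- by rewrite (chainE_2E ok lb mg gC).
apply: filterS cg => x h Ox; apply: cvgM; first exact: cvg_cst.
exact: h.
Qed.

Lemma isd_chain chi l phi b i (x: vec): smooth chi -> smooth l ->
 smooth phi -> smooth b ->
 is_derive x (ei i) (fun x => chi x * b (phi x - l x))
  ('D_(ei i) chi x * b (phi x - l x) +
   chi x * ('D_1 b (phi x - l x) * ('D_(ei i) phi x - 'D_(ei i) l x))).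
move=> schi sl sphi sb.
have d1: is_derive x (ei i) chi ('D_(ei i) chi x) by apply: DeriveDef =>//; exact: sm_der.
have d2: is_derive x (ei i) l ('D_(ei i) l x) by apply: DeriveDef =>//; exact: sm_der.
have d3: is_derive x (ei i) phi ('D_(ei i) phi x) by apply: DeriveDef =>//; exact: sm_der.
have d4: is_derive (phi x - l x) (1: R) b ('D_1 b (phi x - l x)) by apply: DeriveDef =>//; exact: sm_der.
have d5 := isd_comp_eq (is_deriveB d3 d2) d4.
apply: is_derive_eq (is_deriveM d1 d5) _.
by rewrite addrC; congr (_ + _); rewrite [LHS]mulrC.
Qed.

Lemma sm_lip b C: smooth b -> (forall s, `|'D_1 b s| <= C) -> lip b C.
move=> sb bC s t; apply: (@lipschitz_line _ b ('D_1 b)) =>// x.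
by apply: DeriveDef =>//; exact: sm_der.
Qed.

Lemma H_chain chi l C b (u: E): chain_ok chi l C -> smooth b -> (forall s, `|'D_1 b s| <= C) ->
 (forall phi, test_function Omega phi -> test_function Omega (fun x => chi x * b (phi x - l x))) ->
 H1_0 u -> H1_0 (chainE chi l b ('D_1 b) u).
move=> ok sb bC tb Hu; have [phi_ [tphi c1 c2 ca]] := H_seq Hu.
have [schi sl C0 bnd bndD] := ok; have lb := sm_lip sb bC.
have cDb: continuous ('D_1 b) by exact: sm_cont (sm_derive _ sb).
have mDb: mfunT ('D_1 b) by exact: continuous_measurable_fun.
have E0 n: chainE chi l b ('D_1 b) (tstE (phi_ n)) = tstE (fun x => chi x * b (phi_ n x - l x)).
 apply: (tstE_ext (tb _ (tphi n))) => [x|i x].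
  by rewrite (chainE1 ok _ lb) (tstE1 (tphi n)).
 rewrite (chainE2 ok lb mDb bC) (tstE1 (tphi n)) (tstE2 i (tphi n)).
 by have [_ ->] := isd_chain i x schi sl (tf_smooth (tphi n)) sb.
have [|||d1 d2] := @chain_cv chi l C (fun=> b) (fun=> 'D_1 b) b ('D_1 b)
  (fun n => tstE (phi_ n)) u (fun=> 0) ok (fun=> lb) lb _ _ (fun=> mDb) mDb (fun=> bC) bC c1 c2 _.
- by move=> n s; rewrite subrr normr0.
- exact: cvg_cst.
- apply: filterS ca => x h Ox.
 have H: (fun n => (tstE (phi_ n)).1 x - l x) @ \oo --> u.1 x - l x.
  apply: cvgB; last exact: cvg_cst.
  by under eq_fun do rewrite (tstE1 (tphi _)); exact: h.
 by apply: (cvg_comp _ ('D_1 b) H); exact: cDb.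
have Hn n: H1_0 (chainE chi l b ('D_1 b) (tstE (phi_ n))).
 by rewrite E0; exact: (H_test (tb _ (tphi n))).
exact: (H_lim Hn d1 d2).
Qed.

Lemma H_chain_lim chi l C (be_ ga_: nat -> R -> R) be ga (u: E) (eps: nat -> R) :
 chain_ok chi l C -> (forall n, lip (be_ n) C) -> lip be C ->
 (forall n s, `|be_ n s - be s| <= eps n) -> eps @ \oo --> (0: R) ->
 (forall n, mfunT (ga_ n)) -> mfun setT ga ->
 (forall n s, `|ga_ n s| <= C) -> (forall s, `|ga s| <= C) ->
 (forall s, (fun n => ga_ n s) @ \oo --> ga s) ->
 (forall n, H1_0 (chainE chi l (be_ n) (ga_ n) u)) -> H1_0 (chainE chi l be ga u).
move=> ok lb_ lb bb e0 mg_ mg gC_ gC cg Hn.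
have [|||d1 d2] := @chain_cv chi l C be_ ga_ be ga (fun=> u) u eps ok lb_ lb bb e0 mg_ mg gC_ gC.
- exact: cvgL_cst.
- by move=> i; exact: cvgL_cst.
- by apply/aeW => x _; exact: cg.
exact: (H_lim Hn d1 d2).
Qed.
Definition pos (s: R) := Num.max s 0.
(** The value 1/2 at 0 is the slope there of all the smooth approximations [softpos], whose
    derivatives therefore converge to [pos'] at every point. *)
Definition pos' (s: R): R := if 0 < s then 1 else if s == 0 then 2^-1 else 0.

Lemma pos'_01 s: 0 <= pos' s <= 1.
rewrite /pos'; case: ifP => _; first by rewrite ler01 lexx.
by case: ifP => _; rewrite ?lexx ?ler01// invr_ge0 ler0n/= invf_le1// ler1n.
Qed.
Lemma pos'_abs s: `|pos' s| <= 1.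
by have /andP[h1 h2] := pos'_01 s; rewrite ger0_norm. Qed.

Lemma meas_pos': mfun setT pos'.
apply: measurable_fun_ifT.
- exact: measurable_fun_ltr.
- exact: measurable_cst.
apply: measurable_fun_ifT =>//.
exact: measurable_fun_eqr.
Qed.

Lemma pos_lip C: 1 <= C -> lip pos C.
move=> C1 s t; apply: (@le_trans _ _ (1 * `|s - t|)); last by rewrite ler_wpM2r.
rewrite mul1r /pos ler_norml; have := ler_norm (s - t); have := ler_norm (- (s - t)).
by rewrite normrN; case: (leP s 0) => ?; case: (leP t 0) => ?; have := normr_ge0 (s - t); lra.
Qed.
Definition softpos (n: nat) (s: R): R :=
 n.+1%:R^-1 * (ln (1 + expR (n.+1%:R * s)) - ln 2).

Lemma sm_softpos n: smooth (softpos n).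
apply: smoothZ; apply: smoothB (sm_cst _).
exact: (sm_comp sm_softplus (smoothZ _ sm_id)).
Qed.

Lemma isd_softpos n s: is_derive s (1: R) (softpos n) (sigmoid (n.+1%:R * s)).
have h: is_derive s (1: R) (fun s => ln (1 + expR (n.+1%:R * s))) (sigmoid (n.+1%:R * s) * n.+1%:R).
 apply: (isd_comp_eq (b := fun s => ln (1 + expR s)) _ (isd_softplus _)).
 by apply: is_derive_eq; rewrite ?mulr1//; exact: mulr1.
apply: is_derive_eq (is_deriveZ (n.+1%:R^-1) (is_deriveB h (is_derive_cst (ln 2) s 1))) _.
rewrite subr0 -[LHS]/(n.+1%:R^-1 * (sigmoid (n.+1%:R * s) * n.+1%:R)) mulrC mulfK//.
Qed.
Lemma derive_softpos n (s: R): 'D_1 (softpos n) s = sigmoid (n.+1%:R * s).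
by have [_ ->] := isd_softpos n s. Qed.
Lemma softpos_abs n (s: R): `|'D_1 (softpos n) s| <= 1.
by rewrite derive_softpos; have /andP[h1 h2] := sigmoid_01 (n.+1%:R * s); rewrite ger0_norm. Qed.

Lemma softpos_dist n s: `|softpos n s - pos s| <= n.+1%:R^-1.
have k0: (0: R) < n.+1%:R by [].
have ln2: 0 <= ln (2: R) <= 1.
 rewrite ln_ge0 ?ler1n//= -[leRHS]expRK ler_ln ?posrE ?expR_gt0//.
 by have := @expR_ge1Dx R 1; lra.
rewrite /softpos /pos; move: (n.+1%:R: R) k0 => k k0.
have ->: k^-1 * (ln (1 + expR (k * s)) - ln 2) - Num.max s 0 =
  k^-1 * (ln (1 + expR (k * s)) - ln 2 - k * Num.max s 0) by field; rewrite gt_eqF.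
rewrite normrM ger0_norm ?invr_ge0 ?(ltW k0)// ler_piMr ?invr_ge0 ?(ltW k0)//.
have e0: 0 < expR (k * s) by exact: expR_gt0.
have d0: 0 < 1 + expR (k * s) by rewrite addr_gt0.
have [s0|s0] := leP s 0.
 rewrite mulr0 subr0.
 have h1: 0 <= ln (1 + expR (k * s)) by rewrite ln_ge0// lerDl ltW.
 have h2: ln (1 + expR (k * s)) <= ln 2.
  rewrite ler_ln ?posrE//; have: expR (k * s) <= 1 by rewrite -expR0 ler_expR pmulr_rle0.
  by lra.
 by rewrite ler_norml; lra.
have h1: k * s <= ln (1 + expR (k * s)).
 by rewrite -[leLHS]expRK ler_ln ?posrE// lerDr.
have h2: ln (1 + expR (k * s)) <= ln 2 + k * s.
 rewrite -[X in _ <= _ + X]expRK -lnM ?posrE// ler_ln ?posrE ?mulr_gt0//.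
 have: 1 <= expR (k * s) by rewrite -expR0 ler_expR mulr_ge0// ltW.
 by lra.
by rewrite ler_norml; lra.
Qed.
Lemma harmonic_cvg: (fun n => n.+1%:R^-1: R) @ \oo --> (0: R).
exact: cvg_harmonic. Qed.

Lemma sigmoid_cvg s: (fun n => sigmoid (n.+1%:R * s)) @ \oo --> pos' s.
have sig0: sigmoid (0: R) = 2^-1 by rewrite /sigmoid oppr0 expR0.
have small (t: R): 0 < t -> (fun n => expR (- (n.+1%:R * t))) @ \oo --> (0: R).
 move=> t0; apply: (@squeeze_cvgr _ _ _ _ (fun=> 0) (fun n => t^-1 * n.+1%:R^-1)).
 - apply: nearW => n; rewrite expR_ge0/= expRN -invfM lef_pV2 ?posrE ?expR_gt0 ?mulr_gt0//.
  have := @expR_ge1Dx R (n.+1%:R * t); rewrite [t * _]mulrC => h.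
  by apply: le_trans h; rewrite lerDr.
 - exact: cvg_cst.
 - by rewrite -(mulr0 t^-1); apply: cvgM; [exact: cvg_cst|exact: harmonic_cvg].
rewrite /pos'; case: ltgtP => s0.
- rewrite -[X in _ --> X]invr1 -[X in X^-1](addr0 1); apply: cvgV; first by rewrite addr0 oner_neq0.
 by apply: cvgD; [exact: cvg_cst|exact: small].
- apply/cvgrPdist_lt => e e0; have := small (- s); rewrite oppr_gt0 => /(_ s0)/cvgrPdist_lt /(_ e e0).
 apply: filterS => n; rewrite !sub0r !normrN; apply: le_lt_trans.
 have h := expR_gt0 (n.+1%:R * s); have h' := expR_gt0 (- (n.+1%:R * s)).
 rewrite mulrN opprK !ger0_norm ?expR_ge0//; last by have /andP[] := sigmoid_01 (n.+1%:R * s).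
 rewrite /sigmoid -[leRHS]invrK -expRN lef_pV2 ?posrE ?addr_gt0//.
 by rewrite lerDr.
by rewrite -s0; under eq_fun do rewrite mulr0 sig0; exact: cvg_cst.
Qed.

(* Smooth approximations of the positive part, as in the proof of Stampacchia's lemma. *)
Lemma H_pos_cut chi l C (u: E): chain_ok chi l C -> 1 <= C -> test_function Omega chi ->
 H1_0 u -> H1_0 (chainE chi l pos pos' u).
move=> ok C1 tchi Hu; have [_ sl _ _ _] := ok.
have bC n (s: R): `|'D_1 (softpos n) s| <= C by apply: le_trans (softpos_abs n s) C1.
apply: (H_chain_lim (be_ := softpos) (ga_ := fun n => 'D_1 (softpos n)) (eps := fun n => n.+1%:R^-1) ok).
- by move=> n; apply: sm_lip; [exact: sm_softpos|exact: bC].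
- exact: pos_lip.
- exact: softpos_dist.
- exact: harmonic_cvg.
- by move=> n; apply: continuous_measurable_fun; apply: sm_cont; apply: sm_derive; exact: sm_softpos.
- exact: meas_pos'.
- exact: bC.
- by move=> s; apply: le_trans (pos'_abs s) C1.
- by move=> s; under eq_fun do rewrite derive_softpos; exact: sigmoid_cvg.
move=> n; apply: (H_chain ok (sm_softpos n) (bC n)); last exact: Hu.
move=> phi tphi; apply: (tfM tchi); apply: (sm_comp (sm_softpos n)).
exact: smoothB (tf_smooth tphi) sl.
Qed.

Lemma chain_ok_cst (k: R): 0 <= k -> chain_ok (fun=> 1) (fun=> k) (k + 1).
move=> k0; split.
- exact: sm_cst.
- exact: sm_cst.
- by rewrite addr_ge0.
- by move=> x _; rewrite normr1 (ger0_norm k0) lerDr lerDl k0 ler01.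
by move=> i x _; rewrite !derive_cst normr0 addr_ge0.
Qed.

Lemma H_pos (k: R) (u: E): 0 <= k -> H1_0 u -> H1_0 (chainE (fun=> 1) (fun=> k) pos pos' u).
move=> k0 Hu; have ok := chain_ok_cst k0; set C := k + 1 in ok.
have C1: 1 <= C by rewrite lerDr.
(* Subtracting the value at - k makes b(phi - k) vanish where phi does, so that it is again a test
   function. *)
pose b n s := softpos n s - softpos n (- k).
have sb n: smooth (b n) by apply: smoothB; [exact: sm_softpos|exact: sm_cst].
have Db n (s: R): 'D_1 (b n) s = sigmoid (n.+1%:R * s).
 have [_ ->] := is_deriveB (isd_softpos n s) (is_derive_cst (softpos n (- k)) s 1).
 by rewrite subr0.
have bC n (s: R): `|'D_1 (b n) s| <= C.
 by apply: (le_trans _ C1); rewrite Db -derive_softpos softpos_abs.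
apply: (H_chain_lim (be_ := b) (ga_ := fun n => 'D_1 (b n)) (eps := fun n => n.+1%:R^-1 + n.+1%:R^-1) ok).
- by move=> n; apply: sm_lip; [exact: sb|exact: bC].
- exact: pos_lip.
- move=> n s; have h1 := softpos_dist n s; have h2 := softpos_dist n (- k).
 have pk: pos (- k) = 0 by apply/max_idPr; rewrite oppr_le0.
 rewrite pk subr0 in h2; rewrite /b addrAC; apply: le_trans (ler_normB _ _) _.
 exact: lerD.
- by rewrite -(addr0 0); apply: cvgD; exact: harmonic_cvg.
- by move=> n; apply: continuous_measurable_fun; apply: sm_cont; exact: sm_derive (sb n).
- exact: meas_pos'.
- exact: bC.
- by move=> s; apply: le_trans (pos'_abs s) C1.
- by move=> s; under eq_fun do rewrite Db; exact: sigmoid_cvg.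
move=> n; apply: (H_chain ok (sb n)) =>// phi tphi.
have := @tf_comp _ _ Omega phi (fun s => b n (s - k)) tphi.
rewrite (_: (_ \o phi) = (fun x => 1 * b n (phi x - k))); last first.
 by apply/funext => x; rewrite mul1r.
apply; last by rewrite sub0r /b subrr.
exact: (sm_comp (sb n) (smoothB sm_id (sm_cst k))).
Qed.

Lemma sm_sigmoid: smooth (@sigmoid R).
have := sm_derive (1: R) (@sm_softplus R); apply: sm_ext => s.
exact: derive_softplus.
Qed.

(** A smooth increasing approximation of the sign. It vanishes at 0, hence maps test functions to
    test functions, and it is the test behind the L1 contraction [res_l1]. *)
Definition softsign (n: nat) (s: R): R := 2 * sigmoid (n.+1%:R * s) - 1.

Lemma sm_softsign n: smooth (softsign n).
apply: smoothB (sm_cst _); apply: smoothZ.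
exact: (sm_comp sm_sigmoid (smoothZ _ sm_id)).
Qed.

Lemma isd_softsign n s: is_derive s (1: R) (softsign n)
 (2 * ((sigmoid (n.+1%:R * s) - sigmoid (n.+1%:R * s) ^+ 2) * n.+1%:R)).
have h: is_derive s (1: R) (fun s => sigmoid (n.+1%:R * s))
  ((sigmoid (n.+1%:R * s) - sigmoid (n.+1%:R * s) ^+ 2) * n.+1%:R).
 apply: (isd_comp_eq _ (isd_sigmoid _)).
 by apply: is_derive_eq; rewrite ?mulr1//; exact: mulr1.
apply: is_derive_eq (is_deriveB (is_deriveZ (2: R) h) (is_derive_cst (1: R) s 1)) _.
by rewrite subr0.
Qed.

Lemma softsign_derive n s: 0 <= 'D_1 (softsign n) s <= 2 * n.+1%:R.
have [_ ->] := isd_softsign n s; have /andP[h1 h2] := sigmoid_01 (n.+1%:R * s).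
have k0: (0: R) < n.+1%:R by [].
have h: 0 <= sigmoid (n.+1%:R * s) - sigmoid (n.+1%:R * s) ^+ 2 <= 1.
 by apply/andP; split; nra.
rewrite mulr_ge0 ?mulr_ge0 ?(ltW k0)//=; last by case/andP: h.
by rewrite ler_wpM2l// ler_piMl ?(ltW k0)//; case/andP: h.
Qed.
Lemma softsign0 n: softsign n 0 = 0.
by rewrite /softsign mulr0 /sigmoid oppr0 expR0; field. Qed.
Lemma softsign_abs n s: `|softsign n s| <= 1.
by rewrite /softsign ler_norml; have := sigmoid_01 (n.+1%:R * s); lra. Qed.

Lemma softsign_mul n s: `|s| - n.+1%:R^-1 <= s * softsign n s.
have k0: (0: R) < n.+1%:R by [].
suff h (t: R): 0 <= t -> t - n.+1%:R^-1 <= t * softsign n t.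
 have [s0|s0] := leP 0 s; first by rewrite ger0_norm ?h.
 have sN: softsign n s = - softsign n (- s).
  rewrite /softsign /sigmoid mulrN opprK expRN; have e0 := expR_gt0 (n.+1%:R * s).
  by field; rewrite !gt_eqF// addr_gt0.
 by rewrite ltr0_norm// sN mulrN -mulNr; apply: h; rewrite oppr_ge0 ltW.
move=> t0; rewrite /softsign /sigmoid; set x := n.+1%:R * t.
have x0: 0 <= x by rewrite mulr_ge0// ltW.
have e1: 1 + x <= expR x := expR_ge1Dx x.
have ->: t = n.+1%:R^-1 * x by rewrite /x mulrA mulVf ?mul1r// gt_eqF.
rewrite expRN; have e0: 0 < expR x := expR_gt0 x.
have ->: n.+1%:R^-1 * x * (2 * (1 + (expR x)^-1)^-1 - 1) =
  n.+1%:R^-1 * (x - 2 * x / (1 + expR x)) by field; rewrite !gt_eqF// addr_gt0.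
rewrite -[X in _ - X]mulr1 -mulrBr ler_pM2l ?invr_gt0// lerD2l lerN2.
rewrite ler_pdivrMr ?addr_gt0// mul1r.
have e2: 1 + x / 2 <= expR (x / 2) := expR_ge1Dx (x / 2).
have e3: expR x = expR (x / 2) * expR (x / 2) by rewrite -expRD; congr expR; field.
rewrite e3; nra.
Qed.

Lemma H_softsign n (u: E): H1_0 u ->
 H1_0 (chainE (fun=> 1) (fun=> 0) (softsign n) ('D_1 (softsign n)) u).
have ok: chain_ok (fun=> 1) (fun=> 0) (2 * n.+1%:R).
 have k1: (1: R) <= n.+1%:R by rewrite ler1n.
 split; [exact: sm_cst|exact: sm_cst| | |].
 - by rewrite mulr_ge0.
 - by move=> x _; rewrite normr1 normr0; split; lra.
 by move=> i x _; rewrite !derive_cst normr0; split; lra.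
apply: (H_chain ok (sm_softsign n)) => [s|phi tphi].
 by have /andP[h1 h2] := softsign_derive n s; rewrite ger0_norm.
have := tf_comp tphi (sm_softsign n) (softsign0 n).
by congr test_function; apply/funext => x; rewrite mul1r subr0.
Qed.
End chain_rule.

(** * Nash and isoperimetric inequalities in H1_0 *)

Section sobolev_inequalities.
Implicit Types (phi: vec -> R) (f g: L2O) (u: E).
Lemma dotL_cs f g: dotL f g ^+ 2 <= dotL f f * dotL g g.
exact: (ip_cs (@dotLDl _ _ _ dx Omega mO) (@dotLZl _ _ _ dx Omega mO) (@dotLC _ _ _ dx Omega mO) (@dotL_ge0 _ _ _ dx Omega mO)). Qed.
Lemma dotLDr f g h: dotL f (g + h: L2O) = dotL f g + dotL f h.
by rewrite dotLC dotLDl !(dotLC f). Qed.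
Lemma dotLZr c f g: dotL f (c *: g: L2O) = c * dotL f g.
by rewrite dotLC dotLZl (dotLC f). Qed.
Lemma dotLNl f g: dotL (- f: L2O) g = - dotL f g.
by rewrite -scaleN1r dotLZl mulN1r. Qed.
Lemma dotLBl f g h: dotL (f - g: L2O) h = dotL f h - dotL g h.
by rewrite dotLDl dotLNl. Qed.
Lemma dotLNr f g: dotL f (- g: L2O) = - dotL f g.
by rewrite dotLC dotLNl dotLC. Qed.
Lemma dotLBr f g h: dotL f (g - h: L2O) = dotL f g - dotL f h.
by rewrite dotLDr dotLNr. Qed.

Lemma in_L2_abs f: in_L2 dx Omega (fun x => `|f x|).
have [mf _] := L2P f; apply: (in_L2_le mO _ (L2P f)); first exact: mcomp.
by apply/aeW => x _; rewrite normr_id.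
Qed.
Definition absL f: L2O := toL (fun x => `|f x|).
Lemma absLE f x: absL f x = `|f x|.
by rewrite toL2x//; exact: in_L2_abs. Qed.
Definition oneL: L2O := toL (fun=> 1).

Lemma oneLE x: oneL x = 1.
rewrite toL2x//; apply: (in_L2_bnd mO fO (C := 1)); first exact: measurable_cst.
by apply/aeW => y _; rewrite normr1.
Qed.
Definition ind (A: set vec): L2O := toL (\1_A).

Lemma indE (A: set vec) x: measurable A -> ind A x = \1_A x.
move=> mA; rewrite toL2x//; apply: (in_L2_bnd mO fO (C := 1)).
 by apply: mfunTS; exact: measurable_indic.
by apply/aeW => y _; rewrite indicE; case: (y \in A); rewrite ?normr1 ?normr0 ?ler01.
Qed.
Definition l1 f := dotL (absL f) oneL.
Lemma dotL_abs f: dotL (absL f) (absL f) = dotL f f.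
by apply: eq_dotL; apply/aeW => x _; rewrite !absLE -normrM ger0_norm// -expr2 sqr_ge0. Qed.

Lemma l1_ge0 f: 0 <= l1 f.
rewrite /l1 dotLE; apply: Rintegral_ge0 => x _.
by rewrite absLE oneLE mulr1.
Qed.

Lemma l1D f g: l1 (f + g) <= l1 f + l1 g.
rewrite /l1 -dotLDl; apply: le_dotL; apply/aeW => x _.
rewrite -[(absL f + absL g) x]/(absL f x + absL g x) !absLE oneLE !mulr1.
exact: ler_normD.
Qed.
Lemma l1_sq f: l1 f ^+ 2 <= dotL f f * dotL oneL oneL.
by rewrite -(dotL_abs f); exact: dotL_cs. Qed.

Lemma int_in (f: vec -> R): (forall x, ~ Omega x -> f x = 0) ->
 (\int[dx]_x (f x)%:E = \int[dx]_(x in Omega) (f x)%:E)%E.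
move=> f0; rewrite [RHS]integral_mkcond; apply: eq_integral => x _.
by rewrite patchE; case: ifPn =>// /negP; rewrite inE => /f0 ->.
Qed.

Lemma dotL_EFin2 f g: (\int[dx]_(x in Omega) (f x * g x)%:E = (dotL f g)%:E)%E.
rewrite dotLE -[LHS]fineK//; apply: integrable_fin_num =>//; first exact: mO.
exact: (dotL_L1 f g).
Qed.

(** [nash_c1] with grad(phi^2) = 2 phi grad phi. Young's inequality with weight 2 (N+1) in each of
    the N coordinates puts less than half of the squared L2 norm on the right, where it is
    absorbed. *)
Lemma nash_test phi u (r: R): test_function Omega phi -> u = tstE phi -> 0 < r ->
 dotL u.1 u.1 <= 4 * N.+1%:R * r ^+ 2 * (\sum_i dotL (u.2 i) (u.2 i)) +
  2 * (r ^+ N)^-1 * l1 u.1 ^+ 2.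
move=> tp uE r0; have sp := tf_smooth tp.
have c1p := sm_c1 sp; have c1q: c1 (fun x => phi x ^+ 2).
 by apply: sm_c1; apply: sm_ext (smoothM sp sp) => x; rewrite expr2.
have := nash_c1 c1p c1q r0.
have u1 x: u.1 x = phi x by rewrite uE; exact: (tstE1 tp x).
have u2 i x: u.2 i x = 'D_(ei i) phi x by rewrite uE; exact: (tstE2 i tp x).
have ->: (\int[lvec N]_x (phi x ^+ 2)%:E = (dotL u.1 u.1)%:E)%E.
 rewrite int_in => [|x /(tf_out tp) ->]; last by rewrite expr0n.
 by rewrite -dotL_EFin2; apply: eq_integral => x _; rewrite u1.
have ->: (\int[lvec N]_x `|phi x|%:E = (l1 u.1)%:E)%E.
 rewrite int_in => [|x /(tf_out tp) ->]; last by rewrite normr0.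
 by rewrite -dotL_EFin2; apply: eq_integral => x _; rewrite absLE oneLE mulr1 u1.
have D2 i x: 'D_(ei i) (fun x => phi x ^+ 2) x = 2 * (phi x * 'D_(ei i) phi x).
 have d: is_derive x (ei i) phi ('D_(ei i) phi x) by apply: DeriveDef =>//; exact: sm_der.
 have [_] := is_deriveM d d.
 rewrite (_: (phi * phi) = (fun x => phi x ^+ 2)); last by apply/funext => y; rewrite expr2.
 by move=> ->; rewrite -[phi x *: _]/(phi x * _); ring.
have I i: (\int[lvec N]_x `|'D_(ei i) (fun x => phi x ^+ 2) x|%:E =
  (2 * dotL (absL u.1) (absL (u.2 i)))%:E)%E.
 rewrite int_in => [|x /(tf_out tp) e]; last by rewrite D2 e mul0r mulr0 normr0.
 rewrite -dotLZl -dotL_EFin2; apply: eq_integral => x _.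
 by rewrite -[(2 *: absL u.1) x]/(2 * absL u.1 x) !absLE u1 u2 D2 !normrM ger0_norm ?mulrA.
rewrite (eq_bigr _ (fun i _ => I i)) sumEFin -!EFinM -EFinD lee_fin => h.
have k0: (0: R) < N.+1%:R by [].
have Y i: 2 * r * dotL (absL u.1) (absL (u.2 i)) <=
  (2 * N.+1%:R)^-1 * dotL u.1 u.1 + 2 * N.+1%:R * r ^+ 2 * dotL (u.2 i) (u.2 i).
 set k := N.+1%:R in k0 *; pose w: L2O := absL u.1 - (2 * k * r) *: absL (u.2 i).
 have := dotL_ge0 w; rewrite /w !(dotLBl, dotLBr, dotLZl, dotLZr) !dotL_abs (dotLC (absL (u.2 i))).
 move: (dotL u.1 u.1) (dotL (u.2 i) (u.2 i)) (dotL (absL u.1) _) => a b c h'.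
 have: 0 <= (2 * k)^-1 * (a - 2 * k * r * c - (2 * k * r * c - 2 * k * r * (2 * k * r * b))).
  by rewrite mulr_ge0// invr_ge0 mulr_ge0// ltW.
 have ->: (2 * k)^-1 * (a - 2 * k * r * c - (2 * k * r * c - 2 * k * r * (2 * k * r * b))) =
  (2 * k)^-1 * a + 2 * k * r ^+ 2 * b - 2 * r * c by field; rewrite gt_eqF.
 by rewrite subr_ge0.
have SY: \sum_i 2 * r * dotL (absL u.1) (absL (u.2 i)) <=
  2^-1 * dotL u.1 u.1 + 2 * N.+1%:R * r ^+ 2 * \sum_i dotL (u.2 i) (u.2 i).
 apply: le_trans (ler_sum _ (fun i _ => Y i)) _.
 rewrite big_split/= [X in _ + X <= _](_: _ = 2 * N.+1%:R * r ^+ 2 * \sum_i dotL (u.2 i) (u.2 i)); last by rewrite mulr_sumr.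
 rewrite lerD2r sumr_const card_ord -[leLHS]mulr_natr.
 have a0 := dotL_ge0 u.1; have nk: (N%:R: R) <= N.+1%:R by rewrite ler_nat.
 move: (N.+1%:R: R) (N%:R: R) k0 nk => k n k0 nk.
 by rewrite mulrAC ler_wpM2r// invfM -mulrA ler_piMr ?invr_ge0// ler_pdivrMl// mulr1.
have rN: 0 < r ^+ N by rewrite exprn_gt0.
rewrite -(ler_pM2l rN); apply: (@le_trans _ _ (2 * (l1 u.1 ^+ 2 + r ^+ N * (2 * N.+1%:R * r ^+ 2 * \sum_i dotL (u.2 i) (u.2 i))))); last first.
 apply: leEq.
 by field; rewrite gt_eqF.
have e1: r ^+ N.+1 * (\sum_i 2 * dotL (absL u.1) (absL (u.2 i))) =
  r ^+ N * \sum_i 2 * r * dotL (absL u.1) (absL (u.2 i)).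
 rewrite exprSr -mulrA; congr (_ * _); rewrite mulr_sumr; apply: eq_bigr => i _.
 by rewrite mulrCA mulrA.
rewrite e1 in h; have := ler_wpM2l (ltW rN) SY; rewrite mulrDr => h2.
have e2: r ^+ N * (2^-1 * dotL u.1 u.1) = 2^-1 * (r ^+ N * dotL u.1 u.1) by ring.
by rewrite e2 in h2; rewrite -expr2 in h; lra.
Qed.

Lemma dotL_sub_le f g: dotL g g <= 2 * dotL (f - g: L2O) (f - g) + 2 * dotL f f.
have := dotL_sqD (- (f - g): L2O) f; rewrite dotLNl dotLNr opprK.
by rewrite (_: - (f - g) + f = g)// opprB subrK.
Qed.

Lemma nash_H u (r: R): H1_0 u -> 0 < r ->
 dotL u.1 u.1 <= 16 * N.+1%:R * (r ^+ 2 * (\sum_i dotL (u.2 i) (u.2 i)) +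
  (r ^+ N)^-1 * l1 u.1 ^+ 2).
move=> Hu r0; have rN: 0 < (r ^+ N)^-1 by rewrite invr_gt0 exprn_gt0.
have k0: (1: R) <= N.+1%:R by rewrite ler1n.
pose m := dotL oneL oneL; have m0: 0 <= m by exact: dotL_ge0.
(* [K] collects the factors with which the squared distance [d] to a test function enters. The
   constants 16 (N+1) exceed those of [nash_test] to pay for comparing u and the test function
   twice. *)
pose K := 16 * N.+1%:R * r ^+ 2 + 8 * (r ^+ N)^-1 * m + 3.
have r2: 0 <= r ^+ 2 by rewrite sqr_ge0.
have K0: 0 < K.
 rewrite /K ltr_wpDl// addr_ge0//.
  by rewrite mulr_ge0// mulr_ge0// (le_trans ler01).
 by rewrite mulr_ge0// mulr_ge0// ltW.
apply/ler_addgt0Pr => e e0.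
have [_ [phi tp ->] h] := Hu _ (divr_gt0 e0 K0).
set w := tstE phi in h; have hN := nash_test tp (erefl: w = tstE phi) r0.
set d := ipE (u - w) (u - w) in h.
have d0: 0 <= d by exact: ipE_ge0.
have Kd: K * d <= e by rewrite mulrC -ler_pdivlMr// ltW.
have h1: dotL u.1 u.1 <= 2 * d + 2 * dotL w.1 w.1.
 have ->: u.1 = (u.1 - w.1) + w.1 by rewrite subrK.
 by apply: le_trans (dotL_sqD _ _) _; rewrite lerD2r ler_pM2l//; exact: (ipE_ge1 (u - w)).
have h2: \sum_i dotL (w.2 i) (w.2 i) <= 2 * d + 2 * \sum_i dotL (u.2 i) (u.2 i).
 apply: (@le_trans _ _ (\sum_i (2 * dotL (u.2 i - w.2 i) (u.2 i - w.2 i) + 2 * dotL (u.2 i) (u.2 i)))).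
  by apply: ler_sum => i _; exact: dotL_sub_le.
 rewrite big_split/= -!mulr_sumr lerD2r ler_pM2l// /d /ipE lerDr; exact: dotL_ge0.
have h3: l1 w.1 ^+ 2 <= 2 * (d * m) + 2 * l1 u.1 ^+ 2.
 have a1: l1 w.1 <= l1 (w.1 - u.1) + l1 u.1 by rewrite -{1}(subrK u.1 w.1); exact: l1D.
 have a2: l1 (w.1 - u.1) ^+ 2 <= d * m.
  apply: le_trans (l1_sq _) _; rewrite ler_wpM2r//.
  rewrite -(opprB u.1) dotLNl dotLNr opprK; exact: (ipE_ge1 (u - w)).
 have := l1_ge0 w.1; have := l1_ge0 u.1; have := l1_ge0 (w.1 - u.1).
 move: (l1 w.1) (l1 u.1) (l1 (w.1 - u.1)) a1 a2 => a b c a1 a2 c0 b0 a0.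
 by have := sqr_ge0 (b - c); nra.
have S0: 0 <= \sum_i dotL (u.2 i) (u.2 i) by apply: sumr_ge0 => i _; exact: dotL_ge0.
set S := \sum_i dotL (u.2 i) (u.2 i) in h2 S0 *.
set S' := \sum_i dotL (w.2 i) (w.2 i) in h2 hN *.
have L0 := sqr_ge0 (l1 u.1).
move: (l1 u.1 ^+ 2) (l1 w.1 ^+ 2) (dotL u.1 u.1) (dotL w.1 w.1) h1 h3 hN L0 => L L' a b h1 h3 hN L0.
rewrite /K in Kd; clearbody S S' d m; move: (N.+1%:R: R) (r ^+ 2) ((r ^+ N)^-1) k0 rN r2 hN Kd.
clear K0; clear -h1 h2 h3 L0 S0 m0 d0 => k p q k0 q0 p0 hN Kd.
have kp: 0 <= k * p by rewrite mulr_ge0//; lra.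
have A1: k * p * S' <= k * p * (2 * d + 2 * S) by rewrite ler_wpM2l.
have A2: q * L' <= q * (2 * (d * m) + 2 * L) by rewrite ler_wpM2l// ltW.
have A3: q * L <= k * (q * L) by rewrite ler_peMl// mulr_ge0// ltW.
have ->: 16 * k * (p * S + q * L) + e = 16 * (k * p * S) + 16 * (k * (q * L)) + e by ring.
have E1: 4 * k * p * S' = 4 * (k * p * S') by ring.
have E2: 2 * q * L' = 2 * (q * L') by ring.
have E3: (16 * k * p + 8 * q * m + 3) * d = 16 * (k * p * d) + 8 * (q * (d * m)) + 3 * d by ring.
have E4: k * p * (2 * d + 2 * S) = 2 * (k * p * d) + 2 * (k * p * S) by ring.
have E5: q * (2 * (d * m) + 2 * L) = 2 * (q * (d * m)) + 2 * (q * L) by ring.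
rewrite E1 E2 in hN; rewrite E3 in Kd; rewrite E4 in A1; rewrite E5 in A2.
have qL: 0 <= q * L by rewrite mulr_ge0// ltW.
by lra.
Qed.

Lemma dotL_ind f (A: set vec): measurable A -> A `<=` Omega ->
 dotL f (ind A) = \int[dx]_(x in A) f x.
move=> mA AO; rewrite dotLE -[in RHS](setIidr AO) Rintegral_mkcondr.
by apply: eq_Rintegral => x _; rewrite indE// indicE patchE; case: ifPn; rewrite ?mulr1 ?mulr0.
Qed.

Lemma ind_sq (A: set vec): measurable A -> dotL (ind A) (ind A) = dotL (ind A) oneL.
move=> mA; apply: eq_dotL; apply/aeW => x _; rewrite oneLE indE// indicE.
by case: (x \in A); rewrite ?mulr1 ?mulr0.
Qed.

Lemma ind_le (A B: set vec): measurable A -> measurable B -> A `<=` B ->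
 dotL (ind A) oneL <= dotL (ind B) oneL.
move=> mA mB AB; apply: le_dotL; apply/aeW => x _; rewrite !oneLE !mulr1 !indE// !indicE.
have [xA|xA] := boolP (x \in A); last by case: (x \in B).
by rewrite (mem_set (AB _ (set_mem xA))).
Qed.

Lemma ind_le1 (A: set vec): measurable A -> dotL (ind A) oneL <= dotL oneL oneL.
move=> mA; apply: le_dotL; apply/aeW => x _; rewrite !oneLE !mulr1 indE// indicE.
Qed.
Lemma ind_ge0 (A: set vec): measurable A -> 0 <= dotL (ind A) oneL.
by move=> mA; rewrite -ind_sq// dotL_ge0. Qed.

Lemma ind_vol (A: set vec): measurable A -> A `<=` Omega ->
 (dx A = (dotL (ind A) oneL)%:E)%E.
move=> mA AO; rewrite -ind_sq// dotL_ind//.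
have fA: (dx A < +oo)%E by apply: le_lt_trans fO; apply: le_measure =>//; rewrite inE//; exact: mO.
rewrite (@eq_Rintegral _ _ _ _ _ (fun=> 1)); last first.
 by move=> x xA; rewrite indE// indicE xA.
by rewrite Rintegral_cst// mul1r fineK// ge0_fin_numE.
Qed.

(** In the double integral of [cube_poincare] only x in A and y in B are kept, and the absolute
    value is dropped. If u is at most 0 on A and at least h on B, the left side is at least h |A|
    |B|: this is De Giorgi's isoperimetric inequality. *)
Lemma isoper_test phi u (a: vec) (r: R) (A B: set vec) :
 test_function Omega phi -> u = tstE phi -> 0 <= r -> cube a r `<=` Omega ->
 measurable A -> measurable B -> A `<=` cube a r -> B `<=` cube a r ->
 dotL (ind A) oneL * dotL u.1 (ind B) - dotL (ind B) oneL * dotL u.1 (ind A) <=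
 r ^+ N.+1 * \sum_i dotL (absL (u.2 i)) (ind (cube a r)).
move=> tp uE r0 QO mA mB AQ BQ; have sp := tf_smooth tp.
have c1p := sm_c1 sp; have := cube_poincare a c1p r0.
have mQ := meas_cube a r.
have u1 x: u.1 x = phi x by rewrite uE; exact: (tstE1 tp x).
have u2 i x: u.2 i x = 'D_(ei i) phi x by rewrite uE; exact: (tstE2 i tp x).
have mp := cont_vec c1p.1.
have ip: dx.-integrable setT (EFin \o phi) := test_integrable tp.
have I i: (\int[lvec N]_(x in cube a r) `|'D_(ei i) phi x|%:E =
  (dotL (absL (u.2 i)) (ind (cube a r)))%:E)%E.
 rewrite -dotL_EFin2 -{1}(setIidr QO) integral_mkcondr.
 apply: eq_integral => x _; rewrite absLE u2 indE// indicE patchE.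
 by case: ifPn => _; rewrite ?mulr1 ?mulr0.
rewrite (eq_bigr _ (fun i _ => I i)) sumEFin -!EFinM => h.
rewrite -lee_fin; apply: le_trans h.
have mF: mfunT (fun z: vec * vec => `|phi z.1 - phi z.2|%:E).
 apply/mEFinP/mcomp =>//; apply: measurable_funB.
  exact: mcomp mp measurable_fst.
 exact: mcomp mp measurable_snd.
have mFx x: mfunT (fun y: vec => `|phi x - phi y|%:E).
 by apply/mEFinP/mcomp =>//; apply: measurable_funB.
have mI (S: set vec): measurable S -> mfunT (fun x: vec => \int[dx]_(y in S) `|phi x - phi y|%:E)%E.
 move=> mS; apply: (@int_sndm _ _ _ _ R (lvec N) S
  (fun z: vec * vec => `|phi z.1 - phi z.2|%:E) mS mF) => z.
 by rewrite lee_fin.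
apply: (@le_trans _ _ (\int[dx]_(x in A) \int[dx]_(y in cube a r) `|phi x - phi y|%:E)%E); last first.
 apply: ge0_subset_integral =>//; first by apply: mfunTS; exact: mI.
 by move=> x _; apply: integral_ge0.
pose bB := dotL u.1 (ind B); pose vB := dotL (ind B) oneL.
have intS (S: set vec): measurable S -> dx.-integrable S (EFin \o phi).
 by move=> mS; apply: integrableS ip.
have finS (S: set vec): measurable S -> S `<=` cube a r -> (dx S < +oo)%E.
 move=> mS SQ; apply: le_lt_trans fO; apply: le_measure; rewrite ?inE//; first exact: mO.
 exact: subset_trans SQ QO.
have intcst (S: set vec) (c: R): measurable S -> S `<=` cube a r -> dx.-integrable S (EFin \o cst c).
 by move=> mS SQ; apply: in_L1_cst =>//; exact: finS.
have bE (S: set vec): measurable S -> S `<=` cube a r -> (\int[dx]_(y in S) (phi y)%:E = (dotL u.1 (ind S))%:E)%E.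
 move=> mS SQ; rewrite dotL_ind//; last exact: subset_trans SQ QO.
 rewrite /Rintegral fineK.
  by apply: eq_integral => y _; rewrite u1.
 apply: integrable_fin_num =>//; apply: eq_integrable (intS S mS) =>// y _.
 by rewrite /= u1.
have vE (S: set vec) (c: R): measurable S -> S `<=` cube a r -> (\int[dx]_(y in S) c%:E = (c * dotL (ind S) oneL)%:E)%E.
 move=> mS SQ; rewrite integral_cst// ind_vol// ?EFinM//.
 exact: subset_trans SQ QO.
have inner x: ((bB - phi x * vB)%:E <= \int[dx]_(y in cube a r) `|phi x - phi y|%:E)%E.
 apply: (@le_trans _ _ (\int[dx]_(y in B) `|phi x - phi y|%:E)%E); last first.
  by apply: ge0_subset_integral =>//; exact: mfunTS.
 have ->: ((bB - phi x * vB)%:E = \int[dx]_(y in B) ((phi y)%:E - (phi x)%:E))%E.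
  rewrite (integralB mB (intS B mB) (intcst B (phi x) mB BQ)).
  by rewrite (bE B)// (vE B).
 apply: le_int_ge0 =>//.
 - apply: emeasurable_funB; last exact: measurable_cst.
  by apply: mfunTS; exact/mEFinP.
 - exact: mfunTS.
 by move=> y _; rewrite -EFinB lee_fin distrC ler_norm.
apply: (@le_trans _ _ (\int[dx]_(x in A) (bB%:E - (vB * phi x)%:E))%E).
 have iv: dx.-integrable A (EFin \o (fun x => vB * phi x)).
  by apply: (in_L1Z mA vB (f := phi)); exact: intS.
 rewrite (integralB mA (intcst A bB mA AQ) iv) (vE A)//.
 have ->: (\int[dx]_(x in A) (vB * phi x)%:E = (vB * dotL u.1 (ind A))%:E)%E.
  transitivity (vB%:E * \int[dx]_(x in A) (phi x)%:E)%E; last by rewrite (bE A).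
  exact: (integralZl mA (intS A mA) vB).
 by rewrite -EFinB lee_fin mulrC.
apply: le_int_ge0 =>//.
- apply: emeasurable_funB; first exact: measurable_cst.
 apply: mfunTS; apply/mEFinP; apply: measurable_funM =>//; exact: measurable_cst.
- by apply: mfunTS; exact: mI.
- by move=> x _; apply: integral_ge0.
by move=> x _; rewrite -EFinB mulrC; exact: inner.
Qed.

Lemma isoper_H u (a: vec) (r: R) (A B: set vec) :
 H1_0 u -> 0 <= r -> cube a r `<=` Omega ->
 measurable A -> measurable B -> A `<=` cube a r -> B `<=` cube a r ->
 dotL (ind A) oneL * dotL u.1 (ind B) - dotL (ind B) oneL * dotL u.1 (ind A) <=
 r ^+ N.+1 * \sum_i dotL (absL (u.2 i)) (ind (cube a r)).
move=> Hu r0 QO mA mB AQ BQ; have mQ := meas_cube a r.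
pose m := dotL oneL oneL; have m0: 0 <= m := dotL_ge0 oneL.
have rN: 0 <= r ^+ N.+1 by rewrite exprn_ge0.
pose K := (m + 1) * (2 * m + r ^+ N.+1 * N%:R) + 1.
have K0: 0 < K by rewrite ltr_wpDl// mulr_ge0// addr_ge0// mulr_ge0.
apply/ler_addgt0Pr => e e0; pose eta := e / K.
have h0: 0 < eta by rewrite divr_gt0.
have [_ [phi tp ->] h] := Hu _ (exprn_gt0 2 h0).
set w := tstE phi in h; have hI := isoper_test tp (erefl: w = tstE phi) r0 QO mA mB AQ BQ.
have bnd f (S: set vec): measurable S -> dotL f f <= eta ^+ 2 -> `|dotL f (ind S)| <= eta * (m + 1).
 move=> mS fe; have hS: dotL (ind S) (ind S) <= m by rewrite ind_sq// ind_le1.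
 have hS0 := dotL_ge0 (ind S); have hf0 := dotL_ge0 f.
 have q0: 0 <= eta * (m + 1) by rewrite mulr_ge0 ?(ltW h0)// addr_ge0.
 rewrite -ler_sqr ?nnegrE// real_normK ?num_real//.
 apply: le_trans (dotL_cs _ _) _; rewrite exprMn; apply: ler_pM =>//.
 by apply: le_trans hS _; rewrite expr2; nra.
have e1: dotL (u.1 - w.1) (u.1 - w.1) <= eta ^+ 2.
 by apply: le_trans (ltW h); exact: (ipE_ge1 (u - w)).
have e2 i: dotL (absL (w.2 i) - absL (u.2 i)) (absL (w.2 i) - absL (u.2 i)) <= eta ^+ 2.
 apply: le_trans (ltW h); apply: le_trans (ipE_ge2 (u - w) i).
 apply: le_dotL; apply/aeW => x _.
 rewrite -[(absL _ - absL _) x]/(absL (w.2 i) x - absL (u.2 i) x) -[((u - w).2 i) x]/(u.2 i x - w.2 i x) !absLE -!expr2.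
 rewrite -[leLHS]real_normK ?num_real// -[leRHS]real_normK ?num_real// lerXn2r ?nnegrE//.
 by rewrite [leRHS]distrC; exact: ler_dist_dist.
have fA: `|dotL u.1 (ind A) - dotL w.1 (ind A)| <= eta * (m + 1) by rewrite -dotLBl; exact: bnd.
have fB: `|dotL u.1 (ind B) - dotL w.1 (ind B)| <= eta * (m + 1) by rewrite -dotLBl; exact: bnd.
have fQ i: dotL (absL (w.2 i)) (ind (cube a r)) <= dotL (absL (u.2 i)) (ind (cube a r)) + eta * (m + 1).
 rewrite -lerBlDl -dotLBl; apply: le_trans (ler_norm _) _; exact: bnd.
have SQ: \sum_i dotL (absL (w.2 i)) (ind (cube a r)) <=
  \sum_i dotL (absL (u.2 i)) (ind (cube a r)) + N%:R * (eta * (m + 1)).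
 apply: le_trans (ler_sum _ (fun i _ => fQ i)) _.
 by rewrite big_split/= sumr_const card_ord mulr_natl.
have vA0 := ind_ge0 mA; have vA1 := ind_le1 mA; have vB0 := ind_ge0 mB; have vB1 := ind_le1 mB.
rewrite -/m in vA1 vB1.
have Ke: eta * ((m + 1) * (2 * m + r ^+ N.+1 * N%:R)) <= e.
 have: eta * K = e by rewrite /eta divfK// gt_eqF.
 by rewrite /K mulrDr mulr1 => <-; rewrite lerDl ltW.
have := ler_wpM2l rN SQ.
move: (\sum_i dotL (absL (w.2 i)) _) (\sum_i dotL (absL (u.2 i)) _) hI => S' S hI.
move: fA fB; rewrite !ler_norml => /andP[fA1 fA2] /andP[fB1 fB2].
set q := eta * (m + 1) in fA1 fA2 fB1 fB2 *.
have q0: 0 <= q by rewrite mulr_ge0 ?(ltW h0)// addr_ge0.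
have {}Ke: q * (2 * m) + r ^+ N.+1 * (N%:R * q) <= e.
 by apply: le_trans Ke; apply: leEq; rewrite /q; ring.
move: (dotL (ind A) oneL) (dotL (ind B) oneL) (dotL u.1 (ind A)) (dotL u.1 (ind B)) (dotL w.1 (ind A)) (dotL w.1 (ind B)) vA0 vA1 vB0 vB1 fA1 fA2 fB1 fB2 hI.
move: (r ^+ N.+1) (N%:R: R) Ke rN; clearbody q m; clear -m0 q0.
move=> p n Ke p0 vA vB a b a' b' vA0 vA1 vB0 vB1 fA1 fA2 fB1 fB2 hI hS.
have g1: vA * (b - b') <= m * q by apply: (@le_trans _ _ (vA * q)); [rewrite ler_wpM2l|rewrite ler_wpM2r].
have g2: vB * (a' - a) <= m * q.
 by apply: (@le_trans _ _ (vB * q)); [rewrite ler_wpM2l//; lra|rewrite ler_wpM2r].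
rewrite mulrBr in g1; rewrite mulrBr in g2; rewrite mulrDr in hS.
have g3: q * (2 * m) = 2 * (m * q) by ring.
by rewrite g3 in Ke; lra.
Qed.
End sobolev_inequalities.

(** * Comparison of [H1_0] with [in_H10] *)

Section in_H10_closure.
Lemma in_L1_EFin (f: vec -> R): in_L1 dx Omega f ->
 (\int[dx]_(x in Omega) (f x)%:E)%E = (\int[dx]_(x in Omega) f x)%:E.
by move=> f1; rewrite /Rintegral fineK//; apply: integrable_fin_num =>//; exact: mO. Qed.

Lemma dotL_sum_EFin (V: 'I_N -> L2O) :
 (\int[dx]_(x in Omega) (\sum_i V i x * V i x)%:E)%E = (\sum_i dotL (V i) (V i))%:E.
have L1 i: in_L1 dx Omega (fun x => V i x * V i x) by exact: dotL_L1.
rewrite (in_L1_EFin (in_L1_sum mO (index_enum 'I_N) L1)) (Rint_sum mO _ L1).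
by congr (_%:E); apply: eq_bigr => i _; rewrite dotLE.
Qed.

Lemma H_weak_gradient (u: E) phi i: H1_0 u -> test_function Omega phi ->
 dotL u.1 ((tstE phi).2 i) = - dotL (u.2 i) (tstE phi).1.
move=> Hu tp; apply/eqP; rewrite -addr_eq0; apply/eqP.
set f := (tstE phi).2 i; set g := (tstE phi).1.
apply: (@closure_ext _ _ (@ipE) (@ipE_ge0) (@testE)
 (fun v => dotL v.1 f + dotL (v.2 i) g) (2 * dotL f f + 2 * dotL g g) _ _ _ _ _ Hu).
- move=> c x y; rewrite -[(c *: x + y).1]/(c *: x.1 + y.1) -[(c *: x + y).2 i]/(c *: x.2 i + y.2 i).
 by rewrite !dotLDl !dotLZl; ring.
- by rewrite addr_ge0// mulr_ge0// dotL_ge0.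
- move=> w; have h1 := dotL_cs w.1 f; have h2 := dotL_cs (w.2 i) g.
 have h3: dotL w.1 w.1 * dotL f f <= ipE w w * dotL f f by rewrite ler_wpM2r ?dotL_ge0// ipE_ge1.
 have h4: dotL (w.2 i) (w.2 i) * dotL g g <= ipE w w * dotL g g by rewrite ler_wpM2r ?dotL_ge0// ipE_ge2.
 have := sqr_ge0 (dotL w.1 f - dotL (w.2 i) g); move: (le_trans h1 h3) (le_trans h2 h4).
 have ->: (2 * dotL f f + 2 * dotL g g) * ipE w w = 2 * (ipE w w * dotL f f) + 2 * (ipE w w * dotL g g) by ring.
 move: (ipE w w * dotL f f) (ipE w w * dotL g g) (dotL w.1 f) (dotL (w.2 i) g) => p q a b k1 k2 k3.
 have ->: (a + b) ^+ 2 = 2 * a ^+ 2 + 2 * b ^+ 2 - (a - b) ^+ 2 by ring.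
 by move: (a ^+ 2) (b ^+ 2) (_ ^+ 2) k1 k2 k3 => s t r k1 k2 k3; lra.
move=> w [psi tps ->]; rewrite /f /g !dotLE.
have e1: \int[dx]_(x in Omega) ((tstE psi).1 x * (tstE phi).2 i x) =
  \int[dx]_(x in Omega) (psi x * 'D_(ei i) phi x).
 by apply: eq_Rintegral => x _; rewrite tstE1// tstE2.
have e2: \int[dx]_(x in Omega) ((tstE psi).2 i x * (tstE phi).1 x) =
  \int[dx]_(x in Omega) ('D_(ei i) psi x * phi x).
 by apply: eq_Rintegral => x _; rewrite tstE1// tstE2.
have sp := tf_smooth tp; have sps := tf_smooth tps.
have L1: in_L1 dx Omega (fun x => psi x * 'D_(ei i) phi x).
 exact: (in_L2M mO (in_L2_test tps) (in_L2_test_derive i tp)).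
have L2: in_L1 dx Omega (fun x => 'D_(ei i) psi x * phi x).
 exact: (in_L2M mO (in_L2_test_derive i tps) (in_L2_test tp)).
rewrite e1 e2 -RintegralD//; last exact: mO.
have tM := tfM tps sp.
have dM x: 'D_(ei i) (fun x => psi x * phi x) x = psi x * 'D_(ei i) phi x + 'D_(ei i) psi x * phi x.
 have d1: is_derive x (ei i) psi ('D_(ei i) psi x) by apply/derivableP; exact: sm_der sps.
 have d2: is_derive x (ei i) phi ('D_(ei i) phi x) by apply/derivableP; exact: sm_der sp.
 have [_ h] := is_deriveM d1 d2; apply: etrans h _.
 by rewrite -[LHS]/(psi x * 'D_(ei i) phi x + phi x * 'D_(ei i) psi x) [in RHS](mulrC _ (phi x)).
have := int_test_derive (ei i) tM; rewrite (@int_in); last first.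
 by move=> x nO; exact: (tf_out (tf_derive (ei i) tM)).
move=> h; rewrite /Rintegral -[RHS]/(fine 0%E) -h; congr fine.
by apply: eq_integral => x _; rewrite dM.
Qed.

Lemma ipE_EFin (u: E) phi: test_function Omega phi ->
 (\int[dx]_(x in Omega) ((u.1 x - phi x) ^+ 2)%:E +
  \int[dx]_(x in Omega) (dot ((\col_i u.2 i x) - grad phi x) ((\col_i u.2 i x) - grad phi x))%:E
  = (ipE (u - tstE phi) (u - tstE phi))%:E)%E.
move=> tp; rewrite /ipE EFinD; congr (_ + _)%E.
 rewrite -dotL_EFin; apply: eq_integral => x _; congr (_ ^+ 2)%:E.
 by rewrite -[(u - tstE phi).1 x]/(u.1 x - (tstE phi).1 x) tstE1.
rewrite -(dotL_sum_EFin (u - tstE phi).2); apply: eq_integral => x _; congr (_%:E).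
apply: eq_bigr => i _; rewrite !mxE.
by rewrite -[(u - tstE phi).2 i x]/(u.2 i x - (tstE phi).2 i x) tstE2.
Qed.

Lemma H_in_H10 (u: E): H1_0 u -> in_H10 Omega u.1 (fun x => \col_i u.2 i x).
move=> Hu; split.
- exact: L2P.
- move=> i; rewrite (_: (fun x => _) = u.2 i); first exact: L2P.
 by apply/funext => x; rewrite mxE.
- move=> phi tp i; have := H_weak_gradient i Hu tp; rewrite !dotLE => h.
 transitivity (\int[dx]_(x in Omega) (u.1 x * (tstE phi).2 i x)).
  by apply: eq_Rintegral => x _; rewrite mxE tstE2.
 by rewrite h; congr (- _); apply: eq_Rintegral => x _; rewrite mxE tstE1.
- move=> e e0; have [w [phi tp ->] we] := Hu e e0; exists phi =>//.
 by rewrite (ipE_EFin u tp) lte_fin.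
Qed.

Lemma in_H10_H (v: vec -> R) G: in_H10 Omega v G ->
 H1_0 ((toL v, fun i => toL (fun x => G x i ord0)): E).
move=> [v2 G2 _ h] e e0; have [phi tp pe] := h e e0; exists (tstE phi); first by exists phi.
rewrite -lte_fin -(ipE_EFin _ tp); apply: le_lt_trans pe; apply: leEq.
congr (_ + _)%E; apply: eq_integral => x _; first by rewrite /= toL2x.
by congr (_%:E); congr dot; apply/colP => i; rewrite !mxE toL2x.
Qed.
End in_H10_closure.
Section multipliers.
Implicit Types (u v w: E) (V W P: 'I_N -> L2O) (f g: L2O).

Lemma in_L2_mulb_ae (b: vec -> R) (C: R) f: mfun Omega b ->
 {aeO x, `|b x| <= C} -> in_L2 dx Omega (fun x => b x * f x).
move=> mb bC; have mf: mfun Omega f by case: (L2P f).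
have h: in_L2 dx Omega (fun x => C * f x + 0).
 by apply: (in_L2_lin mO) =>//; [exact: L2P|exact: in_L20].
apply: (in_L2_le mO _ h); first exact: measurable_funM.
apply: filterS bC => x bC Dx; rewrite addr0 !normrM ler_wpM2r//.
exact: le_trans (bC Dx) (ler_norm _).
Qed.
Lemma meas_sqrt: mfunT (@Num.sqrt R).
by apply: continuous_measurable_fun; exact: sqrt_continuous. Qed.
Definition S2 V: R := \sum_i dotL (V i) (V i).
Lemma S2_ge0 V: 0 <= S2 V.
by apply: sumr_ge0 => i _; exact: dotL_ge0. Qed.

Lemma sum_sq_le (n: nat) (x: 'I_n -> R) (T: R): 0 <= T ->
 (forall i, x i ^+ 2 <= T) -> (\sum_i x i) ^+ 2 <= n%:R ^+ 2 * T.
move=> T0 xT; have xs i: `|x i| <= Num.sqrt T.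
 by rewrite -ler_sqr ?nnegrE ?sqrtr_ge0// sqr_sqrtr// real_normK ?num_real.
have: `|\sum_i x i| <= n%:R * Num.sqrt T.
 apply: le_trans (ler_norm_sum _ _ _) _; apply: le_trans (ler_sum _ (fun i _ => xs i)) _.
 by rewrite sumr_const card_ord mulr_natl.
move=> h; rewrite -[leLHS]real_normK ?num_real// -[X in _ * X](sqr_sqrtr T0) -exprMn.
by rewrite lerXn2r ?nnegrE// mulr_ge0// sqrtr_ge0.
Qed.
End multipliers.
(** * Elliptic equations and De Giorgi's theorem *)
Section elliptic_equation.
Variables (B: vec -> 'M[R]_N) (C al: R).
Hypothesis mB: forall i j, mfun Omega (fun x => B x i j).
Hypothesis C0: 0 <= C.
Hypothesis BC: forall i j, {aeO x, `|B x i j| <= C}.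
Hypothesis al0: 0 < al.
Hypothesis Bal: elliptic Omega B al.
Notation one := oneL.

(** * The resolvent of an elliptic operator *)

Section resolvent.
Implicit Types (u v w: E) (V W P: 'I_N -> L2O) (f g: L2O).
Definition mulB i j f: L2O := toL (fun x => B x i j * f x).
Lemma mulBE i j f x: mulB i j f x = B x i j * f x.
by rewrite toL2x//; exact: in_L2_mulb_ae (BC i j). Qed.
(** The form acts on arbitrary vector fields and not only on gradients, so that weights can be moved
    between its two arguments. *)
Definition aV V W: R := \sum_i \sum_j dotL (mulB i j (V j)) (W i).

Lemma mulB_lin i j c f g: mulB i j (c *: f + g) = c *: mulB i j f + mulB i j g.
apply: L2_eqP => x; rewrite -[RHS]/(c * mulB i j f x + mulB i j g x) !mulBE.
by rewrite -[(c *: f + g) x]/(c * f x + g x); ring.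
Qed.

Lemma aV_linl c V V' W: aV (c *: V + V') W = c * aV V W + aV V' W.
rewrite /aV mulr_sumr -big_split; apply: eq_bigr => i _.
rewrite mulr_sumr -big_split; apply: eq_bigr => j _ /=.
by rewrite -[(c *: V + V') j]/(c *: V j + V' j) mulB_lin dotLDl dotLZl.
Qed.

Lemma aV_linr c V W W': aV V (c *: W + W') = c * aV V W + aV V W'.
rewrite /aV mulr_sumr -big_split; apply: eq_bigr => i _.
rewrite mulr_sumr -big_split; apply: eq_bigr => j _ /=.
by rewrite -[(c *: W + W') i]/(c *: W i + W' i) dotLDr dotLZr.
Qed.

Lemma aV_sq V W: aV V W ^+ 2 <= N%:R ^+ 4 * C ^+ 2 * S2 V * S2 W.
have T0: 0 <= C ^+ 2 * S2 V * S2 W by rewrite !mulr_ge0 ?sqr_ge0 ?S2_ge0.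
have h i j: dotL (mulB i j (V j)) (W i) ^+ 2 <= C ^+ 2 * S2 V * S2 W.
 apply: le_trans (dotL_cs _ _) _; apply: ler_pM; rewrite ?dotL_ge0//.
  apply: (@le_trans _ _ (C ^+ 2 * dotL (V j) (V j))).
   rewrite -dotLZl; apply: le_dotL; apply: filterS (BC i j) => x BCx Ox.
   rewrite mulBE -[(C ^+ 2 *: V j) x]/(C ^+ 2 * V j x).
   have: B x i j ^+ 2 <= C ^+ 2.
    by rewrite -[leLHS]real_normK ?num_real// lerXn2r ?nnegrE// BCx.
   by have := sqr_ge0 (V j x); move: (B x i j) (V j x) (C ^+ 2) => b v c; nra.
  rewrite ler_wpM2l ?sqr_ge0// /S2 (bigD1 j)//= lerDl sumr_ge0// => k _; exact: dotL_ge0.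
 by rewrite /S2 (bigD1 i)//= lerDl sumr_ge0// => k _; exact: dotL_ge0.
have h2 i: (\sum_j dotL (mulB i j (V j)) (W i)) ^+ 2 <= N%:R ^+ 2 * (C ^+ 2 * S2 V * S2 W).
 exact: sum_sq_le.
have h20: 0 <= N%:R ^+ 2 * (C ^+ 2 * S2 V * S2 W) by rewrite mulr_ge0 ?sqr_ge0.
apply: le_trans (sum_sq_le h20 h2) _.
by apply: leEq; ring.
Qed.

Lemma aV_coer V: al * S2 V <= aV V V.
have L1a i j: in_L1 dx Omega (fun x => mulB i j (V j) x * V i x) by exact: dotL_L1.
have L1b i: in_L1 dx Omega (fun x => V i x * V i x) by exact: dotL_L1.
have L1s i := in_L1_sum mO (index_enum 'I_N) (L1a i).
rewrite /aV (eq_bigr (fun i => \int[dx]_(x in Omega) \sum_j mulB i j (V j) x * V i x)); last first.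
 by move=> i _; rewrite (Rint_sum mO _ (L1a i)); apply: eq_bigr => j _; rewrite dotLE.
rewrite -(Rint_sum mO _ L1s) /S2 (eq_bigr (fun i => \int[dx]_(x in Omega) (V i x * V i x))); last first.
 by move=> i _; rewrite dotLE.
rewrite -(Rint_sum mO _ L1b) -(RintegralZl al mO (in_L1_sum mO _ L1b)).
apply: (le_Rint_ae mO); first exact: (in_L1Z mO al (in_L1_sum mO _ L1b)).
 exact: (in_L1_sum mO _ L1s).
apply: filterS Bal => x h Ox; have := h Ox (\col_i V i x); rewrite /dot.
rewrite (eq_bigr (fun i => V i x * V i x)); last by move=> i _; rewrite !mxE.
move=> h'; apply: le_trans h' _; apply: leEq.
apply: eq_bigr => i _; rewrite !mxE mulr_suml; apply: eq_bigr => j _.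
by rewrite !mxE mulBE.
Qed.
Definition scaleL (s: vec -> R) P: 'I_N -> L2O := fun i => toL (fun x => s x * P i x).

(** A weight s^2 in the test field is shared equally by both arguments, and coercivity applies to
    the weighted field. Testing with a monotone function of u produces such a weight, with s the
    square root of its derivative. *)
Lemma aV_scale (s: vec -> R) (K: R) V P W: mfun Omega s ->
 (forall x, Omega x -> `|s x| <= K) ->
 (forall i, {aeO x, W i x = s x * (s x * P i x)}) ->
 aV V W = aV (scaleL s V) (scaleL s P).
move=> ms sK WE; apply: eq_bigr => i _; apply: eq_bigr => j _.
apply: eq_dotL; apply: filterS (WE i) => x h Ox.
by rewrite !mulBE /scaleL !(toL2_mulb _ ms sK) h//; ring.
Qed.

Lemma aV_young V W: - aV V W <= al / 2 * S2 W + N%:R ^+ 4 * C ^+ 2 / (2 * al) * S2 V.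
have := aV_sq V W; have := S2_ge0 V; have := S2_ge0 W.
have k0: 0 <= N%:R ^+ 4 * C ^+ 2 by rewrite mulr_ge0 ?sqr_ge0 ?exprn_ge0.
move: (N%:R ^+ 4 * C ^+ 2) (S2 V) (S2 W) (aV V W) k0 => k a b t k0 b0 a0 h.
set y := al / 2 * b + k / (2 * al) * a.
have y0: 0 <= y.
 by rewrite addr_ge0// mulr_ge0// divr_ge0// ?(ltW al0)// mulr_ge0// ltW.
have: t ^+ 2 <= y ^+ 2.
 apply: le_trans h _; rewrite -subr_ge0.
 have ->: y ^+ 2 - k * a * b = (al / 2 * b - k / (2 * al) * a) ^+ 2.
  by rewrite /y; field; rewrite gt_eqF.
 exact: sqr_ge0.
rewrite -[leLHS]real_normK ?num_real// ler_sqr ?nnegrE// => h'.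
by apply: le_trans h'; rewrite -normrN ler_norm.
Qed.
(** u = (I + lam A)^(-1) f with A = - div(B grad): one implicit Euler step of length lam. *)
Definition res_eq (lam: R) f u := H1_0 u /\ forall v, H1_0 v ->
 dotL u.1 v.1 + lam * aV u.2 v.2 = dotL f v.1.

Lemma res_exists lam f: 0 < lam -> exists u, res_eq lam f u.
move=> lam0; pose a u v := dotL u.1 v.1 + lam * aV u.2 v.2.
pose K := 2 + 2 * (lam ^+ 2 * (N%:R ^+ 4 * C ^+ 2)).
have S2E w: S2 w.2 <= ipE w w by rewrite /ipE lerDr dotL_ge0.
have a_linl y c x z: a (c *: x + z) y = c * a x y + a z y.
 rewrite -[LHS]/(dotL (c *: x.1 + z.1) y.1 + lam * aV (c *: x.2 + z.2) y.2) /a.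
 by rewrite aV_linl dotLDl dotLZl; ring.
have a_linr x c y z: a x (c *: y + z) = c * a x y + a x z.
 rewrite -[LHS]/(dotL x.1 (c *: y.1 + z.1) + lam * aV x.2 (c *: y.2 + z.2)) /a.
 by rewrite aV_linr dotLDr dotLZr; ring.
have K0: 0 <= K.
 by rewrite addr_ge0// mulr_ge0// mulr_ge0 ?sqr_ge0// mulr_ge0 ?sqr_ge0 ?exprn_ge0.
have a_bnd x y: a x y ^+ 2 <= K * ipE x x * ipE y y.
 have h1 := dotL_cs x.1 y.1; have h2 := aV_sq x.2 y.2.
 have h3: dotL x.1 x.1 * dotL y.1 y.1 <= ipE x x * ipE y y.
  by apply: ler_pM; rewrite ?dotL_ge0 ?ipE_ge1.
 have h4: S2 x.2 * S2 y.2 <= ipE x x * ipE y y by apply: ler_pM; rewrite ?S2_ge0.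
 have k0: 0 <= N%:R ^+ 4 * C ^+ 2 by rewrite mulr_ge0 ?sqr_ge0 ?exprn_ge0.
 rewrite /a /K; move: h2; rewrite -(mulrA _ (S2 x.2)) -(mulrA _ (ipE x x)).
 move: (dotL x.1 y.1) (aV x.2 y.2) (N%:R ^+ 4 * C ^+ 2) (ipE x x * ipE y y) (S2 x.2 * S2 y.2) (dotL x.1 x.1 * dotL y.1 y.1) h1 h3 h4 k0.
 move=> p q k I s d h1 h3 h4 k0 h2.
 have h5: lam ^+ 2 * q ^+ 2 <= lam ^+ 2 * (k * I).
  by rewrite ler_wpM2l ?sqr_ge0//; apply: le_trans h2 _; rewrite ler_wpM2l.
 by have := sqr_ge0 (p - lam * q); nra.
have [||||||||||u Hu uP] := @lax_milgram R _ (@ipE) (@ipEDl) (@ipEZl)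
 (@ipEC) (@ipE_ge0) ipE_complete (@testE) a (fun v => dotL f v.1)
 (Num.min 1 (lam * al)) K (dotL f f).
- exact: testE_subsp.
- by rewrite lt_min ltr01 mulr_gt0.
- exact: K0.
- exact: dotL_ge0.
- exact: a_linl.
- exact: a_linr.
- exact: a_bnd.
- move=> x cx; rewrite /a; have h := aV_coer x.2.
 have m1: Num.min 1 (lam * al) * dotL x.1 x.1 <= dotL x.1 x.1.
  by rewrite ler_piMl ?dotL_ge0// ge_min lexx.
 have m2: Num.min 1 (lam * al) * S2 x.2 <= lam * aV x.2 x.2.
  apply: le_trans (ler_wpM2l (ltW lam0) h); rewrite mulrA ler_wpM2r ?S2_ge0//.
  by rewrite ge_min lexx orbT.
 by rewrite /ipE mulrDr; exact: lerD.
- by move=> c x y; rewrite -[(c *: x + y).1]/(c *: x.1 + y.1) dotLDr dotLZr.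
- move=> w; apply: le_trans (dotL_cs _ _) _.
 by rewrite ler_wpM2l ?dotL_ge0// ipE_ge1.
exists u; split =>// v Hv; apply/eqP; rewrite -subr_eq0; apply/eqP.
have aC x y: a x y ^+ 2 <= K * ipE x x * ipE y y by exact: a_bnd.
apply: (@closure_ext _ _ (@ipE) (@ipE_ge0) (@testE)
 (fun v => a u v - dotL f v.1) (2 * (K * ipE u u) + 2 * dotL f f) _ _ _ _ _ Hv).
- by move=> c x y; rewrite a_linr -[(c *: x + y).1]/(c *: x.1 + y.1) dotLDr dotLZr; ring.
- by rewrite addr_ge0// mulr_ge0 ?dotL_ge0// mulr_ge0 ?ipE_ge0.
- move=> w; have h1 := aC u w; have h2 := dotL_cs f w.1.
 have h3: dotL f f * dotL w.1 w.1 <= dotL f f * ipE w w by rewrite ler_wpM2l ?dotL_ge0// ipE_ge1.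
 have := sqr_ge0 (a u w + dotL f w.1); rewrite mulrDl -!mulrA.
 rewrite -mulrA in h1; move: (a u w) (dotL f w.1) (dotL f f * dotL w.1 w.1) (dotL f f * ipE w w) (K * (ipE u u * ipE w w)) h1 h2 h3.
 by move=> p q x y z h1 h2 h3 h4; nra.
by move=> w /uP ->; rewrite subrr.
Qed.
Lemma res_test (lam: R) f u v: res_eq lam f u -> H1_0 v ->
 dotL u.1 v.1 + lam * aV u.2 v.2 = dotL f v.1.
by case=> _; apply. Qed.

Lemma res_lin lam c f g u v: res_eq lam f u -> res_eq lam g v ->
 res_eq lam (c *: f + g) (c *: u + v).
move=> [Hu uP] [Hv vP]; split; first by have [_ h] := @H_subsp; exact: h.
move=> w Hw; rewrite -[LHS]/(dotL (c *: u.1 + v.1) w.1 + lam * aV (c *: u.2 + v.2) w.2).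
rewrite aV_linl !dotLDl !dotLZl -(uP w Hw) -(vP w Hw); ring.
Qed.

(* Testing with the truncation (u - K)_+ *)
Lemma res_le lam f u (K: R): 0 < lam -> 0 <= K -> res_eq lam f u ->
 {aeO x, f x <= K} -> {aeO x, u.1 x <= K}.
move=> lam0 K0 uP fK; have [Hu _] := uP.
have ok := @chain_ok_cst K K0.
pose psi := @chainE (fun=> 1) (fun=> K) (@pos) (@pos') u.
have Hpsi: H1_0 psi by exact: H_pos.
have C1: 1 <= K + 1 by rewrite lerDr.
have gC s: `|pos' s| <= K + 1 by apply: le_trans (pos'_abs s) C1.
have p1 x: psi.1 x = pos (u.1 x - K).
 by rewrite /psi (chainE1 ok _ (pos_lip C1)) mul1r.
have p2 i x: psi.2 i x = pos' (u.1 x - K) * u.2 i x.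
 rewrite /psi (chainE2 ok (pos_lip C1) meas_pos' gC) !derive_cst.
 by rewrite mul0r add0r mul1r subr0.
have mu1: mfun Omega u.1 by case: (L2P u.1).
have ms: mfun Omega (fun x => Num.sqrt (pos' (u.1 x - K))).
 apply: mcomp; first exact: meas_sqrt.
 apply: mcomp; first exact: meas_pos'.
 by apply: measurable_funB =>//; exact: measurable_cst.
have sK x: Omega x -> `|Num.sqrt (pos' (u.1 x - K))| <= 1.
 move=> _; rewrite ger0_norm ?sqrtr_ge0// -[leRHS]sqrtr1 ler_wsqrtr//.
 by case/andP: (pos'_01 (u.1 x - K)).
have a0: 0 <= aV u.2 psi.2.
 rewrite (aV_scale u.2 (P := u.2) ms sK); first by apply: le_trans (aV_coer _); rewrite mulr_ge0 ?S2_ge0 ?ltW.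
 move=> i; apply/aeW => x _; rewrite p2 mulrA -expr2 sqr_sqrtr//.
 by case/andP: (pos'_01 (u.1 x - K)).
have h := res_test uP Hpsi.
have h1: dotL (u.1 - f) psi.1 <= 0.
 by rewrite dotLBl -h opprD addrA subrr sub0r oppr_le0 mulr_ge0// ltW.
have h2: dotL psi.1 psi.1 <= dotL (u.1 - f) psi.1.
 apply: le_dotL; apply: filterS fK => x h' Ox; rewrite -[(u.1 - f) x]/(u.1 x - f x) !p1.
 rewrite /pos; have [u0|u0] := leP (u.1 x - K) 0; first by rewrite !mulr0.
 by rewrite ler_wpM2r ?(ltW u0)// lerD2l lerN2 h'.
apply: filterS (dotL_eq0 (le_trans h2 h1)) => x h' Ox.
have := h' Ox; rewrite p1 /pos; case: (leP (u.1 x - K) 0) => [|h0 e]; first by rewrite subr_le0.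
by rewrite e ltxx in h0.
Qed.

Lemma res_abs lam f u (K: R): 0 < lam -> 0 <= K -> res_eq lam f u ->
 {aeO x, `|f x| <= K} -> {aeO x, `|u.1 x| <= K}.
move=> lam0 K0 uP fK.
have r0: res_eq lam 0 0.
 split; first by case: (@H_subsp).
 move=> v _; rewrite -[LHS]/(dotL 0 v.1 + lam * aV 0 v.2).
 have := aV_linl 1 0 0 v.2; rewrite scale1r addr0 mul1r => h.
 have ->: aV 0 v.2 = 0 by move: h; move: (aV _ _) => t; lra.
 by rewrite mulr0 addr0.
have uN := res_lin (-1) uP r0.
have a1: {aeO x, u.1 x <= K}.
 by apply: (res_le lam0 K0 uP); apply: filterS fK => x h Ox; apply: le_trans (ler_norm _) (h Ox).
have a2: {aeO x, (-1 *: u + 0).1 x <= K}.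
 apply: (res_le lam0 K0 uN); apply: filterS fK => x h Ox.
 rewrite -[(-1 *: f + 0) x]/(-1 * f x + 0) addr0 mulN1r; apply: le_trans (h Ox).
 by rewrite -normrN ler_norm.
apply: filterS2 a1 a2 => x h1 h2 Ox; have {}h2 := h2 Ox.
rewrite -[(-1 *: u + 0).1 x]/(-1 * u.1 x + 0) addr0 mulN1r in h2.
by rewrite ler_norml h1// lerNl h2.
Qed.

(** Tested with [softsign n] of u, the form is nonnegative because [softsign] is increasing, the
    right side is at most the L1 norm of f, and [softsign_mul] loses only 1/(n+1) against |u|. *)
Lemma res_l1 lam f u: 0 < lam -> res_eq lam f u -> l1 u.1 <= l1 f.
move=> lam0 uP; have [Hu _] := uP.
suff h n: l1 u.1 <= l1 f + n.+1%:R^-1 * dotL one one.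
 apply/ler_addgt0Pr => e e0; have [n hn] := nat_above (dotL one one / e).
 apply: le_trans (h n) _; rewrite lerD2l mulrC ler_pdivrMr// mulrC -ler_pdivrMr//.
 exact: ltW.
have k1: (1: R) <= n.+1%:R by rewrite ler1n.
have ok: chain_ok (fun=> 1) (fun=> 0) (2 * n.+1%:R: R).
 split; [exact: sm_cst|exact: sm_cst| | |].
 - by rewrite mulr_ge0.
 - by move=> x _; rewrite normr1 normr0; split; lra.
 by move=> i x _; rewrite !derive_cst normr0; split; lra.
pose psi := @chainE (fun=> 1) (fun=> 0) (@softsign n) ('D_1 (@softsign n)) u.
have Hpsi: H1_0 psi by exact: H_softsign.
have DC (s: R): `|'D_1 (@softsign n) s| <= 2 * n.+1%:R.
 by have /andP[h1 h2] := softsign_derive n s; rewrite ger0_norm.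
have lb := sm_lip (@sm_softsign n) DC.
have mD: mfunT ('D_1 (@softsign n)).
 by apply: continuous_measurable_fun; apply: sm_cont; apply: sm_derive; exact: sm_softsign.
have p1 x: psi.1 x = softsign n (u.1 x).
 by rewrite /psi (chainE1 ok _ lb) mul1r subr0.
have p2 i x: psi.2 i x = 'D_1 (@softsign n) (u.1 x) * u.2 i x.
 rewrite /psi (chainE2 ok lb mD DC) !derive_cst.
 by rewrite mul0r add0r mul1r !subr0.
have mu1: mfun Omega u.1 by case: (L2P u.1).
have ms: mfun Omega (fun x => Num.sqrt ('D_1 (@softsign n) (u.1 x))).
 by apply: mcomp meas_sqrt _; apply: mcomp mD mu1.
have sK x: Omega x -> `|Num.sqrt ('D_1 (@softsign n) (u.1 x))| <= Num.sqrt (2 * n.+1%:R).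
 move=> _; rewrite ger0_norm ?sqrtr_ge0// ler_wsqrtr//.
 by case/andP: (softsign_derive n (u.1 x)).
have a0: 0 <= aV u.2 psi.2.
 rewrite (aV_scale u.2 (P := u.2) ms sK); first by apply: le_trans (aV_coer _); rewrite mulr_ge0 ?S2_ge0 ?ltW.
 move=> i; apply/aeW => x _; rewrite p2 mulrA -expr2 sqr_sqrtr//.
 by case/andP: (softsign_derive n (u.1 x)).
have h := res_test uP Hpsi.
have h1: dotL u.1 psi.1 <= dotL f psi.1 by rewrite -h lerDl mulr_ge0// ltW.
have h2: dotL f psi.1 <= l1 f.
 apply: le_dotL; apply/aeW => x _; rewrite absLE oneLE// mulr1 p1.
 apply: le_trans (ler_norm _) _; rewrite normrM ler_piMr//; exact: softsign_abs.
have h3: l1 u.1 - n.+1%:R^-1 * dotL one one <= dotL u.1 psi.1.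
 rewrite /l1 -dotLZl -dotLBl; apply: le_dotL; apply/aeW => x _.
 rewrite -[(absL u.1 - n.+1%:R^-1 *: one) x]/(absL u.1 x - n.+1%:R^-1 * one x) absLE oneLE// !mulr1 p1.
 exact: softsign_mul.
by rewrite -lerBlDr; apply: le_trans h3 (le_trans h1 h2).
Qed.

Lemma res_energy lam f u: 0 < lam -> res_eq lam f u ->
 dotL u.1 u.1 + 2 * lam * al * S2 u.2 <= dotL f f.
move=> lam0 uP; have [Hu _] := uP; have h := res_test uP Hu.
have := ler_wpM2l (ltW lam0) (aV_coer u.2).
have := dotL_ge0 (f - u.1); rewrite dotLBl !dotLBr (dotLC u.1 f).
move: (dotL u.1 u.1) (dotL f u.1) (dotL f f) (lam * aV _ _) h => a b c d h.
have ->: lam * (al * S2 u.2) = lam * al * S2 u.2 by ring.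
have ->: 2 * lam * al * S2 u.2 = 2 * (lam * al * S2 u.2) by ring.
by move: (lam * al * _) => e; lra.
Qed.

(** Tested with u - f, the form at u - f is absorbed by coercivity and only the gradient of f
    remains. This approximates elements of H1_0 by elements of the domain of the operator. *)
Lemma res_near (lam: R) u (f: E): 0 < lam -> H1_0 f -> res_eq lam f.1 u ->
 dotL (u.1 - f.1) (u.1 - f.1) <= lam * (N%:R ^+ 4 * C ^+ 2 / (2 * al) * S2 f.2).
move=> lam0 Hf uP; have [Hu _] := uP.
have Hd: H1_0 (u - f) by exact: (subspB H_subsp Hu Hf).
have h := res_test uP Hd; have hy := aV_young f.2 (u - f).2; have hc := aV_coer (u - f).2.
have e: aV u.2 (u - f).2 = aV (u - f).2 (u - f).2 + aV f.2 (u - f).2.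
 have := aV_linl 1 (u - f).2 f.2 (u - f).2; rewrite mul1r => <-; congr aV.
 by rewrite scale1r -[(u - f).2]/(u.2 - f.2) subrK.
rewrite e in h; have h': dotL (u.1 - f.1) (u - f).1 = - (lam * (aV (u - f).2 (u - f).2 + aV f.2 (u - f).2)).
 by rewrite dotLBl -h; ring.
rewrite -[X in dotL _ X]/((u - f).1) h' -mulrN ler_wpM2l ?(ltW lam0)//.
by have := mulr_ge0 (ltW al0) (S2_ge0 (u - f).2); lra.
Qed.
End resolvent.

(** * De Giorgi's theorem *)

Section degiorgi.
Definition vol (A: set vec): R := dotL (ind A) one.
(** Despite the name, an equality: u is a weak solution of - div(B grad u) = z. *)
Definition subsol (u: E) (z: L2O) := H1_0 u /\
 forall v: E, H1_0 v -> aV u.2 v.2 = dotL z v.1.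
Definition upper (u: L2O) x r k e :=
 [set y | cbx x r y /\ bowl x k (e / r ^+ 2) y <= u y].

Lemma meas_upper u x r k e: cbx x r `<=` Omega -> measurable (upper u x r k e).
move=> sO; have ->: upper u x r k e = cbx x r `&` [set y | 0 <= u y - bowl x k (e / r ^+ 2) y].
 by apply/seteqP; split => y [h1 h2]; split =>//=; move: h2; rewrite /= subr_ge0.
apply: measurable_fun_le; [exact: meas_cbx|exact: measurable_cst|].
apply: measurable_funB.
 by apply: measurable_funS sO _ =>//; [exact: mO|by case: (L2P u)].
apply: measurable_funS (subsetT _) _ =>//.
by apply: cont_vec; apply: sm_cont; exact: sm_bowl.
Qed.

(** The cut-off falls from 1 to 0 between the radii r and 3/2 r, so its support stays in the box of
    radius 2 r and hence in [Omega]. The bounds on the paraboloid come from a cube containing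
    [Omega]. *)
Lemma chain_ok_cutoff (x: vec) (r k c: R): 0 < r -> cbx x (2 * r) `<=` Omega ->
 exists2 K, 1 <= K & chain_ok (cutoff x r (3 / 2 * r)) (bowl x k c) K /\
  test_function Omega (cutoff x r (3 / 2 * r)).
move=> r0 sO; set chi := cutoff _ _ _; have r32: r < 3 / 2 * r by lra.
have tc: test_function Omega chi.
 apply: (@tfI _ _ Omega (cbx x (2 * r))) =>//.
 - exact: sm_cutoff.
 - exact: cbox_compact.
 - move=> y h; apply/cbxP => i; have := cutoff_neq0 r32 h i; lra.
have [a [s [s0 sA]]] := bnd_set_cube bO.
have Dx y i: Omega y -> `|y i ord0 - x i ord0| <= \sum_i (`|a i ord0| + s + `|x i ord0|).
 move=> /sA/(_ i); rewrite mxE => /andP[h1 h2].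
 rewrite (bigD1 i)//= -[leLHS]addr0 lerD// ?sumr_ge0// => [|j _]; last by rewrite !addr_ge0.
 apply: le_trans (ler_normB _ _) _; rewrite lerD2r ler_norml.
 have := ler_norm (a i ord0); have := ler_norm (- a i ord0); rewrite normrN => h3 h4.
 by apply/andP; split; lra.
set D := \sum_i _ in Dx.
have D0: 0 <= D by apply: sumr_ge0 => i _; rewrite !addr_ge0.
have /choice[K KP]: forall i, exists K, 0 <= K /\ forall y, `|'D_(ei i) chi y| <= K.
 by move=> i; have [K K0 KP] := tf_bnd (tf_derive (ei i) tc); exists K.
have K0: 0 <= \sum_i K i by apply: sumr_ge0 => i _; have [] := KP i.
pose KK := 1 + (`|k| + `|c| * (N%:R * D ^+ 2)) + \sum_i K i + `|c| * 2 * D.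
have t1: 0 <= `|c| * (N%:R * D ^+ 2) by rewrite !mulr_ge0 ?sqr_ge0.
have t2: 0 <= `|c| * 2 * D by rewrite !mulr_ge0.
have t3 := normr_ge0 k.
exists KK; first by rewrite /KK; lra.
split =>//; split.
- exact: sm_cutoff.
- exact: sm_bowl.
- by rewrite /KK; lra.
- move=> y Oy; split.
  have /andP[h1 h2] := cutoff_01 x r (3 / 2 * r) y.
  by rewrite ger0_norm//; apply: le_trans h2 _; rewrite /KK; lra.
 apply: (@le_trans _ _ (`|k| + `|c| * (N%:R * D ^+ 2))); last by rewrite /KK; lra.
 apply: le_trans (ler_normD _ _) _; rewrite lerD2l normrM ler_wpM2l// ger0_norm ?dsq_ge0//.
 by apply: dsq_le; apply/cbxP => i; exact: Dx.
move=> i y Oy; split.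
 apply: (@le_trans _ _ (\sum_i K i)); last by rewrite /KK; lra.
 have [_ h] := KP i; apply: le_trans (h y) _.
 by rewrite (bigD1 i)//= lerDl sumr_ge0// => j _; have [] := KP j.
rewrite derive_bowl !normrM; apply: (@le_trans _ _ (`|c| * 2 * D)); last by rewrite /KK; lra.
by rewrite [`|2|]ger0_norm// ler_wpM2l ?mulr_ge0// Dx.
Qed.
Lemma pos_lt0 (s: R): s < 0 -> pos s = 0.
by move=> s0; rewrite /pos; case: leP s0 =>//; lra. Qed.
Lemma pos'_lt0 (s: R): s < 0 -> pos' s = 0.
by move=> s0; rewrite /pos' ltNge (ltW s0) /= lt_eqF. Qed.
(** The 1 is due to the source, the other term to [aV_young] and to the gradient of the paraboloid,
    at most 2 e / r in each of N coordinates; 2 / al divides by the half of the coercivity that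
    Young's inequality leaves. *)
Definition KE := 2 / al * (1 + N%:R ^+ 4 * C ^+ 2 / (2 * al) * (4 * N%:R)).

Lemma KE_gt0: 0 < KE.
apply: mulr_gt0; first by rewrite divr_gt0.
apply: ltr_pwDl =>//; apply: mulr_ge0; last by rewrite mulr_ge0.
by apply: divr_ge0; rewrite mulr_ge0 ?sqr_ge0 ?exprn_ge0// ltW.
Qed.

(* Testing the equation with the part of u above a paraboloid instead of with a cut-off
  power of u: all energies are then localized for free where u is bounded above. *)
Lemma energy (u: E) (z: L2O) (Z: R) (x: vec) (r k e: R): subsol u z ->
 {aeO y, `|z y| <= Z} -> 0 < r -> 0 < e -> r ^+ 2 * Z <= e ->
 cbx x (2 * r) `<=` Omega ->
 {aeO y, cbx x (2 * r) y -> u.1 y <= k + e} ->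
 exists psi: E, [/\ H1_0 psi,
  {aeO y,
   psi.1 y = \1_(cbx x r) y * pos (u.1 y - bowl x k (e / r ^+ 2) y)},
  forall i, {aeO y, psi.2 i y = \1_(cbx x r) y *
   (pos' (u.1 y - bowl x k (e / r ^+ 2) y) * (u.2 i y - e / r ^+ 2 * 2 * (y i ord0 - x i ord0)))} &
  S2 psi.2 <= KE * (e / r) ^+ 2 * vol (upper u.1 x r k e)].
move=> [Hu uz] zZ r0 e0 rZ sO uk; set c := e / r ^+ 2; set l := bowl x k c.
have c0: 0 < c by rewrite divr_gt0// exprn_gt0.
have cr: c * r ^+ 2 = e by rewrite /c divfK// gt_eqF// exprn_gt0.
have [K K1 [ok tc]] := chain_ok_cutoff k c r0 sO.
set chi := cutoff x r (3 / 2 * r) in ok tc.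
have r32: r < 3 / 2 * r by lra.
have sO1: cbx x r `<=` Omega by apply: subset_trans (cbx_le _) sO; lra.
have gC s: `|pos' s| <= K by apply: le_trans (pos'_abs s) K1.
pose psi: E := @chainE chi l (@pos) (@pos') u.
have p1 y: psi.1 y = chi y * pos (u.1 y - l y) by rewrite /psi (chainE1 ok _ (pos_lip K1)).
have p2 i y: psi.2 i y = 'D_(ei i) chi y * pos (u.1 y - l y) +
  chi y * (pos' (u.1 y - l y) * (u.2 i y - c * 2 * (y i ord0 - x i ord0))).
 by rewrite /psi (chainE2 ok (pos_lip K1) meas_pos' gC) derive_bowl.
have Hpsi: H1_0 psi by exact: H_pos_cut ok K1 tc Hu.
(* The cut-off leaves no trace: on the box it is 1, and off the box either it vanishes or u lies
   strictly below the paraboloid. *)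
have key: {aeO y,
  [/\ psi.1 y = \1_(cbx x r) y * pos (u.1 y - l y) &
  forall i, psi.2 i y = \1_(cbx x r) y * (pos' (u.1 y - l y) * (u.2 i y - c * 2 * (y i ord0 - x i ord0)))]}.
 apply: filterS uk => y uk Oy; have [yr|yr] := pselect (cbx x r y).
  have chi1: chi y = 1 by apply: cutoff_eq1 =>//; exact/cbxP.
  split; first by rewrite p1 chi1 (indic_in yr).
  by move=> i; rewrite p2 chi1 (indic_in yr) derive_cutoff0 ?mul0r ?add0r//; right.
 have [chi0|chi0] := eqVneq (chi y) 0.
  split; first by rewrite p1 chi0 (indic_notin yr) !mul0r.
  by move=> i; rewrite p2 chi0 (indic_notin yr) derive_cutoff0 ?mul0r ?add0r//; left.
 have y2: cbx x (2 * r) y by apply/cbxP => i; have := cutoff_neq0 r32 chi0 i; lra.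
 have s0: u.1 y - l y < 0.
  have := uk Oy y2; have := dsq_gt (ltW r0) yr; rewrite /l /bowl -(ltr_pM2l c0) cr.
  by move: (c * _) => t; lra.
 split; first by rewrite p1 (pos_lt0 s0) (indic_notin yr) !mulr0.
 by move=> i; rewrite p2 (pos_lt0 s0) (pos'_lt0 s0) (indic_notin yr) !(mulr0, mul0r, addr0).
pose A := upper u.1 x r k e.
have mA: measurable A by exact: meas_upper.
have mu1: mfun Omega u.1 by case: (L2P u.1).
have ml: mfun Omega l.
 apply: measurable_funS (subsetT _) _ =>//.
 by apply: cont_vec; apply: sm_cont; exact: sm_bowl.
pose s y := Num.sqrt (\1_(cbx x r) y * pos' (u.1 y - l y)).
have ms: mfun Omega s.
 apply: mcomp; first exact: meas_sqrt.
 apply: measurable_funM.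
  by apply: measurable_funS (subsetT _) _ =>//; apply: measurable_indic; exact: meas_cbx.
 by apply: mcomp; [exact: meas_pos'|exact: measurable_funB].
have nA y: ~ A y -> cbx x r y -> u.1 y - l y < 0.
 by move=> yA yr; rewrite subr_lt0 ltNge; apply/negP => h; apply: yA.
have s01 y: 0 <= \1_(cbx x r) y * pos' (u.1 y - l y) <= (\1_A y: R).
 have /andP[q1 q2] := pos'_01 (u.1 y - l y).
 have [yA|yA] := pselect (A y).
  by have [yr _] := yA; rewrite (indic_in yA) (indic_in yr) mul1r q1.
 rewrite (indic_notin yA); have [yr|yr] := pselect (cbx x r y).
  by rewrite (pos'_lt0 (nA y yA yr)) mulr0 lexx.
 by rewrite (indic_notin yr) mul0r lexx.
have sK y: Omega y -> `|s y| <= 1.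
 move=> _; rewrite ger0_norm ?sqrtr_ge0// -[leRHS]sqrtr1 ler_wsqrtr//.
 by have := s01 y; have := indic_01 A y; lra.
have ss y: s y * s y = \1_(cbx x r) y * pos' (u.1 y - l y).
 by rewrite -expr2 sqr_sqrtr//; case/andP: (s01 y).
have inG i: in_L2 dx Omega (fun y => c * 2 * (y i ord0 - x i ord0)).
 have := in_L2_Dl ok i; rewrite (_: 'D_(ei i) _ = fun y => c * 2 * (y i ord0 - x i ord0))//.
 by apply/funext => y; rewrite derive_bowl.
pose G i: L2O := toL (fun y => c * 2 * (y i ord0 - x i ord0)).
have GE i y: G i y = c * 2 * (y i ord0 - x i ord0) by rewrite toL2x.
pose P i: L2O := u.2 i - G i.
have PE i y: P i y = u.2 i y - c * 2 * (y i ord0 - x i ord0).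
 by rewrite -[LHS]/(u.2 i y - G i y) GE.
have sE (V: 'I_N -> L2O) i y: scaleL s V i y = s y * V i y.
 by rewrite /scaleL (toL2_mulb _ ms sK).
have W i: {aeO y, psi.2 i y = s y * (s y * P i y)}.
 by apply: filterS key => y h Oy; have [_ ->] := h Oy; rewrite PE mulrA ss mulrA.
(* The gradient of u is that of u - l, here [P], plus the gradient [G] of the paraboloid: the first
   contributes a coercive term, the second is handled by [aV_young]. *)
have eV: aV u.2 psi.2 = aV (scaleL s P) (scaleL s P) + aV (scaleL s G) (scaleL s P).
 rewrite (aV_scale u.2 ms sK W); have := aV_linl 1 (scaleL s P) (scaleL s G) (scaleL s P).
 rewrite mul1r => <-; congr aV; apply/funext => i; apply: L2_eqP => y.
 rewrite -[RHS]/(1 * scaleL s P i y + scaleL s G i y) !sE mul1r PE GE; ring.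
have eq1 := uz _ Hpsi; rewrite eV in eq1.
have hz: dotL z psi.1 <= (e / r) ^+ 2 * vol A.
 rewrite /vol -dotLZl; apply: le_dotL; apply: filterS2 zZ (filterI key uk) => y hz [hk hu] Oy.
 rewrite -[((e / r) ^+ 2 *: ind A) y]/((e / r) ^+ 2 * ind A y) (indE y mA) oneLE// mulr1.
 have [-> _] := hk Oy.
 have ->: (e / r) ^+ 2 = c * e by rewrite /c; field; rewrite gt_eqF.
 have zc: `|z y| <= c.
  by apply: le_trans (hz Oy) _; rewrite /c ler_pdivlMr ?exprn_gt0// mulrC.
 have /andP[h1 h2]: 0 <= \1_(cbx x r) y * pos (u.1 y - l y) <= e * \1_A y.
  have p0: 0 <= pos (u.1 y - l y) by rewrite /pos le_max lexx orbT.
  have [yr|yr] := pselect (cbx x r y); last first.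
   by rewrite (indic_notin yr) mul0r lexx mulr_ge0 ?(ltW e0)//; case/andP: (indic_01 A y).
  rewrite (indic_in yr) mul1r p0 /=; have [yA|yA] := pselect (A y).
   rewrite (indic_in yA) mulr1 /pos ge_max (ltW e0) andbT.
   have y2: cbx x (2 * r) y by apply: cbx_le yr; lra.
   have := hu Oy y2; have := mulr_ge0 (ltW c0) (dsq_ge0 x y); rewrite /l /bowl.
   by move: (c * _) (u.1 y) => t1 t2 q1 q2; lra.
  by rewrite (indic_notin yA) mulr0 (pos_lt0 (nA y yA yr)).
 rewrite -mulrA; apply: le_trans (ler_wpM2l (ltW c0) h2).
 by apply: le_trans (ler_wpM2r h1 zc); rewrite ler_wpM2r// ler_norm.
have hG: S2 (scaleL s G) <= 4 * N%:R * (e / r) ^+ 2 * vol A.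
 have ->: 4 * N%:R * (e / r) ^+ 2 * vol A = \sum_(i < N) 4 * (e / r) ^+ 2 * vol A.
  by rewrite sumr_const card_ord -mulr_natr; ring.
 apply: ler_sum => i _; rewrite /vol -dotLZl; apply: le_dotL; apply/aeW => y Oy.
 rewrite -[((4 * (e / r) ^+ 2) *: ind A) y]/(4 * (e / r) ^+ 2 * ind A y) (indE y mA) oneLE// mulr1.
 rewrite sE GE; have ->: s y * (c * 2 * (y i ord0 - x i ord0)) * (s y * (c * 2 * (y i ord0 - x i ord0))) =
  4 * c ^+ 2 * (y i ord0 - x i ord0) ^+ 2 * (s y * s y) by ring.
 rewrite ss; have [yr|yr] := pselect (cbx x r y); last first.
  have /andP[q1 _] := indic_01 A y; rewrite (indic_notin yr) mul0r mulr0; apply: mulr_ge0 q1.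
  by rewrite mulr_ge0 ?sqr_ge0.
 have /andP[h1 h2] := s01 y; apply: ler_pM h1 _ h2; first by apply: mulr_ge0; last exact: sqr_ge0; apply: mulr_ge0; [|exact: sqr_ge0].
 have ->: 4 * (e / r) ^+ 2 = 4 * c ^+ 2 * r ^+ 2 by rewrite /c; field; rewrite gt_eqF.
 apply: ler_wpM2l; first by apply: mulr_ge0; last exact: sqr_ge0.
 move/cbxP: yr => /(_ i) h; rewrite -[leLHS]real_normK ?num_real//.
 by rewrite lerXn2r ?nnegrE// ltW.
have hy := aV_young (scaleL s G) (scaleL s P).
have hc := aV_coer (scaleL s P).
have hS: S2 psi.2 <= S2 (scaleL s P).
 apply: ler_sum => i _; apply: le_dotL; apply: filterS (W i) => y h Oy.
 rewrite h// !sE; have ->: s y * (s y * P i y) * (s y * (s y * P i y)) = (s y * s y) * (s y * P i y * (s y * P i y)) by ring.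
 rewrite ler_piMl//; first by rewrite -expr2 sqr_ge0.
 by rewrite -expr2 -[leLHS]real_normK ?num_real// expr_le1// sK.
exists psi; split =>//.
- by apply: filterS key => y h Oy; have [] := h Oy.
- by move=> i; apply: filterS key => y h Oy; have [_] := h Oy; apply.
apply: le_trans hS _.
have K10: 0 <= N%:R ^+ 4 * C ^+ 2 / (2 * al).
 by rewrite divr_ge0 ?mulr_ge0 ?sqr_ge0 ?exprn_ge0// ltW.
have := ler_wpM2l K10 hG; rewrite -/A.
rewrite /KE; move: hz hy hc eq1; move: (dotL z psi.1) (aV _ (scaleL s P)) (aV _ _) => a b b'.
move: (N%:R: R) ((e / r) ^+ 2) (vol A) (S2 (scaleL s P)) (S2 (scaleL s G)) (N%:R ^+ 4 * C ^+ 2 / (2 * al)) => n er v sp sg K1'.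
move=> h1 h2 h3 h4 h5.
have h6: al / 2 * sp <= er * v + K1' * (4 * n * er * v).
 have: al * sp = al / 2 * sp + al / 2 * sp by field.
 by move: h2 h3; move: (al * sp) (al / 2 * sp) (K1' * sg) (K1' * _) h5 => a1 a2 a3 a4; lra.
have al2: 0 < al / 2 by rewrite divr_gt0.
rewrite -(ler_pM2l al2); apply: le_trans h6 _.
by apply: leEq; field; rewrite gt_eqF.
Qed.
End degiorgi.
Section positive_part.
Implicit Types u k e b: R.
Lemma pos_low u k b: u <= k -> 0 <= b -> pos (u - (k + b)) = 0.
by move=> h1 h2; rewrite /pos; apply/max_idPr; lra. Qed.
Lemma pos_gap u k e b: k + e / 2 <= u -> 0 <= b -> b <= e / 4 ->
 pos (u - (k + b)) - pos (u - (k + e / 8 + b)) = e / 8.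
by move=> h1 h2 h3; rewrite /pos !(max_idPl _); lra. Qed.

Lemma pos'_gap u k e b: 0 < e -> u < k \/ k + e / 2 <= u -> 0 <= b -> b <= e / 4 ->
 pos' (u - (k + b)) = pos' (u - (k + e / 8 + b)).
move=> e0 [h|h] h1 h2; first by rewrite !pos'_lt0; lra.
have pp s: 0 < s -> pos' s = 1 by rewrite /pos' => ->.
by rewrite !pp; lra.
Qed.
End positive_part.
Section oscillation.
Lemma vol_le (A A': set vec): measurable A -> measurable A' -> A `<=` A' -> vol A <= vol A'.
exact: ind_le. Qed.
Lemma vol_ge0 A: measurable A -> 0 <= vol A.
exact: ind_ge0. Qed.

Lemma vol_cbx x r: 0 <= r -> cbx x r `<=` Omega -> vol (cbx x r) = (2 * r) ^+ N.
move=> r0 sO; apply: EFin_inj; rewrite -ind_vol //; last exact: meas_cbx.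
by apply: leb_cube; rewrite mulr_ge0.
Qed.

Lemma l1_supp (f: L2O) (A: set vec): measurable A ->
 {aeO y, ~ A y -> f y = 0} -> l1 f ^+ 2 <= dotL f f * vol A.
move=> mA fA; have ->: l1 f = dotL (absL f) (ind A).
 rewrite /l1; apply: eq_dotL; apply: filterS fA => y h Oy.
 rewrite absLE oneLE// (indE y mA).
 by have [yA|yA] := pselect (A y); [rewrite indic_in|rewrite h// normr0 !mul0r].
by apply: le_trans (dotL_cs _ _) _; rewrite dotL_abs (ind_sq mA).
Qed.

Section solution.
Variables (u: E) (z: L2O) (Z: R).
Hypothesis uz: subsol u z.
Hypothesis zZ: {aeO y, `|z y| <= Z}.

(** Nash's inequality for the part of u above the level h. Its support has a volume small against
    rho^N, so by Cauchy-Schwarz the L1 term is absorbed, and the factor rho^2 of the energy is the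
    gain. *)
Lemma stampacchia_step (x: vec) (r k e h h' rho: R): 0 < r -> 0 < e -> r ^+ 2 * Z <= e ->
 cbx x (2 * r) `<=` Omega -> {aeO y, cbx x (2 * r) y -> u.1 y <= k + e} ->
 0 <= h -> h <= h' -> 0 < rho -> 32 * N.+1%:R * vol (upper u.1 x r (k + h) e) <= rho ^+ N ->
 (h' - h) ^+ 2 * vol (upper u.1 x r (k + h') e) <=
 32 * N.+1%:R * KE * rho ^+ 2 * (e / r) ^+ 2 * vol (upper u.1 x r (k + h) e).
move=> r0 e0 rZ sO uk h0 hh rho0 small.
have uk': {aeO y, cbx x (2 * r) y -> u.1 y <= k + h + e}.
 by apply: filterS uk => y q Oy yr; have := q Oy yr; lra.
have sO1: cbx x r `<=` Omega by apply: subset_trans (cbx_le _) sO; lra.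
have [psi [Hpsi p1 p2 pS]] := energy uz zZ r0 e0 rZ sO uk'.
have mA h1: measurable (upper u.1 x r h1 e) by exact: meas_upper.
have bE k1 y: bowl x (k + k1) (e / r ^+ 2) y = k1 + bowl x k (e / r ^+ 2) y by rewrite /bowl; ring.
have low: (h' - h) ^+ 2 * vol (upper u.1 x r (k + h') e) <= dotL psi.1 psi.1.
 rewrite /vol -dotLZl; apply: le_dotL; apply: filterS p1 => y p1 Oy.
 rewrite -[((h' - h) ^+ 2 *: ind (upper u.1 x r (k + h') e)) y]/((h' - h) ^+ 2 * ind (upper u.1 x r (k + h') e) y).
 rewrite (indE y (mA _)) oneLE// mulr1 -expr2.
 have [yA|yA] := pselect (upper u.1 x r (k + h') e y); last by rewrite (indic_notin yA) mulr0 sqr_ge0.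
 rewrite (indic_in yA) mulr1 p1//; case: yA => yr; rewrite /= (indic_in yr) mul1r !bE => yA.
 have hp: h' - h <= pos (u.1 y - (h + bowl x k (e / r ^+ 2) y)) by rewrite /pos le_max; apply/orP; left; lra.
 by rewrite lerXn2r ?nnegrE ?subr_ge0// (le_trans _ hp)// subr_ge0.
have l1b: l1 psi.1 ^+ 2 <= dotL psi.1 psi.1 * vol (upper u.1 x r (k + h) e).
 apply: l1_supp =>//; apply: filterS p1 => y p1 Oy yA; rewrite p1//.
 have [yr|yr] := pselect (cbx x r y); last by rewrite indic_notin// mul0r.
 have [q|q] := ltP (u.1 y - bowl x (k + h) (e / r ^+ 2) y) 0; first by rewrite (pos_lt0 q) mulr0.
 by exfalso; apply: yA; split =>//=; rewrite -subr_ge0.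
have := nash_H Hpsi rho0; move: l1b pS low small; rewrite -/(S2 psi.2) => l1b pS low small nash.
apply: le_trans low _; move: l1b pS small nash (dotL_ge0 psi.1) (vol_ge0 (mA (k + h))).
move: (vol _) (S2 psi.2) (dotL _ _) (l1 _) KE ((e / r) ^+ 2) => v s X l K w l1b pS small nash X0 v0.
have rN: 0 < rho ^+ N by rewrite exprn_gt0.
have n0: 0 < N.+1%:R :> R by rewrite ltr0n.
have h1: 16 * N.+1%:R * (rho ^- N * l ^+ 2) <= X / 2.
 apply: (@le_trans _ _ (16 * N.+1%:R * (rho ^- N * (X * v)))).
  by rewrite !ler_wpM2l ?mulr_ge0 ?invr_ge0 ?(ltW n0) ?(ltW rN).
 have ->: 16 * N.+1%:R * (rho ^- N * (X * v)) = X / 2 * (32 * N.+1%:R * v / rho ^+ N).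
  by field; rewrite gt_eqF.
 by rewrite ler_piMr ?divr_ge0// ler_pdivrMr// mul1r.
have h2: 16 * N.+1%:R * (rho ^+ 2 * s) <= 16 * N.+1%:R * (rho ^+ 2 * (K * w * v)).
 apply: ler_wpM2l; first by rewrite mulr_ge0// ltW.
 by apply: ler_wpM2l pS; exact: sqr_ge0.
rewrite mulrDr in nash.
have ->: 32 * N.+1%:R * K * rho ^+ 2 * w * v = 2 * (16 * N.+1%:R * (rho ^+ 2 * (K * w * v))) by ring.
move: (16 * N.+1%:R * (rho ^- N * l ^+ 2)) (16 * N.+1%:R * (rho ^+ 2 * s)) h1 h2 nash => a b.
move: (16 * _ * _) => c h1 h2 nash; lra.
Qed.

(** The levels rise to k + e/2 by steps e 2^(-j) / 4 while rho_j = eta r 2^(-j). Both sides of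
    [stampacchia_step] then scale by 4^(-j), the volumes decrease by a factor 2^(-N) at each step,
    and that is exactly what reproduces the smallness hypothesis at the scale rho_(j+1). *)
Lemma stampacchia (N0: (0 < N)%N) (eta: R): 0 < eta -> 16 * (32 * N.+1%:R * KE) * eta ^+ 2 <= 2^-1 ^+ N ->
 forall (x: vec) (r k e: R), 0 < r -> 0 < e -> r ^+ 2 * Z <= e ->
 cbx x (2 * r) `<=` Omega -> {aeO y, cbx x (2 * r) y -> u.1 y <= k + e} ->
 32 * N.+1%:R * vol (upper u.1 x r k e) <= (eta * r) ^+ N ->
 {aeO y, cbx x r y -> u.1 y <= bowl x (k + e / 2) (e / r ^+ 2) y}.
move=> eta0 etaP x r k e r0 e0 rZ sO uk small.
have sO1: cbx x r `<=` Omega by apply: subset_trans (cbx_le _) sO; lra.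
have mA h1: measurable (upper u.1 x r h1 e) by exact: meas_upper.
pose h j: R := e / 2 * (1 - 2^-1 ^+ j).
have t0 j: 0 < 2^-1 ^+ j :> R by rewrite exprn_gt0 ?invr_gt0.
have t1 j: 2^-1 ^+ j <= 1 :> R by rewrite exprn_ile1 ?invr_ge0// invf_le1// ler1n.
have h0 j: 0 <= h j by rewrite mulr_ge0 ?divr_ge0 ?(ltW e0)// subr_ge0.
have hS j: h j.+1 - h j = e / 4 * 2^-1 ^+ j by rewrite /h exprS; field.
pose a j := vol (upper u.1 x r (k + h j) e).
have a0: a 0%N = vol (upper u.1 x r k e) by rewrite /a /h expr0 subrr mulr0 addr0.
have aj j: a j <= (2^-1 ^+ N) ^+ j * a 0%N.
 elim: j => [|j IH]; first by rewrite expr0 mul1r.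
 have rho0: 0 < eta * r * 2^-1 ^+ j by rewrite !mulr_gt0.
 have hl: h j <= h j.+1 by rewrite -subr_ge0 hS mulr_ge0 ?(ltW (t0 j))// divr_ge0// ltW.
 have sm: 32 * N.+1%:R * a j <= (eta * r * 2^-1 ^+ j) ^+ N.
  apply: le_trans (ler_wpM2l _ IH) _; first by rewrite mulr_ge0.
  have ->: (eta * r * 2^-1 ^+ j) ^+ N = (2^-1 ^+ N) ^+ j * (eta * r) ^+ N.
   by rewrite exprMn -!exprM mulnC mulrC.
  by rewrite mulrCA a0 ler_wpM2l// exprn_ge0// ltW.
 have := stampacchia_step r0 e0 rZ sO uk (h0 j) hl rho0 sm; rewrite hS -/(a j) -/(a j.+1).
 have ->: 32 * N.+1%:R * KE * (eta * r * 2^-1 ^+ j) ^+ 2 * (e / r) ^+ 2 * a j =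
  (e / 4 * 2^-1 ^+ j) ^+ 2 * (16 * (32 * N.+1%:R * KE) * eta ^+ 2 * a j).
  by move: KE (2^-1 ^+ j) (N.+1%:R) => K t n; field; rewrite gt_eqF.
 rewrite ler_pM2l; last by rewrite exprn_gt0// !mulr_gt0// invr_gt0.
 move=> q; apply: le_trans q _.
 apply: (le_trans _ (_: 2^-1 ^+ N * ((2^-1 ^+ N) ^+ j * a 0%N) <= _)); last by rewrite (exprS _ j) mulrA.
 apply: ler_pM =>//; last exact: (vol_ge0 (mA _)).
 apply: mulr_ge0; last exact: sqr_ge0.
 by apply: mulr_ge0 =>//; apply: mulr_ge0; [exact: mulr_ge0|exact: ltW KE_gt0].
pose A := upper u.1 x r (k + e / 2) e.
have vA: vol A <= 0.
 have q j: vol A * j.+1%:R <= a 0%N.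
  have q1: vol A <= 2^-1 ^+ j * a 0%N.
   apply: (@le_trans _ _ (a j)).
    apply: vol_le; [exact: mA|exact: mA|move=> y [yr yA]].
    split =>//; apply: le_trans yA; rewrite /bowl lerD2r lerD2l.
    by rewrite /h ler_piMr ?divr_ge0 ?(ltW e0)// gerBl ltW.
   apply: le_trans (aj j) _; rewrite ler_wpM2r ?a0 ?vol_ge0// -exprM.
   by rewrite ler_wiXn2l ?invr_ge0// ?invf_le1 ?ler1n// leq_pmull.
  have q2: (j.+1%:R: R) <= 2 ^+ j.
   by rewrite -natrX ler_nat ltn_expl.
  apply: le_trans (ler_wpM2r _ q1) _ =>//; rewrite mulrAC -[leRHS]mul1r ler_wpM2r ?a0 ?vol_ge0//.
  by rewrite exprVn mulrC ler_pdivrMr ?exprn_gt0// mul1r.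
 rewrite leNgt; apply/negP => v0; have [n hn] := nat_above (a 0%N / vol A).
 by have := q n; rewrite leNgt mulrC -ltr_pdivrMr// hn.
rewrite /vol -(ind_sq (mA _)) in vA; apply: filterS (dotL_eq0 vA) => y h' Oy yr.
rewrite leNgt; apply/negP => q; have := h' Oy; rewrite (indE y (mA _)) indic_in.
 by move/eqP; rewrite oner_eq0.
by split =>//=; exact: ltW.
Qed.

Lemma S2B (V W: 'I_N -> L2O): S2 (fun i => V i - W i) <= 2 * S2 V + 2 * S2 W.
rewrite /S2 !mulr_sumr -big_split; apply: ler_sum => i _ /=.
by apply: le_trans (dotL_sqD _ _) _; rewrite dotLNl dotLNr opprK.
Qed.

(* The truncated difference of two positive parts is constant above the level k + e/2, so its
  gradient lives on the slice k <= u < k + e/2. *)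
Lemma level_gap (N0: (0 < N)%N) (c: R): 0 < c ->
 forall (x: vec) (r m k e: R), 0 < r -> 0 < e -> r ^+ 2 * Z <= e -> m <= k ->
 cbx x (2 * r) `<=` Omega -> {aeO y, cbx x (2 * r) y -> u.1 y <= k + e} ->
 let Q := cbx x (r / (2 * N%:R)) in
 2^-1 * vol Q <= vol (Q `&` [set y | u.1 y <= m]) ->
 c * vol Q <= vol (Q `&` [set y | k + e / 2 <= u.1 y]) ->
 c ^+ 2 / (1024 * KE * (2 * N%:R) ^+ N) * vol Q <= vol (Q `&` [set y | k <= u.1 y < k + e / 2]).
move=> c0 x r m k e r0 e0 rZ mk sO uk Q.
have n0: 0 < N%:R :> R by rewrite ltr0n.
have n1: 1 <= N%:R :> R by rewrite ler1n.
have r1_gt0: 0 < r / (2 * N%:R) by rewrite divr_gt0// mulr_gt0.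
have r1r: r / (2 * N%:R) <= r.
 by rewrite ler_pdivrMr ?mulr_gt0// ler_peMr ?(ltW r0)//; lra.
have sO1: cbx x r `<=` Omega by apply: subset_trans (cbx_le _) sO; lra.
have Qr: Q `<=` cbx x r by exact: cbx_le.
have QO: Q `<=` Omega by exact: subset_trans Qr sO1.
have mQ: measurable Q by exact: meas_cbx.
have mu1: mfun Q u.1 by apply: measurable_funS QO _ =>//; [exact: mO|case: (L2P u.1)].
set A := Q `&` _; set A' := Q `&` [set y | k + _ <= _]; set D := Q `&` _ => vA vA'.
have mA: measurable A by apply: measurable_fun_le =>//; exact: measurable_cst.
have mA': measurable A' by apply: measurable_fun_le =>//; exact: measurable_cst.
have mD: measurable D.
 have ->: D = (Q `&` [set y | k <= u.1 y]) `\` A'.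
  apply/seteqP; split => [y [Qy /= /andP[h1 h2]]|y [[Qy /= h1] h2]].
   by split; [split|move=> [_ /=]; rewrite leNgt h2].
  by split =>//=; rewrite h1 /= ltNge; apply/negP => h3; apply: h2.
 by apply: measurableD =>//; apply: measurable_fun_le =>//; exact: measurable_cst.
have uk': {aeO y, cbx x (2 * r) y -> u.1 y <= k + e / 8 + e}.
 by apply: filterS uk => y q Oy yr; have := q Oy yr; lra.
have [psi [Hp p1 p2 pS]] := energy uz zZ r0 e0 rZ sO uk.
have [psi' [Hp' p1' p2' pS']] := energy uz zZ r0 e0 rZ sO uk'.
pose f: E := psi - psi'; have Hf: H1_0 f by exact: (subspB H_subsp Hp Hp').
have f1 y: f.1 y = psi.1 y - psi'.1 y by [].
have f2 i y: f.2 i y = psi.2 i y - psi'.2 i y by [].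
(* The radius r / (2 N) is chosen so that the paraboloid rises by at most e/4 on Q, as [pos_gap] and
   [pos'_gap] require. *)
have bQ y: Q y -> 0 <= e / r ^+ 2 * dsq x y <= e / 4.
 move=> yQ; have e1: 0 < e / r ^+ 2 by rewrite divr_gt0// exprn_gt0.
 rewrite mulr_ge0 ?dsq_ge0 ?(ltW e1)//=; have := ler_wpM2l (ltW e1) (dsq_le yQ).
 move=> h; apply: le_trans h _.
 have ->: e / r ^+ 2 * (N%:R * (r / (2 * N%:R)) ^+ 2) = e / 4 * N%:R^-1.
  by field; rewrite !gt_eqF.
 by rewrite ler_piMr ?divr_ge0 ?(ltW e0)// invf_le1.
have t0: 0 <= 2 * (r / (2 * N%:R)) by rewrite mulr_ge0// ltW.
have iso := isoper_H Hf t0 QO mA mA' (@subIsetl _ _ _) (@subIsetl _ _ _).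
have i1: dotL f.1 (ind A) <= 0.
 have ->: 0 = 0 * dotL f.1 (ind A) by rewrite mul0r.
 rewrite -dotLZl; apply: le_dotL; apply: filterS2 p1 p1' => y q q' Oy.
 rewrite -[(0 *: f.1) y]/(0 * f.1 y) !mul0r (indE y mA).
 have [yA|yA] := pselect (A y); last by rewrite indic_notin// mulr0.
 rewrite f1 q// q'//; have [Qy /= um] := yA; have /andP[b0 _] := bQ y Qy.
 have uk0 := le_trans um mk; have e8: k <= k + e / 8 by rewrite lerDl divr_ge0// ltW.
 by rewrite /bowl !pos_low// ?(le_trans uk0)// !mulr0 subrr mul0r.
have i2: e / 8 * vol A' <= dotL f.1 (ind A').
 rewrite /vol -dotLZl; apply: le_dotL; apply: filterS2 p1 p1' => y q q' Oy.
 rewrite -[(e / 8 *: ind A') y]/(e / 8 * ind A' y) !(indE y mA') oneLE// mulr1.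
 have [yA|yA] := pselect (A' y); last by rewrite indic_notin// !mulr0.
 rewrite (indic_in yA) !mulr1 f1 q// q'//; have [Qy /= um] := yA; have /andP[b0 b1] := bQ y Qy.
 by rewrite (indic_in (Qr y Qy)) !mul1r /bowl (pos_gap um b0 b1).
have i3 i: dotL (absL (f.2 i)) (ind Q) ^+ 2 <= S2 f.2 * vol D.
 have ->: dotL (absL (f.2 i)) (ind Q) = dotL (absL (f.2 i)) (ind D).
  apply: eq_dotL; apply: filterS2 (p2 i) (p2' i) => y q q' Oy.
  rewrite absLE (indE y mQ) (indE y mD).
  have [Qy|Qy] := pselect (Q y); last by rewrite indic_notin// indic_notin// => -[].
  have /andP[b0 b1] := bQ y Qy.
  have [yD|yD] := pselect (D y); first by rewrite !indic_in.
  rewrite (indic_notin yD) mulr0 f2 q// q'// (indic_in (Qr y Qy)) !mul1r.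
  have h: u.1 y < k \/ k + e / 2 <= u.1 y.
   have [lo|hi] := ltP (u.1 y) k; [by left|right].
   by rewrite leNgt; apply/negP => h; apply: yD; split =>//=; rewrite hi.
  by rewrite /bowl (pos'_gap e0 h b0 b1) subrr normr0 mul0r.
 apply: le_trans (dotL_cs _ _) _; rewrite dotL_abs (ind_sq mD) ler_wpM2r ?vol_ge0//.
 by rewrite /S2 (bigD1 i)//= lerDl sumr_ge0// => j _; exact: dotL_ge0.
have i4: S2 f.2 <= 4 * (KE * (e / r) ^+ 2 * (2 * r) ^+ N).
 apply: le_trans (S2B _ _) _.
 have h k' v: v <= KE * (e / r) ^+ 2 * vol (upper u.1 x r k' e) -> v <= KE * (e / r) ^+ 2 * (2 * r) ^+ N.
  move=> h; apply: le_trans h _; rewrite -(vol_cbx (ltW r0) sO1).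
  apply: ler_wpM2l; first by rewrite mulr_ge0 ?sqr_ge0// (ltW KE_gt0).
  by apply: vol_le; [exact: meas_upper|exact: meas_cbx|move=> y []].
 by move: (h _ _ pS) (h _ _ pS'); move: (KE * _ * _) => t; lra.
have D0: 0 <= vol D by exact: vol_ge0.
have f20 := S2_ge0 f.2; have i5 := sum_sq_le (mulr_ge0 f20 D0) i3.
have vQ: vol Q = (r / N%:R) ^+ N.
 by rewrite /Q vol_cbx ?(ltW r1_gt0)//; congr (_ ^+ _); field; rewrite gt_eqF.
have vQ0: 0 < vol Q by rewrite vQ exprn_gt0// divr_gt0.
have r2: (2 * r) ^+ N = (2 * N%:R) ^+ N * vol Q.
 by rewrite vQ -exprMn; congr (_ ^+ _); field; rewrite gt_eqF.
have tE: (2 * (r / (2 * N%:R))) ^+ N.+1 = r / N%:R * vol Q.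
 rewrite vQ exprS; congr (_ * _ ^+ _); field; rewrite gt_eqF//.
rewrite tE in iso; rewrite r2 in i4; move: iso i1 i2 i4 i5 D0 f20 vA vA' vQ0; rewrite -/(vol A) -/(vol A').
have w0: 0 < (2 * N%:R) ^+ N :> R by rewrite exprn_gt0// mulr_gt0.
move: (vol Q) (vol A) (vol A') (vol D) (S2 f.2) (dotL f.1 _) (dotL f.1 _) KE KE_gt0 (\sum_i _) ((2 * N%:R) ^+ N) w0.
move=> q a b d s fb fa K K0 sm w w0 iso i1 i2 i4 i5 d0 s0 vA vA' q0.
have a0: 0 <= a by apply: le_trans vA; rewrite mulr_ge0// ltW.
have b0: 0 <= b by apply: le_trans vA'; rewrite mulr_ge0// ltW.
have l0: c * q ^+ 2 * e / 16 <= r / N%:R * q * sm.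
 apply: le_trans iso; apply: (@le_trans _ _ (a * (e / 8 * b))).
  have ->: c * q ^+ 2 * e / 16 = 2^-1 * q * (e / 8 * (c * q)) by field.
  have e8: 0 <= e / 8 by rewrite divr_ge0// ltW.
  apply: ler_pM =>//; [by rewrite mulr_ge0// ltW| |exact: ler_wpM2l].
  by rewrite mulr_ge0// mulr_ge0// ltW.
 rewrite -[leLHS]subr0; apply: lerB; first exact: ler_wpM2l.
 by rewrite mulr_ge0_le0.
have l1': (c * q * e * N%:R / (16 * r)) <= sm.
 rewrite -(ler_pM2l (_: 0 < r / N%:R * q)); last by rewrite mulr_gt0// divr_gt0.
 apply: le_trans l0; apply: leEq; field.
 by rewrite !gt_eqF.
have l2: (c * q * e * N%:R / (16 * r)) ^+ 2 <= N%:R ^+ 2 * (s * d).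
 apply: le_trans i5; rewrite lerXn2r ?nnegrE//; last by apply: le_trans l1'; rewrite divr_ge0// ?mulr_ge0 ?(ltW c0) ?(ltW q0) ?(ltW e0) ?(ltW r0).
 by rewrite divr_ge0// ?mulr_ge0 ?(ltW c0) ?(ltW q0) ?(ltW e0) ?(ltW r0).
have l3: (c * q * e * N%:R / (16 * r)) ^+ 2 <= N%:R ^+ 2 * (4 * (K * (e / r) ^+ 2 * (w * q)) * d).
 by apply: le_trans l2 _; rewrite ler_wpM2l ?sqr_ge0// ler_wpM2r.
have fac: 0 < N%:R ^+ 2 * (4 * (K * (e / r) ^+ 2 * (w * q))) :> R.
 by rewrite !mulr_gt0 ?exprn_gt0// ?invr_gt0.
rewrite -(ler_pM2l fac); apply: (le_trans _ (_: N%:R ^+ 2 * (4 * (K * (e / r) ^+ 2 * (w * q)) * d) <= _)); last by rewrite mulrA.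
apply: le_trans l3.
apply: leEq; field; rewrite !gt_eqF//.
Qed.
End solution.
End oscillation.
Section holder.


Lemma vol_disj (A A1 A2: set vec): measurable A -> measurable A1 -> measurable A2 ->
 A1 `<=` A -> A2 `<=` A -> (forall y, A1 y -> ~ A2 y) -> vol A1 + vol A2 <= vol A.
move=> mA m1 m2 s1 s2 d12; rewrite /vol -dotLDl; apply: le_dotL; apply/aeW => y _.
rewrite oneLE// !mulr1 -[(ind A1 + ind A2) y]/(ind A1 y + ind A2 y).
rewrite (indE y mA) (indE y m1) (indE y m2).
have [y1|y1] := pselect (A1 y).
 by rewrite (indic_in y1) (indic_notin (d12 y y1)) (indic_in (s1 y y1)) addr0.
rewrite (indic_notin y1) add0r; have [y2|y2] := pselect (A2 y).
 by rewrite (indic_in y2) (indic_in (s2 y y2)).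
by rewrite (indic_notin y2); case/andP: (indic_01 A y).
Qed.

Lemma volU (A A1 A2: set vec): measurable A -> measurable A1 -> measurable A2 ->
 A `<=` A1 `|` A2 -> vol A <= vol A1 + vol A2.
move=> mA m1 m2 s; rewrite /vol -dotLDl; apply: le_dotL; apply/aeW => y _.
rewrite oneLE// !mulr1 -[(ind A1 + ind A2) y]/(ind A1 y + ind A2 y).
rewrite (indE y mA) (indE y m1) (indE y m2).
have /andP[a1 _] := indic_01 A1 y; have /andP[a2 _] := indic_01 A2 y.
have [yA|yA] := pselect (A y); last by rewrite (indic_notin yA) addr_ge0.
by rewrite (indic_in yA); case: (s y yA) => h; rewrite (indic_in h) ?lerDl ?lerDr.
Qed.

Lemma meas_ge (f: L2O) (Q: set vec) k: measurable Q -> Q `<=` Omega ->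
 measurable (Q `&` [set y | k <= f y]) /\ measurable (Q `&` [set y | f y <= k]).
move=> mQ QO; have mf: mfun Q f.
 by apply: measurable_funS QO _ =>//; [exact: mO|case: (L2P f)].
by split; apply: measurable_fun_le =>//; exact: measurable_cst.
Qed.

Section solution.
Variables (u: E) (z: L2O) (Z: R).
Hypothesis uz: subsol u z.
Hypothesis zZ: {aeO y, `|z y| <= Z}.
Hypothesis N0: (0 < N)%N.

(** By [level_gap] each of the J slices between the levels m + e - e 2^(-j) takes the same fraction
    of Q, because the set below m and the set above the top level bound from below those seen at
    each stage. The slices are disjoint, so their number is limited. *)
Lemma level_iter (c: R) (J: nat) (x: vec) (r m e: R): 0 < c -> 0 < r -> 0 < e ->
 r ^+ 2 * Z <= e * 2^-1 ^+ J -> cbx x (2 * r) `<=` Omega ->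
 {aeO y, cbx x (2 * r) y -> u.1 y <= m + e} ->
 let Q := cbx x (r / (2 * N%:R)) in
 2^-1 * vol Q <= vol (Q `&` [set y | u.1 y <= m]) ->
 c * vol Q <= vol (Q `&` [set y | m + e - e * 2^-1 ^+ J <= u.1 y]) ->
 J%:R * (c ^+ 2 / (1024 * KE * (2 * N%:R) ^+ N)) <= 1.
move=> c0 r0 e0 rZ sO uk Q.
have n0: 0 < N%:R :> R by rewrite ltr0n.
have n1: 1 <= N%:R :> R by rewrite ler1n.
have r1_gt0: 0 < r / (2 * N%:R) by rewrite divr_gt0// mulr_gt0.
have r1r: r / (2 * N%:R) <= 2 * r.
 by rewrite ler_pdivrMr ?mulr_gt0// mulrAC mulrA; nra.
have QO: Q `<=` Omega by apply: subset_trans (cbx_le _) sO.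
have mQ: measurable Q by exact: meas_cbx.
have vQ: 0 < vol Q by rewrite (vol_cbx (ltW r1_gt0) QO) exprn_gt0// mulr_gt0.
pose F j := vol (Q `&` [set y | m + e - e * 2^-1 ^+ j <= u.1 y]).
rewrite -/(F J); set c2 := c ^+ 2 / _ => low high.
have t0 j: 0 < 2^-1 ^+ j :> R by rewrite exprn_gt0 ?invr_gt0.
have tm i j: (i <= j)%N -> 2^-1 ^+ j <= 2^-1 ^+ i :> R.
 by move=> ij; rewrite ler_wiXn2l ?invr_ge0// ?invf_le1 ?ler1n.
have Fm i j: (i <= j)%N -> F j <= F i.
 move=> ij; apply: vol_le =>//; [exact: (meas_ge _ _ mQ QO).1|exact: (meas_ge _ _ mQ QO).1|].
 move=> y [Qy /= h]; split =>//=; apply: le_trans h.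
 by rewrite lerB// ler_wpM2l ?(ltW e0)// tm.
have step j: (j < J)%N -> F j.+1 + c2 * vol Q <= F j.
 move=> jJ; have ej: 0 < e * 2^-1 ^+ j by rewrite mulr_gt0.
 have kE: m + e - e * 2^-1 ^+ j + e * 2^-1 ^+ j / 2 = m + e - e * 2^-1 ^+ j.+1.
  by rewrite exprS; field.
 have uk': {aeO y, cbx x (2 * r) y -> u.1 y <= m + e - e * 2^-1 ^+ j + e * 2^-1 ^+ j}.
  by rewrite subrK.
 have rZ': r ^+ 2 * Z <= e * 2^-1 ^+ j.
  by apply: le_trans rZ _; rewrite ler_wpM2l ?(ltW e0)// tm// ltnW.
 have mk: m <= m + e - e * 2^-1 ^+ j.
  by rewrite -addrA lerDl subr_ge0 ler_piMr ?(ltW e0)//; exact: (tm 0%N).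
 have := level_gap uz zZ N0 c0 r0 ej rZ' mk sO uk' low.
 rewrite kE; have cF: c * vol Q <= F j.+1 by apply: le_trans high (Fm _ _ jJ).
 move=> /(_ cF) h; apply: (@le_trans _ _ (F j.+1 + vol (Q `&` [set y | m + e - e * 2^-1 ^+ j <= u.1 y < m + e - e * 2^-1 ^+ j.+1]))).
  by rewrite lerD2l.
 have [m1 _] := meas_ge u.1 (m + e - e * 2^-1 ^+ j) mQ QO.
 have [m2 _] := meas_ge u.1 (m + e - e * 2^-1 ^+ j.+1) mQ QO.
 apply: vol_disj =>//.
 - have ->: Q `&` [set y | m + e - e * 2^-1 ^+ j <= u.1 y < m + e - e * 2^-1 ^+ j.+1] =
    (Q `&` [set y | m + e - e * 2^-1 ^+ j <= u.1 y]) `\` (Q `&` [set y | m + e - e * 2^-1 ^+ j.+1 <= u.1 y]).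
   apply/seteqP; split => [y [Qy /= /andP[h1 h2]]|y [[Qy /= h1] h2]].
    by split; [split|move=> [_ /=]; rewrite leNgt h2].
   by split =>//=; rewrite h1 /= ltNge; apply/negP => h3; apply: h2.
  exact: measurableD.
 - move=> y [Qy /= h']; split =>//=; apply: le_trans h'.
  by rewrite lerB// ler_wpM2l ?(ltW e0)// tm.
 - by move=> y [Qy /= /andP[]].
 - by move=> y [Qy /= h'] [_ /= /andP[_]]; rewrite ltNge h'.
have bound j: (j <= J)%N -> F j + j%:R * (c2 * vol Q) <= vol Q.
 elim: j => [_|j IH jJ].
  rewrite mul0r addr0; apply: vol_le =>//; exact: (meas_ge _ _ mQ QO).1.
 apply: le_trans (IH (ltnW jJ)); rewrite -natr1 mulrDl mul1r.
 by rewrite addrCA [leRHS]addrC lerD2l; exact: step.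
have := bound J (leqnn J); have := vol_ge0 (meas_ge u.1 (m + e - e * 2^-1 ^+ J) mQ QO).1.
rewrite -/(F J) mulrA => FJ h; rewrite -(ler_pM2r vQ) mul1r.
by apply: le_trans h; rewrite lerDr.
Qed.
End solution.

(** Beyond the J allowed by [level_iter], the set where u is within e 2^(-J) of its upper bound
    fills at most the fraction c of Q, and [stampacchia] on Q lowers the bound. On the smaller box
    the paraboloid costs at most half of what is gained. *)
Lemma osc_half (N0: (0 < N)%N): exists J: nat, forall u z Z, subsol u z ->
 {aeO y, `|z y| <= Z} -> 0 <= Z -> forall x r m e, 0 < r -> 0 < e ->
 r ^+ 2 * Z <= e * 2^-1 ^+ J -> cbx x (2 * r) `<=` Omega ->
 {aeO y, cbx x (2 * r) y -> u.1 y <= m + e} ->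
 let Q := cbx x (r / (2 * N%:R)) in
 2^-1 * vol Q <= vol (Q `&` [set y | u.1 y <= m]) ->
 {aeO y, cbx x (r / (2 * N%:R) / (2 * N%:R)) y ->
  u.1 y <= m + e - e * 2^-1 ^+ J / 4}.
have n0: 0 < N%:R :> R by rewrite ltr0n.
have n1: 1 <= N%:R :> R by rewrite ler1n.
pose K3 := 16 * (32 * N.+1%:R * KE).
have K30: 0 < K3 by apply: mulr_gt0 =>//; apply: mulr_gt0; [exact: mulr_gt0|exact: KE_gt0].
have t0: 0 < 2^-1 ^+ N :> R by rewrite exprn_gt0 ?invr_gt0.
pose eta := 2^-1 ^+ N / (K3 + 1).
have K31: 0 < K3 + 1 by rewrite addr_gt0.
have eta0: 0 < eta by rewrite divr_gt0.
have eta1: eta <= 1.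
 rewrite /eta ler_pdivrMr// mul1r; apply: (@le_trans _ _ 1); last by rewrite lerDr ltW.
 by rewrite exprn_ile1 ?invr_ge0// invf_le1// ler1n.
have etaP: K3 * eta ^+ 2 <= 2^-1 ^+ N.
 apply: (@le_trans _ _ ((K3 + 1) * eta)); last by rewrite /eta mulrC divfK// gt_eqF.
 apply: ler_pM; rewrite ?(ltW K30) ?sqr_ge0 ?lerDl//.
 by rewrite expr2 ler_piMr// ltW.
(* A fraction c of the volume of Q is exactly the smallness that [stampacchia] allows on Q. *)
pose c := eta ^+ N / (32 * N.+1%:R * 2 ^+ N).
have c0: 0 < c by rewrite divr_gt0 ?exprn_gt0// !mulr_gt0// exprn_gt0.
have w0: 0 < (2 * N%:R) ^+ N :> R by rewrite exprn_gt0// mulr_gt0.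
have q0: 0 < 1024 * KE by apply: mulr_gt0; [rewrite ltr0n|exact: KE_gt0].
have c20: 0 < c ^+ 2 / (1024 * KE * (2 * N%:R) ^+ N).
 exact: (divr_gt0 (exprn_gt0 2 c0) (mulr_gt0 q0 w0)).
have [J hJ] := nat_above (c ^+ 2 / (1024 * KE * (2 * N%:R) ^+ N))^-1.
exists J.+1 => u z Z uz zZ Z0 x r m e r0 e0 rZ sO uk Q low.
have r1_gt0: 0 < r / (2 * N%:R) by rewrite divr_gt0// mulr_gt0.
have r1r: r / (2 * N%:R) <= r by rewrite ler_pdivrMr ?mulr_gt0// ler_peMr ?(ltW r0)//; lra.
have sO1: cbx x (2 * (r / (2 * N%:R))) `<=` Omega by apply: subset_trans (cbx_le _) sO; lra.
have QO: Q `<=` Omega by apply: subset_trans (cbx_le _) sO; lra.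
have mQ: measurable Q by exact: meas_cbx.
have [mH _] := meas_ge u.1 (m + e - e * 2^-1 ^+ J.+1) mQ QO.
have small: vol (Q `&` [set y | m + e - e * 2^-1 ^+ J.+1 <= u.1 y]) <= c * vol Q.
 rewrite leNgt; apply/negP => /ltW h.
 have := level_iter uz zZ N0 c0 r0 e0 rZ sO uk low h; rewrite leNgt => /negP; apply.
 by rewrite -ltr_pdivrMr// mul1r.
have ej: 0 < e * 2^-1 ^+ J.+1 by rewrite mulr_gt0// exprn_gt0// invr_gt0.
have rZ1: (r / (2 * N%:R)) ^+ 2 * Z <= e * 2^-1 ^+ J.+1.
 by apply: le_trans rZ; rewrite ler_wpM2r// lerXn2r ?nnegrE// ltW.
have uk1: {aeO y, cbx x (2 * (r / (2 * N%:R))) y ->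
  u.1 y <= m + e - e * 2^-1 ^+ J.+1 + e * 2^-1 ^+ J.+1}.
 rewrite subrK; apply: filterS uk => y h Oy yr; apply: h =>//; apply: cbx_le yr; lra.
have vs: 32 * N.+1%:R * vol (upper u.1 x (r / (2 * N%:R)) (m + e - e * 2^-1 ^+ J.+1) (e * 2^-1 ^+ J.+1)) <=
  (eta * (r / (2 * N%:R))) ^+ N.
 apply: (@le_trans _ _ (32 * N.+1%:R * (c * vol Q))).
  rewrite ler_wpM2l ?mulr_ge0//; apply: le_trans small; apply: vol_le =>//.
   exact: meas_upper.
  move=> y [Qy yA]; split =>//=; apply: le_trans yA; rewrite /bowl lerDl.
  by rewrite mulr_ge0 ?dsq_ge0// divr_ge0 ?sqr_ge0// ltW.
 rewrite (vol_cbx (ltW r1_gt0) QO) /c !exprMn.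
 apply: leEq; field.
 by apply/andP; split; rewrite gt_eqF ?exprn_gt0 ?addr_gt0.
have := stampacchia uz zZ N0 eta0 etaP r1_gt0 ej rZ1 sO1 uk1 vs.
apply: filterS => y h Oy yr; have yr1: cbx x (r / (2 * N%:R)) y.
 apply: cbx_le yr; rewrite ler_pdivrMr ?mulr_gt0// ler_peMr ?(ltW r1_gt0)//; lra.
apply: le_trans (h Oy yr1) _; rewrite /bowl.
have e1: 0 < e * 2^-1 ^+ J.+1 / (r / (2 * N%:R)) ^+ 2 by rewrite divr_gt0// exprn_gt0.
have := ler_wpM2l (ltW e1) (dsq_le yr).
have ->: e * 2^-1 ^+ J.+1 / (r / (2 * N%:R)) ^+ 2 * (N%:R * (r / (2 * N%:R) / (2 * N%:R)) ^+ 2) =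
  e * 2^-1 ^+ J.+1 / 4 * N%:R^-1.
 by field; rewrite !gt_eqF.
have: e * 2^-1 ^+ J.+1 / 4 * N%:R^-1 <= e * 2^-1 ^+ J.+1 / 4.
 by rewrite ler_piMr ?divr_ge0 ?(ltW ej)// invf_le1.
move: (e * 2^-1 ^+ J.+1) (_ / N%:R) (_ * dsq _ _) => s q p.
by move=> h1 h2; lra.
Qed.

Lemma aV0 (W: 'I_N -> L2O): aV 0 W = 0.
have := aV_linl 1 0 0 W; rewrite scale1r addr0 mul1r.
by move: (aV _ _) => t h; lra.
Qed.

Lemma subsolN u z: subsol u z -> subsol (- u) (- z).
move=> [Hu uz]; have [H0 Hl] := H_subsp; split.
 by rewrite -[- u]addr0 -scaleN1r; exact: Hl.
move=> v Hv; rewrite -[(- u).2]/(- u.2) dotLNl -(uz v Hv).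
have := aV_linl 1 (- u.2) u.2 v.2; rewrite scale1r addNr aV0 mul1r => h.
by move: h; move: (aV _ _) (aV u.2 _) => s t h; lra.
Qed.

(** Either u is below its middle level on half of Q, or - u is below the opposite level on half of
    Q; [osc_half] lowers the upper bound in the first case and raises the lower bound in the
    second. *)
Lemma oscillation (N0: (0 < N)%N): exists J: nat, forall u z Z, subsol u z ->
 {aeO y, `|z y| <= Z} -> 0 <= Z -> forall x r a b, 0 < r -> a < b ->
 r ^+ 2 * Z <= (b - a) / 2 * 2^-1 ^+ J -> cbx x (2 * r) `<=` Omega ->
 {aeO y, cbx x (2 * r) y -> a <= u.1 y <= b} ->
 exists a' b', b' - a' = (b - a) * (1 - 2^-1 ^+ J / 8) /\
  {aeO y, cbx x (r / (2 * N%:R) / (2 * N%:R)) y -> a' <= u.1 y <= b'}.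
have [J HJ] := osc_half N0; exists J => u z Z uz zZ Z0 x r a b r0 ab rZ sO uab.
have n0: 0 < N%:R :> R by rewrite ltr0n.
have n1: 1 <= N%:R :> R by rewrite ler1n.
have r1_gt0: 0 < r / (2 * N%:R) by rewrite divr_gt0// mulr_gt0.
have r1r: r / (2 * N%:R) <= r by rewrite ler_pdivrMr ?mulr_gt0// ler_peMr ?(ltW r0)//; lra.
have r2r: r / (2 * N%:R) / (2 * N%:R) <= 2 * r.
 apply: (@le_trans _ _ (r / (2 * N%:R))); last lra.
 by rewrite ler_pdivrMr ?mulr_gt0// ler_peMr ?(ltW r1_gt0)//; lra.
set Q := cbx x (r / (2 * N%:R)).
have QO: Q `<=` Omega by apply: subset_trans (cbx_le _) sO; lra.
have mQ: measurable Q by exact: meas_cbx.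
have e0: 0 < (b - a) / 2 by rewrite divr_gt0// subr_gt0.
have [low|high] := lerP (2^-1 * vol Q) (vol (Q `&` [set y | u.1 y <= (a + b) / 2])).
 exists a, (b - (b - a) / 2 * 2^-1 ^+ J / 4); split; first by field.
 have ub: {aeO y, cbx x (2 * r) y -> u.1 y <= (a + b) / 2 + (b - a) / 2}.
  by apply: filterS uab => y h Oy yr; have /andP[_ h2] := h Oy yr; apply: le_trans h2 _; lra.
 have := HJ u z Z uz zZ Z0 x r ((a + b) / 2) ((b - a) / 2) r0 e0 rZ sO ub low.
 apply: filterS2 uab => y h1 h2 Oy yr; have /andP[-> _] := h1 Oy (cbx_le r2r yr).
 by apply: le_trans (h2 Oy yr) _; move: (_ * _ / 4) => t; lra.
exists (a + (b - a) / 2 * 2^-1 ^+ J / 4), b; split; first by field.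
have zN: {aeO y, `|(- z) y| <= Z}.
 by apply: filterS zZ => y h Oy; rewrite -[(- z) y]/(- z y) normrN h.
have ub: {aeO y, cbx x (2 * r) y -> (- u).1 y <= - ((a + b) / 2) + (b - a) / 2}.
 apply: filterS uab => y h Oy yr; have /andP[h2 _] := h Oy yr.
 by rewrite -[(- u).1 y]/(- u.1 y); lra.
have lowN: 2^-1 * vol Q <= vol (Q `&` [set y | (- u).1 y <= - ((a + b) / 2)]).
 have ->: Q `&` [set y | (- u).1 y <= - ((a + b) / 2)] = Q `&` [set y | (a + b) / 2 <= u.1 y].
  apply/seteqP; split => y [Qy h]; split; [exact: Qy| |exact: Qy|].
   have h': - u.1 y <= - ((a + b) / 2) by exact: h.
   by rewrite lerN2 in h'.
  have h': - u.1 y <= - ((a + b) / 2) by rewrite lerN2; exact: h.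
  exact: h'.
 have [m1 _] := meas_ge u.1 ((a + b) / 2) mQ QO.
 have [_ m2] := meas_ge u.1 ((a + b) / 2) mQ QO.
 have := volU mQ m1 m2; set v1 := vol (Q `&` [set y | _ <= u.1 y]) => h.
 have {}h: vol Q <= v1 + vol (Q `&` [set y | u.1 y <= (a + b) / 2]).
  by apply: h => y Qy; have [q|q] := leP (u.1 y) ((a + b) / 2); [right|left; split =>//=; exact: ltW].
 by move: h high; move: (vol Q) (vol _) => p q; lra.
have := HJ (- u) (- z) Z (subsolN uz) zN Z0 x r (- ((a + b) / 2)) ((b - a) / 2) r0 e0 rZ sO ub lowN.
apply: filterS2 uab => y h1 h2 Oy yr; have /andP[_ ->] := h1 Oy (cbx_le r2r yr).
have := h2 Oy yr; rewrite -[(- u).1 y]/(- u.1 y) andbT; move: (_ * _ / 4) (u.1 y) => t s; lra.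
Qed.
End holder.
Section regularity.


(** Let I be the infimum of the oscillations over boxes around x. If I were positive, [oscillation]
    applied in a box that nearly attains I, shrunk until the source is negligible, would produce an
    oscillation below I. *)
Lemma local_oscillation (N0: (0 < N)%N) u z (Z K: R): subsol u z -> 0 <= Z ->
 {aeO y, `|z y| <= Z} -> {aeO y, `|u.1 y| <= K} ->
 forall x e, Omega x -> 0 < e -> exists r a b, [/\ 0 < r, cbx x r `<=` Omega, b - a < e &
  {aeO y, cbx x r y -> a <= u.1 y <= b}].
move=> uz Z0 zZ uK x e Ox e0.
pose S := [set d | exists r a b, [/\ 0 < r, cbx x r `<=` Omega, d = b - a &
 {aeO y, cbx x r y -> a <= u.1 y <= b}]].
suff [d [r [a [b [r0 rO -> h]]]] de]: exists2 d, S d & d < e by exists r, a, b.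
have S0 d: S d -> 0 <= d.
 move=> [r [a [b [r0 rO -> h]]]]; have [y yr h'] := ae_cbx x r0 h.
 by have /andP[h1 h2] := h' (rO y yr) yr; rewrite subr_ge0 (le_trans h1).
have Sn: S !=set0.
 have [r r0 rO] := open_nbhs_box oO Ox; exists (K - - K), (r / 2), (- K), K; split =>//.
 - by rewrite divr_gt0.
 - by move=> y /cbxP h; apply: rO => i; apply: le_lt_trans (h i) _; lra.
 - by apply: filterS uK => y h Oy _; rewrite -ler_norml h.
have hS: has_inf S by split =>//; exists 0 => d; exact: S0.
have [Ie|Ie] := ltP (inf S) e.
 have e1: 0 < e - inf S by rewrite subr_gt0.
 by have [d Sd] := inf_adherent e1 hS; rewrite addrC subrK => de; exists d.
exfalso; have I0: 0 < inf S by apply: lt_le_trans Ie.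
have [J HJ] := oscillation N0.
have t0: 0 < 2^-1 ^+ J :> R by rewrite exprn_gt0// invr_gt0.
have t1: 2^-1 ^+ J <= 1 :> R by rewrite exprn_ile1// ?invr_ge0// invf_le1// ler1n.
have ka: 0 < inf S * (2^-1 ^+ J / 8) by rewrite mulr_gt0// divr_gt0.
have [d Sd dI] := inf_adherent ka hS.
have Id: inf S <= d by apply: ge_inf =>//; exists 0 => d'; exact: S0.
have [r [a [b [r0 rO dE h]]]] := Sd.
have d0: 0 < d by apply: lt_le_trans Id.
have ab: a < b by rewrite -subr_gt0 -dE.
pose q := (b - a) / 2 * 2^-1 ^+ J / (Z + 1).
have q0: 0 < q by rewrite /q -dE divr_gt0 ?mulr_gt0 ?divr_gt0// ltr_wpDl.
pose r' := Num.min (r / 2) (Num.min 1 q).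
have r'0: 0 < r' by rewrite !lt_min divr_gt0// ltr01.
have r'1: r' <= 1 by rewrite !ge_min lexx orbT.
have r'q: r' <= q by rewrite !ge_min lexx !orbT.
have r'h: r' <= r / 2 by rewrite ge_min lexx.
have r'r: 2 * r' <= r by rewrite mulrC -ler_pdivlMr.
have rZ: r' ^+ 2 * Z <= (b - a) / 2 * 2^-1 ^+ J.
 apply: (@le_trans _ _ (q * (Z + 1))); last by rewrite /q divfK// gt_eqF// ltr_wpDl.
 apply: ler_pM; rewrite ?sqr_ge0 ?lerDl//; apply: le_trans r'q.
 by rewrite expr2 ler_piMr// ltW.
have sO: cbx x (2 * r') `<=` Omega by apply: subset_trans (cbx_le r'r) rO.
have uab: {aeO y, cbx x (2 * r') y -> a <= u.1 y <= b}.
 by apply: filterS h => y h' Oy yr; apply: h' =>//; apply: cbx_le yr.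
have [a' [b' [bE h']]] := HJ u z Z uz zZ Z0 x r' a b r'0 ab rZ sO uab.
have Sd': S (b' - a').
 have n1: 1 <= 2 * N%:R :> R by rewrite -natrM ler1n muln_gt0.
 exists (r' / (2 * N%:R) / (2 * N%:R)), a', b'; split =>//.
  by rewrite !divr_gt0// (lt_le_trans _ n1).
 apply: subset_trans (cbx_le _) sO; rewrite !ler_pdivrMr ?(lt_le_trans _ n1)//.
 rewrite -mulrA; have: 1 <= 2 * N%:R * (2 * N%:R) :> R by rewrite -[leLHS]mul1r; apply: ler_pM.
 by move: (_ * _ * (_ * _)) => w; nra.
have: inf S <= b' - a' by apply: ge_inf =>//; exists 0 => d'; exact: S0.
rewrite bE -dE; move: dI Id t0 t1 I0; move: (2^-1 ^+ J) (inf S) => t I; nra.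
Qed.
End regularity.
End elliptic_equation.

Lemma aV_tr (B: vec -> 'M[R]_N) (C: R) :
 (forall i j, mfun Omega (fun x => B x i j)) ->
 (forall i j, {aeO x, `|B x i j| <= C}) ->
 forall V W, aV B V W = aV (fun x => (B x)^T) W V.
move=> mB BC V W; rewrite /aV exchange_big; apply: eq_bigr => i _; apply: eq_bigr => j _ /=.
have mB' k l: mfun Omega (fun x => (B x)^T k l).
 by rewrite (_: (fun x => _) = fun x => B x l k)//; apply/funext => x; rewrite mxE.
have BC' k l: {aeO x, `|(B x)^T k l| <= C}.
 by apply: filterS (BC l k) => x; rewrite mxE.
apply: eq_dotL; apply/aeW => x Ox; rewrite (mulBE mB BC) (mulBE mB' BC') mxE; ring.
Qed.

(** * The retrograde problem *)
Section retrograde_equation.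
Notation dtx := (lebesgue_tx N: {measure set (R * vec)%type -> \bar R}).
Notation l1m := (leb1: {measure set R -> \bar R}).
Variable T: R.
Hypothesis T0: 0 < T.
Notation Q := (cylinder T Omega).
Notation I0T := (`]0, T[%classic: set R).
Variables (M: vec -> 'M[R]_N) (C al: R).
Hypothesis mM: forall i j, mfun Omega (fun x => M x i j).
Hypothesis C0: 0 <= C.
Hypothesis MC: forall i j, {aeO x, `|M x i j| <= C}.
Hypothesis al0: 0 < al.
Hypothesis Mal: elliptic Omega M al.
Hypothesis N0: (0 < N)%N.
Notation Mt := (fun x => (M x)^T).

(** * The retrograde equation tested against elliptic solutions *)

Section retrograde.

Lemma mI: measurable I0T. Proof. exact: measurable_itv. Qed.

Lemma mQ: measurable Q. Proof. by apply: measurableX; [exact: measurable_itv|exact: mO]. Qed.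

Lemma fI0T: (l1m I0T < +oo)%E.
have h: (leb1 `[0%R, T]%classic < +oo)%E by rewrite (leb1_itv (ltW T0)) ltry.
apply: le_lt_trans h; apply: le_measure; rewrite ?inE; [exact: measurable_itv|exact: measurable_itv|].
by move=> s /=; rewrite !in_itv /= => /andP[/ltW -> /ltW ->].
Qed.
Notation LQ := (L2 dtx mQ).
Notation toQ := (toL2 dtx mQ).
Lemma dotL_csQ (f g: LQ): dotL f g ^+ 2 <= dotL f f * dotL g g.
exact: (ip_cs (@dotLDl _ _ _ _ _ _) (@dotLZl _ _ _ _ _ _) (@dotLC _ _ _ _ _ _) (@dotL_ge0 _ _ _ _ _ _)). Qed.
Lemma dotLBlQ (f g h: LQ): dotL (f - g) h = dotL f h - dotL g h.
by rewrite dotLDl -scaleN1r dotLZl mulN1r. Qed.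
Lemma dotL_linrQ c (f g h: LQ): dotL f (c *: g + h) = c * dotL f g + dotL f h.
by rewrite dotLC dotLDl dotLZl dotLC (dotLC h). Qed.

Lemma ae_snd (P: vec -> Prop): {ae dx, forall x, P x} -> {ae dtx, forall z, P z.2}.
move=> [A [mA A0 AP]]; exists (setT `*` A); split; first exact: measurableX.
 have := product_measure1E (leb1: {sigma_finite_measure set R -> \bar R}) (lvec N) (@measurableT _ R) mA.
 by move=> h; rewrite -[LHS]/((leb1 \x lvec N)%E (setT `*` A)) h A0 mule0.
by move=> z nP; split =>//; apply: AP.
Qed.

Lemma meas_snd_in (f: vec -> R): mfun Omega f ->
 mfun Q (fun z: R * vec => f z.2).
move=> mf; apply: (measurable_comp mO _ mf); first by move=> _ [z [_ Oz] <-].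
by apply: measurable_funS (subsetT _) _ =>//; exact: measurable_snd.
Qed.

Lemma meas_fst_in (f: R -> R): mfun I0T f ->
 mfun Q (fun z: R * vec => f z.1).
move=> mf; apply: (measurable_comp mI _ mf); first by move=> _ [z [Iz _] <-].
by apply: measurable_funS (subsetT _) _ =>//; exact: measurable_fst.
Qed.

Lemma in_L2_lift (v: L2O): in_L2 dtx Q (fun z => v z.2).
apply: (@in_L2_slices _ _ _ _ _ leb1 (lvec N) I0T Omega mI mO _ (fun=> dotL v v)).
- by apply: meas_snd_in; case: (L2P v).
- by apply/aeW => t _; rewrite -dotL_EFin.
- exact: (in_L1_cst mI fI0T).
Qed.
Definition liftL (v: L2O): LQ := toQ (fun z => v z.2).
Lemma liftLE v z: liftL v z = v z.2.
by rewrite /liftL toL2x//; exact: in_L2_lift. Qed.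

Lemma liftL_sq v: dotL (liftL v) (liftL v) <= fine (l1m I0T) * dotL v v.
rewrite dotLE; have f1 := dotL_L1 (liftL v) (liftL v).
have [_ _ e] := fubini_in1 mI mO (f1: in_L1 (leb1 \x lvec N)%E (I0T `*` Omega) _).
rewrite -[leLHS]/(\int[(leb1 \x lvec N)%E]_(z in I0T `*` Omega) (liftL v z * liftL v z)) e.
rewrite (_: (fun t => _) = cst (dotL v v)); last first.
 by apply/funext => t; rewrite dotLE; apply: eq_Rintegral => x _; rewrite !liftLE.
by rewrite (Rintegral_cst _ mI) mulrC.
Qed.

Lemma liftL_lin c (u v: L2O): liftL (c *: u + v) = c *: liftL u + liftL v.
apply: L2_eqP => z; rewrite -[RHS]/(c * liftL u z + liftL v z) !liftLE.
by rewrite -[LHS]/(c * u z.2 + v z.2).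
Qed.

Section one_solution.
Variables (g w: R * vec -> R) (G: R * vec -> vec).
Hypothesis g2: in_L2 dtx Q g.
Hypothesis wG: in_L2H10 Omega T w G.
Hypothesis weq: forall phi, test_function Q phi ->
 \int[dtx]_(z in Q) (w z * dt phi z) +
 \int[dtx]_(z in Q) dot ((M z.2)^T *m G z) (gradx phi z) = \int[dtx]_(z in Q) (g z * phi z).
Let w2: in_L2 dtx Q w. Proof. by case: wG. Qed.
Let G2 i: in_L2 dtx Q (fun z => G z i ord0). Proof. by case: wG. Qed.
(** The component i of eta M^T G: what a product test function eta(t) psi(x) meets in the gradient
    term of the equation. *)
Definition flux (eta: R -> R) i z := eta z.1 * \sum_j M z.2 j i * G z j ord0.

Lemma bmul_time (b: R -> R) (f: R * vec -> R) (K: R): mfun setT b ->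
 (forall t, `|b t| <= K) -> in_L2 dtx Q f -> in_L2 dtx Q (fun z => b z.1 * f z).
move=> mb bK f2; apply: (in_L2_bmul mQ (C := K)) =>//; last by apply/aeW => z _; exact: bK.
by apply: meas_fst_in; exact: measurable_funS mb.
Qed.

Lemma flux_L2 (eta: R -> R) i (K: R): mfun setT eta -> (forall t, `|eta t| <= K) ->
 in_L2 dtx Q (flux eta i).
move=> me eK; apply: bmul_time me eK _; apply: (in_L2_sum mQ) => j.
apply: (in_L2_bmul mQ (C := C)) =>//; first exact: (meas_snd_in (mM j i)).
by apply: filterS (ae_snd (MC j i)) => z h [_ Oz]; exact: h.
Qed.

Lemma test_bnd_time eta: test_function I0T eta -> exists K, 0 <= K /\
 [/\ mfun setT eta, mfunT ('D_1 eta), forall t, `|eta t| <= K &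
  forall t, `|'D_1 eta t| <= K].
move=> te; have [K1 K10 h1] := tf_bnd te.
have td := tf_derive (1: R) te; have [K2 K20 h2] := tf_bnd td.
exists (K1 + K2); split; first exact: addr_ge0.
split.
- by apply: continuous_measurable_fun; apply: sm_cont; exact: tf_smooth te.
- by apply: continuous_measurable_fun; apply: sm_cont; exact: tf_smooth td.
- by move=> t; apply: le_trans (h1 t) _; rewrite lerDl.
- by move=> t; apply: le_trans (h2 t) _; rewrite lerDr.
Qed.

(** The products eta(t) psi(x) are admissible test functions. For fixed eta both sides are
    continuous in psi for [ipE], which extends the identity from test functions psi to H1_0. *)
Lemma weak_H eta: test_function I0T eta -> forall v: E, H1_0 v ->
 dotL (toQ (fun z => 'D_1 eta z.1 * w z)) (liftL v.1) +
 \sum_i dotL (toQ (flux eta i)) (liftL (v.2 i)) = dotL (toQ (fun z => eta z.1 * g z)) (liftL v.1).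
move=> te v Hv; have [K [K0 [me mde eK deK]]] := test_bnd_time te.
have A2 := bmul_time mde deK w2; have B2 := bmul_time me eK g2.
have F2 i := flux_L2 i me eK.
set A: LQ := toQ _; set F := fun i => toQ (flux eta i): LQ; set B: LQ := toQ (fun z => eta z.1 * g z).
apply/eqP; rewrite -subr_eq0; apply/eqP.
pose l (v: E) := dotL (A - B) (liftL v.1) + \sum_i dotL (F i) (liftL (v.2 i)).
rewrite -[LHS]/(dotL A (liftL v.1) + \sum_i dotL (F i) (liftL (v.2 i)) - dotL B (liftL v.1)).
have ->: dotL A (liftL v.1) + \sum_i dotL (F i) (liftL (v.2 i)) - dotL B (liftL v.1) = l v.
 by rewrite /l dotLBlQ; ring.
pose S := dotL (A - B) (A - B) + \sum_i dotL (F i) (F i).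
have S1: dotL (A - B) (A - B) <= S by rewrite lerDl sumr_ge0// => i _; exact: dotL_ge0.
have S2' i: dotL (F i) (F i) <= S.
 rewrite /S (bigD1 i)//= addrCA lerDl addr_ge0 ?dotL_ge0// sumr_ge0// => j _; exact: dotL_ge0.
have S0: 0 <= S by apply: le_trans S1; exact: dotL_ge0.
set tau := fine (l1m I0T); have tau0: 0 <= tau by rewrite fine_ge0.
have lb (X: LQ) (u: L2O) (e: E): dotL X X <= S -> dotL u u <= ipE e e ->
  dotL X (liftL u) ^+ 2 <= S * tau * ipE e e.
 move=> XS ue; apply: le_trans (dotL_csQ _ _) _; rewrite -mulrA.
 apply: ler_pM =>//; rewrite ?dotL_ge0//.
 by apply: le_trans (liftL_sq u) _; rewrite ler_wpM2l.
apply: (@closure_ext _ _ (@ipE) (@ipE_ge0) (@testE)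
 l ((2 + 2 * N%:R ^+ 2) * (S * tau)) _ _ _ _ _ Hv).
- move=> c x y; rewrite /l -[(c *: x + y).1]/(c *: x.1 + y.1) liftL_lin.
 have ->: \sum_i dotL (F i) (liftL ((c *: x + y).2 i)) =
   c * (\sum_i dotL (F i) (liftL (x.2 i))) + \sum_i dotL (F i) (liftL (y.2 i)).
  rewrite mulr_sumr -big_split; apply: eq_bigr => i _ /=.
  by rewrite -[(c *: x.2 + y.2) i]/(c *: x.2 i + y.2 i) liftL_lin dotL_linrQ.
 by rewrite dotL_linrQ; ring.
- by rewrite !mulr_ge0// addr_ge0// mulr_ge0// sqr_ge0.
- move=> e; have h1 := lb _ _ e S1 (ipE_ge1 e).
 have h2: (\sum_i dotL (F i) (liftL (e.2 i))) ^+ 2 <= N%:R ^+ 2 * (S * tau * ipE e e).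
  apply: sum_sq_le; first by rewrite !mulr_ge0// ipE_ge0.
  by move=> i; apply: lb =>//; exact: ipE_ge2.
 rewrite /l; move: (dotL _ _) (\sum_i _) h1 h2 => a b h1 h2.
 have ->: (a + b) ^+ 2 = 2 * a ^+ 2 + 2 * b ^+ 2 - (a - b) ^+ 2 by ring.
 have ->: (2 + 2 * N%:R ^+ 2) * (S * tau) * ipE e e =
  2 * (S * tau * ipE e e) + 2 * (N%:R ^+ 2 * (S * tau * ipE e e)) by ring.
 apply: (@le_trans _ _ (2 * a ^+ 2 + 2 * b ^+ 2)); first by rewrite gerBl sqr_ge0.
 by apply: lerD; rewrite ler_pM2l.
move=> _ [psi tp ->]; have sp := tf_smooth tp; have se := tf_smooth te.
have tphi := tf_prod te tp; have := weq tphi.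
have dE z: dt (fun z: R * vec => eta z.1 * psi z.2) z = 'D_1 eta z.1 * psi z.2.
 by rewrite /dt (derive_prod (1: R) (0: vec) z se sp) derive_dir0 mulr0 addr0.
have gE z i: gradx (fun z: R * vec => eta z.1 * psi z.2) z i ord0 = eta z.1 * 'D_(ei i) psi z.2.
 rewrite mxE; have := derive_prod (0: R) (ei i) z se sp; rewrite derive_dir0 mul0r add0r => <-.
 by [].
have ->: \int[dtx]_(z in Q) (w z * dt (fun z: R * vec => eta z.1 * psi z.2) z) =
  dotL A (liftL (tstE psi).1).
 rewrite dotLE; apply: eq_Rintegral => z _; rewrite liftLE tstE1// /A (toL2x mQ A2) dE; ring.
have ->: \int[dtx]_(z in Q) (g z * (eta z.1 * psi z.2)) = dotL B (liftL (tstE psi).1).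
 rewrite dotLE; apply: eq_Rintegral => z _; rewrite liftLE tstE1// /B (toL2x mQ B2); ring.
have ->: \int[dtx]_(z in Q) dot ((M z.2)^T *m G z) (gradx (fun z: R * vec => eta z.1 * psi z.2) z) =
  \sum_i dotL (F i) (liftL ((tstE psi).2 i)).
 have L1 i: in_L1 dtx Q (fun z => F i z * liftL ((tstE psi).2 i) z) by exact: dotL_L1.
 rewrite (eq_bigr (fun i => \int[dtx]_(z in Q) (F i z * liftL ((tstE psi).2 i) z))); last by move=> i _; rewrite dotLE.
 rewrite -(Rint_sum mQ _ L1); apply: eq_Rintegral => z _; apply: eq_bigr => i _.
 rewrite gE liftLE tstE2// /F (toL2x mQ (F2 i)) /flux !mxE.
 rewrite (eq_bigr (fun j => M z.2 j i * G z j ord0)); last by move=> j _; rewrite mxE.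
 ring.
by move=> h; rewrite /l dotLBlQ -h; ring.
Qed.

Lemma time_fubini (b: R -> R) (f: R * vec -> R) (K: R): mfun setT b ->
 (forall t, `|b t| <= K) -> in_L1 dtx Q f ->
 in_L1 l1m I0T (fun t => \int[dx]_(x in Omega) f (t, x)) /\
 \int[dtx]_(z in Q) (b z.1 * f z) = \int[l1m]_(t in I0T) (b t * \int[dx]_(x in Omega) f (t, x)).
move=> mb bK f1; have [ae1 i1 _] := fubini_in1 mI mO (f1: in_L1 (leb1 \x lvec N)%E (I0T `*` Omega) _).
split =>//.
have bf1: in_L1 dtx Q (fun z => b z.1 * f z).
 apply: (in_L1_le mQ (g := fun z => K * `|f z|)).
 - apply: measurable_funM; first by apply: meas_fst_in; exact: measurable_funS mb.
  exact: (in_L1_meas f1).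
 - by move=> z _; rewrite normrM ler_wpM2r.
 - by apply: (in_L1Z mQ); exact: in_L1_abs.
have [_ i2 e2] := fubini_in1 mI mO (bf1: in_L1 (leb1 \x lvec N)%E (I0T `*` Omega) _).
rewrite [LHS]e2; apply: (Rint_ae_eq mI).
- exact: (in_L1_meas i2).
- apply: measurable_funM; last exact: (in_L1_meas i1).
 exact: measurable_funS mb.
by apply: filterS ae1 => t h It; rewrite /= RintegralZl//; [exact: mO|exact: h].
Qed.
Definition pairing (f: R * vec -> R) (v: L2O) t := \int[dx]_(x in Omega) (f (t, x) * v x).
Lemma pairing_L1Q f (v: L2O): in_L2 dtx Q f -> in_L1 dtx Q (fun z => f z * v z.2).
by move=> f2; apply: (in_L2M mQ f2); exact: in_L2_lift. Qed.

Lemma pairing_L1 f (v: L2O): in_L2 dtx Q f -> in_L1 l1m I0T (pairing f v).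
move=> f2; have f1 := pairing_L1Q v f2.
by have [_ i1 _] := fubini_in1 mI mO (f1: in_L1 (leb1 \x lvec N)%E (I0T `*` Omega) _).
Qed.

(** For almost every t the slice w(t) lies in H1_0 and is admissible in the elliptic equation of
    [phi], whose matrix is the transpose of the retrograde one. The gradient term thus becomes a
    pairing of w with [zp], and t to (w(t), phi) has an integrable weak derivative. *)
Lemma weak_time (phi: E) (zp: L2O) eta: subsol M phi zp -> test_function I0T eta ->
 \int[l1m]_(t in I0T) ('D_1 eta t * pairing w phi.1 t) =
 \int[l1m]_(t in I0T) (eta t * (pairing g phi.1 t - pairing w zp t)).
move=> [Hphi phiE] te; have [K [K0 [me mde eK deK]]] := test_bnd_time te.
have := weak_H te Hphi; rewrite !dotLE.
have A2 := bmul_time mde deK w2; have B2 := bmul_time me eK g2.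
have F2 i := flux_L2 i me eK.
have ->: \int[dtx]_(z in Q) (toQ (fun z => 'D_1 eta z.1 * w z) z * liftL phi.1 z) =
  \int[l1m]_(t in I0T) ('D_1 eta t * pairing w phi.1 t).
 rewrite -(time_fubini mde deK (pairing_L1Q phi.1 w2)).2; apply: eq_Rintegral => z _.
 by rewrite (toL2x mQ A2) liftLE mulrA.
have ->: \int[dtx]_(z in Q) (toQ (fun z => eta z.1 * g z) z * liftL phi.1 z) =
  \int[l1m]_(t in I0T) (eta t * pairing g phi.1 t).
 rewrite -(time_fubini me eK (pairing_L1Q phi.1 g2)).2; apply: eq_Rintegral => z _.
 by rewrite (toL2x mQ B2) liftLE mulrA.
have mul1 i j: in_L1 dtx Q (fun z => M z.2 j i * G z j ord0 * phi.2 i z.2).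
 apply: (in_L2M mQ); last exact: in_L2_lift.
 apply: (in_L2_bmul mQ (C := C)) =>//; first exact: (meas_snd_in (mM j i)).
 by apply: filterS (ae_snd (MC j i)) => y h [_ Oy]; exact: h.
pose f z := \sum_i \sum_j M z.2 j i * G z j ord0 * phi.2 i z.2.
have f1: in_L1 dtx Q f.
 by apply: (in_L1_sum mQ) => i; apply: (in_L1_sum mQ) => j; exact: (mul1 i j).
have ->: \sum_i dotL (toQ (flux eta i)) (liftL (phi.2 i)) =
  \int[l1m]_(t in I0T) (eta t * pairing w zp t).
 transitivity (\int[dtx]_(z in Q) (eta z.1 * f z)).
  have L1 i: in_L1 dtx Q (fun z => toQ (flux eta i) z * liftL (phi.2 i) z) by exact: dotL_L1.
  rewrite (eq_bigr (fun i => \int[dtx]_(z in Q) (toQ (flux eta i) z * liftL (phi.2 i) z))); last by move=> i _; rewrite dotLE.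
  rewrite -(Rint_sum mQ _ L1); apply: eq_Rintegral => z _; rewrite /f mulr_sumr; apply: eq_bigr => i _.
  by rewrite (toL2x mQ (F2 i)) liftLE /flux -mulrA mulr_suml.
 have [i1 ->] := time_fubini me eK f1; apply: (Rint_ae_eq mI).
 - apply: measurable_funM; last exact: (in_L1_meas i1).
  exact: measurable_funS me.
 - apply: measurable_funM; last exact: (in_L1_meas (pairing_L1 zp w2)).
  exact: measurable_funS me.
 have [_ _ aeH] := wG; apply: filterS aeH => t h; rewrite /= in_itv /= => It; congr (_ * _).
 have wH := h It; have Hw := in_H10_H wH; have := phiE _ Hw.
 have [wt2 Gt2 _ _] := wH.
 rewrite /pairing dotLE /= => e.
 transitivity (\int[dx]_(x in Omega) (zp x * toL (fun x => w (t, x)) x)); last first.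
  by apply: eq_Rintegral => x _; rewrite toL2x// mulrC.
 rewrite -e /aV.
 have L1 i j: in_L1 dx Omega (fun x => mulB M i j (phi.2 j) x * toL (fun x => G (t, x) i ord0) x) by exact: dotL_L1.
 have L1i i: in_L1 dx Omega (fun x => \sum_j mulB M i j (phi.2 j) x * toL (fun x => G (t, x) i ord0) x).
  exact: (in_L1_sum mO _ (L1 i)).
 rewrite (eq_bigr (fun i => \int[dx]_(x in Omega) (\sum_j mulB M i j (phi.2 j) x * toL (fun x => G (t, x) i ord0) x))); last first.
  by move=> i _; rewrite (Rint_sum mO _ (L1 i)); apply: eq_bigr => j _; rewrite dotLE.
 rewrite -(Rint_sum mO _ L1i); apply: eq_Rintegral => x _; rewrite /f exchange_big.
 apply: eq_bigr => i _; apply: eq_bigr => j _ /=.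
 by rewrite (mulBE mM MC) toL2x//; ring.
have ip: in_L1 l1m I0T (pairing g phi.1) by exact: pairing_L1.
have iw: in_L1 l1m I0T (pairing w zp) by exact: pairing_L1.
have bI f': in_L1 l1m I0T f' -> in_L1 l1m I0T (fun t => eta t * f' t).
 move=> i1; apply: (in_L1_le mI (g := fun t => K * `|f' t|)).
 - by apply: measurable_funM; [exact: measurable_funS me|exact: (in_L1_meas i1)].
 - by move=> t _; rewrite normrM ler_wpM2r.
 - by apply: (in_L1Z mI); exact: in_L1_abs.
move=> e; rewrite (_: (fun t => eta t * (_ - _)) = fun t => eta t * pairing g phi.1 t - eta t * pairing w zp t); last first.
 by apply/funext => t; rewrite mulrBr.
rewrite (RintegralB mI (bI _ ip) (bI _ iw)).
by rewrite -e addrK.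
Qed.
End one_solution.
End retrograde.

(** * The supremum bound for the retrograde problem *)

Section retrograde_bound.

Lemma fQ: (dtx Q < +oo)%E.
have h := product_measure1E (leb1: {sigma_finite_measure set R -> \bar R}) (lvec N) mI mO.
rewrite -[X in (X < _)%E]/((leb1 \x lvec N)%E (I0T `*` Omega)) h.
by rewrite lte_mul_pinfty// ge0_fin_numE//; exact: fI0T.
Qed.
Lemma Loo_L2 (f: R * vec -> R): in_Loo dtx Q f -> in_L2 dtx Q f.
by move=> [mf [K fK]]; exact: (in_L2_bnd mQ fQ mf fK). Qed.

Section one_solution.
Variables g w: R * vec -> R.
Hypothesis ret: retrograde_solution Omega T M g w.
Hypothesis gb: in_Loo dtx Q g.
Let g2: in_L2 dtx Q g := Loo_L2 gb.
Definition slice t: L2O := toL (fun x => w (t, x)).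
Let wt2 t: 0 <= t <= T -> in_L2 dx Omega (fun x => w (t, x)).
by case: ret => -[h _] _ _; exact: h. Qed.
Lemma sliceE t: 0 <= t <= T -> forall x, slice t x = w (t, x).
by move=> tT x; rewrite /slice toL2x//; exact: wt2. Qed.
Lemma pairing_slice (v: L2O) t: 0 <= t <= T -> pairing w v t = dotL (slice t) v.
by move=> tT; rewrite dotLE; apply: eq_Rintegral => x _; rewrite sliceE. Qed.
Definition dist s t := dotL (slice s - slice t) (slice s - slice t).

Lemma dist_tri r s t: dist r t <= 2 * dist r s + 2 * dist s t.
rewrite /dist -[X in dotL X X](_: (slice r - slice s) + (slice s - slice t) = _); first exact: dotL_sqD.
by rewrite addrA subrK.
Qed.
Lemma distC s t: dist s t = dist t s.
by rewrite /dist -(opprB (slice t)) dotLNl dotLNr opprK. Qed.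

Lemma slice_cont t: 0 <= t <= T -> forall e, 0 < e -> exists2 d, 0 < d &
 forall s, 0 <= s <= T -> `|t - s| < d -> dist s t < e.
move=> tT e e0; case: ret => -[_ cw] _ _; have := cw t tT.
move=> /(_ [set y | (y < e%:E)%E]) h.
have: nbhs 0%E [set y: \bar R | (y < e%:E)%E].
 by apply: open_nbhs_nbhs; split; [exact: open_ereal_lt_ereal|rewrite /= lte_fin].
move=> /h /=; rewrite /within /= => /nbhs_ballP[d d0 hd]; exists d =>// s sT sd.
have := hd s sd; rewrite /= in_itv /= => /(_ sT); rewrite -lte_fin; apply: le_lt_trans.
rewrite /dist -dotL_EFin le_eqVlt; apply/orP; left; apply/eqP; apply: eq_integral => x _.
by rewrite -[(slice s - slice t) x]/(slice s x - slice t x) !sliceE.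
Qed.

(** Heine's theorem: continuity of the slices in L2 becomes uniform, by the near-covering form of
    the compactness of [0, T]. *)
Lemma slice_unif e: 0 < e -> exists2 d, 0 < d &
 forall s t, 0 <= s <= T -> 0 <= t <= T -> `|s - t| <= d -> dist s t <= e.
move=> e0; pose P d t := forall s, 0 <= s <= T -> 0 <= t <= T -> `|s - t| <= d -> dist s t <= e.
suff [d d0 h]: exists2 d, 0 < d & forall t, 0 <= t <= T -> P d t by exists d =>// s t sT tT; exact: h.
have e4: 0 < e / 4 by rewrite divr_gt0.
have loc x: `[0, T]%classic x -> \forall x' \near x & d \near (0: R)^'+, P d x'.
 rewrite /= in_itv /= => xT; have [d d0 hd] := slice_cont xT e4.
 have d2: 0 < d / 2 by rewrite divr_gt0.
 exists (ball x (d / 2), [set d' | d' < d / 2]).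
  by split => /=; [exact: nbhsx_ballx|exact: nbhs_right_lt].
 move=> [y d'] [/= xy d'd] s sT yT sy; have yx: `|x - y| < d / 2 by [].
 have h1 := hd y yT (lt_trans yx _); have h2 := hd s sT _.
 apply: le_trans (dist_tri s x y) _; rewrite (distC x y).
 have {}h1: dist y x < e / 4 by apply: h1; lra.
 have {}h2: dist s x < e / 4.
  apply: h2; have := ler_distD y x s; rewrite (distrC y s); lra.
 lra.
have nc: near_covering (`[0, T]%classic: set R) by apply/compact_near_coveringP; exact: segment_compact.
have := nc R (0: R)^'+ P _ loc; move=> [d /= d0 h]; exists (d / 2); first by rewrite divr_gt0.
move=> t tT; apply: (h (d / 2)) => /=.
- by rewrite sub0r normrN ger0_norm ?divr_ge0 ?(ltW d0)//; lra.
- by rewrite divr_gt0.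
- by rewrite in_itv.
Qed.

Lemma pairing_close (v: L2O) s t (e Zs: R): 0 <= s <= T -> 0 <= t <= T -> 0 <= e -> 0 <= Zs ->
 dist s t <= e ^+ 2 -> dotL v v <= Zs ^+ 2 -> `|pairing w v s - pairing w v t| <= e * Zs.
move=> sT tT e0 Zs0 de vZ; rewrite !pairing_slice// -dotLBl.
rewrite -ler_sqr ?nnegrE ?mulr_ge0// real_normK ?num_real//.
apply: le_trans (dotL_cs _ _) _; rewrite exprMn; apply: ler_pM =>//; exact: dotL_ge0.
Qed.

Lemma time_diff (phi: E) (zp: L2O) a b: subsol M phi zp -> 0 < a -> a < b -> b < T ->
 pairing w phi.1 a - pairing w phi.1 b =
 \int[l1m]_(t in `]a, b]) (pairing g phi.1 t - pairing w zp t).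
move=> sub a0 ab bT; have [_ _ [G [wG weq]]] := ret; have [w2 _ _] := wG.
have pg := pairing_L1 phi.1 g2; have pw := pairing_L1 zp w2.
apply: (@weak_derivative R T T0 (pairing w phi.1) _ (pairing_L1 phi.1 w2)) =>//.
- exact: (in_L1B mI pg pw).
- move=> t /andP[t0 tT] e e0; pose Zs := dotL phi.1 phi.1 + 1.
 have p0 := dotL_ge0 phi.1; have Zs0: 0 < Zs by rewrite ltr_wpDl.
 have e1: 0 < (e / Zs) ^+ 2 by rewrite exprn_gt0// divr_gt0.
 have [d d0 hd] := slice_unif e1; exists d =>// s /andP[s0 sT] st.
 have tT': 0 <= t <= T by rewrite !ltW. have sT': 0 <= s <= T by rewrite !ltW.
 have ->: e = e / Zs * Zs by rewrite divfK// gt_eqF.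
 apply: pairing_close =>//; rewrite ?divr_ge0 ?(ltW e0) ?(ltW Zs0)//; first exact: hd.
 by rewrite /Zs; nra.
move=> eta te; exact: (weak_time g2 wG weq sub te).
Qed.
Definition gpow t := \int[dx]_(x in Omega) (`|g (t, x)| ^+ N.+2).

Lemma gpow_L1: in_L1 l1m I0T gpow.
have f1 := Loo_pow mQ fQ N.+2 gb.
by have [_ i1 _] := fubini_in1 mI mO (f1: in_L1 (leb1 \x lvec N)%E (I0T `*` Omega) _).
Qed.

Lemma gpow_int: \int[l1m]_(t in I0T) gpow t = \int[dtx]_(z in Q) (`|g z| ^+ N.+2).
have f1 := Loo_pow mQ fQ N.+2 gb.
by have [_ _ <-] := fubini_in1 mI mO (f1: in_L1 (leb1 \x lvec N)%E (I0T `*` Omega) _).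
Qed.

Lemma sub_I0T a b: 0 < a -> b < T -> `]a, b]%classic `<=` I0T.
move=> a0 bT t /=; rewrite !in_itv /= => /andP[t1 t2]; apply/andP; split; first exact: lt_trans t1.
exact: le_lt_trans bT.
Qed.

Lemma L1_sub (f: R -> R) a b: 0 < a -> b < T -> in_L1 l1m I0T f -> in_L1 l1m `]a, b] f.
by move=> a0 bT; apply: integrableS; [exact: mI|exact: measurable_itv|exact: sub_I0T].
Qed.

Lemma Rint_cst a b (c: R): a <= b -> \int[l1m]_(t in `]a, b]) c = c * (b - a).
move=> ab; rewrite Rintegral_cst; last exact: measurable_itv.
by congr (_ * _); rewrite -[l1m _]/(@lebesgue_measure R `]a, b]%classic) lebesgue_measure_itv /= lte_fin; case: ltgtP ab =>// -> _; rewrite subrr.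
Qed.

(** [young_scaled] under the integrals; the scale [rho] stays free, to be matched with the L1 and L2
    bounds of v. *)
Lemma source_bound (v: L2O) a b (rho: R): 0 < rho -> 0 < a -> a <= b -> b < T ->
 `|\int[l1m]_(t in `]a, b]) pairing g v t| <=
 (b - a) * (rho^-1 * l1 v + rho ^+ N * dotL v v / 2) + (\int[l1m]_(t in `]a, b]) gpow t) / 2.
move=> r0 a0 ab bT; have mJ: measurable (`]a, b]%classic: set R) by exact: measurable_itv.
have pg: in_L1 l1m `]a, b] (pairing g v) by apply: L1_sub =>//; exact: (pairing_L1 v g2).
have gp: in_L1 l1m `]a, b] gpow by apply: L1_sub =>//; exact: gpow_L1.
apply: le_trans (le_normr_Rintegral mJ pg) _.
set c := rho^-1 * l1 v + _.
have fJ: (l1m `]a, b]%classic < +oo)%E.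
 apply: le_lt_trans fI0T; apply: le_measure; rewrite ?inE//; exact: sub_I0T.
have i1: in_L1 l1m `]a, b] (fun=> c) by exact: (in_L1_cst mJ fJ).
have i2: in_L1 l1m `]a, b] (fun t => 2^-1 * gpow t) by exact: (in_L1Z mJ).
have ->: (b - a) * c + (\int[l1m]_(t in `]a, b]) gpow t) / 2 =
  \int[l1m]_(t in `]a, b]) (c + 2^-1 * gpow t).
 by rewrite (RintegralD mJ i1 i2) Rint_cst// (RintegralZl _ mJ gp) mulrC [in RHS](mulrC 2^-1).
apply: (le_Rint_ae mJ (in_L1_abs pg) (in_L1D mJ i1 i2)).
have f1 := Loo_pow mQ fQ N.+2 gb.
have [ae1 _ _] := fubini_in1 mI mO (f1: in_L1 (leb1 \x lvec N)%E (I0T `*` Omega) _).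
have g1 := pairing_L1Q v g2.
have [ae2 _ _] := fubini_in1 mI mO (g1: in_L1 (leb1 \x lvec N)%E (I0T `*` Omega) _).
apply: filterS2 ae1 ae2 => t h1 h2 tJ; have It: I0T t := sub_I0T a0 bT tJ.
have {}h1 := h1 It; have {}h2 := h2 It; apply: le_trans (le_normr_Rintegral mO h2) _.
have j1: in_L1 dx Omega (fun x => rho^-1 * (absL v x * oneL x)).
 by apply: (in_L1Z mO); exact: dotL_L1.
have j2: in_L1 dx Omega (fun x => rho ^+ N / 2 * (v x * v x)).
 by apply: (in_L1Z mO); exact: dotL_L1.
have j3: in_L1 dx Omega (fun x => 2^-1 * `|g (t, x)| ^+ N.+2) by exact: (in_L1Z mO).
have ->: c + 2^-1 * gpow t = \int[dx]_(x in Omega) (rho^-1 * (absL v x * oneL x) +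
  rho ^+ N / 2 * (v x * v x) + 2^-1 * `|g (t, x)| ^+ N.+2).
 rewrite (RintegralD mO (in_L1D mO j1 j2) j3) (RintegralD mO j1 j2) !RintegralZl//.
 - by rewrite /c /l1 !dotLE; congr (_ + _ + _); ring.
 - exact: mO.
 - exact: mO.
 - exact: dotL_L1.
 - exact: mO.
 - exact: dotL_L1.
apply: (le_Rint_ae mO (in_L1_abs h2) (in_L1D mO (in_L1D mO j1 j2) j3)).
apply/aeW => x Ox; rewrite normrM absLE oneLE// mulr1.
have := young_scaled N (normr_ge0 (g (t, x))) (normr_ge0 (v x)) r0.
rewrite (real_normK (num_real _)) => h; apply: le_trans h _; apply: leEq.
by rewrite expr2; move: (`|v x|) (`|g (t, x)| ^+ N.+2) (rho ^+ N) (rho^-1) => p q r s; field.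
Qed.

Lemma Rint_split (f: R -> R) a b c: 0 < a -> a <= b -> b <= c -> c < T -> in_L1 l1m I0T f ->
 \int[l1m]_(t in `]a, c]) f t = \int[l1m]_(t in `]a, b]) f t + \int[l1m]_(t in `]b, c]) f t.
move=> a0 ab bc cT f1.
have E: (`]a, c]%classic: set R) = `]a, b] `|` `]b, c].
 by rewrite -itv_bndbnd_setU// bnd_simp.
have i1: in_L1 l1m (`]a, b] `|` `]b, c]) f by rewrite -E; exact: L1_sub.
have d1: [disjoint (`]a, b]%classic: set R) & `]b, c]%classic].
 apply/disj_setPS => t [] /=; rewrite !in_itv /= => /andP[_ q] /andP[q' _].
 by rewrite ltNge q in q'.
by rewrite E; exact: (Rintegral_setU (measurable_itv _) (measurable_itv _) i1 d1).
Qed.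
Let c := al / (16 * N.+1%:R) / 2 ^+ N.+1.
Let A: R := 32 * N.+1%:R.

Section iteration.
Variables (t0 lam a0 e Zs: R) (u: nat -> E) (z0: L2O).
Hypotheses (lam0: 0 < lam) (a00: 0 < a0) (cla: c * lam <= a0) (e0: 0 <= e) (Zs0: 0 <= Zs).
Hypotheses (su0: subsol M (u 0%N) z0) (ures: forall k, res_eq M lam (u k).1 (u k.+1)).
Hypotheses (l10: l1 (u 0%N).1 <= 1) (t00: 0 < t0).
Let rho k := Num.sqrt (a0 + c * lam * k%:R).
Hypothesis X0: dotL (u 0%N).1 (u 0%N).1 * rho 0%N ^+ N <= A.
Hypothesis zZ: dotL z0 z0 <= Zs ^+ 2.
Hypothesis ed: forall s t, 0 <= s <= T -> 0 <= t <= T -> `|s - t| <= lam -> dist s t <= e ^+ 2.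
(** The source of the elliptic equation solved by [u k]: for a resolvent iterate it is the
    difference quotient of the scheme, at the start it is given. *)
Let zs k := if k is k'.+1 then lam^-1 *: ((u k').1 - (u k).1) else z0.
Let c0: 0 < c.
by rewrite /c !divr_gt0 ?exprn_gt0// mulr_gt0. Qed.
Let base k: 0 < a0 + c * lam * k%:R.
by rewrite ltr_pwDl// mulr_ge0// mulr_ge0// ltW. Qed.
Let rho0 k: 0 < rho k.
by rewrite sqrtr_gt0. Qed.
Let uE k: (u k).1 = (u k.+1).1 + lam *: zs k.+1.
by rewrite /zs scalerA mulfV ?gt_eqF// scale1r addrC subrK. Qed.

(** The L1 bound is [res_l1], the L2 decay [nash_decay_step]. The norms of [zs] do not increase:
    with d = u_k - u_(k+1) = lam zs_(k+1), the form at d is lam times the product of zs_k - zs_(k+1)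
    with zs_(k+1), and it is nonnegative. *)
Lemma iteration_facts k: [/\ l1 (u k).1 <= 1, dotL (u k).1 (u k).1 * rho k ^+ N <= A,
 subsol M (u k) (zs k) & dotL (zs k) (zs k) <= Zs ^+ 2].
elim: k => [//|k [l1k Xk [Hk sk] zk]]; have rk := ures k; have [Hk1 _] := rk.
have sub1: subsol M (u k.+1) (zs k.+1).
 split =>// v Hv; have := res_test rk Hv; rewrite (uE k) dotLDl dotLZl => h.
 by apply: (mulfI (lt0r_neq0 lam0)); exact: (addrI _ h).
have l1k1: l1 (u k.+1).1 <= 1 by apply: le_trans l1k; exact: (res_l1 mM MC al0 Mal lam0 rk).
split =>//.
- apply: (@nash_decay_step R N al c lam (rho k) (rho k.+1) (dotL (u k).1 (u k).1) _ (S2 (u k.+1).2)) =>//.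
 + by rewrite !sqr_sqrtr ?(ltW (base _))// -natr1; ring.
 + by rewrite sqr_sqrtr ?(ltW (base _))//; apply: (le_trans cla); rewrite lerDl mulr_ge0// mulr_ge0// ltW.
 + exact: dotL_ge0.
 + exact: S2_ge0.
 + apply: le_trans (nash_H Hk1 (rho0 k.+1)) _; rewrite ler_wpM2l ?mulr_ge0// lerD2l.
  rewrite ler_piMr ?invr_ge0 ?exprn_ge0 ?(ltW (rho0 _))//.
  by rewrite expr_le1 ?l1_ge0.
 + exact: (res_energy mM MC Mal lam0 rk).
have Hd: H1_0 (u k - u k.+1) by exact: (subspB H_subsp Hk Hk1).
have d1: (u k - u k.+1).1 = lam *: zs k.+1.
 by rewrite -[LHS]/((u k).1 - (u k.+1).1) /zs scalerA mulfV ?gt_eqF// scale1r.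
have h1 := sk _ Hd; have [_ sk1] := sub1; have h2 := sk1 _ Hd.
have h3 := aV_linl mM MC (-1) (u k.+1).2 (u k).2 (u k - u k.+1).2.
have dV: -1 *: (u k.+1).2 + (u k).2 = (u k - u k.+1).2.
 by rewrite scaleN1r addrC.
have pos_: 0 <= aV M (u k - u k.+1).2 (u k - u k.+1).2.
 by apply: le_trans (aV_coer mM MC Mal _); rewrite mulr_ge0 ?S2_ge0 ?(ltW al0).
have dz (z': L2O): dotL z' (u k - u k.+1).1 = lam * dotL z' (zs k.+1) by rewrite d1 (dotLZr lam).
rewrite dV h1 h2 (dz (zs k)) (dz (zs k.+1)) in h3; rewrite h3 in pos_.
have {}pos_: dotL (zs k.+1) (zs k.+1) <= dotL (zs k) (zs k.+1).
 by rewrite -(ler_pM2l lam0) -subr_ge0; apply: le_trans pos_ _; rewrite mulN1r addrC.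
have cs := dotL_cs (zs k) (zs k.+1); apply: le_trans zk.
have p0 := dotL_ge0 (zs k.+1); have p1 := dotL_ge0 (zs k).
move: p0 p1 pos_ cs; move: (dotL (zs k.+1) (zs k.+1)) (dotL (zs k) (zs k.+1)) (dotL (zs k) (zs k)) => p q s p0 s0 pq cs.
move: p0; rewrite le_eqVlt => /orP[/eqP <-//|p0]; rewrite -(ler_pM2r p0); apply: le_trans cs.
by rewrite -expr2 lerXn2r ?nnegrE ?(ltW p0)// (le_trans (ltW p0)).
Qed.

(** Over one step, [time_diff] for u_(n+1) gives the integral of (g, u_(n+1)) minus that of (w(t),
    zs_(n+1)). Replacing u_n by u_(n+1) at the left end a produces lam (w(a), zs_(n+1)), which
    cancels the last integral up to the modulus of continuity of w; the first is [source_bound] at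
    the scale rho_(n+1). *)
Lemma iteration_bound n: t0 + lam * n%:R < T ->
 `|pairing w (u 0%N).1 t0 - pairing w (u n).1 (t0 + lam * n%:R)| <=
 \sum_(k < n) lam / rho k.+1 + lam * n%:R * (A / 2 + e * Zs) +
 (\int[l1m]_(t in `]t0, (t0 + lam * n%:R)]) gpow t) / 2.
elim: n => [_|n IH tnT].
 rewrite mulr0 addr0 subrr normr0 big_ord0 mul0r !add0r divr_ge0//.
 by apply: Rintegral_ge0 => t _; apply: Rintegral_ge0 => x _; exact: exprn_ge0.
set a := t0 + lam * n%:R in IH *; set b := t0 + lam * n.+1%:R in tnT *.
have bE: b = a + lam by rewrite /a /b -natr1; ring.
have ab: a < b by rewrite bE ltrDl.
have ta: t0 <= a by rewrite lerDl mulr_ge0// ltW.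
have a0': 0 < a by apply: lt_le_trans ta.
have aT: a < T by apply: lt_trans tnT.
have [l1n Xn sn zn] := iteration_facts n.+1.
have td := time_diff sn a0' ab tnT.
have aI: 0 <= a <= T by rewrite !ltW.
have lin: pairing w (u n).1 a = pairing w (u n.+1).1 a + lam * pairing w (zs n.+1) a.
 by rewrite !pairing_slice// uE dotLDr dotLZr.
have mJ: measurable (`]a, b]%classic: set R) by exact: measurable_itv.
have [_ _ [G [[w2 _ _] _]]] := ret.
have p1: in_L1 l1m `]a, b] (pairing g (u n.+1).1) by apply: L1_sub =>//; exact: (pairing_L1 _ g2).
have p2: in_L1 l1m `]a, b] (pairing w (zs n.+1)) by apply: L1_sub =>//; exact: (pairing_L1 _ w2).
rewrite (RintegralB mJ p1 p2) in td.
have fJ: (l1m `]a, b]%classic < +oo)%E.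
 apply: le_lt_trans fI0T; apply: le_measure; rewrite ?inE//; exact: sub_I0T.
have close: `|\int[l1m]_(t in `]a, b]) pairing w (zs n.+1) t - lam * pairing w (zs n.+1) a| <= lam * (e * Zs).
 have ca := in_L1_cst mJ fJ (pairing w (zs n.+1) a).
 have bal: b - a = lam by rewrite bE addrC addKr.
 have ->: lam * pairing w (zs n.+1) a = \int[l1m]_(t in `]a, b]) pairing w (zs n.+1) a.
  by rewrite Rint_cst ?(ltW ab)// bal mulrC.
 rewrite -(RintegralB mJ p2 ca); apply: le_trans (le_normr_Rintegral mJ (in_L1B mJ p2 ca)) _.
 have ->: lam * (e * Zs) = \int[l1m]_(t in `]a, b]) (e * Zs) by rewrite Rint_cst ?(ltW ab)// bal mulrC.
 apply: (le_Rint_ae mJ (in_L1_abs (in_L1B mJ p2 ca)) (in_L1_cst mJ fJ _)).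
 apply/aeW => t; rewrite /= in_itv /= => /andP[at_ tb].
 have tI: 0 <= t <= T.
  by rewrite (le_trans (ltW a0') (ltW at_)) (le_trans tb (ltW tnT)).
 apply: pairing_close =>//; apply: ed =>//.
 by rewrite ger0_norm ?subr_ge0 ?(ltW at_)// -bal lerB.
have sb := source_bound (u n.+1).1 (rho0 n.+1) a0' (ltW ab) tnT.
rewrite (_: b - a = lam) in sb; last by rewrite bE addrC addKr.
have r1: (rho n.+1)^-1 * l1 (u n.+1).1 <= (rho n.+1)^-1 by rewrite ler_piMr ?invr_ge0 ?(ltW (rho0 _)).
have gs := Rint_split t00 ta (ltW ab) tnT gpow_L1.
have {}IH := IH aT.
rewrite big_ord_recr /= gs -natr1.
have lX: lam * ((rho n.+1)^-1 * l1 (u n.+1).1 + rho n.+1 ^+ N * dotL (u n.+1).1 (u n.+1).1 / 2) <=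
  lam * (rho n.+1)^-1 + lam * (A / 2).
 by rewrite -mulrDr ler_pM2l// lerD// ler_pM2r ?invr_gt0// mulrC.
have tri: pairing w (u 0%N).1 t0 - pairing w (u n.+1).1 b =
  (pairing w (u 0%N).1 t0 - pairing w (u n).1 a) + (\int[l1m]_(t in `]a, b]) pairing g (u n.+1).1 t) -
  (\int[l1m]_(t in `]a, b]) pairing w (zs n.+1) t - lam * pairing w (zs n.+1) a).
 by rewrite lin; apply/eqP; rewrite -subr_eq0; apply/eqP; move/eqP: td; rewrite -subr_eq0 => /eqP td; rewrite -[RHS]td; ring.
rewrite tri; apply: le_trans (ler_normB _ _) _; apply: le_trans (lerD (ler_normD _ _) (lexx _)) _.
apply: le_trans (lerD (lerD IH sb) close) _; rewrite !mulrDr !mulrDl mulr1.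
rewrite mulrDr in lX.
by apply: iter_arith lX.
Qed.
End iteration.
(** In this order: the sum of lam / rho_k, bounded by [sum_inv_le] with an initial weight at most 1;
    the L2 term, A/2 per unit of time; half the power of the source. *)
Definition sup_bound := 2 / c * (1 + c * T) + T * (A / 2) +
 (\int[dtx]_(z in Q) (`|g z| ^+ N.+2)) / 2.

Lemma pairing_T (v: L2O): pairing w v T = 0.
have [_ wT _] := ret; have TT: 0 <= T <= T by rewrite (ltW T0) lexx.
have h0: {aeO x, slice T x * v x = 0}.
 by apply: filterS wT => x h Ox; rewrite sliceE// h// mul0r.
rewrite pairing_slice// dotLE (Rint_ae_eq mO (in_L1_meas (dotL_L1 _ _)) (measurable_cst _) h0).
by rewrite Rintegral_cst ?mul0r//; exact: mO.
Qed.

(** March from t0 to a time t1 just before T, where the pairing is small since w(T) = 0. Apart from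
    its L1 norm, [phi] enters only through the initial weight, which is at most 1, and through
    errors that the choice of [e] makes arbitrarily small. *)
Lemma pairing_domain_bound (phi: E) (z: L2O) t0: subsol M phi z -> l1 phi.1 <= 1 -> 0 < t0 < T ->
 `|pairing w phi.1 t0| <= sup_bound.
move=> sub l1p /andP[t00 t0T]; have c0: 0 < c by rewrite /c !divr_gt0 ?exprn_gt0// mulr_gt0.
set X := dotL phi.1 phi.1; have X0: 0 <= X by exact: dotL_ge0.
(* The square of s0 is the initial weight: s0 is small enough for X s0^N <= A, from which the decay
   can start. *)
pose s0 := (X + 1)^-1; have s00: 0 < s0 by rewrite invr_gt0 ltr_wpDl.
have s01: s0 <= 1 by rewrite invf_le1 ?ltr_wpDl// lerDr.
have A0: 0 < A by rewrite /A mulr_gt0.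
have XA: X * s0 ^+ N <= A.
 apply: (@le_trans _ _ 1); last by rewrite /A -natrM ler1n.
 apply: (@le_trans _ _ (X * s0)); last by rewrite /s0 ler_pdivrMr ?ltr_wpDl// mul1r lerDl.
 by rewrite ler_wpM2l// -(prednK N0) exprS ler_piMr ?(ltW s00)// exprn_ile1// ltW.
have sqs: Num.sqrt (s0 ^+ 2) = s0 by rewrite sqrtr_sqr gtr0_norm.
pose Zs := dotL z z + 1; have Zs0: 0 < Zs by rewrite ltr_wpDl ?dotL_ge0.
have zZ: dotL z z <= Zs ^+ 2 by have := dotL_ge0 z; rewrite /Zs; nra.
pose Y := A / s0 ^+ N + 1; have Y0: 0 < Y by rewrite ltr_wpDl// divr_ge0 ?exprn_ge0// ltW.
apply/ler_addgt0Pr => eps eps0; pose D := T * Zs + Y + 1.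
have D0: 0 < D by apply: addr_gt0 =>//; apply: addr_gt0 =>//; exact: mulr_gt0.
pose e := eps / D; have e0: 0 < e by rewrite divr_gt0.
have [d d0 hd] := slice_unif (exprn_gt0 2 e0).
have [t1 /andP[t01 t1T] t1d]: exists2 t1, t0 < t1 < T & T - t1 <= d.
 exists (T - Num.min d (T - t0) / 2).
  have m0: 0 < Num.min d (T - t0) by rewrite lt_min d0 subr_gt0.
  have: Num.min d (T - t0) <= T - t0 by rewrite ge_min lexx orbT.
  by move=> h; apply/andP; split; lra.
 have m0: 0 < Num.min d (T - t0) by rewrite lt_min d0 subr_gt0.
 have: Num.min d (T - t0) <= d by rewrite ge_min lexx.
 by move: m0; move: (Num.min _ _) => m m0 md; lra.
have L0: 0 < t1 - t0 by rewrite subr_gt0.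
have [n hn] := nat_above ((t1 - t0) / Num.min d (s0 ^+ 2 / c)).
have m0: 0 < Num.min d (s0 ^+ 2 / c) by rewrite lt_min d0 divr_gt0// exprn_gt0.
pose lam := (t1 - t0) / n.+1%:R; have lam0: 0 < lam by rewrite divr_gt0.
have lamm: lam <= Num.min d (s0 ^+ 2 / c).
 by rewrite ler_pdivrMr// mulrC -ler_pdivrMr// ltW.
have lamd: lam <= d by apply: le_trans lamm _; rewrite ge_min lexx.
have cla: c * lam <= s0 ^+ 2.
 by rewrite mulrC -ler_pdivlMr//; apply: le_trans lamm _; rewrite ge_min lexx orbT.
have lamn: lam * n.+1%:R = t1 - t0 by rewrite divfK// pnatr_eq0.
pose step (f: L2O): E := projT1 (cid (res_exists mM C0 MC al0 Mal f lam0)).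
pose u := fix u k := if k is k'.+1 then step (u k').1 else phi.
have ures k: res_eq M lam (u k).1 (u k.+1) by exact: (projT2 (cid (res_exists mM C0 MC al0 Mal (u k).1 lam0))).
have XA': dotL (u 0%N).1 (u 0%N).1 * Num.sqrt (s0 ^+ 2 + c * lam * 0%:R) ^+ N <= A.
 by rewrite mulr0 addr0 sqs.
have ed s t: 0 <= s <= T -> 0 <= t <= T -> `|s - t| <= lam -> dist s t <= e ^+ 2.
 by move=> sT tT st; apply: hd =>//; exact: le_trans lamd.
have s20: 0 < s0 ^+ 2 by rewrite exprn_gt0.
have bn := @iteration_bound t0 lam (s0 ^+ 2) e Zs u z lam0 s20 cla (ltW e0) (ltW Zs0) sub ures l1p t00 XA' zZ ed n.+1.
have tE: t0 + lam * n.+1%:R = t1 by rewrite lamn addrC subrK.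
rewrite tE lamn in bn; have {}bn := bn t1T.
have [l1n Xn _ _] := @iteration_facts lam (s0 ^+ 2) Zs u z lam0 s20 cla sub ures l1p XA' zZ n.+1.
have Xn': dotL (u n.+1).1 (u n.+1).1 <= Y ^+ 2.
 have Y1: 1 <= Y by rewrite lerDr divr_ge0 ?exprn_ge0// ltW.
 apply: (@le_trans _ _ Y); last by rewrite expr2 ler_peMl// ltW.
 apply: ler_wpDr =>//; rewrite ler_pdivlMr ?exprn_gt0//; apply: le_trans Xn.
 rewrite ler_wpM2l ?dotL_ge0// lerXn2r ?nnegrE ?sqrtr_ge0 ?(ltW s00)// -[X in X <= _]sqs.
 by rewrite ler_sqrt ?lerDl ?addr_ge0 ?mulr_ge0// ?(ltW s20)// ltW.
have t1I: 0 <= t1 <= T by rewrite (ltW (lt_trans t00 t01)) ltW.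
have TI: 0 <= T <= T by rewrite (ltW T0) lexx.
have end_: `|pairing w (u n.+1).1 t1| <= e * Y.
 rewrite -[X in `|X|]subr0 -(pairing_T (u n.+1).1); apply: pairing_close =>//; try exact: ltW.
 by apply: hd =>//; rewrite distrC ger0_norm// subr_ge0 ltW.
have sm := sum_inv_le n.+1 c0 lam0 s20.
have sq1: Num.sqrt (s0 ^+ 2 + c * lam * n.+1%:R) <= 1 + c * T.
 have cT: 0 <= c * T by rewrite mulr_ge0// ltW.
 have p1: 0 <= 1 + c * T by rewrite addr_ge0.
 rewrite -(ler_sqr (sqrtr_ge0 _) p1) sqr_sqrtr; last by rewrite addr_ge0 ?(ltW s20)// !mulr_ge0// ltW.
 apply: (@le_trans _ _ (1 + c * T)).
  rewrite lerD ?exprn_ile1 ?(ltW s00)// -mulrA lamn ler_pM2l//; lra.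
 by rewrite expr2 ler_peMl// lerDl.
have {}sm: \sum_(k < n.+1) lam / Num.sqrt (s0 ^+ 2 + c * lam * k.+1%:R) <= 2 / c * (1 + c * T).
 by apply: le_trans sm _; rewrite ler_wpM2l// divr_ge0// ltW.
have gle: \int[l1m]_(t in `]t0, t1]) gpow t <= \int[dtx]_(z in Q) (`|g z| ^+ N.+2).
 rewrite -gpow_int; apply: (Rint_sub_le (measurable_itv _) mI (sub_I0T t00 t1T) gpow_L1) => t _.
 by apply: Rintegral_ge0 => x _; exact: exprn_ge0.
have eps_: T * (e * Zs) + e * Y <= eps.
 rewrite [T * _]mulrCA -mulrDr /e mulrAC ler_pdivrMr// ler_pM2l// /D; lra.
have tle: (t1 - t0) * (A / 2 + e * Zs) <= T * (A / 2) + T * (e * Zs).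
 have nn: 0 <= A / 2 + e * Zs.
  by apply: addr_ge0; [rewrite divr_ge0// ltW|rewrite mulr_ge0// ltW].
 rewrite -mulrDr; apply: ler_wpM2r =>//; rewrite lerBlDl.
 by apply: le_trans (ltW t1T) _; rewrite lerDr ltW.
rewrite -[pairing w phi.1 t0](subrK (pairing w (u n.+1).1 t1)).
apply: le_trans (ler_normD _ _) _; apply: le_trans (lerD bn end_) _.
rewrite /sup_bound; apply: le_trans (lerD (lerD (lerD sm tle) (ler_wpM2r _ gle)) (lexx _)) _ =>//.
by rewrite -!addrA !lerD2l addrCA lerD2l.
Qed.

Lemma H_slice: {ae l1m, forall t, I0T t -> exists2 v: E, H1_0 v & v.1 = slice t}.
have [_ _ [G [[_ _ h] _]]] := ret; apply: filterS h => t ht /=; rewrite in_itv /= => tI.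
by have := in_H10_H (ht tI); move=> Hv; eexists; first exact: Hv.
Qed.

Lemma sup_bound_ge0: 0 <= sup_bound.
have c0: 0 < c by rewrite /c !divr_gt0 ?exprn_gt0// mulr_gt0.
rewrite /sup_bound addr_ge0 ?addr_ge0//.
- by apply: mulr_ge0; [rewrite divr_ge0// ltW|rewrite addr_ge0// mulr_ge0// ltW].
- by rewrite mulr_ge0 ?(ltW T0)// /A !mulr_ge0.
by rewrite divr_ge0//; apply: Rintegral_ge0 => z _; exact: exprn_ge0.
Qed.

(** [pairing_domain_bound] applies to the resolvent phi of psi. Moving the resolvent to the other
    side, (w(t), phi) = (y, psi) with y the resolvent of w(t) for the transpose, and y is close to
    w(t) by [res_near] because w(t) is in H1_0. *)
Lemma dual_bound_H (psi: L2O) t (v: E): l1 psi <= 1 -> I0T t -> H1_0 v -> v.1 = slice t ->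
 `|dotL (slice t) psi| <= sup_bound.
move=> l1p; rewrite /= in_itv /= => tI Hv vE.
have mMt := tr_meas mM; have MtC := tr_bnd MC; have Mtal := tr_elliptic Mal.
pose K := N%:R ^+ 4 * C ^+ 2 / (2 * al) * S2 v.2.
pose P := dotL psi psi.
have key sg: 0 < sg -> `|dotL (slice t) psi| <= sup_bound + Num.sqrt (sg * K * P).
 move=> sg0; have [phi rp] := res_exists mM C0 MC al0 Mal psi sg0.
 have [y ry] := res_exists mMt C0 MtC al0 Mtal (slice t) sg0.
 have sub: subsol M phi (sg^-1 *: (psi - phi.1)).
  have [Hp hp] := rp; split =>// h Hh; have := hp h Hh => e1.
  rewrite dotLZl dotLBl -e1 addrAC subrr add0r mulrA mulVf ?mul1r//; exact: lt0r_neq0.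
 have l1phi: l1 phi.1 <= 1 by apply: le_trans l1p; exact: (res_l1 mM MC al0 Mal sg0 rp).
 have := pairing_domain_bound sub l1phi tI.
 rewrite pairing_slice; last by case/andP: tI => ? ?; rewrite !ltW.
 have [Hp hp] := rp; have [Hy hy] := ry.
 rewrite -(hy _ Hp) -(aV_tr mM MC) -[X in _ + sg * X]/(aV M phi.2 y.2) (dotLC y.1) (hp _ Hy) => hb.
 rewrite -vE in ry; have near := res_near mMt C0 MtC al0 Mtal sg0 Hv ry.
 have ->: dotL (slice t) psi = dotL psi y.1 - dotL (y.1 - v.1) psi by rewrite dotLBl vE (dotLC y.1); ring.
 apply: le_trans (ler_normB _ _) _; apply: lerD =>//.
 rewrite -sqrtr_sqr ler_sqrt; last by apply: le_trans (_: 0 <= dotL (y.1 - v.1) (y.1 - v.1) * P) _; rewrite ?mulr_ge0 ?dotL_ge0// ler_wpM2r ?dotL_ge0.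
 by apply: le_trans (dotL_cs _ _) _; rewrite ler_wpM2r ?dotL_ge0.
apply/ler_addgt0Pr => e e0.
have KP0: 0 <= K * P by rewrite !mulr_ge0 ?dotL_ge0 ?S2_ge0 ?invr_ge0 ?exprn_ge0 ?mulr_ge0// ltW.
have KP1: 0 < K * P + 1 by rewrite ltr_wpDl.
apply: le_trans (key (e ^+ 2 / (K * P + 1)) _) _; first by rewrite divr_gt0 ?exprn_gt0.
rewrite lerD2l -[leRHS](ger0_norm (ltW e0)) -sqrtr_sqr ler_sqrt ?exprn_ge0 ?(ltW e0)//.
by rewrite -mulrA mulrAC -mulrA ler_piMr ?exprn_ge0 ?(ltW e0)// ler_pdivrMr// mul1r lerDl.
Qed.

(** [dual_bound_H] covers almost every t; the continuity of the slices in L2 supplies the others, t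
    = 0 included. *)
Lemma dual_bound (psi: L2O) t: l1 psi <= 1 -> 0 <= t <= T -> `|dotL (slice t) psi| <= sup_bound.
move=> l1p tT; apply/ler_addgt0Pr => e e0; pose P := dotL psi psi + 1.
have P0: 0 < P by rewrite ltr_wpDl ?dotL_ge0.
have [d d0 hd] := slice_cont tT (exprn_gt0 2 (divr_gt0 e0 P0)).
have [s [sI sd [v Hv vE]]]: exists s, [/\ I0T s, `|t - s| < d & exists2 v: E, H1_0 v & v.1 = slice s].
 pose a := Num.max 0 (t - d); pose b := Num.min T (t + d).
 have ab: a < b.
  rewrite lt_min !gt_max; case/andP: tT => t1 t2.
  by rewrite T0 (ltr_wpDl t1 d0) ltrBlDr (le_lt_trans t2) ?ltrDl// ltrBlDr -addrA ltrDl addr_gt0.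
 have [s sab h] := ae_itv ab H_slice; exists s.
 have sI: I0T s.
  move: sab; rewrite /= !in_itv /= => /andP[]; rewrite gt_max lt_min => /andP[-> _] /andP[-> _] //.
 split =>//; last exact: h.
 move: sab; rewrite /= in_itv /= => /andP[]; rewrite gt_max lt_min => /andP[_ s1] /andP[_ s2].
 by rewrite ltr_norml; apply/andP; split; lra.
have sT: 0 <= s <= T by move: sI; rewrite /= in_itv /= => /andP[? ?]; rewrite !ltW.
have := dual_bound_H l1p sI Hv vE; rewrite -(pairing_slice psi sT) -(pairing_slice psi tT) => h.
have e': 0 <= e / P by rewrite divr_ge0// ltW.
have cl: `|pairing w psi t - pairing w psi s| <= e / P * P.
 apply: pairing_close =>//; [exact: ltW|rewrite distC; apply: ltW; apply: hd =>//|].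
 by have := dotL_ge0 psi; rewrite /P; nra.
rewrite divfK ?gt_eqF// in cl; rewrite -[pairing w psi t](subrK (pairing w psi s)).
by apply: le_trans (ler_normD _ _) _; rewrite addrC; apply: lerD.
Qed.

(** Duality of L1 and Loo. For s = 1 or -1 and p the positive part of s w(t) - b, with b the bound,
    [dual_bound] gives (s w(t), p) <= b |p|_1, while (s w(t) - b) p = p^2; hence p vanishes almost
    everywhere. *)
Lemma slice_sup t: 0 <= t <= T -> {aeO x, `|w (t, x)| <= sup_bound}.
move=> tT.
have half (s: R): `|s| = 1 -> {aeO x, s * w (t, x) <= sup_bound}.
 move=> s1; pose f x := Num.max (s * slice t x - sup_bound) 0.
 have mf: mfun Omega f.
  have [ms _] := L2P (slice t).
  by apply: measurable_maxr =>//; apply: measurable_funB =>//; apply: measurable_funM.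
 have f2: in_L2 dx Omega f.
  apply: (in_L2_le mO mf (L2P (slice t))); apply/aeW => x Ox; rewrite /f.
  have b0 := sup_bound_ge0; rewrite ger0_norm ?le_max ?lexx ?orbT// ge_max normr_ge0 andbT.
  have := ler_norm (s * slice t x); rewrite normrM s1 mul1r; move=> h; lra.
 pose p: L2O := toL f; have pE x: p x = f x by rewrite toL2x.
 have lp : l1 p = dotL p oneL.
  by apply: eq_dotL; apply/aeW => x Ox; rewrite absLE oneLE// mulr1 ger0_norm ?mulr1// pE le_max lexx orbT.
 have sp: s * dotL (slice t) p <= sup_bound * l1 p.
  apply/ler_addgt0Pr => e e0; have b0 := sup_bound_ge0.
  have l0: 0 <= l1 p by exact: l1_ge0.
  (* Slightly more than the L1 norm of p, which may be 0 and could not be divided by. *)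
  pose k := l1 p + e / (sup_bound + 1).
  have bp: 0 < sup_bound + 1 by rewrite ltr_wpDl.
  have k0: 0 < k by rewrite ltr_wpDl// divr_gt0.
  have lk: l1 (k^-1 *: p) <= 1.
   have ->: l1 (k^-1 *: p) = k^-1 * l1 p.
    rewrite /l1 -dotLZl; apply: eq_dotL; apply/aeW => x _; rewrite absLE.
    rewrite -[(k^-1 *: absL p) x]/(k^-1 * absL p x) absLE -[(k^-1 *: p) x]/(k^-1 * p x).
    by rewrite normrM gtr0_norm ?invr_gt0.
   by rewrite mulrC ler_pdivrMr// mul1r lerDl divr_ge0// ltW.
  have := dual_bound lk tT; rewrite dotLZr normrM gtr0_norm ?invr_gt0// mulrC ler_pdivrMr// => h.
  apply: le_trans (ler_norm _) _; rewrite normrM s1 mul1r; apply: le_trans h _; rewrite /k mulrDr lerD2l.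
  by rewrite mulrCA ler_piMr ?(ltW e0)// ler_pdivrMr// mul1r lerDl.
 have pp: dotL p p <= 0.
  have ->: dotL p p = s * dotL (slice t) p - sup_bound * dotL p oneL.
   rewrite -dotLZl -dotLZr -(dotLC (sup_bound *: oneL)) -dotLBl; apply: eq_dotL; apply/aeW => x Ox.
   rewrite -[((s *: slice t - sup_bound *: oneL): L2O) x]/(s * slice t x - sup_bound * oneL x).
   rewrite oneLE// mulr1 pE /f; case: (leP (s * slice t x - sup_bound) 0) =>// h.
   by rewrite !mulr0.
  by rewrite subr_le0 -lp.
 apply: filterS (dotL_eq0 pp) => x h Ox; have := h Ox; rewrite pE /f => h0.
 by rewrite -sliceE// -subr_le0 -h0 le_max lexx.
apply: filterS2 (half 1 (normr1 _)) (half (-1) (normrN1 _)) => x h1 h2 Ox.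
have := h1 Ox; have := h2 Ox; rewrite mul1r mulN1r => a1 a2; rewrite ler_norml a2 andbT; lra.
Qed.

(** On each slice the bound holds almost everywhere; continuity excludes even a single point above
    it, as is needed to integrate w against [mu]. *)
Lemma retrograde_sup: {within Q, continuous w} -> forall z, Q z -> `|w z| <= sup_bound.
move=> cw [t x] Qz; rewrite leNgt; apply/negP => big.
have oQ: open Q by exact: open_cylinder.
have cz: {for (t, x), continuous w} by move: cw; rewrite continuous_open_subspace//; apply; rewrite inE.
have /nbhs_ballP[r r0 hr]: \forall z \near (t, x), sup_bound < `|w z| /\ Q z.
 apply: filterI; last exact: open_nbhs_nbhs.
 have cn: {for (t, x), continuous (fun z => `|w z|)} by apply: continuous_comp =>//; exact: norm_continuous.
 have nb: nbhs `|w (t, x)| [set y | sup_bound < y].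
  by apply: open_nbhs_nbhs; split; [exact: open_gt|].
 exact: (cn _ nb).
have [It Ox]: I0T t /\ Omega x by [].
have tT: 0 <= t <= T by move: It; rewrite /= in_itv /= => /andP[? ?]; rewrite !ltW.
have r2: 0 < r / 2 by rewrite divr_gt0.
have [y xy h] := ae_cbx x r2 (slice_sup tT); have xy' := (cbxP _ _ _).1 xy.
have [|w1 [_ Oy]] := hr (t, y); first by split => /=; [exact: ballxx|split =>// i j; rewrite (ord1 j) /ball /= distrC; apply: le_lt_trans (xy' i) _; rewrite ltr_pdivrMr// mulr_natr mulr2n ltrDl].
by have := h Oy; rewrite leNgt w1.
Qed.
End one_solution.
End retrograde_bound.

(** * Explicit retrograde solutions *)

Section special_solutions.

Lemma test_L2 f: test_function Q f -> in_L2 dtx Q f.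
move=> tf; have [Kf _ fK] := tf_bnd tf.
apply: (in_L2_bnd mQ fQ (C := Kf)); last exact/aeW.
apply: mfunTS; apply: cont_meas_tx; exact: sm_cont (tf_smooth tf).
Qed.

Lemma L1_flux (w: R * vec -> R) G phi i: in_L2H10 Omega T w G -> test_function Q phi ->
 in_L1 dtx Q (fun p => flux G (fun=> 1) i p * 'D_((0, ei i): R * vec) phi p).
move=> wG tp; apply: (in_L2M mQ); last by apply: test_L2; exact: tf_derive.
apply: (flux_L2 wG i (K := 1)); first exact: measurable_cst.
by move=> t; rewrite normr1.
Qed.

Lemma dot_flux G (phi: R * vec -> R) p: dot ((M p.2)^T *m G p) (gradx phi p) =
 \sum_i flux G (fun=> 1) i p * 'D_((0, ei i): R * vec) phi p.
apply: eq_bigr => i _; rewrite /flux !mxE mul1r; congr (_ * _).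
by apply: eq_bigr => j _; rewrite mxE.
Qed.

Lemma L1_dot (w: R * vec -> R) G phi: in_L2H10 Omega T w G -> test_function Q phi ->
 in_L1 dtx Q (fun p => dot ((M p.2)^T *m G p) (gradx phi p)).
move=> wG tp; under eq_fun do rewrite dot_flux.
by apply: (in_L1_sum mQ) => i; exact: L1_flux wG tp.
Qed.
(** The function (c - t)_+, frozen for t < 0 so that it is bounded on the whole line. *)
Definition tent (c t: R) := Num.max (c - Num.max t 0) 0.

Lemma tent_01 c t: 0 <= c -> `|tent c t| <= c.
move=> c0; rewrite /tent ger0_norm ?le_max ?lexx ?orbT// ge_max c0 andbT gerBl.
by rewrite le_max lexx orbT.
Qed.

Lemma tentE c t: 0 <= t -> tent c t = if t < c then c - t else 0.
move=> t0; rewrite /tent (max_l t0); case: ltP => h; first by rewrite max_l// subr_ge0 ltW.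
by rewrite max_r// subr_le0.
Qed.

Lemma tent_cont c: continuous (tent c).
have pos_ (f: R -> R): continuous f -> continuous (fun t => Num.max (f t) 0).
 move=> cf t; rewrite (_: (fun t => _) = fun t => (f t + `|f t|) / 2); last first.
  by apply/funext => s; rewrite maxr_absE subr0 addr0.
 apply: cvgMr_tmp; apply: cvgD; first exact: cf.
 by apply: (@continuous_comp _ _ _ f (fun y => `|y|)); [exact: cf|exact: norm_continuous].
apply: (pos_ (fun t => c - Num.max t 0)) => t; apply: cvgB; first exact: cvg_cst.
by apply: (pos_ id) => s; exact: cvg_id.
Qed.

Lemma tent_meas c: mfunT (tent c).
apply: measurable_maxr; last exact: measurable_cst.
apply: measurable_funB; first exact: measurable_cst.
by apply: measurable_maxr; [exact: measurable_id|exact: measurable_cst].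
Qed.

Section one_special.
Variables (v: E) (z: L2O) (c K: R).
Hypothesis sub: subsol Mt v z.
Hypothesis cv: {within Omega, continuous v.1}.
Hypothesis vK: forall x, Omega x -> `|v.1 x| <= K.
Hypothesis c0T: 0 < c <= T.
Let w (p: R * vec) := tent c p.1 * v.1 p.2.
Let G (p: R * vec): vec := \col_i (tent c p.1 * v.2 i p.2).
Let on (p: R * vec): R := if p.1 < c then 1 else 0.
(** The two summands are - w_t and - div(M^T grad w) for w = [tent] times v. *)
Definition spec_source (p: R * vec) := on p * v.1 p.2 + tent c p.1 * z p.2.
Let c0: 0 <= c. Proof. by case/andP: c0T => /ltW. Qed.
Let Hs t: H1_0 (tent c t *: v).
by apply: (subspZ _ H_subsp); case: sub. Qed.

Lemma spec_CL2: in_CL2 Omega T w.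
split=> t tT; first exact: (L2P (tent c t *: v).1).
have E s: (\int[dx]_(x in Omega) ((w (s, x) - w (t, x)) ^+ 2)%:E)%E =
  ((tent c s - tent c t) ^+ 2 * dotL v.1 v.1)%:E.
 have := dotL_EFin ((tent c s - tent c t) *: v.1); rewrite dotLZl dotLZr mulrA -expr2 => <-.
 by apply: eq_integral => x _; rewrite /w /= -mulrBl.
rewrite (_: (fun s => _) = fun s => ((tent c s - tent c t) ^+ 2 * dotL v.1 v.1)%:E); last first.
 by apply/funext => s; rewrite E.
apply: cvg_within_filter; apply: cvg_EFin; first by apply: nearW.
have ->: 0 = (tent c t - tent c t) ^+ 2 * dotL v.1 v.1 by rewrite subrr expr0n mul0r.
apply: cvgMr_tmp; apply: (@continuous_comp _ _ _ (fun s => tent c s - tent c t) (fun y => y ^+ 2)).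
 by apply: cvgB; [exact: tent_cont|exact: cvg_cst].
exact: exprn_continuous.
Qed.

Lemma spec_L2H10: in_L2H10 Omega T w G.
have tb t := tent_01 t c0; split.
- exact: (bmul_time (tent_meas c) tb (in_L2_lift v.1)).
- move=> i; rewrite (_: (fun p => _) = fun p => tent c p.1 * v.2 i p.2).
  exact: (bmul_time (tent_meas c) tb (in_L2_lift (v.2 i))).
 by apply/funext => p; rewrite mxE.
apply/aeW => t _; have h := H_in_H10 (Hs t).
rewrite (_: (fun x => G (t, x)) = fun x => \col_i (tent c t *: v).2 i x); first exact: h.
by apply/funext => x; apply/colP => i; rewrite !mxE.
Qed.

Lemma spec_cont: {within Q, continuous w}.
rewrite continuous_open_subspace; last exact: open_cylinder.
move=> -[t x]; rewrite inE => -[_ Ox]; apply: cvgM.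
 by apply: (@continuous_comp _ _ _ fst (tent c)); [exact: cvg_fst|exact: tent_cont].
apply: (@continuous_comp _ _ _ snd v.1); first exact: cvg_snd.
by move: cv; rewrite continuous_open_subspace//; apply; rewrite inE.
Qed.

Section weak_equation.
Variable phi: R * vec -> R.
Hypothesis tp: test_function Q phi.
Let sp := tf_smooth tp.
Let fA p := v.1 p.2 * (tent c p.1 * dt phi p - on p * phi p).
Let on_meas: mfunT (fun t: R => if t < c then 1 else 0: R).
apply: measurable_fun_ifT; [|exact: measurable_cst|exact: measurable_cst].
by apply: measurable_fun_ltr; [exact: measurable_id|exact: measurable_cst].
Qed.
Let on01 (t: R): `|if t < c then 1 else 0: R| <= 1.
by case: ifP; rewrite ?normr1 ?normr0. Qed.
Let dphi_test: test_function Q (dt phi).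
exact: (tf_derive _ tp). Qed.
Let L1_wdt: in_L1 dtx Q (fun p => w p * dt phi p).
by apply: (in_L2M mQ); [case: spec_L2H10|exact: test_L2]. Qed.
Let L1_onv: in_L1 dtx Q (fun p => on p * v.1 p.2 * phi p).
apply: (in_L2M mQ); last exact: test_L2.
exact: (bmul_time on_meas on01 (in_L2_lift v.1)).
Qed.

(** For fixed x the difference of the integrands is, for t < c, the derivative of (c - t) phi(t,x)
    v(x). This function vanishes at t = c, and at t = 0 because phi is supported in the open
    cylinder. *)
Lemma spec_time: \int[dtx]_(p in Q) (w p * dt phi p) = \int[dtx]_(p in Q) (on p * v.1 p.2 * phi p).
apply/eqP; rewrite -subr_eq0 -(RintegralB mQ L1_wdt L1_onv); apply/eqP.
have i1 := in_L1B mQ L1_wdt L1_onv.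
have [_ _ ->] := fubini_in2 mI mO (i1: in_L1 (leb1 \x lvec N)%E (I0T `*` Omega) _).
apply: Rint_eq0 => x Ox.
pose F t := v.1 x * ((c - t) * phi (t, x)).
pose dF t := v.1 x * ((c - t) * dt phi (t, x) - phi (t, x)).
have cs f: continuous f -> continuous (fun t: R => f (t, x): R).
 move=> cf t; apply: (@continuous_comp _ _ _ (fun t: R => (t, x)) f); last exact: cf.
 by apply: (@cvg_pair _ _ _ _ (nbhs t) (nbhs x)); [exact: cvg_id|exact: cvg_cst].
have dphi t: is_derive t (1: R) (fun t => phi (t, x)) (dt phi (t, x)).
 have d := derive_slice1 phi (1: R) t x; rewrite /dt d.1; apply: derivableP.
 by rewrite -d.2; exact: sm_der.
have dFP t: is_derive t (1: R) F (dF t).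
 have dl: is_derive t (1: R) (fun t: R => c - t) (-1) by have h := is_deriveB (is_derive_cst c t 1) (is_derive_id t 1); apply: (is_derive_eq h); rewrite sub0r.
 have := is_deriveZ (v.1 x) (is_deriveM dl (dphi t)) => h.
 apply: (is_derive_eq h); rewrite /dF /GRing.scale /=; ring.
have cdF: continuous dF.
 move=> t; apply: cvgMl_tmp; apply: cvgB; last by apply: cs; exact: sm_cont sp.
 apply: cvgM; last by apply: cs; exact: sm_cont (tf_smooth dphi_test).
 by apply: cvgB; [exact: cvg_cst|exact: cvg_id].
have c0': 0 < c by case/andP: c0T.
have mdF: mfun setT dF by exact: continuous_measurable_fun.
transitivity (\int[l1m]_(t in `]0, c[) dF t); last first.
 rewrite (Rint_I0T (measurable_funS measurableT (@subsetT _ _) mdF)).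
 rewrite (FTC_line (ltW c0') dFP cdF) /F subrr mul0r mulr0.
 have ->: phi (0, x) = 0 by apply: (tf_out tp) => -[]; rewrite /= in_itv /= ltxx.
 by rewrite !mulr0 subrr.
rewrite /Rintegral; congr fine.
rewrite (_: (`]0, c[%classic: set R) = I0T `&` `]0, c[); last first.
 apply/seteqP; split=> t; rewrite /= !in_itv /=; last by case.
 by move=> /andP[t0 tc]; rewrite t0 tc (lt_le_trans tc)//; case/andP: c0T.
rewrite integral_mkcondr; apply: eq_integral => t; rewrite inE /= in_itv /= => /andP[t0 tT].
rewrite patchE /= /w /on /= (tentE _ (ltW t0)); case: (ltP t c) => tc.
 rewrite ifT; last by rewrite inE /= in_itv /= t0.
 by congr (_%:E); rewrite /dF; ring.
rewrite ifF; last by apply/negbTE; rewrite notin_setE /= in_itv /= t0 /= => tc'; rewrite leNgt tc' in tc.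
by rewrite !mul0r subr0.
Qed.
Let L1_tz: in_L1 dtx Q (fun p => tent c p.1 * z p.2 * phi p).
apply: (in_L2M mQ); last exact: test_L2.
exact: (bmul_time (tent_meas c) (fun t => tent_01 t c0) (in_L2_lift z)).
Qed.

Lemma spec_space: \int[dtx]_(p in Q) dot ((M p.2)^T *m G p) (gradx phi p) =
 \int[dtx]_(p in Q) (tent c p.1 * z p.2 * phi p).
have L1d := L1_dot spec_L2H10 tp.
apply/eqP; rewrite -subr_eq0 -(RintegralB mQ L1d L1_tz); apply/eqP.
have i1 := in_L1B mQ L1d L1_tz.
have [_ _ ->] := fubini_in1 mI mO (i1: in_L1 (leb1 \x lvec N)%E (I0T `*` Omega) _).
apply: Rint_eq0 => t _.
have ts := test_slice t tp; have [Hv hv] := sub.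
have := hv _ (H_test ts); set psi := tstE _ => eq1.
have i2: in_L1 dx Omega (fun x => z x * psi.1 x) by exact: dotL_L1.
have i3 i j: in_L1 dx Omega (fun x => mulB Mt i j (v.2 j) x * psi.2 i x) by exact: dotL_L1.
have i4: in_L1 dx Omega (fun x => \sum_i \sum_j mulB Mt i j (v.2 j) x * psi.2 i x).
 by apply: (in_L1_sum mO) => i; apply: (in_L1_sum mO) => j.
transitivity (tent c t * (aV Mt v.2 psi.2 - dotL z psi.1)); last by rewrite eq1 subrr mulr0.
have ->: aV Mt v.2 psi.2 = \int[dx]_(x in Omega) (\sum_i \sum_j mulB Mt i j (v.2 j) x * psi.2 i x).
 rewrite (Rint_sum mO) => [|i]; last by apply: (in_L1_sum mO) => j.
 by apply: eq_bigr => i _; rewrite (Rint_sum mO)//; apply: eq_bigr => j _; rewrite dotLE.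
rewrite dotLE -(RintegralB mO i4 i2) -(RintegralZl _ mO (in_L1B mO i4 i2)).
apply: eq_Rintegral => x _; rewrite dot_flux mulrBr; congr (_ - _); last first.
 by rewrite /= (tstE1 ts) mulrA.
rewrite mulr_sumr; apply: eq_bigr => i _; rewrite /flux mul1r /= (derive_slice2 phi (ei i) t x).1.
rewrite (tstE2 i ts) -mulr_suml mulrA; congr (_ * _); rewrite mulr_sumr; apply: eq_bigr => j _.
by rewrite (mulBE (tr_meas mM) (tr_bnd MC)) !mxE; ring.
Qed.

Lemma spec_weak: \int[dtx]_(p in Q) (w p * dt phi p) +
 \int[dtx]_(p in Q) dot ((M p.2)^T *m G p) (gradx phi p) =
 \int[dtx]_(p in Q) (spec_source p * phi p).
rewrite spec_time spec_space -(RintegralD mQ L1_onv L1_tz); apply: eq_Rintegral => p _.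
by rewrite /spec_source mulrDl.
Qed.
End weak_equation.

Lemma spec_solution: exists w, retrograde_solution Omega T M spec_source w /\
 {within Q, continuous w}.
exists w; split; last exact: spec_cont; split; first exact: spec_CL2.
 apply/aeW => x _; rewrite /w /= tentE ?(ltW T0)//.
 by case/andP: c0T => _ cT; rewrite ltNge cT /= mul0r.
by exists G; split; [exact: spec_L2H10|exact: spec_weak].
Qed.
End one_special.
End special_solutions.

(** * Density of the sources of continuous solutions *)

Section density.
Let mMt := tr_meas mM.
Let MtC := tr_bnd MC.
Let Mtal := tr_elliptic Mal.

(** The quotient (v - v') / lam is itself the resolvent of z, so the maximum principle [res_abs]
    carries the bound on the source from one Euler step to the next. *)
Lemma res_subsol (v v': E) (z: L2O) lam: 0 < lam -> subsol Mt v z -> res_eq Mt lam v.1 v' ->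
 subsol Mt v' (lam^-1 *: (v.1 - v'.1)) /\
 forall Z, 0 <= Z -> {aeO x, `|z x| <= Z} ->
  {aeO x, `|(lam^-1 *: (v.1 - v'.1)) x| <= Z}.
move=> lam0 [Hv vz] rv; have [Hv' hv'] := rv.
have sub': subsol Mt v' (lam^-1 *: (v.1 - v'.1)).
 split=> // h Hh; have e1 := hv' h Hh.
 rewrite dotLZl dotLBl -e1 addrAC subrr add0r mulrA mulVf ?mul1r//; exact: lt0r_neq0.
split=> // Z Z0 zZ; pose y: E := lam^-1 *: (v - v').
apply: (res_abs (u := y) mMt MtC al0 Mtal lam0 Z0 _ zZ); split.
 apply: (subspZ _ H_subsp); exact: (subspB H_subsp Hv Hv').
move=> h Hh; have [_ hs] := sub'; have e1 := vz h Hh; have e2 := hs h Hh.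
have ->: y.1 = lam^-1 *: (v.1 - v'.1) by [].
have ->: aV Mt y.2 h.2 = lam^-1 * (aV Mt v.2 h.2 - aV Mt v'.2 h.2).
 have := aV_linl mMt MtC (- lam^-1) v'.2 (lam^-1 *: v.2) h.2.
 have := aV_linl mMt MtC (lam^-1) v.2 0 h.2.
 have := aV_linl mMt MtC (-1) v.2 v.2 h.2.
 rewrite scaleN1r addNr => ->; rewrite addr0 => -> e3.
 have yE: y.2 = - lam^-1 *: v'.2 + lam^-1 *: v.2.
  by rewrite -[LHS]/(lam^-1 *: (v.2 - v'.2)) scalerBr scaleNr addrC.
 rewrite yE e3; ring.
rewrite e1 e2 mulrA divff ?gt_eqF// mul1r addrC subrK //.
Qed.

Section dense_class.
(** An arbitrary class with the closure properties of [Sdense], to be shown to contain every bounded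
    function. *)
Variable K: (R * vec -> R) -> Prop.
Hypothesis KLoo: forall f, K f -> in_Loo dtx Q f.
Hypothesis Klin: forall (c: R) f g, K f -> K g -> K (fun z => c * f z + g z).
Hypothesis Klim: forall (f_: nat -> R * vec -> R) (f: R * vec -> R) (B: R), (forall n, K (f_ n)) ->
 mfun Q f -> (forall n, {ae dtx, forall z, Q z -> `|f_ n z| <= B}) ->
 {ae dtx, forall z, Q z -> f_ n z @[n --> \oo] --> f z} -> K f.
Hypothesis Kret: forall g w, in_Loo dtx Q g -> retrograde_solution Omega T M g w ->
 {within Q, continuous w} -> K g.
Definition source (c: R) (v z: L2O) (p: R * vec): R :=
 (if p.1 < c then 1 else 0) * v p.2 + tent c p.1 * z p.2.

Lemma on_meas (c: R): mfunT (fun t: R => if t < c then 1 else 0: R).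
apply: measurable_fun_ifT; [|exact: measurable_cst|exact: measurable_cst].
by apply: measurable_fun_ltr; [exact: measurable_id|exact: measurable_cst].
Qed.

Lemma on_fst_meas c: mfun Q (fun p => if p.1 < c then 1 else 0: R).
apply: (meas_fst_in (f := fun t => if t < c then 1 else 0: R)).
by apply: (measurable_funS measurableT (@subsetT _ _)); exact: on_meas.
Qed.

Lemma source_meas c v z: mfun Q (source c v z).
have [mv _] := L2P v; have [mz _] := L2P z.
apply: measurable_funD; apply: measurable_funM.
- exact: on_fst_meas.
- exact: (meas_snd_in mv).
- apply: (meas_fst_in (f := tent c)).
 by apply: (measurable_funS measurableT (@subsetT _ _)); exact: tent_meas.
- exact: (meas_snd_in mz).
Qed.

Lemma slab_meas b (f: vec -> R): mfun Omega f ->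
 mfun Q (fun p => if p.1 < b then f p.2 else 0).
move=> mf; have := measurable_funM (on_fst_meas b) (meas_snd_in mf).
congr measurable_fun; apply/funext => p /=; by case: ifP; rewrite ?mul1r ?mul0r.
Qed.
Lemma ae_slab (P: vec -> Prop): {aeO x, P x} ->
 {ae dtx, forall z, Q z -> P z.2}.
by move=> aP; apply: filterS (ae_snd aP) => -[t x] h [_ Ox]; exact: h. Qed.

(** De Giorgi's theorem gives v a continuous representative, which keeps the same gradient. The
    explicit solution built on it has a source that agrees almost everywhere with the wanted one. *)
Lemma K_source_gt0 (v: E) (z: L2O) (c Kv Z: R): subsol Mt v z -> 0 <= Kv -> 0 <= Z ->
 {aeO x, `|v.1 x| <= Kv} -> {aeO x, `|z x| <= Z} ->
 0 < c <= T -> K (source c v.1 z).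
move=> sub Kv0 Z0 vK zZ c0T; have /andP[c0 _] := c0T.
have [vs [cvs vvs vsK]] := continuous_of_osc oO
 (local_oscillation mMt C0 MtC al0 Mtal N0 sub Z0 zZ vK).
have vs2: in_L2 dx Omega vs.
 apply: (in_L2_bnd mO fO (within_meas_vec oO cvs) (C := Kv)).
 by apply/aeW => x; exact: vsK.
pose v': E := (toL vs, v.2).
have v'E x: v'.1 x = vs x by exact: toL2x.
have sub': subsol Mt v' z.
 have [Hv hv] := sub; split=> // e e0; have [p tp pe] := Hv e e0; exists p =>//.
 apply: le_lt_trans pe; apply: leEq.
 congr (_ + _); apply: eq_dotL; apply: filterS vvs => x h Ox.
 rewrite -[(v' - p).1 x]/(v'.1 x - p.1 x) -[(v - p).1 x]/(v.1 x - p.1 x).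
 by rewrite v'E h.
have cv': {within Omega, continuous v'.1} by rewrite (_: (v'.1: _ -> _) = vs)//; apply/funext.
have v'K x: Omega x -> `|v'.1 x| <= Kv by rewrite v'E; exact: vsK.
have [w [rw cw]] := spec_solution sub' cv' c0T.
have Loo: in_Loo dtx Q (source c v'.1 z).
 split; first exact: source_meas.
 exists (Kv + c * Z); apply: filterS (ae_slab zZ) => -[t x] h Qz; have [_ Ox] := Qz.
 apply: le_trans (ler_normD _ _) _; rewrite !normrM; apply: lerD.
  apply: (@le_trans _ _ (1 * `|v'.1 x|)); last by rewrite mul1r v'K.
  by rewrite ler_wpM2r//=; case: ifP; rewrite ?normr1 ?normr0.
 by apply: ler_pM =>//; [exact: (tent_01 _ (ltW c0))|exact: h].
have Ks: K (source c v'.1 z) by exact: (Kret Loo rw cw).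
apply: (K_ae KLoo Klim Ks (source_meas _ _ _)); apply: filterS (ae_slab vvs) => -[t x] h Qz.
by rewrite /source v'E -(h Qz).
Qed.

Lemma K_source (v: E) (z: L2O) (c Kv Z: R): subsol Mt v z -> 0 <= Kv -> 0 <= Z ->
 {aeO x, `|v.1 x| <= Kv} -> {aeO x, `|z x| <= Z} ->
 0 <= c <= T -> K (source c v.1 z).
move=> sub Kv0 Z0 vK zZ /andP[]; rewrite le_eqVlt => /orP[/eqP <- _|c0 cT]; last first.
 by apply: (K_source_gt0 sub Kv0 Z0 vK zZ); rewrite c0.
have KT: K (source T v.1 z) by apply: (K_source_gt0 sub Kv0 Z0 vK zZ); rewrite T0 lexx.
apply: (K_ae KLoo Klim (Klin (-1) KT KT) (source_meas _ _ _)); apply/aeW => -[t x] [/= tI _].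
move: tI; rewrite /= in_itv /= => /andP[t0 _]; rewrite mulN1r addNr.
by rewrite /source /= ltNge (ltW t0) mul0r tentE ?(ltW t0)// ltNge (ltW t0) mul0r addr0.
Qed.

Section euler.
Variables (b lam Z: R) (v_: nat -> E) (z_: nat -> L2O).
Hypothesis lam0: 0 < lam.
Hypothesis stepz: forall k, z_ k.+1 = lam^-1 *: ((v_ k).1 - (v_ k.+1).1).
(** For t below b - lam (k+1) the k-th difference is lam z_(k+1) = v_k - v_(k+1); on the strip of
    length lam above that time it is v_(k+1) up to lam z_(k+1). The sum therefore telescopes to v_0
    for t < b, up to lam Z, on all strips already reached. *)
Definition euler_source n p := \sum_(k < n)
 (source (b - lam * k%:R) (v_ k.+1).1 (z_ k.+1) p - source (b - lam * k.+1%:R) (v_ k.+1).1 (z_ k.+1) p).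

Lemma euler_sourceE n t x: 0 <= t -> (forall k, `|z_ k x| <= Z) ->
 if t < b - lam * n%:R then euler_source n (t, x) = (v_ 0%N).1 x - (v_ n).1 x
 else `|euler_source n (t, x) - (if t < b then (v_ 0%N).1 x else 0)| <= lam * Z.
move=> t0 zZ; have Z0: 0 <= Z by exact: le_trans (zZ 0%N).
have lZ: 0 <= lam * Z by rewrite mulr_ge0// ltW.
elim: n => [|n IH].
 rewrite mulr0 subr0 /euler_source big_ord0 subrr; case: ifP => [//|->].
 by rewrite subrr normr0.
have zE: lam * z_ n.+1 x = (v_ n).1 x - (v_ n.+1).1 x.
 have ->: z_ n.+1 x = lam^-1 * ((v_ n).1 x - (v_ n.+1).1 x) by rewrite stepz.
 by rewrite mulrA divff ?gt_eqF// mul1r.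
have cE: b - lam * n.+1%:R = b - lam * n%:R - lam by rewrite -natr1; ring.
rewrite /euler_source big_ord_recr /= -/(euler_source n (t, x)) cE.
move: (euler_source n (t, x)) IH; set c := b - lam * n%:R => G IH.
have cb: c <= b by rewrite gerBl mulr_ge0// ltW.
rewrite /source /= !(tentE _ t0); case: (ltP t (c - lam)) => h1.
 have h2: t < c by apply: lt_trans h1 _; rewrite gtrBl.
 rewrite h2 in IH *; rewrite IH !mul1r.
 have ->: (v_ n.+1).1 x = (v_ n).1 x - lam * z_ n.+1 x by rewrite zE; ring.
 ring.
case: (ltP t c) IH => h2 IH; last first.
 by rewrite !mul0r !addr0 subrr addr0.
have ->: t < b by exact: lt_le_trans cb.
rewrite IH mul1r !mul0r addr0 subr0.
have ->: (v_ 0%N).1 x - (v_ n).1 x + ((v_ n.+1).1 x + (c - t) * z_ n.+1 x) - (v_ 0%N).1 x =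
  (c - t - lam) * z_ n.+1 x by (have ->: (v_ n.+1).1 x = (v_ n).1 x - lam * z_ n.+1 x by rewrite zE; ring); ring.
by rewrite normrM ler_pM// ler_norml; apply/andP; split; lra.
Qed.
End euler.

(** The scheme starts at a resolvent v because v then has a bounded elliptic source, and
    [res_subsol] keeps this bound along all iterates; the error of [euler_sourceE] tends to 0 with
    the step. *)
Lemma K_slab_res (f: E) (lam0 b B: R) (v: E): 0 < lam0 -> 0 < b <= T -> 0 <= B ->
 {aeO x, `|f.1 x| <= B} -> res_eq Mt lam0 f.1 v ->
 K (fun p => if p.1 < b then v.1 p.2 else 0).
move=> l0 /andP[b0 bT] B0 fB rv; have [Hv hv] := rv.
have vB := res_abs mMt MtC al0 Mtal l0 B0 rv fB.
pose z: L2O := lam0^-1 *: (f.1 - v.1); pose Z := lam0^-1 * (2 * B).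
have Z0: 0 <= Z by rewrite mulr_ge0 ?invr_ge0 ?(ltW l0)// mulr_ge0.
have zZ: {aeO x, `|z x| <= Z}.
 apply: filterS2 fB vB => x h1 h2 Ox.
 rewrite -[z x]/(lam0^-1 * (f.1 x - v.1 x)) normrM ger0_norm ?invr_ge0 ?(ltW l0)//.
 rewrite ler_wpM2l ?invr_ge0 ?(ltW l0)//; apply: le_trans (ler_normB _ _) _.
 by rewrite mulr_natl mulr2n; apply: lerD; [exact: h1|exact: h2].
have sub: subsol Mt v z.
 split=> // h Hh; rewrite /z dotLZl dotLBl -(hv h Hh) addrAC subrr add0r mulrA mulVf ?mul1r//.
 exact: lt0r_neq0.
have ex n: exists g, K g /\ {ae dtx, forall p, Q p ->
  `|g p - (if p.1 < b then v.1 p.2 else 0)| <= b / n.+1%:R * Z}.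
 (* [n.+1] steps of this length lead exactly to time 0, so the first alternative of [euler_sourceE]
    is empty on the cylinder. *)
 pose lam := b / n.+1%:R; have lam_gt0: 0 < lam by rewrite divr_gt0.
 pose step (f: L2O): E := projT1 (cid (res_exists mMt C0 MtC al0 Mtal f lam_gt0)).
 pose v_ := fix u k := if k is k'.+1 then step (u k').1 else v.
 have ures k: res_eq Mt lam (v_ k).1 (v_ k.+1).
  exact: (projT2 (cid (res_exists mMt C0 MtC al0 Mtal (v_ k).1 lam_gt0))).
 pose z_ k := if k is k'.+1 then lam^-1 *: ((v_ k').1 - (v_ k).1) else z.
 have facts k: [/\ subsol Mt (v_ k) (z_ k), {aeO x, `|z_ k x| <= Z} &
   {aeO x, `|(v_ k).1 x| <= B}].
  elim: k => [//|k [sk zk vk]]; have [sk1 zk1] := res_subsol lam_gt0 sk (ures k).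
  split; [exact: sk1|exact: zk1|].
  exact: (res_abs mMt MtC al0 Mtal lam_gt0 B0 (ures k) vk).
 have cn k: (k <= n.+1)%N -> 0 <= b - lam * k%:R <= T.
  move=> kn; apply/andP; split; last first.
   by apply: le_trans bT; rewrite gerBl mulr_ge0// ltW.
  rewrite subr_ge0 /lam mulrAC ler_pdivrMr// ler_pM2l// ler_nat //.
 exists (euler_source b lam v_ z_ n.+1); split.
  have: forall m, (m <= n.+1)%N -> K (euler_source b lam v_ z_ m).
   elim=> [_|m IH mn].
    have Ks := K_source sub B0 Z0 vB zZ (cn 0%N isT).
    apply: (K_ae KLoo Klim (Klin (-1) Ks Ks)) => [|]; last by apply/aeW => p _; rewrite mulN1r addNr /euler_source big_ord0.
    by rewrite /euler_source; under eq_fun do rewrite big_ord0; exact: measurable_cst.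
   have [s1 z1 v1] := facts m.+1.
   have K1 := K_source s1 B0 Z0 v1 z1 (cn m (ltnW mn)).
   have K2 := K_source s1 B0 Z0 v1 z1 (cn m.+1 mn).
   have := Klin 1 (Klin (-1) K2 K1) (IH (ltnW mn)); congr K; apply/funext => p.
   by rewrite /euler_source big_ord_recr /= mul1r mulN1r addrC (addrC (- _)).
  exact.
 have zall: {aeO x, forall k, `|z_ k x| <= Z}.
  have: {ae dx, forall x, forall k, Omega x -> `|z_ k x| <= Z}.
   by apply: ae_foralln => k; have [] := facts k.
  by apply: filterS => x h Ox k; exact: h.
 apply: filterS (ae_slab zall) => -[t x] h Qp; have {}h := h Qp.
 have [tI _] := Qp; move: tI; rewrite /= in_itv /= => /andP[t0 _].
 have := @euler_sourceE b lam Z v_ z_ lam_gt0 (fun k => erefl) n.+1 t x (ltW t0) h.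
 rewrite {1}/lam divfK ?pnatr_eq0// subrr ltNge (ltW t0) //.
have mg: mfun Q (fun p => if p.1 < b then v.1 p.2 else 0).
 have [mv _] := L2P v.1.
 exact: slab_meas.
pose g n := projT1 (cid (ex n)).
have gP n := projT2 (cid (ex n)).
apply: (Klim (f_ := g) (B := B + b * Z)) =>//; first by move=> n; have [] := gP n.
- move=> n; have [_ h] := gP n; apply: filterS2 h (ae_slab vB) => p h hv' Qp.
 have {}h := h Qp; have {}hv' := hv' Qp.
 rewrite -[g n p](subrK (if p.1 < b then v.1 p.2 else 0)); apply: le_trans (ler_normD _ _) _.
 rewrite addrC; apply: lerD; first by case: ifP; rewrite ?normr0.
 apply: le_trans h _; rewrite ler_wpM2r// ler_pdivrMr// ler_peMr ?(ltW b0)//.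
 by rewrite ler1n.
have: {ae dtx, forall p, forall n, Q p -> `|g n p - (if p.1 < b then v.1 p.2 else 0)| <= b / n.+1%:R * Z}.
 by apply: ae_foralln => n; have [] := gP n.
apply: filterS => p h Qp; apply/cvgrPdist_le => e e0.
have [m hm] := nat_above (b * Z / e); near=> n.
rewrite distrC; apply: le_trans (h n Qp) _; rewrite mulrAC ler_pdivrMr// [leRHS]mulrC -ler_pdivrMr//.
apply: le_trans (ltW hm) _; rewrite ler_nat ltnS; near: n; exact: nbhs_infty_ge.
Unshelve. all: by end_near. Qed.

(** The resolvents of phi with parameters 1/(n+1) keep the bound of phi and tend to phi in L2 by
    [res_near], hence almost everywhere along a subsequence. *)
Lemma K_slab_test (phi: vec -> R) b: test_function Omega phi -> 0 < b <= T ->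
 K (fun p => if p.1 < b then phi p.2 else 0).
move=> tp bT; have [B B0 pB] := tf_bnd tp.
pose f := tstE phi; have fE x: f.1 x = phi x by exact: (tstE1 tp).
have Hf: H1_0 f by exact: (H_test tp).
have fB: {aeO x, `|f.1 x| <= B} by apply/aeW => x _; rewrite fE.
have l0 n: 0 < n.+1%:R^-1 :> R by rewrite invr_gt0.
pose v n: E := projT1 (cid (res_exists mMt C0 MtC al0 Mtal f.1 (l0 n))).
have rv n: res_eq Mt n.+1%:R^-1 f.1 (v n) by exact: (projT2 (cid (res_exists mMt C0 MtC al0 Mtal f.1 (l0 n)))).
have cv: ip_cvg (@dotL _ _ _ dx Omega mO) (fun n => (v n).1) f.1.
 move=> e e0; set k := N%:R ^+ 4 * C ^+ 2 / (2 * al) * S2 f.2.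
 have [m hm] := nat_above (k / e); exists m => n mn.
 apply: le_lt_trans (res_near mMt C0 MtC al0 Mtal (l0 n) Hf (rv n)) _; rewrite -/k.
 rewrite mulrC ltr_pdivrMr// mulrC -ltr_pdivrMr//; apply: lt_le_trans hm _.
 by rewrite ler_nat ltnS.
have [s [sk aes]] := cvgL_ae fO cv.
apply: (Klim (f_ := fun n p => if p.1 < b then (v (s n)).1 p.2 else 0) (B := B)).
- by move=> n; exact: (K_slab_res (l0 (s n)) bT B0 fB (rv (s n))).
- have mf: mfun Omega f.1 by have [] := L2P f.1.
 by apply: slab_meas; rewrite (_: phi = f.1)//; apply/funext.
- move=> n; apply: filterS (ae_slab (res_abs mMt MtC al0 Mtal (l0 (s n)) B0 (rv (s n)) fB)) => p h Qp.
 by case: ifP; rewrite ?normr0// => _; exact: h.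
apply: filterS (ae_slab aes) => p h Qp; case: ifP => _; last exact: cvg_cst.
by rewrite -fE; exact: h.
Qed.

(** On [Omega] the indicator is the limit of 1 - exp(- n s_n), with s_n a sum of bumps over the
    boxes that exhaust the intersection of [U] and [Omega]. The outer function vanishes at 0 and is
    at most 1, so these are test functions bounded by 1. *)
Lemma K_open (U: set vec) b: open U -> 0 < b <= T ->
 K (fun p => if p.1 < b then \1_U p.2 else 0).
move=> oo bT; have oU: open (U `&` Omega) by exact: openI.
have [F [P [UE FP]]] := open_bigcup_box oU.
pose bm k x: R := if `[< P k >] then bump (F k).1 (F k).2 x else 0.
have bm0 k x: 0 <= bm k x by rewrite /bm; case: ifP =>// _; exact: bump_ge0.
have tbm k: test_function Omega (bm k).
 rewrite /bm; case: asboolP => Pk; last exact: tf0.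
 by apply: test_bump => x /(FP k Pk) [].
pose phi n x := \sum_(k < n) bm k x.
have phi0 n x: 0 <= phi n x by apply: sumr_ge0 => k _; exact: bm0.
pose be n (s: R) := 1 - expR (- n%:R * s).
pose psi n x := be n (phi n x).
have tpsi n: test_function Omega (psi n).
 apply: (tf_comp (b := be n)); last by rewrite /be mulr0 expR0 subrr.
  by apply: tf_sum => k; exact: tbm.
 apply: smoothB; first exact: sm_cst.
 by apply: (sm_comp (b := @expR R)); [exact: sm_expR|apply: smoothZ; exact: sm_id].
have psi01 n x: `|psi n x| <= 1.
 rewrite /psi /be ger0_norm; last by rewrite subr_ge0 -[leRHS]expR0 ler_expR mulNr oppr_le0 mulr_ge0.
 by rewrite gerBl expR_ge0.
apply: (Klim (f_ := fun n p => if p.1 < b then psi n p.2 else 0) (B := 1)).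
- by move=> n; exact: K_slab_test.
- apply: slab_meas; apply: (measurable_funS measurableT (@subsetT _ _)).
 by apply: measurable_indic; exact: open_meas_vec.
- by move=> n; apply/aeW => p _; case: ifP; rewrite ?normr0.
apply/aeW => -[t x] [_ /= Ox]; case: ifP => _; last exact: cvg_cst.
rewrite indicE; have [xO|xO] := pselect (U x); last first.
 rewrite memNset//; have z n: psi n x = 0.
  rewrite /psi /be /phi big1 ?mulr0 ?expR0 ?subrr// => k _; rewrite /bm; case: asboolP =>// Pk.
  apply/eqP; rewrite eq_le bump_ge0 andbT leNgt bump_gt0; apply/asboolP => bx.
  by apply: xO; have []: (U `&` Omega) x by rewrite UE; exists k.
 by under eq_fun do rewrite z; exact: cvg_cst.
rewrite mem_set//; have: (U `&` Omega) x by [].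
rewrite UE => -[k Pk bx]; set a := bm k x.
have a0: 0 < a by rewrite /a /bm; case: asboolP =>// _; rewrite bump_gt0; exact/asboolP.
apply/cvgrPdist_le => e e0; have [m hm] := nat_above ((e * a)^-1); near=> n.
have nm: (m < n)%N by near: n; exact: nbhs_infty_gt.
have nk: (k < n)%N by near: n; exact: nbhs_infty_gt.
rewrite /psi /be opprB addrC subrK ger0_norm ?expR_ge0// mulNr expRN.
have an: e^-1 <= n%:R * phi n x.
 apply: (@le_trans _ _ (n%:R * a)).
  rewrite -ler_pdivrMr// -invfM; apply: (le_trans (ltW hm)); by rewrite ler_nat.
 rewrite ler_wpM2l// /phi (bigD1 (Ordinal nk))//= lerDl sumr_ge0// => i _; exact: bm0.
have ex: e^-1 <= expR (n%:R * phi n x).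
 by apply: le_trans an _; apply: le_trans (expR_ge1Dx _); rewrite lerDr.
by rewrite -[leRHS]invrK lef_pV2 ?posrE ?invr_gt0 ?expR_gt0.
Unshelve. all: by end_near. Qed.
Let slabs: set (set (R * vec)) := [set A | exists b U, open U /\ A = [set p | p.1 < b /\ U p.2]].

(** Slabs are stable under intersection, as Dynkin's lemma requires. Sets that constrain x alone are
    recovered as unions of slabs with integer b. *)
Lemma slabs_generate: @measurable _ (R * vec)%type = <<s slabs >>.
apply/seteqP; split => A; last first.
 apply: smallest_sub; first exact: sigma_algebra_measurable.
 move=> _ [b [U [oo ->]]].
 rewrite (_: [set p | _] = `]-oo, b[%classic `*` U); last first.
  by apply/seteqP; split => -[t x] /=; rewrite in_itv /=.
 by apply: measurableX; [exact: measurable_itv|exact: open_meas_vec].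
move=> mA.
have m1: mfunT (fun p: g_sigma_algebraType slabs => p.1: R).
 apply: (measurability _ (measurable_realfun.RGenInftyO.measurableE R)).
 move=> _ [_ [b ->] <-]; rewrite setTI; apply: sub_sigma_algebra; exists b, setT; split; first exact: openT.
 by apply/seteqP; split => -[t x] /=; rewrite in_itv /=; [|case].
have m2: mfunT (fun p: g_sigma_algebraType slabs => p.2: vec).
 apply: measurable_fun_mx => i j; apply: open_preimage_meas => X oX; rewrite setTI.
 suff: <<s slabs >> [set p: R * vec | X (p.2 i j)] by [].
 rewrite (_: [set p: R * vec | X (p.2 i j)] = \bigcup_n [set p: R * vec | p.1 < n.+1%:R /\ X (p.2 i j)]); last first.
  apply/seteqP; split => [[t x] Xx|[t x] [n _ []]//].
  by have [n tn] := nat_above t; exists n.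
 apply: sigma_algebra_bigcup => n; apply: sub_sigma_algebra; exists n.+1%:R, ((fun x: vec => x i j) @^-1` X).
 by split=> //; apply: open_comp =>// x _; exact: coord_continuous.
have m3: mfunT (fun p: g_sigma_algebraType slabs => (p.1: R, p.2: vec)).
 exact: measurable_fun_pair.
have := m3 measurableT A mA; rewrite setTI.
by rewrite (_: _ @^-1` A = A)//; apply/seteqP; split => -[].
Qed.

(** Dynkin's lemma on the slabs. A slab with b <= 0 misses the cylinder and any other may be cut at
    T, which reduces to the range of b in [K_open]. *)
Lemma K_indic (A: set (R * vec)): measurable A -> K \1_A.
have mind (B: set (R * vec)): measurable B -> mfun Q (\1_B: _ -> R).
 by move=> mB; apply: (measurable_funS measurableT (@subsetT _ _)); exact: measurable_indic.
have KT: K \1_setT.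
 have h := @K_open setT T openT; have {}h: K (fun p => if p.1 < T then \1_setT p.2 else 0) by apply: h; rewrite T0 lexx.
 apply: (K_ae KLoo Klim h (mind _ measurableT)); apply/aeW => -[t x] [/= tI _].
 by move: tI; rewrite /= in_itv /= => /andP[_ ->]; rewrite !indicT.
rewrite slabs_generate; move: A; apply: (dynkin_induction slabs_generate) =>//.
- move=> _ _ [b [U [oO1 ->]]] [b' [U' [oU' ->]]]; exists (Num.min b b'), (U `&` U'); split; first exact: openI.
 by apply/seteqP; split => -[t x] /=; rewrite lt_min; [move=> [[-> ?] [-> ?]]|move=> [/andP[-> ->] [? ?]]].
- move=> _ [b [U [oo ->]]].
 have mA: measurable [set p: R * vec | p.1 < b /\ U p.2].
  by rewrite slabs_generate; apply: sub_sigma_algebra; exists b, U.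
 have [b0|b0] := ltP 0 b; last first.
  apply: (K_ae KLoo Klim (Klin (-1) KT KT) (mind _ mA)); apply/aeW => -[t x] [/= tI _].
  move: tI; rewrite /= in_itv /= => /andP[t0 _]; rewrite mulN1r addNr indicE memNset// => -[/= tb _].
  by have := lt_trans t0 tb; rewrite ltNge b0.
 have Kb: K (fun p => if p.1 < Num.min b T then \1_U p.2 else 0).
  by apply: K_open =>//; rewrite lt_min b0 T0 ge_min lexx orbT.
 apply: (K_ae KLoo Klim Kb (mind _ mA)); apply/aeW => -[t x] [/= tI _].
 move: tI; rewrite /= in_itv /= => /andP[_ tT]; rewrite lt_min tT andbT !indicE.
 case: ifP => tb; last by rewrite memNset// => -[/=]; rewrite tb.
 by congr (_ %:R); congr nat_of_bool; apply/idP/idP; rewrite !inE =>//= -[].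
- move=> S mS KS; have := Klin (-1) KS KT; congr K; apply/funext => z.
 by rewrite !indicE in_setC in_setT; case: (z \in S); rewrite ?mulr1 ?mulr0 ?addNr ?add0r.
move=> F mF tF KF; have lim_ := sum_indic_cvg tF; have fB := sum_indic_01 tF.
apply: (Klim (f_ := fun n z => \sum_(k < n) \1_(F k) z) (B := 1)).
- move=> n; have K00 := Klin (-1) KT KT.
 have := K_sum Klin (index_enum 'I_n) (F := fun k: 'I_n => \1_(F k)) 1 K00 (fun k => KF k).
 by congr K; apply/funext => z; rewrite mul1r mulN1r addNr addr0.
- by apply: mind; exact: bigcup_measurable.
- by move=> n; apply/aeW.
by apply/aeW => z _; exact: lim_.
Qed.
Lemma K_Loo f: in_Loo dtx Q f -> K f.
by apply: (bnd_class mQ Klin Klim) => A; exact: K_indic. Qed.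
End dense_class.
End density.

(** * The duality solution *)

Section duality.

(** [lebesgue_tx] is typed as a mere measure, while the density of [representation] comes from the
    Radon-Nikodym theorem for sigma-finite measures; this fact is packed with the measure there. *)
Lemma leb_tx_sigma_finite: sigma_finite setT dtx.
have /sigma_finiteP[F [TF ndF Foo]] := sigma_finiteT (@lebesgue1 R).
have /sigma_finiteP[G [TG ndG Goo]] := sigma_finiteT (@lebesgue_vec R N).
exists (fun k => F k `*` G k).
 apply/seteqP; split=> // -[x y] _.
 have [i _ Fix]: (\bigcup_i F i) x by rewrite -TF.
 have [j _ Gjy]: (\bigcup_i G i) y by rewrite -TG.
 exists (maxn i j) =>//; split.
  by move: x Fix; exact/subsetPset/ndF/leq_maxl.
 by move: y Gjy; exact/subsetPset/ndG/leq_maxr.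
move=> k; have [mF Fk] := Foo k; have [mG Gk] := Goo k; split; first exact: measurableX.
rewrite -[X in (X < _)%E]/((leb1 \x lvec N)%E (F k `*` G k)).
by rewrite (product_measure1E (leb1: {sigma_finite_measure set R -> \bar R}))// lte_mul_pinfty// ge0_fin_numE.
Qed.

Lemma H10_lin c (v v': vec -> R) G G': in_H10 Omega v G -> in_H10 Omega v' G' ->
 in_H10 Omega (fun x => c * v x + v' x) (fun x => c *: G x + G' x).
move=> h h'; have [v2 G2 _ _] := h; have [v2' G2' _ _] := h'.
have Hv := in_H10_H h; have Hv' := in_H10_H h'.
have [_ /(_ c _ _ Hv Hv')/H_in_H10] := H_subsp.
set V := (_ *: _ + _)%R => hV.
have e1: (fun x => c * v x + v' x) = V.1.
 by apply/funext => x; rewrite -[RHS]/(c * toL v x + toL v' x) !toL2x.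
have e2: (fun x => c *: G x + G' x) = fun x => \col_i V.2 i x.
 apply/funext => x; apply/colP => i.
 by rewrite !mxE -[RHS]/(c * toL (fun x => G x i ord0) x + toL (fun x => G' x i ord0) x) !toL2x.
by rewrite e1 e2.
Qed.

Lemma CL2_lin c (w w': R * vec -> R): in_CL2 Omega T w -> in_CL2 Omega T w' ->
 in_CL2 Omega T (fun z => c * w z + w' z).
move=> [w2 cw] [w2' cw']; split=> t tT; first by apply: (in_L2_lin mO); [exact: w2|exact: w2'].
pose S (u: R * vec -> R) s: L2O := toL (fun x => u (s, x)).
pose D u s := dotL (S u s - S u t) (S u s - S u t).
have DE u: (forall s, 0 <= s <= T -> in_L2 dx Omega (fun x => u (s, x))) -> forall s, 0 <= s <= T ->
  (\int[dx]_(x in Omega) ((u (s, x) - u (t, x)) ^+ 2)%:E)%E = (D u s)%:E.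
 move=> u2 s sT; rewrite /D -dotL_EFin; apply: eq_integral => x _.
 rewrite -[(S u s - S u t) x]/(S u s x - S u t x) /S (toL2x mO (u2 s sT)) (toL2x mO (u2 t tT)) //.
pose W z := c * w z + w' z.
have W2 s: 0 <= s <= T -> in_L2 dx Omega (fun x => W (s, x)).
 by move=> sT; apply: (in_L2_lin mO); [exact: w2|exact: w2'].
have SW s: 0 <= s <= T -> S W s = c *: S w s + S w' s.
 move=> sT; apply: L2_eqP => x; rewrite -[RHS]/(c * S w s x + S w' s x) /S.
 by rewrite (toL2x mO (W2 s sT)) (toL2x mO (w2 s sT)) (toL2x mO (w2' s sT)).
have up := cvgeD _ (cvgeZl (y := (2 * c ^+ 2)%:E) _ (cw t tT)) (cvgeZl (y := 2%:E) _ (cw' t tT)).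
rewrite !mule0 adde0 in up.
apply: (@squeeze_cvge _ _ _ _ (cst 0%E) _ _ _ _ (cvg_cst _) (up _ _ _ _)) =>//.
near=> s; have sT: 0 <= s <= T.
 by near: s; apply: filterS (near_withinT _ _) => s; rewrite /= in_itv.
rewrite (DE w w2 s sT) (DE w' w2' s sT) (DE W W2 s sT) /= lee_fin dotL_ge0 /= -!EFinM -EFinD lee_fin.
rewrite /D !SW//; have ->: c *: S w s + S w' s - (c *: S w t + S w' t) =
  c *: (S w s - S w t) + (S w' s - S w' t) by rewrite scalerBr opprD addrACA.
apply: le_trans (dotL_sqD _ _) _; rewrite dotLZl dotLZr.
by apply: leEq; ring.
Unshelve. all: by end_near. Qed.

Lemma retrograde_lin c (g w g' w': R * vec -> R): in_Loo dtx Q g -> in_Loo dtx Q g' ->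
 retrograde_solution Omega T M g w -> retrograde_solution Omega T M g' w' ->
 retrograde_solution Omega T M (fun z => c * g z + g' z) (fun z => c * w z + w' z).
move=> gb gb' [cw wT [G [wG wE]]] [cw' wT' [G' [wG' wE']]]; split; first exact: CL2_lin.
 by apply: filterS2 wT wT' => x h h' Ox; rewrite h// h'// mulr0 addr0.
exists (fun z => c *: G z + G' z); have [w2 G2 H] := wG; have [w2' G2' H'] := wG'; split.
 split; first exact: (in_L2_lin mQ).
  move=> i; have := in_L2_lin mQ c (G2 i) (G2' i); congr in_L2.
  by apply/funext => z; rewrite !mxE.
 by apply: filterS2 H H' => t h h' tT; exact: (H10_lin c (h tT) (h' tT)).
move=> phi tp.
have L2phi f: test_function Q f -> in_L2 dtx Q f := @test_L2 f.
have pdt: in_L2 dtx Q (dt phi) by apply: L2phi; exact: (tf_derive _ tp).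
have i1 := in_L2M mQ w2 pdt; have i1' := in_L2M mQ w2' pdt.
have i2 := in_L2M mQ (Loo_L2 gb) (L2phi _ tp).
have i2' := in_L2M mQ (Loo_L2 gb') (L2phi _ tp).
have i3 := L1_dot wG tp; have i3' := L1_dot wG' tp.
have e1 := wE phi tp; have e2 := wE' phi tp.
have ->: \int[dtx]_(z in Q) ((c * g z + g' z) * phi z) =
  c * (\int[dtx]_(z in Q) (g z * phi z)) + \int[dtx]_(z in Q) (g' z * phi z).
 by rewrite -(RintegralZl _ mQ i2) -(RintegralD mQ (in_L1Z mQ c i2) i2'); apply: eq_Rintegral => z _; ring.
rewrite -e1 -e2.
have ->: \int[dtx]_(z in Q) ((c * w z + w' z) * dt phi z) =
  c * (\int[dtx]_(z in Q) (w z * dt phi z)) + \int[dtx]_(z in Q) (w' z * dt phi z).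
 by rewrite -(RintegralZl _ mQ i1) -(RintegralD mQ (in_L1Z mQ c i1) i1'); apply: eq_Rintegral => z _; ring.
have ->: \int[dtx]_(z in Q) dot ((M z.2)^T *m (c *: G z + G' z)) (gradx phi z) =
  c * (\int[dtx]_(z in Q) dot ((M z.2)^T *m G z) (gradx phi z)) +
  \int[dtx]_(z in Q) dot ((M z.2)^T *m G' z) (gradx phi z).
 rewrite -(RintegralZl _ mQ i3) -(RintegralD mQ (in_L1Z mQ c i3) i3'); apply: eq_Rintegral => z _.
 rewrite /dot mulr_sumr -big_split; apply: eq_bigr => i _ /=.
 rewrite mulmxDr -scalemxAr !mxE; ring.
by ring.
Qed.
Variable mu: {charge set (R * vec)%type -> \bar R}.
Variable u0: vec -> R.
Hypothesis u01: in_L1 dx Omega u0.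
Definition datum w := \int[dx]_(x in Omega) (u0 x * w (0, x)) + charge_integral mu Q w.
Definition dual_pair g L := in_Loo dtx Q g /\ exists w, [/\ retrograde_solution Omega T M g w,
 {within Q, continuous w} & L = datum w].
Let bnd g w (gb: in_Loo dtx Q g) (rw: retrograde_solution Omega T M g w) := retrograde_sup rw gb.

Lemma dual_pair_lin c f a g b: dual_pair f a -> dual_pair g b ->
 dual_pair (fun z => c * f z + g z) (c * a + b).
move=> [fb [w [rw cw ->]]] [gb [w' [rw' cw' ->]]]; split; first exact: Loo_lin.
exists (fun z => c * w z + w' z); split; first exact: retrograde_lin.
 by move=> z; apply: cvgD; [apply: cvgMl_tmp; exact: cw|exact: cw'].
have oQ: open Q by exact: open_cylinder.
have mw := within_meas_tx oQ cw; have mw' := within_meas_tx oQ cw'.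
have T00: (0: R) <= 0 <= T by apply/andP; split; last exact: ltW.
have s0 h v (hb: in_Loo dtx Q h) (rv: retrograde_solution Omega T M h v) :
  in_L1 dx Omega (fun x => u0 x * v (0, x)).
 have [[v2 _] _ _] := rv; have [mv _] := v2 0 T00.
 apply: (L1_Loo mO u01); split=> //.
 by eexists; exact: (slice_sup rv hb T00).
have [m1 [m2 cE]] := charge_intE mu.
have fin (m: {finite_measure set (R * vec)%type -> \bar R}) h v: in_Loo dtx Q h ->
  retrograde_solution Omega T M h v -> {within Q, continuous v} -> mfun Q v -> in_L1 m Q v.
 move=> hb rv cv mv; apply: (in_L1_bnd mQ _ mv (bnd hb rv cv)).
 by rewrite -ge0_fin_numE// fin_num_measure//; exact: mQ.
have lin (m: {finite_measure set (R * vec)%type -> \bar R}) :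
  Rintegral m Q (fun z => c * w z + w' z) = c * Rintegral m Q w + Rintegral m Q w'.
 have i1 := fin m _ _ fb rw cw mw; have i2 := fin m _ _ gb rw' cw' mw'.
 by rewrite -(RintegralZl _ mQ i1) -(RintegralD mQ (in_L1Z mQ c i1) i2).
have i1 := s0 _ _ fb rw; have i2 := s0 _ _ gb rw'.
rewrite /datum !cE !lin.
have ->: \int[dx]_(x in Omega) (u0 x * (c * w (0, x) + w' (0, x))) =
  c * (\int[dx]_(x in Omega) (u0 x * w (0, x))) + \int[dx]_(x in Omega) (u0 x * w' (0, x)).
 by rewrite -(RintegralZl _ mO i1) -(RintegralD mO (in_L1Z mO c i1) i2); apply: eq_Rintegral => x _; ring.
by ring.
Qed.

Lemma dual_pair_bound: exists2 B, 0 <= B & forall g L, dual_pair g L ->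
 `|L| <= B * (1 + \int[dtx]_(z in Q) (`|g z| ^+ N.+2)).
have [m1 [m2 cE]] := charge_intE mu.
pose U := \int[dx]_(x in Omega) `|u0 x|; pose m (m: {finite_measure set (R * vec)%type -> \bar R}) := fine (m Q).
have m0 m': 0 <= m m' by exact: fine_ge0.
have U0: 0 <= U by apply: Rintegral_ge0.
(* [sup_bound] depends on the source through one additive term, so its value at the source 0 is the
   part common to all g. *)
pose k := sup_bound (fun=> 0: R).
have k0: 0 <= k by exact: sup_bound_ge0.
exists ((U + m m1 + m m2) * (k + 1)); first by apply: mulr_ge0; apply: addr_ge0 =>//; exact: addr_ge0.
move=> g L [gb [w [rw cw ->]]]; set P := \int[dtx]_(z in Q) _.
have P0: 0 <= P by apply: Rintegral_ge0 => z _; exact: exprn_ge0.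
pose b := sup_bound g; have b0: 0 <= b by exact: sup_bound_ge0.
have bP: b <= (k + 1) * (1 + P).
 rewrite /b /k /sup_bound -/P; rewrite (_: \int[dtx]_(z in Q) (`|(fun=> 0: R) z| ^+ N.+2) = 0); last first.
  by apply: Rint_eq0 => z _; rewrite normr0 expr0n.
 rewrite mul0r addr0; set q := _ + _ * (_ / _); have q0: 0 <= q.
  by move: k0; rewrite /k /sup_bound (_: \int[dtx]_(z in Q) _ = 0) ?mul0r ?addr0//; apply: Rint_eq0 => z _; rewrite normr0 expr0n.
 by move: q q0 => q q0; nra.
have T00: (0: R) <= 0 <= T by apply/andP; split; last exact: ltW.
have oQ: open Q by exact: open_cylinder.
have mw := within_meas_tx oQ cw; have wb := bnd gb rw cw.
have cm (m': {finite_measure set (R * vec)%type -> \bar R}): `|Rintegral m' Q w| <= m m' * b.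
 have fm: (m' Q < +oo)%E by rewrite -ge0_fin_numE// fin_num_measure//; exact: mQ.
 have i1 := in_L1_bnd mQ fm mw wb.
 apply: le_trans (le_normr_Rintegral mQ i1) _; rewrite mulrC -(Rintegral_cst m' mQ b).
 by apply: (le_Rint_ae mQ (in_L1_abs i1) (in_L1_cst mQ fm b)); apply/aeW.
have [[w2 _] _ _] := rw; have [mw0 _] := w2 0 T00.
have sb := slice_sup rw gb T00.
have i0: in_L1 dx Omega (fun x => u0 x * w (0, x)).
 by apply: (L1_Loo mO u01); split=> //; exists b.
have u0b: `|\int[dx]_(x in Omega) (u0 x * w (0, x))| <= U * b.
 apply: le_trans (le_normr_Rintegral mO i0) _; rewrite mulrC -(RintegralZl _ mO (in_L1_abs u01)).
 apply: (le_Rint_ae mO (in_L1_abs i0) (in_L1Z mO b (in_L1_abs u01))).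
 by apply: filterS sb => x h Ox; rewrite normrM mulrC ler_wpM2r// h.
rewrite -mulrA; apply: le_trans (ler_wpM2l _ bP); last by rewrite !addr_ge0.
rewrite /datum cE !mulrDl -addrA; apply: le_trans (ler_normD _ _) _; apply: lerD =>//.
by apply: le_trans (ler_normB _ _) _; apply: lerD.
Qed.

Lemma duality_solP u: duality_solution Omega T M mu u0 u <->
 in_L1 dtx Q u /\ forall g L, dual_pair g L -> \int[dtx]_(z in Q) (u z * g z) = L.
split=> -[u1 h]; split=> //.
 by move=> g L [gb [w [rw cw ->]]]; have := h g gb w rw cw; rewrite /datum => <-; ring.
move=> g gb w rw cw; rewrite (h g (datum w)); last by split=> //; exists w.
by rewrite /datum; ring.
Qed.

Lemma duality_existence_uniqueness: exists2 u, duality_solution Omega T M mu u0 u &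
 forall v, duality_solution Omega T M mu u0 v -> {ae dtx, forall z, Q z -> v z = u z}.
have [B B0 hB] := dual_pair_bound.
pose m: {sigma_finite_measure set (R * vec)%type -> \bar R} :=
 HB.pack (Measure.sort dtx) (Measure_isSigmaFinite.Build _ _ _ (Measure.sort dtx) leb_tx_sigma_finite).
have SLoo f a: dual_pair f a -> in_Loo m Q f by case.
(* [power] has exponent p + 1, so p = N + 1 yields the exponent N + 2 of [dual_pair_bound]. *)
have [|u [u1 ur] uu] := @representation _ _ R m Q N.+1 mQ fQ dual_pair SLoo dual_pair_lin B B0 hB.
 move=> K KLoo Klin Klim KS h Lh.
 have Kret g w: in_Loo dtx Q g -> retrograde_solution Omega T M g w -> {within Q, continuous w} -> K g.
  by move=> gb rw cw; apply: (KS g (datum w)); split=> //; exists w.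
 exact: (K_Loo KLoo Klin Klim Kret Lh).
exists u; first by apply/duality_solP.
by move=> v /duality_solP[v1 vr]; exact: uu.
Qed.
End duality.
End retrograde_equation.
End open_domain.

Theorem theorem1p3 (R : realType) (N : nat) (N_ge2 : (2 <= N)%N)
    (Omega : set 'cV[R]_N) (T : R) (M : 'cV[R]_N -> 'M[R]_N)
    (Omega_open : open Omega) (Omega_bounded : bounded_set Omega)
    (T_gt0 : 0 < T)
    (M_Loo : forall i j, in_Loo (lebesgue_vec N) Omega (fun x => M x i j))
    (M_elliptic : exists2 alpha, 0 < alpha & elliptic Omega M alpha)
    (mu : {charge set (R * 'cV[R]_N)%type -> \bar R})
    (u0 : 'cV[R]_N -> R) (u0_L1 : in_L1 (lebesgue_vec N) Omega u0) :
  exists2 u, duality_solution Omega T M mu u0 u &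
    forall v, duality_solution Omega T M mu u0 v ->
      {ae lebesgue_tx N, forall z, cylinder T Omega z -> v z = u z}.
Proof.
have fO : (lebesgue_vec N Omega < +oo)%E.
  by apply: bnd_set_leb => //; exact: open_meas_vec.
have mM i j : measurable_fun Omega (fun x => M x i j) by have [] := M_Loo i j.
(* The sum of the bounds of all entries is one constant that serves for each of them. *)
pose c i j : R := projT1 (cid (M_Loo i j).2); pose C := \sum_i \sum_j `|c i j|.
have C0 : 0 <= C by apply: sumr_ge0 => i _; apply: sumr_ge0.
have MC i j : {ae lebesgue_vec N, forall x, Omega x -> `|M x i j| <= C}.
  apply: filterS (projT2 (cid (M_Loo i j).2)) => x h Ox; apply: le_trans (h Ox) _.
  apply: le_trans (ler_norm _) _; rewrite -/(c i j) /C (bigD1 i)//= (bigD1 j)//= -addrA lerDl.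
  by rewrite addr_ge0// sumr_ge0// => k _; apply: sumr_ge0.
have [al al0 Mal] := M_elliptic.
by apply: (duality_existence_uniqueness Omega_open fO _ T_gt0 mM C0 MC al0 Mal) => //; exact: ltnW.
Qed.
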